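(* Let $k\ge 0$, $n\ge 1$, let $(E_\eta)_{\eta\in\mathbb N_0^n}$ be the non-symmetric and $(P_\lambda)_{\lambda\in\Lambda_n^+}$ the symmetric Jack polynomials of index $1/k$. Then for all $\mu\in\mathbb C$ with $\mathrm{Re}\,\mu>\mu_0$ and all $z\in\mathbb C^n$ with $\mathrm{Re}\,z>0$ (componentwise): (1) for every $\eta\in\mathbb N_0^n$, $$\int_{\mathbb R_+^n}E(-z,x)\,E_\eta(x)\,\Delta(x)^{\mu-\mu_0-1}\,\omega(x)\,dx=\Gamma_n(\eta_++\underline\mu)\,E_\eta\bigl(\tfrac1z\bigr)\,\Delta(z)^{-\mu};$$ (2) for every $\lambda\in\Lambda_n^+$, $$\int_{\mathbb R_+^n}J(-z,x)\,P_\lambda(x)\,\Delta(x)^{\mu-\mu_0-1}\,\omega(x)\,dx=\Gamma_n(\lambda+\underline\mu)\,P_\lambda\bigl(\tfrac1z\bigr)\,\Delta(z)^{-\mu}.$$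
   Context: Notation: $\langle z,w\rangle=\sum_i z_iw_i$ (bilinear on $\mathbb C^n$); $\underline s=(s,\dots,s)\in\mathbb C^n$; $\mathbb R_+=(0,\infty)$; inequalities between vectors and expressions such as $1/z$ are componentwise. $s_{ij}$ denotes the transposition interchanging coordinates $i$ and $j$; $\mathcal S_n$ acts on $\mathbb C^n$ by permuting coordinates. For $\xi\in\mathbb R^n$ the Dunkl operator of type $A_{n-1}$ with multiplicity $k\ge0$ is $T_\xi f(x)=\partial_\xi f(x)+k\sum_{1\le i<j\le n}(\xi_i-\xi_j)\frac{f(x)-f(s_{ij}x)}{x_i-x_j}$; $T_j:=T_{e_j}$. The Dunkl kernel $E(\lambda,z)$ is the unique function holomorphic on $\mathbb C^n\times\mathbb C^n$ such that for each $\lambda$, $T_\xi E(\lambda,\cdot)=\langle\lambda,\xi\rangle E(\lambda,\cdot)$ for all $\xi\in\mathbb R^n$ and $E(\lambda,0)=1$; the Bessel function is $J(\lambda,z)=\frac1{n!}\sum_{\sigma\in\mathcal S_n}E(\lambda,\sigma z)$. Put $\omega(x)=\prod_{i<j}|x_i-x_j|^{2k}$, $\Delta(z)=\prod_j z_j$, $\mu_0=k(n-1)$, and for $\mathrm{Re}\,z>0$, $s\in\mathbb C$: $\Delta(z)^s=\exp(s\sum_j\mathrm{Log}\,z_j)$ (principal branch). $\Gamma_n(\lambda)=d_n(k)\prod_{j=1}^n\Gamma(\lambda_j-k(j-1))$ for $\lambda\in\mathbb C^n$, with $d_n(k)=\prod_{j=1}^n\Gamma(1+jk)/\Gamma(1+k)$.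 Jack polynomials: $\Lambda_n^+=\{\lambda\in\mathbb N_0^n:\lambda_1\ge\dots\ge\lambda_n\}$; for $\eta\in\mathbb N_0^n$, $|\eta|=\sum\eta_i$ and $\eta_+\in\Lambda_n^+$ is the decreasing rearrangement. Dominance order on $\Lambda_n^+$: $\mu\le_D\lambda$ iff $|\mu|=|\lambda|$ and $\sum_{j\le r}\mu_j\le\sum_{j\le r}\lambda_j$ for all $r$. On $\mathbb N_0^n$: $\kappa\prec\eta$ iff either $\kappa_+\le_D\eta_+$ with $\kappa_+\ne\eta_+$, or $\kappa_+=\eta_+$ and $w_\eta<w_\kappa$ in the Bruhat order, where $w_\eta\in\mathcal S_n$ is the shortest permutation with $w_\eta\eta_+=\eta$. Let $\mathcal D_j=x_jT_j+k(1-n)+k\sum_{i>j}s_{ij}$ ($s_{ij}$ acting on functions by interchanging $x_i,x_j$), and $\overline\eta_j=\eta_j-k\#\{i<j:\eta_i\ge\eta_j\}-k\#\{i>j:\eta_i>\eta_j\}$. The non-symmetric Jack polynomial $E_\eta$ of index $1/k$ is the unique polynomial of the form $x^\eta+\sum_{\kappa\prec\eta}c_{\eta\kappa}x^\kappa$ with $\mathcal D_jE_\eta=\overline\eta_jE_\eta$ for $j=1,\dots,n$ (for $k=0$, $E_\eta=x^\eta$). For $\lambda\in\Lambda_n^+$, $P_\lambda$ is the unique scalar multiple of $x\mapsto\sum_{\sigma\in\mathcal S_n}E_\lambda(\sigma x)$ whose coefficient of $x^\lambda$ equals $1$. *)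

(* Defs.v *)
From HB Require Import structures.
From mathcomp Require Import all_boot all_order all_algebra.
From mathcomp Require Import fingroup perm.
From mathcomp Require Import all_classical all_reals all_analysis.
From mathcomp Require Import complex.
Set Implicit Arguments. Unset Strict Implicit. Unset Printing Implicit Defensive.
Import Order.TTheory GRing.Theory Num.Theory.
Import numFieldNormedType.Exports.
Local Open Scope ring_scope.

Definition the_unique (T : Type) (d : T) (P : T -> Prop) : T :=
  match pselect (exists x, P x) with
  | left h => projT1 (cid h)
  | right _ => d
  end.

(* Complex numbers: C = R[i], viewed as a numClosedFieldType, hence a
   normed module over itself (complex differentiability).             *)
Definition Cx (R : realType) : numClosedFieldType := R[i].

Section Defs.
Variable R : realType.
Local Notation C := (Cx R).

Definition cRe (z : C) : R := complex.Re (z : R[i]).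
Definition cIm (z : C) : R := complex.Im (z : R[i]).
Definition cR (x : R) : C := (x +i* 0)%C.

Definition cexp (z : C) : C :=
  ((expR (cRe z) * cos (cIm z)) +i* (expR (cRe z) * sin (cIm z)))%C.

(* principal logarithm on the right half plane Re z > 0 (the only place it
   is used): Log z = ln |z| + i Arg z with Arg z = atan (Im z / Re z). *)
Definition cLog (z : C) : C :=
  ((ln (Num.sqrt (cRe z ^+ 2 + cIm z ^+ 2))) +i* (atan (cIm z / cRe z)))%C.

Definition cvec n := 'I_n -> C.
Definition rvec n := 'I_n -> R.

Definition bil n (z w : cvec n) : C := \sum_(i < n) z i * w i.
Definition cofr n (x : rvec n) : cvec n := fun i => cR (x i).
Definition vconst n (s : C) : cvec n := fun _ => s.
Definition vinv n (z : cvec n) : cvec n := fun i => (z i)^-1.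
Definition vneg n (z : cvec n) : cvec n := fun i => - z i.
Definition vadd n (z w : cvec n) : cvec n := fun i => z i + w i.
Definition vscale n (t : C) (z : cvec n) : cvec n := fun i => t * z i.
Definition cbasis n (i : 'I_n) : cvec n := fun j => (i == j)%:R.

Definition pact n (s : {perm 'I_n}) (z : cvec n) : cvec n :=
  fun i => z ((s^-1)%g i).
Definition swapv n (i j : 'I_n) (z : cvec n) : cvec n :=
  fun l => z (tperm i j l).

Definition Delta n (z : cvec n) : C := \prod_(i < n) z i.
Definition Deltapow n (z : cvec n) (s : C) : C :=
  cexp (s * \sum_(i < n) cLog (z i)).

Definition omega n (k : R) (x : rvec n) : R :=
  \prod_(i < n) \prod_(j < n | (i < j)%N) (`|x i - x j| `^ (2 * k)).

Definition lebR := (@lebesgue_measure R).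
Definition Rpos : set R := `]0, +oo[%classic.

Definition cint (f : R -> C) : C :=
  ((Rintegral lebR Rpos (fun t => cRe (f t))) +i*
   (Rintegral lebR Rpos (fun t => cIm (f t))))%C.

Definition upd (x : nat -> R) (m : nat) (t : R) : nat -> R :=
  fun l => if l == m then t else x l.

Fixpoint iterint (m : nat) (G : (nat -> R) -> C) : (nat -> R) -> C :=
  match m with
  | 0 => G
  | m'.+1 => fun x => cint (fun t => iterint m' G (upd x m' t))
  end.

Fixpoint iterint_abs (m : nat) (G : (nat -> R) -> \bar R) : (nat -> R) -> \bar R :=
  match m with
  | 0 => G
  | m'.+1 => fun x => (\int[lebR]_(t in Rpos) iterint_abs m' G (upd x m' t))%E
  end.

Definition cabs (z : C) : R := Num.sqrt (cRe z ^+ 2 + cIm z ^+ 2).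

Definition intRpos n (F : rvec n -> C) : C :=
  iterint n (fun x => F (fun i => x i)) (fun _ => 0).

(* F is absolutely integrable over R_+^n (Tonelli: iterated integral of |F|
   is finite) *)
Definition integrableRpos n (F : rvec n -> C) : Prop :=
  (iterint_abs n (fun x => (cabs (F (fun i => x i)))%:E) (fun _ => 0%R) < +oo)%E.

Definition cGamma (s : C) : C :=
  cint (fun t => cexp ((s - 1) * cR (ln t)) * cR (expR (- t))).

Definition d_n (n : nat) (k : R) : C :=
  \prod_(j < n) (cGamma (cR (1 + j.+1%:R * k)) / cGamma (cR (1 + k))).

Definition Gamma_n n (k : R) (l : cvec n) : C :=
  d_n n k * \prod_(j < n) cGamma (l j - cR (k * j%:R)).

Definition dderiv n (f : cvec n -> C) (x xi : cvec n) : C :=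
  derive (fun t : C => f (vadd x (vscale t xi))) 0 1.

(* f : C^n -> C is holomorphic: complex differentiable in each variable
   separately at every point (equivalent to holomorphy by Hartogs). *)
Definition holo n (f : cvec n -> C) : Prop :=
  forall (z : cvec n) (i : 'I_n),
    derivable (fun t : C => f (vadd z (vscale t (cbasis i)))) 0 1.

Definition holo2 n (F : cvec n -> cvec n -> C) : Prop :=
  (forall l, holo (F l)) /\ (forall z, holo (fun l => F l z)).

(* points with pairwise distinct coordinates (off the reflecting
   hyperplanes, where the difference quotients are defined) *)
Definition regular n (x : cvec n) : Prop :=
  forall i j : 'I_n, i != j -> x i != x j.

Definition Dunkl n (k : R) (xi : rvec n) (f : cvec n -> C) (x : cvec n) : C :=
  dderiv f x (cofr xi) +
  cR k * \sum_(i < n) \sum_(j < n | (i < j)%N)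
     cR (xi i - xi j) * ((f x - f (swapv i j x)) / (x i - x j)).

Definition is_DunklKernel n (k : R) (F : cvec n -> cvec n -> C) : Prop :=
  holo2 F /\
  forall l : cvec n,
    (forall (xi : rvec n) (x : cvec n), regular x ->
        Dunkl k xi (F l) x = bil l (cofr xi) * F l x) /\
    F l (fun _ => 0) = 1.

Definition DunklE n (k : R) : cvec n -> cvec n -> C :=
  the_unique (fun _ _ => 0) (is_DunklKernel k).

Definition DunklJ n (k : R) (l z : cvec n) : C :=
  (n`!%:R)^-1 * \sum_(s : {perm 'I_n}) DunklE k l (pact s z).

Definition mi n := {ffun 'I_n -> nat}.
Definition msize n (e : mi n) : nat := \sum_(i < n) e i.

Definition is_partition n (e : mi n) : Prop :=
  forall i j : 'I_n, (i <= j)%N -> (e j <= e i)%N.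

Definition mplus n (e : mi n) : mi n :=
  [ffun i : 'I_n => nth 0%N (sort geq [seq e j | j <- enum 'I_n]) i].

Definition domle n (m l : mi n) : Prop :=
  msize m = msize l /\
  forall r : nat, (\sum_(j < n | (j < r)%N) m j <= \sum_(j < n | (j < r)%N) l j)%N.

Definition mact n (w : {perm 'I_n}) (e : mi n) : mi n :=
  [ffun i => e ((w^-1)%g i)].

Definition plength n (w : {perm 'I_n}) : nat :=
  #|[set p : 'I_n * 'I_n | (p.1 < p.2)%N && (w p.2 < w p.1)%N]|.

Inductive bruhat_le n : {perm 'I_n} -> {perm 'I_n} -> Prop :=
  | bruhat_refl u : bruhat_le u u
  | bruhat_step u i j v : bruhat_le u v ->
      (plength v < plength (v * tperm i j)%g)%N -> bruhat_le u (v * tperm i j)%g.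

Definition bruhat_lt n (u v : {perm 'I_n}) : Prop := bruhat_le u v /\ u <> v.

Definition shortest_perm n (e : mi n) (w : {perm 'I_n}) : Prop :=
  mact w (mplus e) = e /\
  forall w', mact w' (mplus e) = e -> (plength w <= plength w')%N.

Definition mprec n (kp e : mi n) : Prop :=
  (domle (mplus kp) (mplus e) /\ mplus kp <> mplus e) \/
  (mplus kp = mplus e /\
   exists we wk, shortest_perm e we /\ shortest_perm kp wk /\ bruhat_lt we wk).

Definition mono n (kp : mi n) (x : cvec n) : C := \prod_(i < n) x i ^+ kp i.

Definition peval n (d : nat) (c : mi n -> C) (x : cvec n) : C :=
  \sum_(kp : {ffun 'I_n -> 'I_d.+1})
     c [ffun i => nat_of_ord (kp i)] * mono [ffun i => nat_of_ord (kp i)] x.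

Definition Dop n (k : R) (j : 'I_n) (f : cvec n -> C) (x : cvec n) : C :=
  x j * Dunkl k (fun i => (i == j)%:R) f x + cR (k * (1 - n%:R)) * f x +
  cR k * \sum_(i < n | (j < i)%N) f (swapv i j x).

Definition etabar n (k : R) (e : mi n) (j : 'I_n) : R :=
  (e j)%:R
  - k * #|[set i : 'I_n | (i < j)%N && (e j <= e i)%N]|%:R
  - k * #|[set i : 'I_n | (j < i)%N && (e j < e i)%N]|%:R.

Definition is_nsJack_coef n (k : R) (e : mi n) (c : mi n -> C) : Prop :=
  c e = 1 /\
  (forall kp, c kp != 0 -> kp = e \/ mprec kp e) /\
  forall (j : 'I_n) (x : cvec n), regular x ->
    Dop k j (peval (msize e) c) x = cR (etabar k e j) * peval (msize e) c x.

Definition nsJack n (k : R) (e : mi n) : cvec n -> C :=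
  peval (msize e) (the_unique (fun _ => 0) (is_nsJack_coef k e)).

Definition symsum n (k : R) (l : mi n) (x : cvec n) : C :=
  \sum_(s : {perm 'I_n}) nsJack k l (pact s x).

Definition is_sJack n (k : R) (l : mi n) (f : cvec n -> C) : Prop :=
  (exists a : C, forall x, f x = a * symsum k l x) /\
  (exists c : mi n -> C, (forall x, f x = peval (msize l) c x) /\ c l = 1).

Definition sJack n (k : R) (l : mi n) : cvec n -> C :=
  the_unique (fun _ => 0) (is_sJack k l).

Definition mi_to_c n (e : mi n) : cvec n := fun i => cR (e i)%:R.

End Defs.

(* Main.v *)
(* Homogeneous polynomials E_m(lambda, .) with T_i E_(m+1) = lambda_i E_m exist because
   sum_i x_i T_i is the Euler operator plus a reflection part G, and m + G is inverted by
   convolution with an explicit function on the symmetric group whose total mass is at most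
   1/m; their sum is the Dunkl kernel.  Integrating by parts shows that the functional
   L_z[p] = int E(-z, x) p(x) Delta(x)^a omega(x) dx, where a = mu - mu_0 - 1, satisfies
   z_i L_z[x_i p] = L_z[T_i x_i p + a p].  For p = 1 this is a linear differential equation
   in z, whose solution is a constant times Delta(z)^(-mu).  The Knop-Sahi raising operator,
   which together with adjacent transpositions generates all non-symmetric Jack polynomials,
   propagates the formula to every E_eta.  The constant is the Selberg-type integral L_1[1]:
   its recursion in mu and its growth as mu tends to infinity determine it up to a factor
   independent of mu, which is found by induction on n from the boundary term of the
   integral of a derivative in the first coordinate. *)
From HB Require Import structures.
From mathcomp Require Import all_boot all_order all_algebra.
From mathcomp Require Import fingroup perm.
From mathcomp Require Import ring lra zify.
From mathcomp Require mpoly boolp.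

(** Two obstacles shape the analysis. The kernel is known only through its differential-difference
    system, and its homogeneous series at [-z] is not absolutely summable under the integral. It is
    therefore written as [E(-z, x) = exp(-s tr x) E(s - z, x)], where [tr x] is the sum of the
    coordinates and s is real with [|s - z_i| <= rho < s] for all i; such an s exists because
    [Re z_i > 0], and the terms are then dominated by [exp(rho tr x)]. This identity, and the
    equality of the kernel selected by [the_unique] with the series, rest on uniqueness for the
    Dunkl system at real points, obtained from an energy estimate for the orbit sum of [|g|^2] while
    the coordinates are lowered to 0 without crossing. Secondly, omega need not be differentiable on
    the hyperplanes. The integrations by parts are done with [((x_i - x_j)^2 + e)^k], and e tends to
    0 only after symmetrisation has turned the singular quotient into a bounded one. The growth in
    mu is a concentration argument: under the weight with parameter [al + N], the product of the
    coordinates divided by [(N + 1)^n] has moments tending to 1, by the recursion alone. *)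

Module DunklAlgebra.
Import mpoly.
Import Order.TTheory GRing.Theory Num.Theory.
Local Open Scope ring_scope.
Set Implicit Arguments. Unset Strict Implicit. Unset Printing Implicit Defensive.

Local Notation "m # s" := [multinom m (s i) | i < _]
  (at level 40, left associativity, format "m # s").

Lemma mul_sub_mul (A : comPzRingType) (a b c d : A) :
  a * b - c * d = (a - c) * d + a * (b - d).
Proof. ring. Qed.

(** * Compositions: ranks, squeezing and swapping moves *)

Section Compositions.
Variable n : nat.
Implicit Types (m : 'X_{1..n}) (i j l : 'I_n) (w : 'S_n).

(** A strict total order on the indices: larger entries come first, ties are broken from left to
    right. [rk] counts the predecessors, hence is the position of an index in the decreasing
    rearrangement, and [m j - k * rk m j] is the spectral vector of the Jack polynomial of index
    m. *)
Definition before m i j := (m j < m i)%N || ((m i == m j) && (i < j)%N).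

Definition rk m j : nat := \sum_i before m i j.

Definition mv m i j c : 'X_{1..n} :=
  [multinom (if l == i then m i - c else if l == j then m j + c else m l)%N | l < n].

Definition sqz m' m := exists i j, [/\ i != j, forall l, l != i -> l != j -> m' l = m l,
  (m' i + m' j = m i + m j)%N, (m' i < maxn (m i) (m j))%N & (m' j < maxn (m i) (m j))%N].

Definition swp m' m := exists i j, [/\ (i < j)%N, (m j < m i)%N & m' = m#(tperm i j)].

(** The exponents other than m that the operators [D] below can create from the monomial of m
    ([dtermP]). Triangularity of these operators is expressed through this relation; its link with
    the dominance and Bruhat orders comes later. *)
Definition move m' m := sqz m' m \/ swp m' m.

Lemma mv_sqz i j m c : i != j -> (m j < m i)%N -> (0 < c)%N -> (c < m i - m j)%N ->
  sqz (mv m i j c) m.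
Proof.
move=> nij hm c0 c1; have nji : j != i by rewrite eq_sym.
exists i, j; split=> //; rewrite ?mnmE ?eqxx ?(negbTE nji); try lia.
by move=> l /negbTE li /negbTE lj; rewrite mnmE li lj.
Qed.

Lemma mv_full i j m : i != j -> (m j <= m i)%N -> mv m i j (m i - m j) = m#(tperm i j).
Proof.
move=> nij hm; apply/mnmP => l; rewrite !mnmE; case: tpermP => [->|->|/eqP/negbTE -> /eqP/negbTE ->//].
  by rewrite eqxx subKn.
by rewrite eqxx eq_sym (negbTE nij) subnKC.
Qed.

Definition sqsum m : nat := \sum_i m i ^ 2.

Definition wsum m : nat := \sum_(i < n) i * m i.

Lemma sum_two (f g : 'I_n -> nat) i j : i != j ->
  (forall l, l != i -> l != j -> f l = g l) ->
  (\sum_l f l + (g i + g j) = \sum_l g l + (f i + f j))%N.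
Proof.
move=> nij h; have nji : j != i by rewrite eq_sym.
rewrite (bigD1 i) //= (bigD1 j) //= [in RHS](bigD1 i) //= [in RHS](bigD1 j) //=.
rewrite (eq_bigr g) => [|l /andP[]]; last exact: h.
by lia.
Qed.

(** Convexity of the square: with a fixed sum, two entries closer to each other have a smaller sum
    of squares. *)
Lemma sqz_sqsum m' m : sqz m' m -> (sqsum m' < sqsum m)%N.
Proof.
case=> i [j [nij h e1 e2 e3]].
have h2 l : l != i -> l != j -> (m' l ^ 2 = m l ^ 2)%N by move=> li lj; rewrite h.
have := sum_two nij h2; rewrite -/(sqsum m) -/(sqsum m') -!mulnn.
by case: (leqP (m i) (m j)) e2 e3 => hm; nia.
Qed.

Lemma move_mdeg m' m : move m' m -> mdeg m' = mdeg m.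
Proof.
case=> [[i [j [nij h e1 _ _]]]|[i [j [_ _ ->]]]]; last exact: mdeg_mperm.
by have := sum_two nij h; rewrite !mdegE e1 => /addIn.
Qed.

Lemma mperm_sum (f : nat -> nat) m (w : 'S_n) : (\sum_i f ((m#w) i) = \sum_i f (m i))%N.
Proof.
rewrite [RHS](reindex_inj (@perm_inj _ w)) /=.
by apply: eq_bigr => i _; rewrite mnmE.
Qed.

Lemma sqsum_perm m (w : 'S_n) : sqsum (m#w) = sqsum m.
Proof. exact: (mperm_sum (fun x => x ^ 2)%N). Qed.

Lemma swp_wsum m' m : swp m' m -> (wsum m < wsum m')%N.
Proof.
case=> i [j [ij hm ->]]; have nij : i != j by rewrite -(inj_eq val_inj) /= ltn_eqF.
have h l : l != i -> l != j -> (l * (m#(tperm i j)) l = l * m l)%N.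
  by move=> li lj; rewrite mnmE tpermD // eq_sym.
have := sum_two nij h; rewrite -!/(wsum _) !mnmE tpermL tpermR.
have [d hd] : exists d, j = (i + d.+1)%N :> nat by exists (j - i).-1; lia.
have [e he] : exists e, m i = (m j + e.+1)%N by exists (m i - m j).-1; lia.
by rewrite hd he; nia.
Qed.

Lemma wsum_le m : (wsum m <= n * mdeg m)%N.
Proof.
by rewrite mdegE big_distrr /= leq_sum // => i _; rewrite leq_mul2r ltnW ?orbT.
Qed.

(** A lexicographic measure packed into one number: [sqsum] first, then [wsum] in reverse. The bound
    [wsum <= n * mdeg] makes the packing faithful; a squeeze lowers the first component, a swap
    keeps it and raises [wsum]. *)
Definition hgt m : nat := (sqsum m * (n * mdeg m).+1 + (n * mdeg m - wsum m))%N.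

Lemma move_hgt m' m : move m' m -> (hgt m' < hgt m)%N.
Proof.
move=> mv; rewrite /hgt (move_mdeg mv); have := wsum_le m'; rewrite (move_mdeg mv) => le'.
case: mv => [/sqz_sqsum lt|sp]; first by nia.
have -> : sqsum m' = sqsum m by case: sp => i [j [_ _ ->]]; exact: sqsum_perm.
by have := swp_wsum sp; lia.
Qed.

Inductive chain m : 'X_{1..n} -> Prop :=
| chain_refl : chain m m
| chain_step m1 m2 : chain m m1 -> move m2 m1 -> chain m m2.

Lemma before_total m i j : i != j -> before m i j || before m j i.
Proof.
rewrite -(inj_eq val_inj) /before /= => nij.
by case: (ltngtP (m i) (m j)) => //= _; rewrite -neq_ltn.
Qed.

Lemma before_trans m : transitive (before m).
Proof. by move=> j i l; rewrite /before; lia. Qed.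

Lemma before_irr m i : before m i i = false.
Proof. by rewrite /before !ltnn andbF. Qed.

Lemma before_rk m i j : before m i j -> (rk m i < rk m j)%N.
Proof.
move=> bij; rewrite /rk (bigD1 i) //= before_irr add0n [X in (_ < X)%N](bigD1 i) //= bij.
rewrite add1n ltnS leq_sum // => l _.
by case bl : (before m l i) => //; rewrite (before_trans bl bij).
Qed.

Definition adj i i' := (i' = i.+1 :> nat).

Lemma adj_tperm_lt i i' (x y : 'I_n) : adj i i' -> ~~ ((x == i) && (y == i')) -> 
  ~~ ((x == i') && (y == i)) -> (tperm i i' x < tperm i i' y)%N = (x < y)%N.
Proof.
rewrite /adj -!(inj_eq val_inj) /= => e.
have key (z : 'I_n) : tperm i i' z = (if z == i :> nat then i.+1 else if z == i.+1 :> nat then i : nat else z) :> nat.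
  case: tpermP => [->|->|/eqP zi /eqP zi']; first by rewrite eqxx.
    by rewrite e eqxx; case: eqP => // h; lia.
  by move: zi zi'; rewrite -!(inj_eq val_inj) /= e => /negbTE -> /negbTE ->.
move=> h1 h2; rewrite !key; move: h1 h2; rewrite e.
by do !case: ifP => ?; lia.
Qed.

Lemma adj_tperm_inv i i' (x y : 'I_n) : adj i i' -> x != i -> x != i' ->
  (x < tperm i i' y)%N = (x < y)%N.
Proof.
move=> a xi xi'; have {1}<- : tperm i i' x = x by rewrite tpermD // eq_sym.
by rewrite adj_tperm_lt // (negbTE xi, negbTE xi').
Qed.

Lemma rk_perm m (w : 'S_n) : (forall x y, m (w x) = m (w y) -> (x < y)%N = (w x < w y)%N) ->
  forall j, rk (m#w) j = rk m (w j).
Proof.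
move=> hw j; rewrite /rk [RHS](reindex_inj (@perm_inj _ w)) /=; apply: eq_bigr => l _.
rewrite /before !mnmE; case: (m (w l) =P m (w j)) => [e|]; last by rewrite !andFb.
by rewrite hw.
Qed.

(** For a weakly increasing m the middle alternative is excluded, so every exponent reached from m
    other than m itself has a strictly smaller sum of squares and is not a rearrangement of m. *)
Lemma chain_swp_or m m' : chain m m' ->
  m' = m \/ (exists i j, (i < j)%N /\ (m j < m i)%N) \/ (sqsum m' < sqsum m)%N.
Proof.
elim=> [|m1 m2 _ [->|[h|h]] mv]; first by left.
- case: mv => [/sqz_sqsum h|[i [j [h1 h2 _]]]]; first by right; right.
  by right; left; exists i, j.
- by right; left.
- right; right; case: mv => [/sqz_sqsum h2|[i [j [_ _ ->]]]]; first exact: ltn_trans h2 h.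
  by rewrite sqsum_perm.
Qed.

Lemma adj_descent m i j : (i < j)%N -> (m j < m i)%N ->
  exists a a', adj a a' /\ (m a' < m a)%N.
Proof.
elim: {j}(j - i)%N {-2}j (erefl (j - i)%N) => [|t IHt] j tj ij mij; first lia.
have ltj : (j.-1 < n)%N by have := ltn_ord j; lia.
have [le|lt] := leqP (m (Ordinal ltj)) (m j); last first.
  by exists (Ordinal ltj), j; split=> //; rewrite /adj /=; lia.
case: (ltngtP i j.-1) => hij; last first.
- have e : Ordinal ltj = i by apply: val_inj; rewrite /= hij.
  by move: le; rewrite e; lia.
- by lia.
by apply: (IHt (Ordinal ltj)) => //=; [lia|exact: leq_ltn_trans le mij].
Qed.

End Compositions.

(** * Dunkl operators on polynomials and their relation to the Euler operator *)

Section Operators.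
Variables (F : numFieldType) (n : nat) (k : F).
Local Notation P := {mpoly F[n]}.
Implicit Types (p q : P) (i j l : 'I_n) (w : 'S_n).

Lemma mpoly_ind_mulX (Q : P -> Prop) :
  (forall c p q, Q p -> Q q -> Q (c *: p + q)) -> Q 1 ->
  (forall i p, Q p -> Q ('X_i * p)) -> forall p, Q p.
Proof.
move=> Qlin Q1 QX.
have Q0 : Q 0 by rewrite -(addNr (1 : P)) -scaleN1r; apply: Qlin.
have QXm (m : 'X_{1..n}) : Q 'X_[m].
  elim: {m}(mdeg m) {-2}m (erefl (mdeg m)) => [|d IHd] m dm.
    by move/eqP: dm; rewrite mdeg_eq0 => /eqP ->; rewrite mpolyX0.
  have [i mi] : exists i, m i != 0%N.
    apply/existsP; rewrite -negb_forall; apply/negP => /forallP m0.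
    have : mdeg m = 0%N.
      by apply/eqP; rewrite mdeg_eq0; apply/eqP/mnmP => i; rewrite mnm0E; apply/eqP.
    by rewrite dm.
  have le : (U_(i) <= m)%MM by rewrite lep1mP.
  rewrite -(submK le) addmC mpolyXD; apply/QX/IHd.
  have /(congr1 (@mdeg n)) := submK le; rewrite mdegD mdeg1 dm addn1 => /eqP.
  by rewrite eqSS => /eqP.
by elim/mpolyind => [//|c m p _ _ Qp]; exact: Qlin.
Qed.

Lemma msymXi w i : msym w 'X_i = 'X_(w i) :> P.
Proof.
rewrite msymX; congr 'X_[_]; apply/mnmP => j; rewrite mnmE !mnm1E.
by rewrite -(inj_eq (@perm_inj _ w)) permKV.
Qed.

Definition sw i j : P -> P := msym (tperm i j).
HB.instance Definition _ i j := GRing.Linear.on (sw i j).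

Lemma swP i j c p q : sw i j (c *: p + q) = c *: sw i j p + sw i j q.
Proof. exact: linearP. Qed.

Lemma swBZ i j c p q : sw i j (p - c *: q) = sw i j p - c *: sw i j q.
Proof. by rewrite linearB linearZ. Qed.

Lemma swB i j p q : sw i j (p - q) = sw i j p - sw i j q.
Proof. exact: linearB. Qed.

Lemma swC i j p : sw i j p = sw j i p.
Proof. by rewrite /sw tpermC. Qed.

Lemma swK i j : involutive (sw i j).
Proof. by move=> p; rewrite /sw -msymMm tperm2 msym1m. Qed.

Lemma msym_sw w i j p : msym w (sw i j p) = sw (w i) (w j) (msym w p).
Proof.
rewrite /sw -!msymMm; congr (msym _ p).
by rewrite -[in RHS]tpermJ conjgE !mulgA mulgV mul1g.
Qed.

Lemma divided_difference_ex i j p : exists q, p - sw i j p == ('X_i - 'X_j) * q.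
Proof.
elim/mpoly_ind_mulX: p => [c p q [a /eqP ha] [b /eqP hb]||l p [q /eqP hq]].
- exists (c *: a + b); apply/eqP; rewrite mulrDr -scalerAr -ha -hb swP.
  by rewrite scalerBr opprD addrACA.
- by exists 0; rewrite /sw msym1 subrr mulr0.
- have [r hr] : exists r, 'X_l - sw i j 'X_l = ('X_i - 'X_j) * r :> P.
    rewrite /sw msymXi; case: tpermP => [->|->|_ _].
    + by exists 1; rewrite mulr1.
    + by exists (-1); rewrite mulrN1 opprB.
    + by exists 0; rewrite subrr mulr0.
  exists (r * sw i j p + 'X_l * q); apply/eqP.
  rewrite {1}/sw msymM -!/(sw _ _ _) mulrDr mulrA -hr.
  by rewrite [_ * (_ * q)]mulrCA -hq mul_sub_mul.
Qed.

(** A quotient chosen from the divisibility just proved. For [i = j] the defining equation reads 0 =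
    0 and the value is arbitrary, whence the condition [i != j] in the rules of computation. *)
Definition dd : 'I_n -> 'I_n -> P -> P :=
  locked (fun i j p => xchoose (divided_difference_ex i j p)).

Lemma ddP i j p : p - sw i j p = ('X_i - 'X_j) * dd i j p.
Proof. by rewrite /dd -lock; exact/eqP/(xchooseP (divided_difference_ex i j p)). Qed.

Lemma XsubX_neq0 i j : i != j -> 'X_i - 'X_j != 0 :> P.
Proof.
move=> nij; apply/negP => /eqP /(congr1 (fun p : P => p@_U_(i))) /eqP.
rewrite mcoeffB !mcoeffXU eqxx (eq_sym j) (negbTE nij) subr0 mcoeff0.
by rewrite oner_eq0.
Qed.

Lemma dd_uniq i j p q : i != j -> p - sw i j p = ('X_i - 'X_j) * q -> dd i j p = q.
Proof. by move=> nij; rewrite ddP => /(mulfI (XsubX_neq0 nij)). Qed.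

Lemma dd_lin i j c p q : i != j -> dd i j (c *: p + q) = c *: dd i j p + dd i j q.
Proof.
move=> nij; apply: dd_uniq => //.
rewrite mulrDr -scalerAr -(ddP i j p) -(ddP i j q) swP scalerBr.
by rewrite opprD addrACA.
Qed.

Lemma ddM i j p q : i != j -> dd i j (p * q) = dd i j p * sw i j q + p * dd i j q.
Proof.
move=> nij; apply: dd_uniq => //.
by rewrite mulrDr mulrA -ddP mulrCA -ddP {1}/sw msymM -!/(sw _ _ _) mul_sub_mul.
Qed.

Lemma dd_sym i j p : i != j -> sw i j p = p -> dd i j p = 0.
Proof. by move=> nij e; apply: dd_uniq => //; rewrite e subrr mulr0. Qed.

Lemma ddC i j p : i != j -> dd j i p = - dd i j p.
Proof.
move=> nij; apply: dd_uniq; first by rewrite eq_sym.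
by rewrite mulrN -mulNr opprB swC ddP.
Qed.

Lemma ddX i j l : i != j -> dd i j 'X_l = ((l == i)%:R - (l == j)%:R)%:MP.
Proof.
move=> nij; apply: dd_uniq => //; rewrite /sw msymXi; case: tpermP => [->|->|/eqP li /eqP lj].
- by rewrite eqxx (negbTE nij) subr0 mulr1.
- by rewrite eqxx (eq_sym j) (negbTE nij) sub0r rmorphN /= mulrN mulr1 opprB.
- by rewrite (negbTE li) (negbTE lj) !subrr mulr0.
Qed.

Lemma msym_dd w i j p : i != j -> msym w (dd i j p) = dd (w i) (w j) (msym w p).
Proof.
move=> nij; apply/esym/dd_uniq; first by rewrite (inj_eq perm_inj).
by rewrite -msym_sw -!msymXi -!msymB -msymM ddP.
Qed.

Lemma msym_mderiv w i p : msym w p^`M(i) = (msym w p)^`M(w i).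
Proof.
apply/mpolyP => m; rewrite mcoeff_sym !mcoeff_deriv mcoeff_sym mnmE; congr (_ *+ _).
congr (p@__); apply/mnmP => j; rewrite !mnmE; congr (_ + _)%N.
by rewrite (inj_eq perm_inj).
Qed.

Definition T : 'I_n -> P -> P :=
  locked (fun i p => p^`M(i) + k *: \sum_(j | j != i) dd i j p).

Lemma TE i p : T i p = p^`M(i) + k *: \sum_(j | j != i) dd i j p.
Proof. by rewrite /T -lock. Qed.

Lemma T_is_linear i : linear (T i).
Proof.
move=> c p q; rewrite !TE linearD linearZ /= scalerDr addrACA; congr (_ + _).
rewrite scalerA mulrC -scalerA -scalerDr; congr (_ *: _).
rewrite scaler_sumr -big_split /=; apply: eq_bigr => j nj.
by rewrite dd_lin // eq_sym.
Qed.

HB.instance Definition _ i := GRing.isLinear.Build F P P *:%R (T i) (T_is_linear i).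

Lemma TP i c p q : T i (c *: p + q) = c *: T i p + T i q.
Proof. exact: linearP. Qed.

Lemma TBZ i c p q : T i (p - c *: q) = T i p - c *: T i q.
Proof. by rewrite linearB linearZ. Qed.

Lemma T1 i : T i 1 = 0.
Proof.
rewrite TE -mpolyC1 mderivC add0r big1 ?scaler0 // => j nj.
by rewrite dd_sym 1?eq_sym // /sw mpolyC1 msym1.
Qed.

Lemma msym_T w i p : msym w (T i p) = T (w i) (msym w p).
Proof.
rewrite !TE linearD linearZ /= msym_mderiv; congr (_ + _ *: _).
rewrite [LHS]linear_sum /=.
rewrite [RHS](reindex_inj (@perm_inj _ w)) /=.
under [RHS]eq_bigl do rewrite (inj_eq perm_inj).
by apply: eq_bigr => j nj; rewrite msym_dd // eq_sym.
Qed.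

Lemma sw_T i j l p : sw i j (T l p) = T (tperm i j l) (sw i j p).
Proof. exact: msym_T. Qed.

Lemma mderivX1 i l : ('X_l : P)^`M(i) = (l == i)%:R%:MP.
Proof.
rewrite mderivX mnm1E; case: eqP => [->|_]; last by rewrite scale0r mpolyC0.
rewrite scale1r [(_ - _)%MM](_ : _ = 0%MM) ?mpolyX0 //.
by apply/mnmP => j; rewrite mnmBE subnn mnm0E.
Qed.

Lemma T_X i p : T i ('X_i * p) = 'X_i * T i p + p + k *: \sum_(j | j != i) sw i j p.
Proof.
rewrite !TE mderivM mderivX1 eqxx mul1r mulrDr [p + _]addrC -!addrA; congr (_ + _).
rewrite addrCA; congr (_ + _); rewrite -scalerAr -scalerDr; congr (_ *: _).
rewrite mulr_sumr -big_split /=; apply: eq_bigr => j; rewrite eq_sym => nij.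
by rewrite ddM // ddX // eqxx (negbTE nij) subr0 mul1r addrC.
Qed.

Lemma T_Xneq i l p : l != i -> T i ('X_l * p) = 'X_l * T i p - k *: sw i l p.
Proof.
move=> nl; rewrite !TE mderivM mderivX1 (negbTE nl) mul0r add0r mulrDr -addrA.
congr (_ + _); rewrite -scalerAr -scalerBr; congr (_ *: _).
rewrite mulr_sumr (bigD1 l) //= [in RHS](bigD1 l) //=.
have nil : i != l by rewrite eq_sym.
rewrite ddM // ddX // eqxx (negbTE nl) sub0r rmorphN /= mulN1r.
rewrite -addrA [RHS]addrC; congr (_ + (_ + _)).
apply: eq_bigr => j /andP[]; rewrite eq_sym => nij; rewrite eq_sym => nlj.
by rewrite ddM // ddX // (negbTE nl) (negbTE nlj) subrr mul0r add0r.
Qed.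

(* The commutator of two Dunkl operators commutes with all multiplications by
   variables and annihilates 1. *)
Lemma T_comm i j p : T i (T j p) = T j (T i p).
Proof.
have [->//|nij] := eqVneq i j.
have main (a b : 'I_n) (q : P) : a != b -> T a (T b q) = T b (T a q) ->
    T a (T b ('X_a * q)) = T b (T a ('X_a * q)).
  move=> nab IH; have nba : b != a by rewrite eq_sym.
  rewrite (T_X a) !linearD linearZ linear_sum /= (T_Xneq q nab) (T_Xneq (T a q) nab).
  rewrite linearB linearZ /= T_X IH (bigD1 b) //= [in RHS](bigD1 b) //=.
  rewrite !scalerDr !sw_T !tpermR (swC b a).
  have -> : \sum_(l < n | (l != a) && (l != b)) sw a l (T b q) =
            \sum_(l < n | (l != a) && (l != b)) T b (sw a l q).
    by apply: eq_bigr => l /andP[la lb]; rewrite sw_T tpermD // eq_sym.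
  move: (\sum_(l < n | _) _) => S.
  move: ('X_a * _) (k *: T a _) (k *: T b _) (T b q) (k *: S) => A B C D E.
  by rewrite [B + E]addrC addrA addrK [A - C + D]addrAC addrA subrK.
elim/mpoly_ind_mulX: p => [c p q hp hq||l p hp].
- by rewrite !linearD !linearZ /= hp hq.
- by rewrite !T1 !linear0.
have [->|nli] := eqVneq l i; first exact: main.
have [->|nlj] := eqVneq l j; first by apply/esym/main; rewrite // eq_sym.
have e1 : tperm i l j = j by rewrite tpermD.
have e2 : tperm j l i = i by rewrite tpermD // eq_sym.
rewrite (T_Xneq p nlj) (T_Xneq p nli) !TBZ (T_Xneq (T j p) nli) (T_Xneq (T i p) nlj).
by rewrite hp !sw_T e1 e2; exact: addrAC.
Qed.

(* [half] avoids ordering the pairs: both ordered versions of a transposition occur. *)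
Definition G : P -> P :=
  locked (fun p => (k / 2) *: \sum_(a | a.1 != a.2) (p - sw a.1 a.2 p)).
Definition eu : P -> P := locked (fun p => \sum_i 'X_i * p^`M(i)).

Lemma GE p : G p = (k / 2) *: \sum_(a | a.1 != a.2) (p - sw a.1 a.2 p).
Proof. by rewrite /G -lock. Qed.

Lemma euE p : eu p = \sum_i 'X_i * p^`M(i).
Proof. by rewrite /eu -lock. Qed.

Lemma G_is_linear : linear G.
Proof.
move=> c p q; rewrite !GE scalerA (mulrC c) -(scalerA (k / 2) c) -scalerDr; congr (_ *: _).
rewrite scaler_sumr -big_split /=; apply: eq_bigr => a _.
by rewrite linearD linearZ /= scalerBr opprD addrACA.
Qed.
HB.instance Definition _ := GRing.isLinear.Build F P P *:%R G G_is_linear.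

Lemma eu_is_linear : linear eu.
Proof.
move=> c p q; rewrite !euE scaler_sumr -big_split /=; apply: eq_bigr => i _.
by rewrite linearD linearZ /= mulrDr scalerAr.
Qed.
HB.instance Definition _ := GRing.isLinear.Build F P P *:%R eu eu_is_linear.

Lemma GBZ c p q : G (p - c *: q) = G p - c *: G q.
Proof. by rewrite linearB linearZ. Qed.

Lemma euDZ c p q : eu (p + c *: q) = eu p + c *: eu q.
Proof. by rewrite addrC linearP addrC. Qed.

Lemma eu1 : eu 1 = 0.
Proof. by rewrite euE big1 // => i _; rewrite -mpolyC1 mderivC mulr0. Qed.

Lemma euM p q : eu (p * q) = eu p * q + p * eu q.
Proof.
rewrite !euE mulr_suml mulr_sumr -big_split /=; apply: eq_bigr => i _.
by rewrite mderivM mulrDr !mulrA; congr (_ + _); rewrite -!mulrA mulrCA.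
Qed.

Lemma euX l : eu 'X_l = 'X_l.
Proof.
rewrite euE (bigD1 l) //= mderivX1 eqxx mulr1 big1 ?addr0 // => i nil.
by rewrite mderivX1 eq_sym (negbTE nil) mpolyC0 mulr0.
Qed.

Lemma msym_eu w p : msym w (eu p) = eu (msym w p).
Proof.
rewrite !euE linear_sum /= [RHS](reindex_inj (@perm_inj _ w)) /=.
by apply: eq_bigr => i _; rewrite msymM msymXi msym_mderiv.
Qed.

Lemma msym_G w p : msym w (G p) = G (msym w p).
Proof.
rewrite !GE [LHS]linearZ /=; congr (_ *: _); rewrite [LHS]linear_sum /=.
rewrite [RHS](reindex_inj (h := fun a : 'I_n * 'I_n => (w a.1, w a.2))) /=; last first.
  by move=> [a b] [c d] /= [/perm_inj -> /perm_inj ->].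
under [RHS]eq_bigl do rewrite (inj_eq perm_inj).
by apply: eq_bigr => a _; rewrite linearB /= msym_sw.
Qed.

Lemma eu_dd i j p : i != j -> eu (dd i j p) = dd i j (eu p) - dd i j p.
Proof.
move=> nij; have := congr1 eu (ddP i j p).
rewrite linearB /= -msym_eu -/(sw i j _) ddP euM linearB /= !euX -mulrDr.
by move=> /(mulfI (XsubX_neq0 nij)) ->; rewrite addrAC subrr add0r.
Qed.

Lemma eu_T i p : eu (T i p) = T i (eu p) - T i p.
Proof.
have edd : eu (\sum_(j < n | j != i) dd i j p) =
    \sum_(j < n | j != i) dd i j (eu p) - \sum_(j < n | j != i) dd i j p.
  rewrite linear_sum /= -sumrB; apply: eq_bigr => j nj.
  by rewrite eu_dd // eq_sym.
have eder : eu p^`M(i) = (eu p)^`M(i) - p^`M(i).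
  rewrite !euE linear_sum /= (bigD1 i) //= [in RHS](bigD1 i) //=.
  rewrite mderivM mderivX1 eqxx mul1r.
  rewrite (eq_bigr (fun j => 'X_j * p^`M(j)^`M(i))); last first.
    by move=> j nji; rewrite mderiv_comm.
  rewrite [in RHS](eq_bigr (fun j => 'X_j * p^`M(j)^`M(i))); last first.
    by move=> j nji; rewrite mderivM mderivX1 (negbTE nji) mul0r add0r.
  by rewrite [RHS]addrAC [p^`M(i) + _]addrC addrK.
by rewrite !TE euDZ edd eder scalerBr opprD addrACA.
Qed.

(** An unordered pair contributes [x_i dd_ij p + x_j dd_ji p = (x_i - x_j) dd_ij p = p - s_ij p].
    The double sum is written in both orders and added, which accounts for the factor 1/2 in [G]. *)
Lemma sum_XT p : \sum_i 'X_i * T i p = eu p + G p.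
Proof.
have -> : \sum_i 'X_i * T i p =
    eu p + k *: \sum_i \sum_(j | j != i) 'X_i * dd i j p.
  rewrite euE scaler_sumr -big_split /=; apply: eq_bigr => i _.
  rewrite TE mulrDr; congr (_ + _); rewrite -[LHS]scalerAr; congr (_ *: _).
  exact: mulr_sumr.
congr (_ + _); rewrite GE -(pair_big_dep xpredT (fun a b => a != b)
  (fun a b => p - sw a b p)) /=.
have e1 : \sum_i \sum_(j | j != i) 'X_i * dd i j p =
          \sum_i \sum_(j | i != j) 'X_i * dd i j p.
  by apply: eq_bigr => i _; apply: eq_bigl => j; rewrite eq_sym.
have e2 : \sum_i \sum_(j | j != i) 'X_i * dd i j p =
          - \sum_i \sum_(j | i != j) 'X_j * dd i j p.
  rewrite (exchange_big_dep xpredT) //= -sumrN; apply: eq_bigr => i _.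
  rewrite -sumrN; apply: eq_bigr => j nij.
  by rewrite ddC // mulrN.
have -> : \sum_i \sum_(j | i != j) (p - sw i j p) =
   (\sum_i \sum_(j | j != i) 'X_i * dd i j p) *+ 2.
  rewrite mulr2n {1}e1 e2 -sumrB; apply: eq_bigr => i _.
  by rewrite -sumrB; apply: eq_bigr => j nij; rewrite ddP mulrBl.
by rewrite -scaler_nat scalerA divfK // pnatr_eq0.
Qed.

(** * Averaging bound, resolvent on the symmetric group, homogeneous parts of the kernel *)

Section MaximumPrinciple.
Hypothesis k_ge0 : 0 <= k.

(* Summing the norms over [I] removes the averaging part, the moves being bijective. *)
Lemma averaging_bound (I A : finType) (Q : pred A) (tau : A -> I -> I) (v b : I -> F) (c kap : F) :
  0 <= kap -> (forall a, injective (tau a)) ->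
  (forall x : I, c * v x + kap * \sum_(a | Q a) (v x - v (tau a x)) = b x) ->
  0 < c -> c * \sum_i `|v i| <= \sum_i `|b i|.
Proof.
move=> kap0 tau_inj eqv c0.
pose N := (\sum_(a | Q a) 1 : F).
have N0 : 0 <= N by apply: sumr_ge0.
have step (i : I) : (c + kap * N) * `|v i| <= `|b i| + kap * \sum_(a | Q a) `|v (tau a i)|.
  have -> : (c + kap * N) * `|v i| = `|b i + kap * \sum_(a | Q a) v (tau a i)|.
    rewrite -eqv sumrB mulrBr -addrA subrK.
    have -> : \sum_(a | Q a) v i = N * v i by rewrite mulr_suml; under [RHS]eq_bigr do rewrite mul1r.
    by rewrite mulrA -mulrDl normrM ger0_norm // addr_ge0 ?mulr_ge0 // ltW.
  apply: le_trans (ler_normD _ _) _; rewrite lerD2l normrM (ger0_norm kap0).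
  by apply: ler_wpM2l => //; exact: ler_norm_sum.
have := ler_sum (index_enum I) (P := xpredT) (fun (x : I) _ => step x).
rewrite -mulr_sumr big_split /= -mulr_sumr exchange_big /=.
have -> : \sum_(a | Q a) \sum_i `|v (tau a i)| = N * \sum_i `|v i|.
  rewrite mulr_suml; apply: eq_bigr => a _.
  by rewrite mul1r [RHS](reindex_inj (tau_inj a)).
by rewrite mulrDl mulrA lerD2r.
Qed.

Lemma averaging_injective (I A : finType) (Q : pred A) (tau : A -> I -> I) (v : I -> F) (c kap : F) :
  0 <= kap -> (forall a, injective (tau a)) -> 0 < c ->
  (forall x : I, c * v x + kap * \sum_(a | Q a) (v x - v (tau a x)) = 0) ->
  forall x : I, v x = 0.
Proof.
move=> kap0 tau_inj c0 /(averaging_bound kap0 tau_inj)/(_ c0).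
rewrite [X in _ <= X]big1 => [|i _]; last exact: normr0.
rewrite pmulr_rle0 // => le0 i.
have : \sum_i `|v i| == 0 by rewrite eq_le le0 sumr_ge0.
rewrite psumr_eq0 // => /allP/(_ i (mem_index_enum _))/=.
by rewrite normr_eq0 => /eqP.
Qed.

Lemma k2_ge0 : 0 <= k / 2.
Proof. by rewrite divr_ge0. Qed.

(** On a combination of translates [msym w p] the operator [m.+1 + G] acts on the coefficient
    function alone; this is that action. Inverting it once on the finite-dimensional space of
    functions on the group yields an inverse valid for every polynomial p. *)
Definition resolvent_fun (m : nat) (q : {ffun 'S_n -> F^o}) : {ffun 'S_n -> F^o} :=
  [ffun w => m.+1%:R * q w + (k / 2) *
     \sum_(a : 'I_n * 'I_n | a.1 != a.2) (q w - q (w * tperm a.1 a.2)%g)].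

Lemma resolvent_fun_linear m : linear (resolvent_fun m).
Proof.
move=> c p q; apply/ffunP => w; rewrite !ffunE /= scalerDr addrACA; congr (_ + _).
  by rewrite mulrDr; congr (_ + _); rewrite /GRing.scale /= mulrCA.
transitivity (k / 2 * (c * \sum_(a : 'I_n * 'I_n | a.1 != a.2) (p w - p (w * tperm a.1 a.2)%g)
    + \sum_(a : 'I_n * 'I_n | a.1 != a.2) (q w - q (w * tperm a.1 a.2)%g))); last first.
  by rewrite mulrDr mulrCA.
congr (_ * _); rewrite mulr_sumr -big_split /=; apply: eq_bigr => a _.
by rewrite !ffunE /GRing.scale /= mulrBr opprD addrACA.
Qed.
HB.instance Definition _ m := GRing.isLinear.Build F _ _ _ (resolvent_fun m) (resolvent_fun_linear m).

Lemma mulg_tperm_inj (a : 'I_n * 'I_n) : injective (fun w : 'S_n => (w * tperm a.1 a.2)%g).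
Proof. by move=> w w' /mulIg. Qed.

(** The averaging bound makes the operator injective, hence bijective in finite dimension; the
    solution is the preimage of the unit mass at the identity. *)
Lemma resolvent_ex m : exists q : 'S_n -> F,
  (forall w, m.+1%:R * q w + (k / 2) *
     \sum_(a : 'I_n * 'I_n | a.1 != a.2) (q w - q (w * tperm a.1 a.2)%g) = (w == 1%g)%:R).
Proof.
pose f := linfun (resolvent_fun m).
have kf : lker f == 0%VS.
  apply/lker0P => p q; rewrite !lfunE /= => epq.
  apply/eqP; rewrite -subr_eq0; apply/eqP/ffunP => w; rewrite [RHS]ffunE.
  apply: (averaging_injective (Q := fun a => a.1 != a.2) k2_ge0 mulg_tperm_inj (ltr0Sn F m)) => {}w.
  have : resolvent_fun m (p - q) w = 0 by rewrite linearB /= epq subrr ffunE.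
  by rewrite ffunE.
pose del : {ffun 'S_n -> F^o} := [ffun w => (w == 1%g)%:R].
have fsurj : f ((f^-1)%VF del) = del.
  apply: limg_lfunVK; suff -> : limg f = fullv by rewrite memvf.
  apply/eqP; rewrite eqEdim subvf limg_dim_eq ?leqnn //.
  by rewrite (eqP kf) capv0.
exists ((f^-1)%VF del) => w; move/ffunP: fsurj => /(_ w).
by rewrite lfunE /= !ffunE.
Qed.

Definition resolvent m : 'S_n -> F := projT1 (boolp.cid (resolvent_ex m)).

Lemma resolventP m w : m.+1%:R * resolvent m w + (k / 2) *
  \sum_(a : 'I_n * 'I_n | a.1 != a.2) (resolvent m w - resolvent m (w * tperm a.1 a.2)%g)
   = (w == 1%g)%:R.
Proof. exact: (projT2 (boolp.cid (resolvent_ex m))). Qed.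

Lemma resolvent_norm m : \sum_w `|resolvent m w| <= m.+1%:R^-1.
Proof.
have := averaging_bound k2_ge0 mulg_tperm_inj (resolventP m) (ltr0Sn F m).
have -> : \sum_(w : 'S_n) `|(w == 1%g)%:R : F| = 1.
  rewrite (bigD1 1%g) //= eqxx normr1 big1 ?addr0 // => w nw.
  by rewrite (negbTE nw) normr0.
by rewrite -ler_pdivlMl ?ltr0Sn // mulr1.
Qed.

Definition linform (lam : 'I_n -> F) : P := \sum_i lam i *: 'X_i.

(** Adding x_i times the equations [T_i E_(m+1) = lam_i E_m] gives the single equation
    [(m + 1 + G) E_(m+1) = linform * E_m], which this recursion solves. That the single equation
    implies the whole system is the content of [T_dunkl_pol_step]. *)
Fixpoint dunkl_pol (lam : 'I_n -> F) (m : nat) : P :=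
  if m is m'.+1 then \sum_w resolvent m' w *: msym w (linform lam * dunkl_pol lam m') else 1.

Lemma eu_linform lam : eu (linform lam) = linform lam.
Proof. by rewrite /linform linear_sum /=; apply: eq_bigr => i _; rewrite linearZ /= euX. Qed.

Lemma eu_dunkl_pol lam m : eu (dunkl_pol lam m) = m%:R *: dunkl_pol lam m.
Proof.
elim: m => [|m IHm]; first by rewrite eu1 scale0r.
rewrite [dunkl_pol lam m.+1]/= linear_sum scaler_sumr /=; apply: eq_bigr => w _.
rewrite [eu _]linearZ /= [RHS]scalerA [_ * resolvent _ _]mulrC -[RHS]scalerA; congr (_ *: _).
rewrite -msym_eu euM eu_linform IHm -scalerAr -[X in X + _]scale1r -scalerDl.
by rewrite [LHS]linearZ /= addrC -natr1.
Qed.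

Lemma dunkl_polS lam m :
  m.+1%:R *: dunkl_pol lam m.+1 + G (dunkl_pol lam m.+1) = linform lam * dunkl_pol lam m.
Proof.
set p := linform lam * dunkl_pol lam m.
have -> : dunkl_pol lam m.+1 = \sum_w resolvent m w *: msym w p by [].
rewrite GE scaler_sumr.
have -> : \sum_(a : 'I_n * 'I_n | a.1 != a.2) (\sum_w resolvent m w *: msym w p -
     sw a.1 a.2 (\sum_w resolvent m w *: msym w p)) =
  \sum_w (\sum_(a : 'I_n * 'I_n | a.1 != a.2) (resolvent m w - resolvent m (w * tperm a.1 a.2)%g))
     *: msym w p.
  under [RHS]eq_bigr do rewrite scaler_suml.
  rewrite [RHS]exchange_big /=; apply: eq_bigr => a _.
  under [RHS]eq_bigr do rewrite scalerBl.
  rewrite sumrB; congr (_ - _); rewrite [LHS]linear_sum /=.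
  rewrite [LHS](reindex_inj (@mulg_tperm_inj a)) /=; apply: eq_bigr => w _.
  by rewrite [LHS]linearZ /= msymMm -[msym (tperm _ _) _]/(sw _ _ _) swK.
rewrite scaler_sumr -big_split /= [LHS](bigD1 1%g) //= [X in _ + X]big1 => [|w nw]; last first.
  by rewrite !scalerA -scalerDl resolventP (negbTE nw) scale0r.
by rewrite !scalerA -scalerDl resolventP eqxx scale1r msym1m addr0.
Qed.

Lemma G1 : G 1 = 0.
Proof.
by rewrite GE big1 ?scaler0 // => a _; rewrite /sw msym1 subrr.
Qed.

Lemma T_linform_mul lam i p : T i (linform lam * p) =
  linform lam * T i p + lam i *: p + k *: \sum_(j | j != i) (lam i - lam j) *: sw i j p.
Proof.
have TsX j : T i (lam j *: 'X_j * p) = lam j *: ('X_j * T i p) +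
   (if j == i then lam i *: p + k *: \sum_(l | l != i) lam i *: sw i l p
    else - (k *: (lam j *: sw i j p))).
  rewrite -scalerAl [LHS]linearZ /=; case: eqP => [->|/eqP nji].
    rewrite T_X -addrA scalerDr; congr (_ + _); rewrite scalerDr; congr (_ + _).
    by rewrite -scaler_sumr !scalerA mulrC.
  by rewrite T_Xneq // scalerBr !scalerA [k * lam j]mulrC.
rewrite /linform mulr_suml [LHS]linear_sum /=.
under eq_bigr do rewrite TsX.
rewrite big_split /= mulr_suml -[RHS]addrA; congr (_ + _).
  by apply: eq_bigr => j _; rewrite scalerAl.
rewrite (bigD1 i) //= eqxx -addrA; congr (_ + _).
under [X in _ + X = _]eq_bigr => j nj do rewrite (negbTE nj).
rewrite sumrN -[X in _ - X]scaler_sumr -scalerBr -sumrB; congr (_ *: _).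
by apply: eq_bigr => j _; rewrite scalerBl.
Qed.

Lemma T_sum_XT i p : T i (\sum_j 'X_j * T j p) =
  \sum_j 'X_j * T j (T i p) + T i p + k *: \sum_(j | j != i) sw i j (T i p - T j p).
Proof.
have TX j : T i ('X_j * T j p) = 'X_j * T j (T i p) +
    (if j == i then T i p + k *: \sum_(l | l != i) sw i l (T i p) else - (k *: sw i j (T j p))).
  by case: eqP => [->|/eqP nji]; rewrite ?T_X ?addrA // T_Xneq // (T_comm i j).
rewrite [LHS]linear_sum /=; under eq_bigr do rewrite TX.
rewrite big_split /= -[RHS]addrA; congr (_ + _).
rewrite (bigD1 i) //= eqxx -addrA; congr (_ + _).
under [X in _ + X = _]eq_bigr => j nj do rewrite (negbTE nj).
rewrite sumrN -scaler_sumr -scalerBr -sumrB; congr (_ *: _).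
by apply: eq_bigr => j _; rewrite linearB.
Qed.

Lemma sum_sw_pairs (v : 'I_n -> P) i :
  \sum_(a | a.1 != a.2) sw a.1 a.2 (v i - v (tperm a.1 a.2 i)) =
  (\sum_(j | j != i) sw i j (v i - v j)) *+ 2.
Proof.
rewrite -(pair_big_dep xpredT (fun a b => a != b)
  (fun a b => sw a b (v i - v (tperm a b i)))) /= mulr2n (bigD1 i) //=; congr (_ + _).
  by apply: eq_big => [j|j _]; rewrite ?tpermL 1?eq_sym.
apply: eq_bigr => j nji; rewrite (bigD1 i) //= tpermR swC big1 ?addr0 // => l /andP[njl nli].
by rewrite tpermD // subrr linear0.
Qed.

(** Applying T_i to the defining equation shows that the defects [v i = T_i E - lam_i D] satisfy a
    homogeneous averaging equation in which each reflection moves the index i as well as the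
    variables. The averaging principle forces them to vanish. *)
Lemma T_dunkl_pol_step lam m :
  (forall i, linform lam * T i (dunkl_pol lam m) =
     lam i *: (m%:R *: dunkl_pol lam m + G (dunkl_pol lam m))) ->
  forall i, T i (dunkl_pol lam m.+1) = lam i *: dunkl_pol lam m.
Proof.
set E := dunkl_pol lam m.+1; set D := dunkl_pol lam m => HD.
pose v i := T i E - lam i *: D.
have key i : m.+1%:R *: v i + (k / 2) *:
    \sum_(a | a.1 != a.2) (v i - sw a.1 a.2 (v (tperm a.1 a.2 i))) = 0.
  have euTE : eu (T i E) + T i E = m.+1%:R *: T i E.
    by rewrite eu_T eu_dunkl_pol subrK [LHS]linearZ.
  pose S1 := \sum_(j | j != i) sw i j (T i E - T j E).
  pose S2 := \sum_(j | j != i) (lam i - lam j) *: sw i j D.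
  have h : m.+1%:R *: T i E + G (T i E) + k *: S1 =
      lam i *: (m%:R *: D + G D) + lam i *: D + k *: S2.
    rewrite -HD -T_linform_mul -dunkl_polS -eu_dunkl_pol -sum_XT T_sum_XT sum_XT.
    by rewrite -euTE [eu _ + T i E + _]addrAC.
  have h2 : lam i *: (m%:R *: D + G D) + lam i *: D = m.+1%:R *: (lam i *: D) + lam i *: G D.
    rewrite -scalerDr addrAC -[X in _ + X + _]scale1r -scalerDl natr1 scalerDr.
    by rewrite !scalerA mulrC.
  have -> : \sum_(a | a.1 != a.2) (v i - sw a.1 a.2 (v (tperm a.1 a.2 i))) =
      \sum_(a | a.1 != a.2) (v i - sw a.1 a.2 (v i)) + (S1 - S2) *+ 2.
    have -> : S1 - S2 = \sum_(j | j != i) sw i j (v i - v j).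
      rewrite /S1 /S2 -sumrB; apply: eq_bigr => j _; rewrite -swBZ; congr (sw _ _ _).
      by rewrite /v scalerBl !opprD !opprK addrACA.
    rewrite -sum_sw_pairs -big_split /=; apply: eq_bigr => a _.
    by rewrite (swB _ _ (v i) (v _)) addrA subrK.
  rewrite (scalerDr (k / 2)) -(GE (v i)) -scaler_nat (scalerA (k / 2)) divfK ?pnatr_eq0 // GBZ.
  rewrite !scalerBr [_ - _ + (k *: _ - _)]addrACA -opprD addrACA -opprD !addrA h h2 subrr //.
suff v0 i : v i = 0 by move=> i; apply/eqP; rewrite -subr_eq0; apply/eqP/v0.
apply/mpolyP => mm; rewrite mcoeff0.
(* Coefficients are indexed by pairs of an index and a rearrangement of one exponent, so that every
   reflection permutes a finite set. *)
pose u (x : 'I_n * 'S_n) := (v x.1)@_(mm#(x.2)).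
pose tau (a : 'I_n * 'I_n) (x : 'I_n * 'S_n) :=
  (tperm a.1 a.2 x.1, (tperm a.1 a.2 * x.2)%g).
have tau_inj a : injective (tau a) by move=> [x w] [y w'] [/perm_inj -> /mulgI ->].
have := averaging_injective (Q := fun a : 'I_n * 'I_n => a.1 != a.2) (v := u)
   k2_ge0 tau_inj (ltr0Sn F m) _ (i, 1%g).
rewrite /u /= mperm1; apply => -[{}i w] /=.
have := congr1 (mcoeff (mm#w)) (key i).
rewrite mcoeff0 mcoeffD !mcoeffZ linear_sum /= => h; apply: (etrans _ h).
congr (_ + _ * _).
by apply: eq_bigr => a _; rewrite mcoeffB mcoeff_sym mpermM.
Qed.

Lemma T_dunkl_pol lam m i : T i (dunkl_pol lam m.+1) = lam i *: dunkl_pol lam m.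
Proof.
elim: m i => [|m IHm] i; apply: T_dunkl_pol_step => {}i.
  by rewrite T1 mulr0 G1 scale0r addr0 scaler0.
by rewrite IHm dunkl_polS scalerAr.
Qed.

Lemma resolvent_op_inj m p : m.+1%:R *: p + G p = 0 -> p = 0.
Proof.
move=> hp; apply/mpolyP => mm; rewrite mcoeff0.
have tau_inj (a : 'I_n * 'I_n) : injective (fun w : 'S_n => (tperm a.1 a.2 * w)%g).
  by move=> w w' /mulgI.
have := averaging_injective (Q := fun a : 'I_n * 'I_n => a.1 != a.2)
   (v := fun w : 'S_n => p@_(mm#w)) k2_ge0 tau_inj (ltr0Sn F m) _ 1%g.
rewrite mperm1; apply => w.
have := congr1 (mcoeff (mm#w)) hp; rewrite GE.
rewrite mcoeff0 mcoeffD !mcoeffZ linear_sum /= => h; apply: (etrans _ h).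
by congr (_ + _ * _); apply: eq_bigr => a _; rewrite mcoeffB mcoeff_sym mpermM.
Qed.

Lemma msym_linform w lam : msym w (linform lam) = linform (fun i => lam ((w^-1)%g i)).
Proof.
rewrite /linform [LHS]linear_sum /= [RHS](reindex_inj (@perm_inj _ w)) /=.
by apply: eq_bigr => i _; rewrite [LHS]linearZ /= msymXi permK.
Qed.

(** Both sides solve the same recursion, because [G] commutes with permutations, and [m.+1 + G] is
    injective. *)
Lemma msym_dunkl_pol w lam m :
  msym w (dunkl_pol lam m) = dunkl_pol (fun i => lam ((w^-1)%g i)) m.
Proof.
elim: m => [|m IHm]; first by rewrite /= msym1.
apply/eqP; rewrite -subr_eq0 -[X in _ - X]scale1r; apply/eqP/(@resolvent_op_inj m).
rewrite GBZ scale1r scalerBr addrACA -[- (_ *: _) + _]opprD.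
by rewrite scale1r dunkl_polS -msym_linform -IHm -msymM -dunkl_polS -msym_G linearD linearZ subrr.
Qed.

End MaximumPrinciple.

(** The failure of the Leibniz rule consists of terms antisymmetric under [s_ij]
    ([sw_T_M_correction]). A permutation invariant functional annihilates them and thus sees T as a
    derivation. *)
Lemma T_M i p q : T i (p * q) = T i p * q + p * T i q
   - k *: \sum_(j | j != i) dd i j p * (q - sw i j q).
Proof.
have ddM2 j : j != i -> dd i j (p * q) =
    dd i j p * q + p * dd i j q - dd i j p * (q - sw i j q).
  by rewrite eq_sym => nij; rewrite ddM // mulrBr opprB [RHS]addrC addrA subrK.
rewrite !TE mderivM mulrDl mulrDr addrACA -[RHS]addrA; congr (_ + _).
rewrite -scalerAl -scalerAr -scalerDr -scalerBr; congr (_ *: _).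
rewrite mulr_suml mulr_sumr -big_split -sumrB /=.
by apply: eq_bigr => j nj; exact: ddM2.
Qed.

Lemma sw_T_M_correction i j p q : i != j ->
  sw i j (dd i j p * (q - sw i j q)) = - (dd i j p * (q - sw i j q)).
Proof.
move=> nij; have sdd : sw i j (dd i j p) = dd i j p.
  have e : sw i j (('X_i - 'X_j) * dd i j p) = - (('X_i - 'X_j) * sw i j (dd i j p)).
    rewrite {1}/sw msymM -!/(sw _ _ _) -mulNr; congr (_ * _).
    by rewrite swB /sw !msymXi tpermL tpermR opprB.
  apply: (mulfI (XsubX_neq0 nij)); apply: oppr_inj.
  by rewrite -e -ddP swB swK opprB.
by rewrite {1}/sw msymM -!/(sw _ _ _) sdd swB swK -mulrN opprB.
Qed.

(** * Eigenvectors of the Cherednik operators: triangularity and simple spectrum *)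

Section Jack.
Hypothesis k_ge0 : 0 <= k.
Implicit Types m : 'X_{1..n}.

Definition eb m j : F := (m j)%:R - k * (rk m j)%:R.

Definition D : 'I_n -> P -> P := locked (fun i p =>
  'X_i * T i p + (k * (1 - n%:R)) *: p + k *: \sum_(l < n | (i < l)%N) sw i l p).

Lemma DE i p : D i p =
  'X_i * T i p + (k * (1 - n%:R)) *: p + k *: \sum_(l < n | (i < l)%N) sw i l p.
Proof. by rewrite /D -lock. Qed.

Lemma D_is_linear i : linear (D i).
Proof.
move=> c p q; rewrite !DE TP mulrDr -scalerAr.
have -> : \sum_(l < n | (i < l)%N) sw i l (c *: p + q) =
   c *: (\sum_(l < n | (i < l)%N) sw i l p) + \sum_(l < n | (i < l)%N) sw i l q.
  by rewrite scaler_sumr -big_split /=; apply: eq_bigr => l _; rewrite swP.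
rewrite !(scalerDr _ _ q) !scalerDr !scalerA ![_ * c]mulrC -!scalerA.
by rewrite [X in X + _ = _]addrACA [LHS]addrACA.
Qed.
HB.instance Definition _ i := GRing.isLinear.Build F P P *:%R (D i) (D_is_linear i).

Lemma DP i c p q : D i (c *: p + q) = c *: D i p + D i q.
Proof. exact: linearP. Qed.

(** Splitting off the part symmetric in x_i and x_j reduces the divided difference of a monomial to
    the geometric sum for [x_i^d - x_j^d]. *)
Lemma dd_monomial i j m : i != j -> (m j <= m i)%N ->
  exists M : P, [/\ sw i j M = M, 'X_[m] = M * 'X_i ^+ (m i - m j) &
  forall a b, M * 'X_i ^+ a * 'X_j ^+ b =
     'X_[[multinom (if l == i then m j + a else if l == j then m j + b else m l)%N | l < n]] ].
Proof.
move=> nij hm; pose m0 : 'X_{1..n} := [multinom (if l == i then m j else m l) | l < n].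
exists 'X_[m0]; have e a b : 'X_[m0] * 'X_i ^+ a * 'X_j ^+ b = 'X_[F, 
     [multinom (if l == i then m j + a else if l == j then m j + b else m l)%N | l < n]].
  rewrite !mpolyXn -!mpolyXD; congr 'X_[_]; apply/mnmP => l.
  rewrite !mnmDE !mulmnE !mnm1E !mnmE [i == l]eq_sym [j == l]eq_sym.
  case: eqP => [->|_]; first by rewrite (negbTE nij) mul1n mul0n addn0.
  by case: eqP => [->|_]; rewrite ?mul1n !mul0n ?addn0.
split=> //.
  rewrite /sw msymX; congr 'X_[_]; apply/mnmP => l; rewrite !mnmE tpermV.
  by case: tpermP => [->|->|]; rewrite ?eqxx // eq_sym (negbTE nij).
rewrite -[RHS]mulr1 -(expr0 'X_j) e; congr 'X_[_]; apply/mnmP => l; rewrite mnmE addn0.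
by case: eqP => [->|_]; [rewrite subnKC|case: eqP => [->|]].
Qed.

Lemma X_dd_ge i j m : i != j -> (m j <= m i)%N ->
  'X_i * dd i j 'X_[m] = \sum_(c < m i - m j) 'X_[mv m i j c].
Proof.
move=> nij hm; have [M [sM eM eMX]] := dd_monomial nij hm.
have -> : dd i j 'X_[m] = M * \sum_(c < m i - m j) 'X_i ^+ ((m i - m j).-1 - c) * 'X_j ^+ c.
  apply: dd_uniq => //; rewrite mulrCA -subrXX eM {1}/sw msymM -!/(sw _ _ _) sM mulrBr.
  by rewrite /sw rmorphXn /= msymXi tpermL.
rewrite mulrCA mulr_sumr mulr_sumr; apply: eq_bigr => -[c /= hc] _.
rewrite [X in _ * X]mulrA -exprS mulrA eMX; congr 'X_[_]; apply/mnmP => l; rewrite !mnmE.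
by case: eqP => // _; lia.
Qed.

Lemma X_dd_lt i j m : i != j -> (m i < m j)%N ->
  'X_i * dd i j 'X_[m] = - \sum_(c < m j - m i) 'X_[mv m j i c.+1].
Proof.
move=> nij hm; have nji : j != i by rewrite eq_sym.
have [M [sM eM eMX]] := dd_monomial nji (ltnW hm).
have -> : dd i j 'X_[m] = - (M * \sum_(c < m j - m i) 'X_j ^+ ((m j - m i).-1 - c) * 'X_i ^+ c).
  rewrite ddC //; congr (- _).
  apply: dd_uniq => //; rewrite mulrCA -subrXX eM {1}/sw msymM -!/(sw _ _ _) sM mulrBr.
  by rewrite /sw rmorphXn /= msymXi tpermL.
rewrite mulrN mulrCA mulr_sumr mulr_sumr; congr (- _); apply: eq_bigr => -[c /= hc] _.
rewrite [X in _ * X]mulrCA -exprS mulrA eMX; congr 'X_[_]; apply/mnmP => l; rewrite !mnmE.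
by case: eqP => // _; lia.
Qed.

(** The contribution of the pair (i, j) to the off-diagonal part of [D i] on the monomial of m: the
    constant [k(1 - n)] is spread over the n - 1 indices j, and the last summand restores what the
    eigenvalue [eb] takes out through the rank. *)
Definition dterm i m j : P := 'X_i * dd i j 'X_[m] - 'X_[m] +
   (i < j)%N%:R *: 'X_[m#(tperm i j)] + (before m j i)%:R *: 'X_[m].

(** In the geometric sum the interior exponents are squeezes of m. Of the two ends, the monomial of
    m cancels against the diagonal terms, and the transposed one survives only if the larger entry
    stood on the left, which is a [swp]. *)
Lemma dtermP i j m m' : j != i -> (dterm i m j)@_m' != 0 -> move m' m.
Proof.
rewrite eq_sym => nij; have nji : j != i by rewrite eq_sym.
rewrite /dterm /before.
have sumP d (f : nat -> 'X_{1..n}) : (forall c, (c < d)%N -> move (f c) m) ->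
    (\sum_(c < d) 'X_[f c] : P)@_m' != 0 -> move m' m.
  move=> hf; rewrite linear_sum /= => hs.
  have /existsP [c hc] : [exists c : 'I_d, ('X_[f c] : P)@_m' != 0].
    rewrite -negb_forall; apply/negP => /forallP h; move/eqP: hs; apply.
    by apply: big1 => c _; apply/eqP/h.
  move: hc; rewrite mcoeffX; case: (f c =P m') => [<- _|_]; first exact: hf.
  by rewrite eqxx.
case: (ltngtP (m i) (m j)) => hm.
- rewrite X_dd_lt // scale1r.
  have [d hd] : exists d, (m j - m i = d.+1)%N by exists (m j - m i).-1; lia.
  rewrite hd big_ord_recr /= -hd (mv_full nji (ltnW hm)) tpermC.
  rewrite [_ - 'X_[m] + _]addrAC subrK opprD -addrA -[- 'X_[_]]scaleN1r -scalerDl.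
  rewrite mcoeffD mcoeffN mcoeffZ mcoeffX.
  case: (boolP (_ == 0)) (sumP d (fun c => mv m j i c.+1)) => [/eqP -> _|hs sh _].
    rewrite oppr0 add0r; case: (_ =P m') => [<- h|_]; last by rewrite mulr0 eqxx.
    right; exists j, i; split=> //; last by rewrite tpermC.
    by move: h; case: ltngtP (nij) => // [_|]; rewrite ?addNr ?mul0r ?eqxx // => /val_inj ->; rewrite eqxx.
  by apply: sh => // c hc; left; apply: mv_sqz; rewrite 1?eq_sym //; lia.
- rewrite X_dd_ge ?(ltnW hm) // scale0r addr0.
  have [d hd] : exists d, (m i - m j = d.+1)%N by exists (m i - m j).-1; lia.
  rewrite hd big_ord_recl /=.
  have -> : mv m i j 0 = m.
    apply/mnmP => l; rewrite mnmE subn0 addn0.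
    by case: eqP => [->//|_]; case: eqP => [->|].
  rewrite ['X_[m] + _]addrC addrK mcoeffD mcoeffZ mcoeffX.
  case: (boolP (_ == 0)) (sumP d (fun c => mv m i j c.+1)) => [/eqP -> _|hs sh _].
    rewrite add0r; case: (_ =P m') => [<- h|_]; last by rewrite mulr0 eqxx.
    right; exists i, j; split=> //.
    by move: h; case: ltnP => //; rewrite mul0r eqxx.
  by apply: sh => // c hc; left; apply: mv_sqz => //; lia.
- rewrite X_dd_ge ?hm // subnn big_ord0 sub0r.
  have -> : m#(tperm i j) = m by apply/mnmP => l; rewrite mnmE; case: tpermP => [->|->|].
  rewrite -[- 'X_[_]]scaleN1r -!scalerDl /=.
  have -> : -1 + (i < j)%N%:R + (j < i)%N%:R = 0 :> F.
    case: ltngtP (nij) => [_|_|/val_inj ->]; rewrite ?eqxx // ?addr0 ?addNr //.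
  by rewrite scale0r mcoeff0 eqxx.
Qed.

Lemma D_monomial i m : D i 'X_[m] = eb m i *: 'X_[m] + k *: \sum_(j | j != i) dterm i m j.
Proof.
have n0 : (0 < n)%N by case: (n) (i) => [[]|].
rewrite DE TE mulrDr -scalerAr.
have -> : 'X_i * ('X_[m])^`M(i) = (m i)%:R *: 'X_[m] :> P.
  rewrite mderivX -scalerAr; case mi : (m i) => [|d]; first by rewrite !scale0r.
  congr (_ *: _); rewrite -mpolyXD addmC submK // lep1mP.
  by rewrite mi.
have -> : (k * (1 - n%:R)) *: 'X_[m] = - (k *: \sum_(j < n | j != i) ('X_[m] : P)).
  rewrite sumr_const -scaler_nat cardC1 card_ord scalerA -scaleNr; congr (_ *: _).
  by rewrite -mulrN -[in LHS](prednK n0) -natr1 opprD addrCA subrr addr0.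
have -> : \sum_(l < n | (i < l)%N) sw i l 'X_[m] =
    \sum_(j < n | j != i) (i < j)%N%:R *: ('X_[m#(tperm i j)] : P).
  rewrite big_mkcond [RHS]big_mkcond; apply: eq_bigr => j _.
  case: ltnP => [lt|le]; last by rewrite scale0r if_same.
  by rewrite -(inj_eq val_inj) /= gtn_eqF // scale1r /sw msymX tpermV.
have -> : eb m i *: 'X_[m] = (m i)%:R *: 'X_[m] -
    k *: \sum_(j < n | j != i) ((before m j i)%:R *: ('X_[m] : P)).
  rewrite /eb scalerBl -scaler_suml scalerA /rk (bigD1 i) //= {1}/before ltnn ltnn andbF.
  by rewrite add0n natr_sum.
rewrite mulr_sumr -!addrA; congr (_ + _).
rewrite -!scalerN -!scalerDr; congr (_ *: _).
rewrite -!sumrN -!big_split /=; apply: eq_bigr => j nj.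
by rewrite /dterm [RHS]addrC addrK addrA.
Qed.

Lemma D_coef i p m' : (forall m, m \in msupp p -> ~ move m' m) ->
  (D i p)@_m' = eb m' i * p@_m'.
Proof.
move=> hmax; rewrite {1}(mpolyE p) [D i _]linear_sum /= linear_sum /=.
have -> : \sum_(m <- msupp p) (D i (p@_m *: 'X_[m]))@_m' =
    \sum_(m <- msupp p) (p@_m * (eb m i * (m == m')%:R)).
  apply: eq_big_seq => m hm; rewrite [D i _]linearZ /= mcoeffZ; congr (_ * _).
  rewrite D_monomial mcoeffD !mcoeffZ mcoeffX linear_sum big1 /= ?mulr0 ?addr0 // => j nj.
  by apply/eqP/negPn/negP => /(dtermP nj) /(hmax _ hm).
rewrite {3}(mpolyE p) linear_sum /= mulr_sumr; apply: eq_bigr => m _.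
rewrite mcoeffZ mcoeffX; case: eqP => [->|]; rewrite ?mulr0 // !mulr1 mulrC //.
Qed.

Definition eigen m p := forall i, D i p = eb m i *: p.

Lemma before_eb m i j : 0 < k -> before m i j -> eb m j < eb m i.
Proof.
move=> k0 bij; rewrite /eb ler_ltD // ?ltrN2 ?ltr_pM2l ?ltr_nat ?before_rk // ler_nat.
by move: bij; rewrite /before; lia.
Qed.

(** For positive k the order [before] is the decreasing order of the spectral vector, so this vector
    determines the ranks and then the entries. For k = 0 it is the composition itself. *)
Lemma eb_inj m m' : (forall i, eb m i = eb m' i) -> m = m'.
Proof.
move=> e; apply/mnmP => i.
suff : (m i)%:R = (m' i)%:R :> F by move/eqP; rewrite eqr_nat => /eqP.
move: k_ge0; rewrite le_eqVlt => /orP[/eqP k0|k0].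
  by have := e i; rewrite /eb -k0 !mul0r !subr0.
have eb_before m1 j l : before m1 j l = (j != l) && (eb m1 l < eb m1 j).
  apply/idP/andP => [b|[njl lt]].
    by rewrite before_eb //; split=> //; apply: contraTneq b => ->; rewrite before_irr.
  case/orP: (before_total m1 njl) => // /(before_eb k0) lt'.
  by have := lt_trans lt lt'; rewrite ltxx.
have := e i; rewrite /eb; have -> : rk m i = rk m' i.
  by apply: eq_bigr => j _; rewrite !eb_before !e.
by move/addIr.
Qed.

Lemma max_supp p (Q : pred 'X_{1..n}) m0 : m0 \in msupp p -> Q m0 ->
  exists2 m, m \in msupp p & Q m /\ forall m2, m2 \in msupp p -> Q m2 -> (hgt m2 <= hgt m)%N.
Proof.
move=> h0 q0; have [b hb] : exists b, forall m, m \in msupp p -> (hgt m <= b)%N.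
  exists (\sum_(m <- msupp p) hgt m)%N => m hm.
  by rewrite (big_rem m) //= leq_addr.
have ex : exists d, has (fun m => Q m && (hgt m == d)) (msupp p).
  by exists (hgt m0); apply/hasP; exists m0 => //; rewrite q0 eqxx.
have ub d : has (fun m => Q m && (hgt m == d)) (msupp p) -> (d <= b)%N.
  by case/hasP => m hm /andP[_ /eqP <-]; exact: hb.
case: (ex_maxnP ex ub) => d /hasP[m hm /andP[qm /eqP <-]] hmax.
exists m => //; split=> // m2 h2 q2; apply: hmax.
by apply/hasP; exists m2 => //; rewrite q2 eqxx.
Qed.

Lemma eigen_max m p m' : eigen m p -> m' \in msupp p ->
  (forall m2, m2 \in msupp p -> ~ move m' m2) -> m' = m.
Proof.
move=> ep hm hmax; apply: eb_inj => i; have := congr1 (mcoeff m') (ep i).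
rewrite D_coef // mcoeffZ; apply: mulIf; by rewrite -mcoeff_msupp.
Qed.

(** An exponent of p that no move produces from another exponent of p has the eigenvalues of m,
    hence equals m. Any other exponent comes from a higher one, and this ascent stops because [hgt]
    is bounded on the support. *)
Lemma eigen_chain m p m' : eigen m p -> m' \in msupp p -> chain m m'.
Proof.
move=> ep; have [b hb] : exists b, forall m2, m2 \in msupp p -> (hgt m2 <= b)%N.
  exists (\sum_(m2 <- msupp p) hgt m2)%N => m2 hm.
  by rewrite (big_rem m2) //= leq_addr.
elim: {m'}(b - hgt m')%N {-2}m' (leqnn (b - hgt m')%N) => [|d IHd] m' hd hm.
  rewrite (eigen_max ep hm) => [|m2 h2 /move_hgt lt]; first exact: chain_refl.
  by have := hb _ h2; lia.
have [[m2 [h2 mv2]]|hmax] := boolp.pselect (exists m2, m2 \in msupp p /\ move m' m2).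
  by apply: (chain_step _ mv2); apply: IHd => //; have := move_hgt mv2; have := hb _ h2; lia.
rewrite (eigen_max ep hm) => [|m2 h2 mv2]; first exact: chain_refl.
by apply: hmax; exists m2.
Qed.

Lemma eigen_lin m c p q : eigen m p -> eigen m q -> eigen m (c *: p + q).
Proof.
by move=> ep eq i; rewrite DP ep eq scalerDr !scalerA [eb m i * c]mulrC.
Qed.

Lemma eigen_eq0 m p : eigen m p -> p@_m = 0 -> p = 0.
Proof.
move=> ep pm; apply/eqP; apply/negPn/negP => p0.
have [m0 h0] : exists m0, m0 \in msupp p by exists (mlead p); exact: mlead_supp.
have [m1 h1 [_ hmax]] := max_supp (Q := xpredT) h0 isT.
have e : m1 = m.
  apply: (eigen_max ep h1) => m2 h2 /move_hgt.
  by rewrite ltnNge hmax.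
by move: h1; rewrite e mcoeff_msupp pm eqxx.
Qed.

Lemma eigen_prop m p q : eigen m p -> p != 0 -> eigen m q -> exists c, q = c *: p.
Proof.
move=> ep p0 eq; exists (q@_m / p@_m).
have pm : p@_m != 0 by apply: contra_neq p0; exact: eigen_eq0.
apply/eqP; rewrite -subr_eq0 addrC -scaleNr; apply/eqP/(eigen_eq0 (m := m)).
  exact: eigen_lin.
by rewrite mcoeffD mcoeffZ mulNr divfK // addNr.
Qed.

Lemma swDZZ i j p q r c d : sw i j (p + c *: q + d *: r) =
  sw i j p + c *: sw i j q + d *: sw i j r.
Proof. by rewrite addrC [p + _]addrC !swP addrC [_ + sw i j p]addrC. Qed.

(** With [sw_D_adj2] and [sw_D_far] these are the relations of the degenerate affine Hecke algebra
    between neighbouring transpositions and the operators [D]. *)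
Lemma sw_D_adj i i' p : adj i i' -> sw i i' (D i p) = D i' (sw i i' p) + k *: p.
Proof.
move=> a; have lt : (i < i')%N by rewrite a.
have nii : i != i' by rewrite -(inj_eq val_inj) /= ltn_eqF.
rewrite !DE swDZZ -[RHS]addrA; congr (_ + _ + _).
  by rewrite {1}/sw msymM msymXi tpermL -/(sw _ _ _) sw_T tpermL.
rewrite -scalerDr; congr (_ *: _); rewrite [LHS]linear_sum /= (bigD1 i') //= addrC swK.
apply: (congr1 (fun x => x + p)); apply: eq_big => [l|l /andP[li li']].
  by move: a; rewrite /adj -(inj_eq val_inj) /=; lia.
rewrite {1}/sw msym_sw tpermL tpermD // 1?eq_sym //.
by rewrite -(inj_eq val_inj) /= gtn_eqF.
Qed.

Lemma sw_D_adj2 i i' p : adj i i' -> D i (sw i i' p) = sw i i' (D i' p) + k *: p.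
Proof.
move=> a; have := sw_D_adj (sw i i' p) a; move/(congr1 (sw i i')).
by rewrite swK swK addrC swP swK addrC.
Qed.

Lemma sw_D_far i i' j p : adj i i' -> j != i -> j != i' -> sw i i' (D j p) = D j (sw i i' p).
Proof.
move=> a ji ji'; have tj : tperm i i' j = j by rewrite tpermD // eq_sym.
rewrite !DE swDZZ; congr (_ + _ + _ *: _).
  by rewrite {1}/sw msymM msymXi tj -/(sw _ _ _) sw_T tj.
rewrite [LHS]linear_sum /= [RHS](reindex_inj (@perm_inj _ (tperm i i'))) /=.
apply: eq_big => [l|l _]; first by rewrite adj_tperm_inv.
by rewrite {1}/sw msym_sw tj.
Qed.

Lemma eb_perm m (w : 'S_n) : (forall x y, m (w x) = m (w y) -> (x < y)%N = (w x < w y)%N) ->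
  forall j, eb (m#w) j = eb m (w j).
Proof. by move=> hw j; rewrite /eb mnmE rk_perm. Qed.

Lemma eb_adj i i' m j : adj i i' -> m i != m i' -> eb (m#(tperm i i')) j = eb m (tperm i i' j).
Proof.
move=> a nm; apply: eb_perm => x y.
have [/andP[/eqP -> /eqP ->]|nxy] := boolP ((x == i) && (y == i')).
  by rewrite tpermL tpermR => e; rewrite e eqxx in nm.
have [/andP[/eqP -> /eqP ->]|nyx] := boolP ((x == i') && (y == i)).
  by rewrite tpermL tpermR => e; rewrite e eqxx in nm.
by rewrite adj_tperm_lt.
Qed.

(** The integer part of the spectrum and the rank part differ with the same sign, so the gap is at
    least 1 + k. It keeps the intertwiner below from annihilating a Jack polynomial. *)
Lemma eb_gap i j m : m i != m j -> k < `|eb m i - eb m j|.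
Proof.
wlog h : i j / (m j < m i)%N.
  move=> H nm; case: (ltngtP (m i) (m j)) => lt; last by rewrite lt eqxx in nm.
    by rewrite distrC; apply: H => //; rewrite eq_sym.
  exact: H.
move=> _; have b : before m i j by rewrite /before h.
have -> : eb m i - eb m j = (m i - m j)%N%:R + k * (rk m j - rk m i)%N%:R.
  rewrite /eb (natrB _ (ltnW h)) (natrB _ (ltnW (before_rk b))).
  by ring.
rewrite ger0_norm ?addr_ge0 ?mulr_ge0 // -[X in X < _]add0r ltr_leD //.
  by rewrite ltr0n subn_gt0.
by rewrite ler_peMr // ler1n subn_gt0 before_rk.
Qed.

(** The constant [c = - k / dlt] absorbs the remainder [k f] of the Hecke relations. If the result
    vanished, f would be an eigenvector of an involution with eigenvalue [- c], forcing [c^2 = 1],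
    whereas [eb_gap] gives [|c| < 1]. *)
Lemma eigen_swap i i' m f : adj i i' -> m i != m i' -> eigen m f -> f != 0 ->
  exists c, eigen (m#(tperm i i')) (c *: f + sw i i' f) /\ c *: f + sw i i' f != 0.
Proof.
move=> a nm ef f0; have lt := eb_gap nm.
set dlt := eb m i - eb m i' in lt; have d0 : dlt != 0.
  by rewrite -normr_gt0; apply: le_lt_trans lt.
pose c := - k / dlt; exists c; split.
  have cd : c * eb m i = - k + c * eb m i'.
    by apply/eqP; rewrite -subr_eq -mulrBr divfK.
  move=> j; rewrite DP eb_adj // ef.
  have [->|ji] := eqVneq j i.
    rewrite tpermL sw_D_adj2 // ef [sw _ _ (_ *: _)]linearZ /= scalerDr.
    rewrite scalerA cd scalerDl scaleNr addrACA addrC -addrA.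
    rewrite !scalerA [eb m i' * c]mulrC addrC [X in X = _]addrC.
    by rewrite addNKr.
  have [->|ji'] := eqVneq j i'.
    rewrite tpermR ; have := sw_D_adj f a; rewrite ef [sw _ _ (_ *: _)]linearZ /= => h.
    rewrite scalerDr h !scalerA [eb m i * c]mulrC cd scalerDl scaleNr addrACA addrC.
    by rewrite -addrA addNKr.
  have tj : tperm i i' j = j by rewrite tpermD // eq_sym.
  by rewrite tj -sw_D_far // ef [sw _ _ (_ *: _)]linearZ /= scalerDr !scalerA [c * _]mulrC.
apply/negP => /eqP h.
have h1 : sw i i' f = - c *: f by apply/eqP; rewrite scaleNr -addr_eq0 addrC h.
have h2 : f = (c ^+ 2) *: f.
  by rewrite -{1}(swK i i' f) h1 [LHS]linearZ /= h1 scalerA mulrNN.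
have : (1 - c ^+ 2) *: f = 0 by rewrite scalerBl scale1r -h2 subrr.
move/eqP; rewrite scaler_eq0 (negbTE f0) orbF subr_eq0 => /eqP c1.
have : `|c| = 1 by apply/eqP; rewrite -sqrp_eq1 // -normrX -c1 normr1.
rewrite /c normrM normfV normrN (ger0_norm k_ge0) => /eqP.
by rewrite -(inj_eq (mulIf (_ : `|dlt| != 0))) ?normr_eq0 // divfK ?normr_eq0 // mul1r lt_eqF.
Qed.

(** * The Knop-Sahi raising operator and existence of Jack polynomials *)

Section Raising.
Variables o mx : 'I_n.
Hypotheses (o0 : o = 0%N :> nat) (mxn : mx.+1 = n :> nat).

Lemma rot_inj : injective (fun i : 'I_n => if i == mx then o else insubd o i.+1).
Proof.
have key (i : 'I_n) : i != mx -> insubd o i.+1 = i.+1 :> nat.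
  rewrite -(inj_eq val_inj) /= => h; rewrite val_insubd ifT //.
  by have := ltn_ord i; lia.
move=> i j /=; case: eqP => [->|/eqP /key hi]; case: eqP => [->|/eqP /key hj] //.
- by move/(congr1 val); rewrite /= o0 hj.
- by move/(congr1 val); rewrite /= o0 hi.
- by move/(congr1 val); rewrite /= hi hj => -[/val_inj].
Qed.
Definition rot : 'S_n := perm rot_inj.

Lemma rot_mx : rot mx = o.
Proof. by rewrite permE eqxx. Qed.

Lemma rotE i : i != mx -> rot i = i.+1 :> nat.
Proof.
move=> h; rewrite permE (negbTE h) val_insubd ifT //.
by move: h; rewrite -(inj_eq val_inj) /=; have := ltn_ord i; lia.
Qed.

(** In coordinates p becomes [x_n p(x_n, x_1, ..., x_(n-1))], and the composition becomes
    [(m_2, ..., m_n, m_1 + 1)]. *)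
Definition raise_pol p : P := 'X_mx * msym (rot^-1)%g p.
Definition raise m : 'X_{1..n} := (m#rot + U_(mx))%MM.

Lemma raiseE m i : raise m i = (m (rot i) + (i == mx))%N.
Proof. by rewrite mnmDE mnm1E mnmE eq_sym. Qed.

Lemma before_raise m i j : before (raise m) i j = before m (rot i) (rot j).
Proof.
rewrite /before !raiseE; case: (eqVneq i mx) => [->|ni]; case: (eqVneq j mx) => [->|nj].
- by rewrite !ltnn !andbF.
- rewrite /= rot_mx (rotE nj) o0 addn0 addn1.
  have -> : (mx < j)%N = false by have := ltn_ord j; lia.
  by lia.
- rewrite /= rot_mx (rotE ni) o0 addn0 addn1.
  have -> : (i < mx)%N by move: ni; rewrite -(inj_eq val_inj) /=; have := ltn_ord i; lia.
  by lia.
- by rewrite !rotE // !addn0 ltnS.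
Qed.

Lemma eb_raise m i : eb (raise m) i = eb m (rot i) + (i == mx)%:R.
Proof.
rewrite /eb raiseE natrD addrAC; congr (_ - _ * _%:R + _).
rewrite /rk [RHS](reindex_inj (@perm_inj _ rot)) /=.
by apply: eq_bigr => l _; rewrite before_raise.
Qed.

Lemma msym_rotV_sw i j p : msym (rot^-1)%g (sw (rot i) (rot j) p) = sw i j (msym (rot^-1)%g p).
Proof. by rewrite msym_sw !permK. Qed.

Lemma D_raise_neq i p : i != mx -> D i (raise_pol p) = raise_pol (D (rot i) p).
Proof.
move=> ni; have nmi : mx != i by rewrite eq_sym.
have lti : (i < mx)%N by move: ni; rewrite -(inj_eq val_inj) /=; have := ltn_ord i; lia.
rewrite /raise_pol !DE T_Xneq // !linearD !linearZ /= msymM msymXi permK msym_T permK.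
set q := msym _ p; rewrite !mulrDr -!scalerAr.
rewrite mulrN scalerN (bigD1 mx) //= (scalerDr k).
rewrite [sw i mx ('X_mx * q)]msymM msymXi tpermR -[msym _ q]/(sw i mx q).
have -> : \sum_(l < n | (i < l)%N && (l != mx)) sw i l ('X_mx * q) =
   'X_mx * msym (rot^-1)%g (\sum_(l < n | (rot i < l)%N) sw (rot i) l p).
  rewrite linear_sum /= [RHS]mulr_sumr [RHS](reindex_inj (@perm_inj _ rot)) /=.
  apply: eq_big => [l|l /andP[il lm]].
    rewrite rotE //; have [->|lm] := eqVneq l mx; first by rewrite rot_mx o0 andbF.
    by rewrite rotE // andbT ltnS.
  have nml : mx != l by rewrite eq_sym.
  have nil : i != l by rewrite -(inj_eq val_inj) /= ltn_eqF.
  by rewrite msym_rotV_sw {1}/sw msymM msymXi tpermD.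
rewrite mulrCA; move: (k *: ('X_i * sw i mx q)) => A.
by rewrite [_ - A + _]addrAC addrA subrK.
Qed.

Lemma D_raise_max p : D mx (raise_pol p) = raise_pol (D o p + p).
Proof.
rewrite /raise_pol !DE T_X -rot_mx !linearD !linearZ /= msymM msymXi permK msym_T permK.
set q := msym _ p; rewrite [\sum_(l < n | (mx < l)%N) _]big1 => [|l hl]; last first.
  by have := ltn_ord l; lia.
have -> : msym (rot^-1)%g (\sum_(l < n | (rot mx < l)%N) sw (rot mx) l p) =
    \sum_(j < n | j != mx) sw mx j q.
  rewrite linear_sum /= [LHS](reindex_inj (@perm_inj _ rot)) /=.
  apply: eq_big => [l|l _]; last exact: msym_rotV_sw.
  by rewrite rot_mx o0; have [->|lm] := eqVneq l mx; rewrite ?rot_mx ?o0 // rotE.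
rewrite scaler0 addr0 !mulrDr -!scalerAr.
rewrite -!addrA; congr (_ + _); rewrite addrC [k *: _ + _]addrC.
by rewrite -!addrA.
Qed.

Lemma eigen_raise m f : eigen m f -> eigen (raise m) (raise_pol f).
Proof.
move=> ef i; rewrite eb_raise; have [->|ni] := eqVneq i mx.
  rewrite D_raise_max ef rot_mx /raise_pol linearD linearZ /= mulrDr -scalerAr.
  by rewrite (scalerDl _ (eb m o) 1) scale1r.
by rewrite D_raise_neq // ef /raise_pol linearZ /= -scalerAr addr0.
Qed.

Lemma raise_pol_neq0 f : f != 0 -> raise_pol f != 0.
Proof.
move=> f0; rewrite mulf_neq0 //.
  apply/negP => /eqP /(congr1 (mcoeff U_(mx))) /eqP.
  by rewrite mcoeffXU eqxx mcoeff0 oner_eq0.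
by apply: contra_neq f0 => h; apply: (@inj_msym _ _ (rot^-1)%g); rewrite msym0.
Qed.

Lemma eigen_1 : eigen 0%MM 1.
Proof.
move=> i; rewrite -[X in D i X](mpolyX0 n F) D_monomial -[in RHS](mpolyX0 n F).
rewrite big1 ?scaler0 ?addr0 // => j nj; apply/mpolyP => m'; rewrite mcoeff0.
apply/eqP/negPn/negP => /(dtermP nj) [[a [b [_ _ _]]]|[a [b [_]]]]; by rewrite !mnm0E.
Qed.

(* Knop-Sahi: every composition is reached from 0 by the raising operator and by
   interchanging neighbouring distinct entries. *)
Lemma eigen_induction (Q : 'X_{1..n} -> P -> Prop) :
  Q 0%MM 1 ->
  (forall m c p q, Q m p -> Q m q -> Q m (c *: p + q)) ->
  (forall m i j p, Q m p -> Q (m#(tperm i j)) (sw i j p)) ->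
  (forall m i j p, Q m p -> Q (m#(tperm i j)) p) ->
  (forall m p, eigen m p -> Q m p -> Q (raise m) (raise_pol p)) ->
  forall m, exists p, [/\ p != 0, eigen m p & Q m p].
Proof.
move=> Q0 Qlin Qsw Qperm Qraise m.
elim: {m}(mdeg m) {-2}m (erefl (mdeg m)) => [|d IHd] m dm.
  move/eqP: dm; rewrite mdeg_eq0 => /eqP ->; exists 1; split=> //; first exact: oner_neq0.
  exact: eigen_1.
have [i mi] : exists i, m i != 0%N.
  apply/existsP; rewrite -negb_forall; apply/negP => /forallP m0.
  have : mdeg m = 0%N.
    by apply/eqP; rewrite mdeg_eq0; apply/eqP/mnmP => i; rewrite mnm0E; apply/eqP.
  by rewrite dm.
elim: {i}(mx - i)%N {-2}i (erefl (mx - i)%N) m dm mi => [|t IHt] i ti m dm mi.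
  have {}ti : i = mx by apply: val_inj => /=; have := ltn_ord i; lia.
  (* A positive last entry means that m is the raise of a composition of smaller degree. *)
  pose m1 : 'X_{1..n} := (m - U_(mx))%MM; pose m' := m1#(rot^-1)%g.
  have em : raise m' = m.
    apply/mnmP => l; rewrite raiseE [m' _]mnmE permK mnmBE mnm1E eq_sym.
    by have [->|_] := eqVneq l mx; rewrite ti in mi *; lia.
  have dm' : mdeg m' = d.
    by have := congr1 (@mdeg n) em; rewrite mdegD mdeg1 mdeg_mperm dm addn1 => -[].
  have [p [p0 ep qp]] := IHd m' dm'.
  by rewrite -em; exists (raise_pol p); split;
    [exact: raise_pol_neq0|exact: eigen_raise|exact: Qraise].
have lti : (i.+1 < n)%N by lia.
pose i' := Ordinal lti; have a : adj i i' by [].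
have ti' : (mx - i' = t)%N by rewrite /= subnS ti.
have [e|nm] := eqVneq (m i) (m i'); first by apply: (IHt i' ti') => //; rewrite -e.
have mi' : (m#(tperm i i')) i' != 0%N by rewrite mnmE tpermR.
(* A positive entry elsewhere is carried one place to the right, unless its neighbour has the same
   value and is itself positive. *)
have [p [p0 ep qp]] := IHt i' ti' (m#(tperm i i')) (etrans (mdeg_mperm _ _) dm) mi'.
have nm' : (m#(tperm i i')) i != (m#(tperm i i')) i' by rewrite !mnmE tpermL tpermR eq_sym.
have mK : m#(tperm i i')#(tperm i i') = m by apply/mnmP => l; rewrite !mnmE tpermK.
have [c [ec c0]] := eigen_swap a nm' ep p0; rewrite mK in ec.
exists (c *: p + sw i i' p); split=> //; apply: Qlin; rewrite -mK; [exact: Qperm|exact: Qsw].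
Qed.

Lemma eigen_ex m : exists p, eigen m p /\ p@_m = 1.
Proof.
have [p [p0 ep _]] := @eigen_induction (fun _ _ => True) I (fun _ _ _ _ _ _ => I)
  (fun _ _ _ _ _ => I) (fun _ _ _ _ _ => I) (fun _ _ _ _ => I) m.
have pm : p@_m != 0 by apply: contra_neq p0; exact: eigen_eq0.
exists ((p@_m)^-1 *: p); split; last by rewrite mcoeffZ mulVf.
have := eigen_lin (p@_m)^-1 ep (_ : eigen m 0); rewrite addr0; apply.
by move=> i; rewrite linear0 scaler0.
Qed.

End Raising.

Lemma eigen_neq0 m p : p@_m = 1 -> p != 0.
Proof. by move=> e; apply/negP => /eqP p0; move/eqP: e; rewrite p0 mcoeff0 eq_sym oner_eq0. Qed.

(** * Symmetrisation of the non-symmetric polynomials *)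

Definition symz p : P := \sum_(w : 'S_n) msym w p.

Lemma symz_coef p m (w : 'S_n) : (symz p)@_(m#w) = (symz p)@_m.
Proof.
rewrite /symz !linear_sum /= [RHS](reindex_inj (@mulIg _ w)) /=; apply: eq_bigr => u _.
by rewrite !mcoeff_sym mpermM.
Qed.

Lemma symzZ c p : symz (c *: p) = c *: symz p.
Proof. by rewrite /symz scaler_sumr; apply: eq_bigr => w _; rewrite linearZ. Qed.

Lemma symzDZ c p q : symz (c *: p + q) = c *: symz p + symz q.
Proof.
by rewrite -symzZ /symz -big_split /=; apply: eq_bigr => w _; rewrite linearD.
Qed.

Lemma symz_sw i j p : symz (sw i j p) = symz p.
Proof.
rewrite /symz [RHS](reindex_inj (@mulgI _ (tperm i j))) /=; apply: eq_bigr => w _.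
by rewrite msymMm.
Qed.

(* The coefficient survives symmetrization: it does so trivially for increasing
   compositions, and neighbouring compositions have proportional symmetrizations. *)
Lemma symz_neq0 m p : eigen m p -> p@_m = 1 -> (symz p)@_m != 0.
Proof.
have [N] := ubnP (hgt m); elim: N => // N IHN in m p * => hN ep pm.
have [[i [j [ij mij]]]|hno] :=
  boolp.pselect (exists i j : 'I_n, (i < j)%N /\ (m j < m i)%N); last first.
  (* No descent: by [chain_swp_or] no other rearrangement of m occurs in p, so only the permutations
     fixing m contribute, each with coefficient 1. *)
  suff -> : (symz p)@_m = (\sum_(w : 'S_n | m#w == m) 1)%:R.
    by rewrite pnatr_eq0 (bigD1 1%g) ?mperm1.
  rewrite /symz linear_sum /= natr_sum [RHS]big_mkcond; apply: eq_bigr => w _.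
  rewrite mcoeff_sym; case: (m#w =P m) => [->//|ne].
  apply/eqP/negPn/negP; rewrite -mcoeff_msupp => /(eigen_chain ep) /chain_swp_or.
  by case=> [//|[//|]]; rewrite sqsum_perm ltnn.
have [a [a' [adja ha]]] := adj_descent ij mij.
have nm : m a != m a' by rewrite gtn_eqF.
have mv : move (m#(tperm a a')) m by right; exists a, a'; split=> //; rewrite adja.
have [c [ec c0]] := eigen_swap adja nm ep (eigen_neq0 pm).
set g := c *: p + sw a a' p in ec c0.
have gm : g@_(m#(tperm a a')) != 0 by apply: contra_neq c0; exact: eigen_eq0.
pose g1 := (g@_(m#(tperm a a')))^-1 *: g.
have eg1 : eigen (m#(tperm a a')) g1.
  by move=> i1; rewrite /g1 [LHS]linearZ /= ec !scalerA mulrC.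
have := IHN (m#(tperm a a')) g1 _ eg1 _; rewrite symz_coef.
have -> : symz g1 = ((g@_(m#(tperm a a')))^-1 * (c + 1)) *: symz p.
  rewrite /g1; move: (_^-1) => b; rewrite /g symzZ symzDZ symz_sw.
  by rewrite -[X in _ *: (_ + X)]scale1r -scalerDl scalerA.
have h1 : g1@_(m#(tperm a a')) = 1 by rewrite /g1 mcoeffZ mulVf.
have lt := move_hgt mv => /(_ (leq_trans lt hN) h1).
by rewrite mcoeffZ mulf_eq0 negb_or => /andP[].
Qed.

End Jack.
End Operators.

Definition mnm_of n (f : 'I_n -> nat) : 'X_{1..n} := [multinom f i | i < n].

Lemma mnm_ofE n (f : 'I_n -> nat) i : mnm_of f i = f i.
Proof. exact: mnmE. Qed.

Lemma mnm_of_eq n (f : 'I_n -> nat) (m : 'X_{1..n}) : (forall i, f i = m i) -> mnm_of f = m.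
Proof. by move=> h; apply/mnmP => i; rewrite mnmE. Qed.
End DunklAlgebra.

From mathcomp Require Import all_classical all_reals all_analysis.
From mathcomp Require Import measurable_realfun complex.
Import -(notations) mpoly.
Require Import Defs.
Import Order.TTheory GRing.Theory Num.Theory.
Import numFieldNormedType.Exports.
Import DunklAlgebra.
Local Open Scope ring_scope.
Set Implicit Arguments. Unset Strict Implicit. Unset Printing Implicit Defensive.

Local Notation "p .@[ v ]" := (mpoly.meval v p).
Local Notation "''X_' i" := (mpoly.mpolyX _ (mpoly.mnm1 i)).
Local Notation "m # s" := (mpoly.Multinom [tuple (mpoly.fun_of_multinom m (s i) : nat) | i < _])
  (at level 40, left associativity).
Local Notation "p ^`M( i )" := (mpoly.mderiv i p) (at level 1, format "p ^`M( i )").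

(** * Moves versus the dominance and Bruhat orders *)

Section Orders.
Variable n : nat.
Implicit Types (m : mpoly.multinom n) (e : mi n).
Local Open Scope nat_scope.

Definition mi_of m : mi n := [ffun i => m i].

Lemma mi_ofE m i : mi_of m i = m i.
Proof. by rewrite ffunE. Qed.

Lemma mpE m (w : {perm 'I_n}) i : (m#w) i = m (w i).
Proof. exact: mpoly.mnmE. Qed.

Lemma before_rk_iff m i j : (rk m i < rk m j) = before m i j.
Proof.
apply/idP/idP => [lt|]; last exact: before_rk.
have [e|ne] := eqVneq i j; first by rewrite e ltnn in lt.
by case/orP: (before_total m ne) => // /before_rk; lia.
Qed.

Lemma rk_lt m i : rk m i < n.
Proof.
rewrite /rk -[X in _ < X](card_ord n) -sum1_card (bigD1 i) //= [X in _ < X](bigD1 i) //=.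
by rewrite before_irr add0n add1n ltnS leq_sum // => j _; case: (before _ _ _).
Qed.

Lemma rk_inj m : injective (fun i => Ordinal (rk_lt m i)).
Proof.
move=> i j [e]; apply/eqP; apply/negPn/negP => ne.
by case/orP: (before_total m ne) => /before_rk; rewrite e ltnn.
Qed.

Definition rkp m : {perm 'I_n} := perm (@rk_inj m).
(** The permutation [w_eta]: it carries the decreasing rearrangement to m and keeps equal entries in
    their order, which makes it the shortest one ([shortest_sortp]). *)
Definition sortp m : {perm 'I_n} := ((rkp m)^-1)%g.

Lemma rkpE m i : rkp m i = rk m i :> nat.
Proof. by rewrite permE. Qed.

Lemma rkp_le m i j : rkp m i <= rkp m j -> m j <= m i.
Proof.
rewrite !rkpE leq_eqVlt before_rk_iff /before => /orP[/eqP e|]; last by lia.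
by have -> : i = j by apply: (@rk_inj m); apply: val_inj.
Qed.

Lemma mplus_rkp m i : mplus (mi_of m) (rkp m i) = m i.
Proof.
rewrite /mplus ffunE.
set s := [seq _ | _ <- _]; pose s' := [seq m (sortp m j) | j <- enum 'I_n].
have -> : sort geq s = s'.
  apply: (@sorted_eq _ geq).
  - by move=> a b c /=; lia.
  - by move=> a b /=; lia.
  - by apply: sort_sorted => a b /=; lia.
  - rewrite sorted_map; apply: (@sub_sorted _ (fun i j : 'I_n => i <= j)); last first.
      by have := iota_sorted 0 n; rewrite -val_enum_ord sorted_map.
    by move=> a b /= le; apply: rkp_le; rewrite /sortp !permKV.
  - rewrite perm_sort /s (eq_map (mi_ofE m)) /s'.
    rewrite (map_comp (fun j => m j) (sortp m)); apply: perm_map.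
    apply: uniq_perm; rewrite ?(map_inj_uniq perm_inj) ?enum_uniq // => x.
    by rewrite mem_enum; apply/esym/mapP; exists (rkp m x); rewrite ?mem_enum // /sortp permK.
by rewrite (nth_map i) ?size_enum_ord // nth_ord_enum /sortp permK.
Qed.

Lemma mact_sortp m : mact (sortp m) (mplus (mi_of m)) = mi_of m.
Proof. by apply/ffunP => i; rewrite /mact ffunE /sortp invgK mplus_rkp mi_ofE. Qed.

Lemma mplus_decr m (p q : 'I_n) : p <= q -> mplus (mi_of m) q <= mplus (mi_of m) p.
Proof.
rewrite -[p](permKV (rkp m)) -[q](permKV (rkp m)) !mplus_rkp; exact: rkp_le.
Qed.

Definition ascents m := [set p : 'I_n * 'I_n | (p.1 < p.2) && (m p.1 < m p.2)].

(** A permutation producing m from a decreasing sequence has an inversion for each pair on which m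
    increases; [sortp] has no other inversions. *)
Lemma plength_ascents m w : mact w (mplus (mi_of m)) = mi_of m -> #|ascents m| <= plength w.
Proof.
move=> hw; have e i : m i = mplus (mi_of m) ((w^-1)%g i) by rewrite -mi_ofE -{1}hw ffunE.
pose f (p : 'I_n * 'I_n) := ((w^-1)%g p.2, (w^-1)%g p.1).
have fi : injective f by move=> [a b] [c d] [/perm_inj -> /perm_inj ->].
rewrite -(card_imset _ fi) /plength; apply: subset_leq_card; apply/fintype.subsetP => p /imsetP[[a b]].
rewrite inE /= => /andP[ab mab] ->; rewrite inE /= !permKV ab andbT ltnNge.
by apply/negP => /(@mplus_decr m); rewrite -!e leqNgt mab.
Qed.

Lemma plength_sortp m : plength (sortp m) = #|ascents m|.
Proof.
apply/eqP; rewrite eqn_leq plength_ascents ?mact_sortp // andbT.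
pose f (p : 'I_n * 'I_n) := (sortp m p.2, sortp m p.1).
have fi : injective f by move=> [a b] [c d] [/perm_inj -> /perm_inj ->].
rewrite /plength -(card_imset _ fi); apply: subset_leq_card; apply/fintype.subsetP => p.
move=> /imsetP[[a b]]; rewrite inE /= => /andP[ab lt] ->; rewrite inE /= lt /=.
move: ab; rewrite -{1}[a](permKV (rkp m)) -{1}[b](permKV (rkp m)) !rkpE before_rk_iff /before.
by rewrite -/(sortp m); move: lt; lia.
Qed.

Lemma shortest_sortp m : shortest_perm (mi_of m) (sortp m).
Proof.
split; first exact: mact_sortp.
by move=> w /plength_ascents; rewrite plength_sortp.
Qed.

(** The map f transposes a pair when its image is still ordered and fixes it otherwise. It embeds
    the ascents of m into those of the swapped composition and misses (i, j). *)
Lemma swp_ascents m (i j : 'I_n) : i < j -> m j < m i -> #|ascents m| < #|ascents (m#(tperm i j))|.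
Proof.
move=> ij mij; set t := tperm i j.
pose f (p : 'I_n * 'I_n) := if t p.1 < t p.2 then (t p.1, t p.2) else p.
have fi : {in ascents m &, injective f}.
  move=> [a b] [c d]; rewrite !inE /f /= => /andP[ab _] /andP[cd _].
  case: ifP => h1; case: ifP => h2 //.
  - by move=> [/perm_inj -> /perm_inj ->].
  - by move=> [ha hb]; move: h2; rewrite -ha -hb /t !tpermK ab.
  - by move=> [ha hb]; move: h1; rewrite ha hb /t !tpermK cd.
rewrite -(card_in_imset fi); apply/proper_card/properP; split.
  apply/fintype.subsetP => p /imsetP[[a b]]; rewrite !inE /= => /andP[ab mab] ->.
  rewrite /f /=; case: ifP => h; rewrite /= !mpE.
    by rewrite h /t !tpermK.
  rewrite ab /=; move: h ab mab; rewrite /t.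
  case: tpermP => [->|->|/eqP ai /eqP aj]; case: tpermP => [->|->|/eqP bi /eqP bj]; try lia.
exists (i, j); first by rewrite inE /= ij !mpE tpermL tpermR.
apply/negP => /imsetP[[a b]]; rewrite inE /= => /andP[ab mab].
rewrite /f /=; case: ifP => h [ei ej].
  have ea : a = j by rewrite -[a](tpermK i j) -/t -ei /t tpermL.
  have eb : b = i by rewrite -[b](tpermK i j) -/t -ej /t tpermR.
  by move: ab; rewrite ea eb; lia.
by move: mab; rewrite -ei -ej; lia.
Qed.

Lemma bruhat_trans (u v w : {perm 'I_n}) : bruhat_le u v -> bruhat_le v w -> bruhat_le u w.
Proof.
move=> uv vw; elim: vw uv => // v1 i j v2 _ IH lt uv.
by apply: bruhat_step => //; exact: IH.
Qed.

(** Without intermediate entries equal to one of the two that are swapped, the order of ties is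
    undisturbed and the ranks change exactly by the transposition. *)
Lemma sortp_swp_near m (i j : 'I_n) : i < j -> m j < m i ->
  (forall l : 'I_n, i < l -> l < j -> m l != m i /\ m l != m j) ->
  sortp (m#(tperm i j)) = (sortp m * tperm i j)%g.
Proof.
move=> ij mij hno; apply: invg_inj; rewrite invMg /sortp !invgK tpermV.
apply/permP => l; apply: val_inj; rewrite permM /= !rkpE.
have far (z : 'I_n) : z != i -> z != j -> m z = m i \/ m z = m j ->
    (i < z) = (j < z) /\ (z < i) = (z < j).
  rewrite -!(inj_eq val_inj) /= => zi zj mz.
  have : ~~ ((i < z) && (z < j)).
    apply/negP => /andP[iz zj']; have [h1 h2] := hno _ iz zj'.
    by case: mz => e; [rewrite e eqxx in h1|rewrite e eqxx in h2].
  by split; lia.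
apply: rk_perm => x y.
case: (tpermP i j x) => [->|->|/eqP xi /eqP xj]; case: (tpermP i j y) => [->|->|/eqP yi /eqP yj] //; try lia.
- by move=> e; have [-> _] := far y yi yj (or_intror (esym e)).
- by move=> e; have [-> _] := far y yi yj (or_introl (esym e)).
- by move=> e; have [_ ->] := far x xi xj (or_intror e).
- by move=> e; have [_ ->] := far x xi xj (or_introl e).
Qed.

Lemma bruhat_lt_trans (u v w : {perm 'I_n}) : bruhat_lt u v -> bruhat_lt v w -> bruhat_lt u w.
Proof.
have len (a b : {perm 'I_n}) : bruhat_le a b -> plength a <= plength b /\ (a = b \/ plength a < plength b).
  elim=> [c|c i j d _ [IH _] lt]; first by split=> //; left.
  by split; [lia|right; lia].
move=> [uv nuv] [vw nvw]; split; first exact: bruhat_trans uv vw.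
have [_ [//|l1]] := len _ _ uv; have [l2 _] := len _ _ vw.
by move=> e; move: l1; rewrite e ltnNge l2.
Qed.

(** Induction on the distance: an intermediate entry equal to one of the two factors the swap into
    two shorter ones; without such an entry a single transposition lengthens [sortp]. *)
Lemma swp_bruhat m (i j : 'I_n) : i < j -> m j < m i ->
  bruhat_lt (sortp m) (sortp (m#(tperm i j))).
Proof.
have [N] := ubnP (j - i); elim: N => // N IHN in m i j * => hN ij mij.
have [[l [il lj ml]]|hno] := pselect (exists l : 'I_n, [/\ i < l, l < j & m l = m i \/ m l = m j]).
  have [nil nlj nij] : [/\ i != l, l != j & i != j].
    by split; rewrite -(inj_eq val_inj) /= ltn_eqF // (ltn_trans il lj).
  have [nli njl nji] : [/\ l != i, j != l & j != i] by rewrite eq_sym nil eq_sym nlj eq_sym nij.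
  case: ml => ml.
    have e : m#(tperm i j) = m#(tperm l j)#(tperm i l).
      apply/mpoly.mnmP => x; rewrite !mpE.
      case: (tpermP i l x) => [->|->|/eqP xi /eqP xl].
      - by rewrite tpermL tpermL.
      - by rewrite [tperm i j l]tpermD // [tperm l j i]tpermD.
      - case: (tpermP l j x) xi xl => [->|->|/eqP _ /eqP xj] xi xl.
        + by rewrite eqxx in xl.
        + by rewrite tpermR ml.
        + by rewrite tpermD // eq_sym.
    rewrite e; apply: (@bruhat_lt_trans _ (sortp (m#(tperm l j)))); apply: IHN => //; try lia.
    by rewrite !mpE tpermL tpermD // ml.
  have e : m#(tperm i j) = m#(tperm i l)#(tperm l j).
    apply/mpoly.mnmP => x; rewrite !mpE.
    case: (tpermP l j x) => [->|->|/eqP xl /eqP xj].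
    - by rewrite [tperm i l j]tpermD // [tperm i j l]tpermD.
    - by rewrite !tpermR.
    - case: (tpermP i l x) xl xj => [->|->|/eqP xi /eqP _] xl xj.
      + by rewrite tpermL ml.
      + by rewrite eqxx in xl.
      + by rewrite tpermD // eq_sym.
  rewrite e; apply: (@bruhat_lt_trans _ (sortp (m#(tperm i l)))); apply: IHN => //; try lia.
  by rewrite !mpE tpermR tpermD // ml.
have {}hno (l : 'I_n) : i < l -> l < j -> m l != m i /\ m l != m j.
  by move=> il lj; split; apply/eqP => e; apply: hno; exists l; split=> //; [left|right].
have es := sortp_swp_near ij mij hno.
have lt : plength (sortp m) < plength (sortp m * tperm i j)%g.
  by rewrite -es !plength_sortp swp_ascents.
rewrite es; split; first exact: bruhat_step (bruhat_refl _) lt.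
by move=> e; move: lt; rewrite -e ltnn.
Qed.

Lemma mplus_perm m (w : {perm 'I_n}) : mplus (mi_of (m#w)) = mplus (mi_of m).
Proof.
apply/ffunP => i; rewrite !ffunE; congr (nth _ _ i).
apply/perm_sortP; [by move=> a b /=; lia|by move=> a b c /=; lia|by move=> a b /=; lia|].
rewrite (eq_map (mi_ofE m)) (eq_map (g := fun j => m (w j))) => [|j]; last by rewrite mi_ofE mpE.
rewrite (map_comp (fun j => m j) w); apply: perm_map.
apply: uniq_perm; rewrite ?(map_inj_uniq perm_inj) ?enum_uniq // => x.
by rewrite mem_enum; apply/mapP; exists ((w^-1)%g x); rewrite ?mem_enum // permKV.
Qed.

Lemma sum_mplus (f : nat -> nat) m : \sum_i f (mplus (mi_of m) i) = \sum_i f (m i).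
Proof.
rewrite (reindex_inj (@perm_inj _ (rkp m))) /=.
by apply: eq_bigr => i _; rewrite mplus_rkp.
Qed.

(** Variational formula: the sum of the r largest entries is the minimum over t of the sum of the
    positive parts of [m i - t], plus t times the number of terms. It is attained at the next entry,
    or at 0 if there is none; [partial_sum_mplus_le] is the inequality for other t. Domination by a
    squeeze thus becomes convexity of the positive part. *)
Lemma partial_sum_mplus m r : exists t, forall B : nat -> bool, (forall s, B s = (s < r)) ->
  \sum_(j < n | B j) mplus (mi_of m) j = \sum_i (m i - t) + t * #|[set j : 'I_n | B j]|.
Proof.
pose t := if r < n then nth 0 [seq mplus (mi_of m) j | j <- enum 'I_n] r else 0.
have tE (lt : r < n) : t = mplus (mi_of m) (Ordinal lt).
  by rewrite /t lt (nth_map (Ordinal lt)) ?size_enum_ord // (nth_ord_enum _ (Ordinal lt)).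
exists t => B hB; rewrite -(sum_mplus (fun x => x - t)).
rewrite -sum1_card big_distrr /= [X in _ + X](eq_bigl (fun j : 'I_n => B j)); last first.
  by move=> j; rewrite inE.
rewrite [X in _ = X + _](bigID (fun j : 'I_n => B j)) /= [X in _ + X + _]big1 => [|j]; last first.
  rewrite hB -leqNgt => rj; have lt : r < n by apply: leq_ltn_trans rj (ltn_ord j).
  by apply/eqP; rewrite subn_eq0 (tE lt); exact: mplus_decr.
rewrite addn0 -big_split /=; apply: eq_bigr => j; rewrite hB => jr.
rewrite muln1 subnK //; have [lt|ge] := ltnP r n; last by rewrite /t ltnNge ge.
by rewrite (tE lt) mplus_decr // ltnW.
Qed.

Lemma partial_sum_mplus_le m r t : 
  \sum_(j < n | j < r) mplus (mi_of m) j <= \sum_i (m i - t) + t * #|[set j : 'I_n | j < r]|.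
Proof.
rewrite -(sum_mplus (fun x => x - t)) -sum1_card big_distrr /=.
rewrite [X in _ + X](eq_bigl (fun j : 'I_n => j < r)) => [|j]; last by rewrite inE.
rewrite [X in _ <= X + _](bigID (fun j : 'I_n => j < r)) /= addnAC -big_split /=.
apply: leq_trans (leq_addr _ _); apply: leq_sum => j _; rewrite muln1; lia.
Qed.

Lemma sqz_domle m' m : sqz m' m -> domle (mplus (mi_of m')) (mplus (mi_of m)).
Proof.
move=> sq; split.
  rewrite /msize (sum_mplus id) (sum_mplus id) -!mpoly.mdegE.
  by apply: move_mdeg; left.
move=> r; have [t ht] := partial_sum_mplus m r; rewrite (ht (fun s => s < r)) //.
apply: leq_trans (partial_sum_mplus_le m' r t) _; rewrite leq_add2r.
case: sq => i [j [nij h e1 e2 e3]].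
have h2 l : l != i -> l != j -> m' l - t = m l - t by move=> li lj; rewrite h.
have := sum_two nij h2; case: (leqP (m i) (m j)) e2 e3 => _; lia.
Qed.

(** A version of [mprec] that is visibly transitive: a smaller sum of squares, which depends on the
    rearrangement only, replaces inequality of the rearrangements, and [sortp] replaces the
    quantified shortest permutations. *)
Definition prec m' m := (sqsum m' < sqsum m /\ domle (mplus (mi_of m')) (mplus (mi_of m))) \/
  (mplus (mi_of m') = mplus (mi_of m) /\ bruhat_lt (sortp m) (sortp m')).

Lemma sqsum_mplus m : sqsum m = \sum_i mplus (mi_of m) i ^ 2.
Proof. by rewrite (sum_mplus (fun x => x ^ 2)). Qed.

Lemma prec_trans m1 m2 m3 : prec m1 m2 -> prec m2 m3 -> prec m1 m3.
Proof.
case=> [[h1 d1]|[h1 b1]] [[h2 d2]|[h2 b2]].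
- left; split; first exact: ltn_trans h1 h2.
  case: d1 d2 => [s1 d1] [s2 d2]; split; first by rewrite s1.
  by move=> r; apply: leq_trans (d1 r) (d2 r).
- by left; rewrite -h2; split=> //; rewrite [X in _ < X]sqsum_mplus -h2 -sqsum_mplus.
- by left; rewrite h1; split=> //; rewrite sqsum_mplus h1 -sqsum_mplus.
- by right; split; [rewrite h1|exact: bruhat_lt_trans b2 b1].
Qed.

Lemma move_prec m' m : move m' m -> prec m' m.
Proof.
case=> [sq|[i [j [ij mij ->]]]].
  by left; split; [exact: sqz_sqsum|exact: sqz_domle].
by right; rewrite mplus_perm; split=> //; exact: swp_bruhat.
Qed.

Lemma chain_mprec m m' : chain m m' -> m' = m \/ mprec (mi_of m') (mi_of m).
Proof.
move=> c; suff [->|] : m' = m \/ prec m' m; first by left.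
  case=> [[h d]|[h b]]; right.
    by left; split=> // e; move: h; rewrite !sqsum_mplus e ltnn.
  right; split=> //; exists (sortp m), (sortp m'); split; first exact: shortest_sortp.
  by split=> //; exact: shortest_sortp.
elim: c => [|m1 m2 _ [->|h] /move_prec mv]; first by left.
  by right.
by right; exact: prec_trans mv h.
Qed.

End Orders.

(** * The embedding of the reals *)

Section ComplexEmbedding.
Variable R : realType.
Local Notation C := (Cx R).

Lemma cRE (x : R) : cR x = real_complex R x. Proof. by []. Qed.
Lemma cRD (x y : R) : cR (x + y) = cR x + cR y. Proof. by rewrite !cRE rmorphD. Qed.
Lemma cRB (x y : R) : cR (x - y) = cR x - cR y. Proof. by rewrite !cRE rmorphB. Qed.
Lemma cRN (x : R) : cR (- x) = - cR x. Proof. by rewrite !cRE rmorphN. Qed.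
Lemma cRM (x y : R) : cR (x * y) = cR x * cR y. Proof. by rewrite !cRE rmorphM. Qed.
Lemma cR0 : cR (0 : R) = 0. Proof. by rewrite cRE rmorph0. Qed.
Lemma cR1 : cR (1 : R) = 1. Proof. by rewrite cRE rmorph1. Qed.
Lemma cR_nat n : cR (n%:R : R) = n%:R. Proof. by rewrite cRE rmorph_nat. Qed.
Lemma cR_sum (I : Type) (r : seq I) (P : pred I) (f : I -> R) :
  cR (\sum_(i <- r | P i) f i) = \sum_(i <- r | P i) cR (f i).
Proof. by rewrite cRE rmorph_sum. Qed.
Lemma cR_ge0 (x : R) : 0 <= x -> 0 <= cR x. Proof. by move=> h; rewrite lecR. Qed.
Lemma cR_inj : injective (@cR R). Proof. by move=> x y []. Qed.
End ComplexEmbedding.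

(** * Polynomials as functions: evaluation, divided differences, derivatives *)

Section Evaluation.
Variables (F : numFieldType) (n : nat).
Local Notation P := (mpoly.mpoly n F).
Implicit Types (p q : P).

Lemma meval_msym w p (v : 'I_n -> F) : (mpoly.msym w p).@[v] = p.@[v \o w].
Proof.
elim/mpoly_ind_mulX: p => [c p q hp hq||i p hp].
- by rewrite mpoly.msymD mpoly.msymZ !mpoly.mevalD !mpoly.mevalZ hp hq.
- by rewrite mpoly.msym1 !mpoly.meval1.
- by rewrite mpoly.msymM !mpoly.mevalM hp msymXi !mpoly.mevalXU.
Qed.

Lemma base_digits (N : nat) (f g : nat -> nat) m :
  (forall i, (i < m)%N -> (f i < N)%N /\ (g i < N)%N) ->
  (\sum_(i < m) f i * N ^ i = \sum_(i < m) g i * N ^ i)%N -> forall i, (i < m)%N -> f i = g i.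
Proof.
elim: m f g => [|m IHm] f g hN //.
have [hf hg] := hN 0%N isT.
have e (h : nat -> nat) : (\sum_(i < m.+1) h i * N ^ i = h 0 + N * \sum_(i < m) h i.+1 * N ^ i)%N.
  rewrite big_ord_recl /= muln1; congr addn; rewrite big_distrr /=; apply: eq_bigr => i _.
  by rewrite /bump /= expnS mulnCA.
rewrite !e => h.
have h0 : f 0%N = g 0%N.
  by have := congr1 (modn^~ N) h; rewrite /= ![(_ + N * _)%N]addnC ![(N * _)%N]mulnC !modnMDl !modn_small.
have N0 : (0 < N)%N by apply: leq_ltn_trans hf.
move: h; rewrite h0 => /addnI /eqP; rewrite eqn_pmul2l // => /eqP h.
case=> [|i] hi //; apply: (IHm (fun i => f i.+1) (fun i => g i.+1)) => // j hj.
exact: hN.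
Qed.

(* Kronecker substitution: the points (t, t^N, t^(N^2), ...) detect all coefficients. *)
Lemma meval_eq0 p : (forall x, (forall i j : 'I_n, i != j -> x i != x j) -> p.@[x] = 0) -> p = 0.
Proof.
move=> hp; pose N := (\sum_(m <- mpoly.msupp p) mpoly.mdeg m).+2.
have hN m i : m \in mpoly.msupp p -> (m i < N)%N.
  move=> hm; rewrite /N ltnS leqW // (big_rem m) //= mpoly.mdegE (bigD1 i) //=.
  by rewrite -!addnA leq_addr.
pose code (m : mpoly.multinom n) := (\sum_(i < n) m i * N ^ i)%N.
have code_inj m m' : m \in mpoly.msupp p -> m' \in mpoly.msupp p -> code m = code m' -> m = m'.
  move=> hm hm' e; apply/mpoly.mnmP => i.
  pose ext (m0 : mpoly.multinom n) (j : nat) := if insub j is Some j' then m0 j' else 0%N.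
  have extE m0 (j : 'I_n) : ext m0 j = m0 j by rewrite /ext valK.
  rewrite -!extE; apply: (@base_digits N (ext m) (ext m') n) => // [j hj|].
    by rewrite -[j]/(val (Ordinal hj)) !extE !hN.
  by under eq_bigr do rewrite extE; under [RHS]eq_bigr do rewrite extE.
pose Q : {poly F} := \sum_(m <- mpoly.msupp p) mpoly.mcoeff m p *: 'X^(code m).
have Q0 : Q = 0.
  apply/eqP/negPn/negP => Qn0.
  (* The points start at 2 because distinct powers of the base must be distinct; their number
     exceeds the degree of Q. *)
  pose s := [seq (j.+2)%:R : F | j <- iota 0 (size Q)].
  have us : uniq s.
    rewrite map_inj_uniq ?iota_uniq // => a b /eqP; rewrite eqr_nat eqSS eqSS.
    by move/eqP.
  have rs : all (root Q) s.
    apply/allP => _ /mapP[j _ ->]; rewrite /root.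
    rewrite -(hp (fun i => (j.+2%:R) ^+ (N ^ i)%N)); last first.
      move=> a b; apply: contra; rewrite -!natrX eqr_nat eqn_exp2l // eqn_exp2l //.
    rewrite mpoly.mevalE horner_sum; apply/eqP; apply: eq_bigr => m _.
    rewrite hornerZ hornerXn; congr (_ * _); rewrite /code -prodrXr.
    by apply: eq_bigr => i _; rewrite -exprM mulnC.
  by have := max_poly_roots Qn0 rs us; rewrite size_map size_iota ltnn.
apply/mpoly.mpolyP => m; rewrite mpoly.mcoeff0; apply/eqP/negPn/negP => hm.
have hm' : m \in mpoly.msupp p by rewrite mpoly.mcoeff_msupp.
have := congr1 (fun q : {poly F} => q`_(code m)) Q0.
rewrite coef0 /Q coef_sum (bigD1_seq m) ?mpoly.msupp_uniq //= coefZ coefXn eqxx mulr1.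
rewrite big_seq_cond big1 ?addr0 => [e|m' /andP[h1 h2]]; first by rewrite e eqxx in hm.
by rewrite coefZ coefXn; case: eqP => [/(code_inj _ _ hm' h1) e|_]; rewrite ?mulr0 // e eqxx in h2 *.
Qed.

Lemma meval_dd (i j : 'I_n) p x : x i != x j ->
  (dd i j p).@[x] = (p.@[x] - p.@[x \o tperm i j]) / (x i - x j).
Proof.
move=> ne; have := congr1 (mpoly.meval x) (ddP i j p).
rewrite mpoly.mevalB mpoly.mevalM mpoly.mevalB !mpoly.mevalXU meval_msym => ->.
by rewrite mulrAC divff ?mul1r // subr_eq0.
Qed.

Lemma is_derive_meval p (x xi : 'I_n -> F) :
  is_derive (0 : F) (1 : F) (fun t : F => p.@[fun i => x i + t * xi i])
    (\sum_i xi i * (mpoly.mderiv i p).@[x]).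
Proof.
have at0 q : q.@[fun i => x i + 0 * xi i] = q.@[x].
  by apply: mpoly.meval_eq => i; rewrite mul0r addr0.
elim/mpoly_ind_mulX: p => [c p q hp hq||l p hp].
- have -> : (fun t : F => (c *: p + q).@[fun i => x i + t * xi i]) =
     (c \*: (fun t : F => p.@[fun i => x i + t * xi i])) + (fun t : F => q.@[fun i => x i + t * xi i]).
    by apply/funext => t; rewrite mpoly.mevalD mpoly.mevalZ.
  apply: is_derive_eq; rewrite scaler_sumr -big_split /=; apply: eq_bigr => i _.
  by rewrite mpoly.mderivD mpoly.mderivZ mpoly.mevalD mpoly.mevalZ mulrDr /GRing.scale /= mulrCA.
- have -> : (fun t : F => (1 : P).@[fun i => x i + t * xi i]) = cst 1.
    by apply/funext => t; rewrite mpoly.meval1.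
  apply: is_derive_eq; rewrite big1 // => i _.
  by rewrite -mpoly.mpolyC1 mpoly.mderivC mpoly.meval0 mulr0.
- have -> : (fun t : F => ('X_l * p).@[fun i => x i + t * xi i]) =
     (cst (x l) + (xi l \*: id)) * (fun t : F => p.@[fun i => x i + t * xi i]).
    apply/funext => t; rewrite mpoly.mevalM mpoly.mevalXU /=; congr (_ * _).
    by rewrite -[RHS]/(x l + xi l * t) mulrC.
  apply: is_derive_eq; rewrite at0 add0r.
  rewrite -[(cst (x l) + (xi l \*: id)) 0]/(x l + xi l * 0) mulr0 addr0 /GRing.scale /= mulr1.
  rewrite mulr_sumr (bigD1 l) //= [in RHS](bigD1 l) //=.
  rewrite mpoly.mderivM mderivX1 eqxx mpoly.mpolyC1 mul1r mpoly.mevalD mpoly.mevalM mpoly.mevalXU.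
  have -> : \sum_(i < n | i != l) xi i * (mpoly.mderiv i ('X_l * p)).@[x] =
      \sum_(i < n | i != l) x l * (xi i * (mpoly.mderiv i p).@[x]).
    apply: eq_bigr => i nil; rewrite mpoly.mderivM mderivX1 eq_sym (negbTE nil) mpoly.mpolyC0 mul0r add0r.
    by rewrite mpoly.mevalM mpoly.mevalXU mulrCA.
  by ring.
Qed.
End Evaluation.

(** * Jack polynomials as defined agree with the eigenvectors *)

Section NsJack.
Variables (R : realType) (k : R) (n : nat).
Hypotheses (k0 : 0 <= k) (n0 : (0 < n)%N).
Local Notation C := (Cx R).
Local Notation P := (mpoly.mpoly n C).
Implicit Types (p q : P).
Let kC : C := cR k.
Let kC0 : 0 <= kC. Proof. exact: cR_ge0. Qed.

Lemma Dunkl_meval p (xi : rvec R n) (x : cvec R n) : regular x ->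
  Dunkl k xi (fun y => p.@[y]) x = \sum_i cR (xi i) * (T kC i p).@[x].
Proof.
move=> rx; rewrite /Dunkl /dderiv.
have -> : derive (fun t : C => p.@[vadd x (vscale t (cofr xi))]) 0 1 =
    \sum_i cofr xi i * (mpoly.mderiv i p).@[x].
  by have [_ e] := is_derive_meval p x (cofr xi); exact: e.
apply/esym.
rewrite (eq_bigr (fun i => cR (xi i) * (mpoly.mderiv i p).@[x] +
   kC * \sum_(j < n | j != i) cR (xi i) * (dd i j p).@[x])); last first.
  move=> i _; rewrite TE mpoly.mevalD mpoly.mevalZ mulrDr; congr (_ + _).
  by rewrite mulrCA (raddf_sum (mpoly.meval x)) mulr_sumr.
rewrite big_split /= -mulr_sumr; congr (_ + _ * _).
have split_lt (f : 'I_n -> 'I_n -> C) : \sum_i \sum_(j < n | j != i) f i j =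
    \sum_(i < n) \sum_(j < n | (i < j)%N) (f i j + f j i).
  have -> : \sum_(i < n) \sum_(j < n | (i < j)%N) (f i j + f j i) =
     \sum_(i < n) \sum_(j < n | (i < j)%N) f i j + \sum_(i < n) \sum_(j < n | (j < i)%N) f i j.
    under eq_bigr do rewrite big_split /=; rewrite big_split /=; congr (_ + _).
    by rewrite (exchange_big_dep xpredT).
  rewrite -big_split /=; apply: eq_bigr => i _.
  rewrite (bigID (fun j : 'I_n => (i < j)%N)) /=; congr (_ + _); apply: eq_bigl => j.
    by rewrite -(inj_eq val_inj) /=; lia.
  by rewrite -(inj_eq val_inj) /=; lia.
rewrite split_lt; apply: eq_bigr => i _; apply: eq_bigr => j ij.
have nij : i != j by rewrite -(inj_eq val_inj) /= ltn_eqF.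
rewrite (ddC p nij) mpoly.mevalN mulrN -mulrBl -cRB meval_dd; last exact: rx.
by [].
Qed.

Lemma Dop_meval p (j : 'I_n) (x : cvec R n) : regular x ->
  Dop k j (fun y => p.@[y]) x = (D kC j p).@[x].
Proof.
move=> rx; rewrite /Dop Dunkl_meval // DE !mpoly.mevalD mpoly.mevalM mpoly.mevalXU !mpoly.mevalZ.
congr (_ + _ + _).
- congr (_ * _); rewrite (bigD1 j) //= eqxx cR1 mul1r big1 ?addr0 // => i /negbTE ->.
  by rewrite cR0 mul0r.
- by rewrite cRM cRB cR1 cR_nat.
- rewrite (raddf_sum (mpoly.meval x)) /=; congr (_ * _); apply: eq_bigr => i _.
  by rewrite swC /sw meval_msym.
Qed.

Definition pol_of d (c : mi n -> C) : P :=
  \sum_(kp : {ffun 'I_n -> 'I_d.+1}) c [ffun i => nat_of_ord (kp i)] *: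
     mpoly.mpolyX C (mnm_of (fun i => kp i)).

Lemma peval_pol_of d c x : peval d c x = (pol_of d c).@[x].
Proof.
rewrite /peval /pol_of (raddf_sum (mpoly.meval x)) /=; apply: eq_bigr => kp _.
rewrite mpoly.mevalZ mpoly.mevalX /mono; congr (_ * _); apply: eq_bigr => i _.
by rewrite ffunE mnm_ofE.
Qed.

Lemma pol_of_coef d c (e : mi n) : (forall i, (e i <= d)%N) ->
  mpoly.mcoeff (mnm_of e) (pol_of d c) = c e.
Proof.
move=> he; pose kp0 : {ffun 'I_n -> 'I_d.+1} := [ffun i => inord (e i)].
have e0 i : kp0 i = e i :> nat by rewrite ffunE inordK // ltnS.
rewrite /pol_of (raddf_sum (mpoly.mcoeff _)) (bigD1 kp0) //= mpoly.mcoeffZ mpoly.mcoeffX.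
have -> : mnm_of (fun i => kp0 i) = mnm_of e by apply: mnm_of_eq => i; rewrite mnm_ofE.
rewrite eqxx mulr1 big1 ?addr0 => [|kp ne].
  by congr c; apply/ffunP => i; rewrite ffunE e0.
rewrite mpoly.mcoeffZ mpoly.mcoeffX; case: eqP => [h|_]; last by rewrite mulr0.
case/negP: ne; apply/eqP/ffunP => i; apply: val_inj => /=.
by have := congr1 (fun m : mpoly.multinom n => m i) h; rewrite !mnm_ofE e0.
Qed.

Lemma entry_le_msize (e : mi n) i : (e i <= msize e)%N.
Proof. by rewrite /msize (bigD1 i) //= leq_addr. Qed.

Lemma regular_inj p q : (forall x : cvec R n, regular x -> p.@[x] = q.@[x]) -> p = q.
Proof.
move=> h; apply/eqP; rewrite -subr_eq0; apply/eqP/meval_eq0 => x rx.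
by rewrite mpoly.mevalB h ?subrr.
Qed.

Lemma eb_etabar (e : mi n) j : eb kC (mnm_of e) j = cR (etabar k e j).
Proof.
rewrite /eb /etabar !cRB !cRM !cR_nat mnm_ofE -addrA -opprD; congr (_ - _).
rewrite -mulrDr -natrD; congr (_ * _%:R).
rewrite /rk -!sum1dep_card [X in _ = (X + _)%N]big_mkcond [X in _ = (_ + X)%N]big_mkcond -big_split /=.
apply: eq_bigr => i _; rewrite /before !mnm_ofE.
have [->|] := eqVneq i j; first by rewrite !ltnn andbF.
by rewrite -(inj_eq val_inj) /=; case: (ltngtP (e j) (e i)); case: (ltngtP i j).
Qed.

Lemma mdeg_mnm_of (e : mi n) : mpoly.mdeg (mnm_of e) = msize e.
Proof. by rewrite mpoly.mdegE; apply: eq_bigr => i _; rewrite mnm_ofE. Qed.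

Lemma mi_of_mnm_of (e : mi n) : mi_of (mnm_of e) = e.
Proof. by apply/ffunP => i; rewrite mi_ofE mnm_ofE. Qed.

Lemma chain_mdeg (m m' : mpoly.multinom n) : chain m m' -> mpoly.mdeg m' = mpoly.mdeg m.
Proof. by elim=> // m1 m2 _ <- /move_mdeg. Qed.

Lemma nsJack_coef_ex (e : mi n) (p : P) : eigen kC (mnm_of e) p -> mpoly.mcoeff (mnm_of e) p = 1 ->
  is_nsJack_coef k e (fun kp => mpoly.mcoeff (mnm_of kp) p) /\
  pol_of (msize e) (fun kp => mpoly.mcoeff (mnm_of kp) p) = p.
Proof.
move=> ep pe; set c := fun kp : mi n => mpoly.mcoeff (mnm_of kp) p.
have supp m : mpoly.mcoeff m p != 0 -> chain (mnm_of e) m.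
  by rewrite -mpoly.mcoeff_msupp; exact: eigen_chain ep.
have cp : pol_of (msize e) c = p.
  apply/mpoly.mpolyP => m; have [/forallP le|] := boolP [forall i, (m i <= msize e)%N].
    have -> : m = mnm_of (mi_of m) by apply/esym/mnm_of_eq => i; rewrite mi_ofE.
    by rewrite pol_of_coef // => i; rewrite mi_ofE.
  rewrite negb_forall => /existsP[i hi].
  have -> : mpoly.mcoeff m p = 0.
    apply/eqP/negPn/negP => /supp /chain_mdeg; rewrite mdeg_mnm_of => dm.
    by case/negP: hi; rewrite -dm mpoly.mdegE (bigD1 i) //= leq_addr.
  rewrite /pol_of (raddf_sum (mpoly.mcoeff m)) big1 //= => kp _.
  rewrite mpoly.mcoeffZ mpoly.mcoeffX; case: eqP => [h|_]; last by rewrite mulr0.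
  by case/negP: hi; rewrite -h mnm_ofE -ltnS.
split=> //; split; first by [].
split=> [kp /supp /chain_mprec|j x rx].
  rewrite !mi_of_mnm_of => -[h|]; last by right.
  by left; rewrite -(mi_of_mnm_of kp) h mi_of_mnm_of.
have -> : peval (msize e) c = fun x => p.@[x] by apply/funext => y; rewrite peval_pol_of cp.
by rewrite Dop_meval // ep mpoly.mevalZ eb_etabar.
Qed.

Lemma eigen_of_coef (e : mi n) c : is_nsJack_coef k e c ->
  eigen kC (mnm_of e) (pol_of (msize e) c) /\ mpoly.mcoeff (mnm_of e) (pol_of (msize e) c) = 1.
Proof.
case=> c1 [_ hD]; split; last by rewrite pol_of_coef // => i; exact: entry_le_msize.
move=> j; apply: regular_inj => x rx; rewrite -Dop_meval // mpoly.mevalZ eb_etabar.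
have -> : (fun y => (pol_of (msize e) c).@[y]) = peval (msize e) c.
  by apply/funext => y; rewrite peval_pol_of.
by rewrite hD // peval_pol_of.
Qed.

Lemma the_uniqueP (X : Type) (d : X) (Q : X -> Prop) : (exists x, Q x) -> Q (the_unique d Q).
Proof. by move=> h; rewrite /the_unique; case: pselect => // h'; exact: projT2 (cid h'). Qed.

Lemma eigen_ex_n m : exists p, eigen kC m p /\ mpoly.mcoeff m p = 1.
Proof.
have lt : (n.-1 < n)%N by rewrite prednK.
exact: (@eigen_ex C n kC kC0 (Ordinal n0) (Ordinal lt) (erefl _) (prednK n0) m).
Qed.

(** An eigenvector with leading coefficient 1 meets the definition, its support being controlled by
    [eigen_chain]. Conversely, whatever coefficient function [the_unique] selects is such an
    eigenvector, which is the form used for the integrals. *)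
Lemma nsJackP (e : mi n) : exists p : P,
  [/\ eigen kC (mnm_of e) p, mpoly.mcoeff (mnm_of e) p = 1 & nsJack k e = fun x => p.@[x]].
Proof.
have [p [ep p1]] := eigen_ex_n (mnm_of e).
have [hc _] := nsJack_coef_ex ep p1.
have := @the_uniqueP _ (fun _ => 0) (is_nsJack_coef k e) (ex_intro _ _ hc).
move=> /eigen_of_coef [e2 c2]; exists (pol_of (msize e) (the_unique (fun=> 0) (is_nsJack_coef k e))).
by split=> //; apply/funext => x; rewrite /nsJack peval_pol_of.
Qed.

(** The normalising division is possible by [symz_neq0], so a polynomial as required exists.
    Proportionality to the symmetrisation is the form in which it enters the integral formula, which
    is linear. *)
Lemma sJackP (l : mi n) : is_partition l -> exists (a : C), 
  sJack k l = fun x => a * symsum k l x.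
Proof.
move=> _; have [p [ep p1 hp]] := nsJackP l.
have hsym x : symsum k l x = (symz p).@[x].
  rewrite /symsum /symz (raddf_sum (mpoly.meval x)) /= (reindex_inj invg_inj) /=.
  apply: eq_bigr => s _; rewrite hp meval_msym; apply: mpoly.meval_eq => i.
  by rewrite /pact invgK.
have s0 := symz_neq0 kC0 ep p1.
suff h : exists f, is_sJack k l f.
  have [[a ha] _] := the_uniqueP (fun _ : cvec R n => 0) h.
  by exists a; apply/funext => x; rewrite /sJack ha.
pose a := (mpoly.mcoeff (mnm_of l) (symz p))^-1.
exists (fun x => a * symsum k l x); split; first by exists a.
exists (fun kp => mpoly.mcoeff (mnm_of kp) (a *: symz p)); split; last first.
  by rewrite mpoly.mcoeffZ mulVf.
move=> x; rewrite hsym -mpoly.mevalZ peval_pol_of; congr mpoly.meval.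
apply/mpoly.mpolyP => m; have [/forallP le|] := boolP [forall i, (m i <= msize l)%N].
  have -> : m = mnm_of (mi_of m) by apply/esym/mnm_of_eq => i; rewrite mi_ofE.
  by rewrite pol_of_coef // => i; rewrite mi_ofE.
rewrite negb_forall => /existsP[i hi].
have -> : mpoly.mcoeff m (a *: symz p) = 0.
  rewrite mpoly.mcoeffZ /symz (raddf_sum (mpoly.mcoeff m)) big1 ?mulr0 //= => w _.
  rewrite mpoly.mcoeff_sym; apply/eqP/negPn/negP; rewrite -mpoly.mcoeff_msupp.
  move=> /(eigen_chain kC0 ep) /chain_mdeg; rewrite mpoly.mdeg_mperm mdeg_mnm_of => dm.
  by case/negP: hi; rewrite -dm mpoly.mdegE (bigD1 i) //= leq_addr.
rewrite /pol_of (raddf_sum (mpoly.mcoeff m)) big1 //= => kp _.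
rewrite mpoly.mcoeffZ mpoly.mcoeffX; case: eqP => [h|_]; last by rewrite mulr0.
by case/negP: hi; rewrite -h mnm_ofE -ltnS.
Qed.

End NsJack.

(** * Lebesgue integration on the half-line *)

Section OneDim.
Local Open Scope classical_set_scope.
Variable R : realType.
Local Notation lebR := (@lebR R).
Local Notation Rpos := (@Rpos R).
Implicit Types (f g phi : R -> R) (t : R).

Definition intR f : R := Rintegral lebR Rpos f.
Definition iRpos f := lebR.-integrable Rpos (EFin \o f).

(* Sequential continuity is the only regularity notion used for the integrands:
   it is stable under all the limits and substitutions needed below. *)
Definition pcont1 f := forall (u : nat -> R) (a : R), (forall m, 0 < u m) -> 0 < a ->
  u m @[m --> \oo] --> a -> f (u m) @[m --> \oo] --> f a.
Definition pcont2 (f : R -> R -> R) := forall (u v : nat -> R) (a b : R),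
  (forall m, 0 < u m) -> (forall m, 0 < v m) -> 0 < a -> 0 < b ->
  u m @[m --> \oo] --> a -> v m @[m --> \oo] --> b ->
  f (u m) (v m) @[m --> \oo] --> f a b.

Lemma RposP t : Rpos t <-> 0 < t.
Proof. by rewrite /Rpos /= in_itv /= andbT. Qed.

Lemma measurable_Rpos : measurable (Rpos : set (measurableTypeR R)).
Proof. exact: measurable_itv. Qed.

(** Rounding up to the grid of mesh 1/(N + 1), so that the value is always positive. A sequentially
    continuous function is the pointwise limit of its values at rounded arguments; these are
    constant on grid cells, hence measurable. *)
Definition step (N : nat) (t : R) : R := (Num.trunc (N.+1%:R * t)).+1%:R / N.+1%:R.

Lemma step_gt0 N t : 0 < step N t.
Proof. by rewrite divr_gt0 // ltr0n. Qed.

Lemma step_bounds N t : 0 < t -> `|step N t - t| <= N.+1%:R^-1.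
Proof.
move=> t0; have N0 : 0 < N.+1%:R :> R by rewrite ltr0n.
have /andP[h1 h2] := @trunc_itv R (N.+1%:R * t) (ltW (mulr_gt0 N0 t0)).
have -> : step N t - t = ((Num.trunc (N.+1%:R * t)).+1%:R - N.+1%:R * t) / N.+1%:R.
  by rewrite mulrBl /step; congr (_ - _); rewrite mulrC mulKf // gt_eqF.
rewrite normrM normfV (gtr0_norm N0) ler_piMl // ?invr_ge0 ?(ltW N0) //.
rewrite ger0_norm ?subr_ge0; last exact: ltW.
by rewrite -natr1 lerBlDr addrC lerD2l.
Qed.

Lemma invS_cvg0 : (N.+1%:R^-1 : R) @[N --> \oo] --> (0 : R).
Proof. exact: (@cvg_harmonic R). Qed.

Lemma step_cvg t : 0 < t -> step N t @[N --> \oo] --> t.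
Proof.
move=> t0; apply/subr_cvg0/norm_cvg0P.
apply: (@squeeze_cvgr _ _ _ _ (fun=> 0) (fun N => N.+1%:R^-1)); last 2 first.
- exact: cvg_cst.
- exact: invS_cvg0.
by apply: nearW => N /=; rewrite normr_ge0 step_bounds.
Qed.

Let A (N i : nat) : set (measurableTypeR R) :=
  Rpos `&` `[i%:R / N.+1%:R, i.+1%:R / N.+1%:R[.

Let AP N i t : A N i t <-> 0 < t /\ Num.trunc (N.+1%:R * t) = i.
Proof.
have N0 : 0 < N.+1%:R :> R by rewrite ltr0n.
rewrite /A /setI /=; split=> [[/RposP t0]|[t0 <-]].
  rewrite /= in_itv /= ler_pdivrMr // ltr_pdivlMr // ![t * _]mulrC => h; split=> //.
  exact: trunc_def.
split; first exact/RposP.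
rewrite /= in_itv /= ler_pdivrMr // ltr_pdivlMr // ![t * _]mulrC.
by apply: trunc_itv; rewrite mulr_ge0 // ltW.
Qed.

Let mA N i : measurable (A N i).
Proof. by apply: measurableI; [exact: measurable_Rpos|exact: measurable_itv]. Qed.

Lemma pcont2_measurable (f : R -> R -> R) : pcont2 f ->
  measurable_fun [set: measurableTypeR R * measurableTypeR R]
    (fun z => if (0 < z.1) && (0 < z.2) then f z.1 z.2 else 0).
Proof.
move=> cf.
apply: (@measurable_fun_cvg _ (measurableTypeR R * measurableTypeR R)%type R setT
  (fun N z => if (0 < z.1) && (0 < z.2) then f (step N z.1) (step N z.2) else 0)); last first.
  case=> t u _ /=; case: ifP => [/andP[t0 u0]|_]; last exact: cvg_cst.
  by apply: cf => //; try exact: step_cvg; move=> N; exact: step_gt0.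
move=> N _ Y mY; rewrite setTI.
pose B i j := (A N i `*` A N j) : set (measurableTypeR R * measurableTypeR R).
pose val (i : nat) : R := i.+1%:R / N.+1%:R.
have mB i j : measurable (B i j) by exact: measurableX.
pose B' i j := if `[< Y (f (val i) (val j)) >] then B i j else set0.
pose Z := if `[< Y 0 >] then ~` (Rpos `*` Rpos) else
  set0 : set (measurableTypeR R * measurableTypeR R).
rewrite (_ : _ @^-1` _ = (\bigcup_i \bigcup_j B' i j) `|` Z); last first.
  apply/seteqP; split=> -[t u] /=.
    case: ifPn => [/andP[t0 u0]|].
      move=> h; left; exists (Num.trunc (N.+1%:R * t)) => //.
      exists (Num.trunc (N.+1%:R * u)) => //; rewrite /B' ifT; last exact/asboolP.
      by split; apply/AP.
    move=> h hY; right; rewrite /Z ifT; last exact/asboolP.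
    by case=> /RposP h1 /RposP h2; move: h; rewrite h1 h2.
  case=> [[i _ [j _]]|].
    rewrite /B'; case: ifP => // /asboolP hY [/AP [t0 e1] /AP [u0 e2]].
    by rewrite t0 u0 /= /step e1 e2.
  rewrite /Z; case: ifP => // /asboolP hY h.
  by rewrite ifN //; apply/negP => /andP[t0 u0]; apply: h; split; apply/RposP.
apply: measurableU.
  apply: bigcupT_measurable => i; apply: bigcupT_measurable => j.
  by rewrite /B'; case: ifP.
rewrite /Z; case: ifP => // _; apply: measurableC; apply: measurableX; exact: measurable_Rpos.
Qed.

Lemma pcont1_measurableT f : pcont1 f ->
  measurable_fun [set: measurableTypeR R] (fun t => if 0 < t then f t else 0).
Proof.
move=> cf.
have h : pcont2 (fun t _ => f t) by move=> u v a b hu hv ha hb cu _; exact: cf.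
have := measurableT_comp (pcont2_measurable h) (@pair2_measurable _ _ (measurableTypeR R) (measurableTypeR R) 1).
by apply: eq_measurable_fun => t _ /=; rewrite ltr01 andbT.
Qed.

Lemma pcont1_measurable f : pcont1 f -> measurable_fun (Rpos : set (measurableTypeR R)) f.
Proof.
move=> cf; apply: (eq_measurable_fun (fun t : measurableTypeR R => if 0 < t then f t else 0)).
  by move=> t; rewrite inE => /RposP ->.
by apply: measurable_funTS; exact: pcont1_measurableT.
Qed.

Lemma iRpos_dom f phi : pcont1 f -> iRpos phi -> (forall t, 0 < t -> `|f t| <= phi t) -> iRpos f.
Proof.
move=> cf ip h; apply: (le_integrable _ _ _ ip); first exact: measurable_Rpos.
  by apply/measurable_EFinP; exact: pcont1_measurable.
by move=> t /RposP t0 /=; rewrite lee_fin (le_trans (h t t0)) // ler_norm.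
Qed.

Lemma Rint_eq f g : (forall t, 0 < t -> f t = g t) -> intR f = intR g.
Proof. by move=> h; apply: eq_Rintegral => t; rewrite inE => /RposP; exact: h. Qed.

Lemma RintD f g : iRpos f -> iRpos g -> intR (fun t => f t + g t) = intR f + intR g.
Proof. exact: RintegralD measurable_Rpos. Qed.

Lemma RintZ c f : iRpos f -> intR (fun t => c * f t) = c * intR f.
Proof. exact: RintegralZl measurable_Rpos. Qed.

Lemma iRposZ c f : iRpos f -> iRpos (fun t => c * f t).
Proof. exact: (integrableZl measurable_Rpos). Qed.

Lemma Rint_le f g : iRpos f -> iRpos g -> (forall t, 0 < t -> f t <= g t) -> intR f <= intR g.
Proof.
by move=> hf hg h; apply: (le_Rintegral measurable_Rpos) => // t /RposP; exact: h.
Qed.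

Lemma Rint_abs_le f phi : pcont1 f -> iRpos phi -> (forall t, 0 < t -> `|f t| <= phi t) ->
  `|intR f| <= intR phi.
Proof.
move=> cf ip h; have fi := iRpos_dom cf ip h.
apply: le_trans (le_normr_Rintegral measurable_Rpos fi) _.
by apply: Rint_le => //; exact: integrable_norm.
Qed.

Lemma Rint_ge0 f : (forall t, 0 < t -> 0 <= f t) -> 0 <= intR f.
Proof. by move=> h; apply: Rintegral_ge0 => t /RposP; exact: h. Qed.

Lemma EFin_Rint f : iRpos f -> (intR f)%:E = (\int[lebR]_(t in Rpos) (f t)%:E)%E.
Proof. by move=> h; rewrite /intR /Rintegral fineK //; exact: (integrable_fin_num measurable_Rpos h). Qed.

Lemma Rint_DCT (F : nat -> R -> R) f phi :
  (forall m, measurable_fun (Rpos : set (measurableTypeR R)) (F m)) -> iRpos phi ->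
  (forall m t, 0 < t -> `|F m t| <= phi t) ->
  (forall t, 0 < t -> F m t @[m --> \oo] --> f t) ->
  iRpos f /\ intR (F m) @[m --> \oo] --> intR f.
Proof.
move=> mF ip hF cF.
have mf : measurable_fun (Rpos : set (measurableTypeR R)) f.
  by apply: (measurable_fun_cvg mF) => t /RposP; exact: cF.
have hb t : 0 < t -> `|f t| <= phi t.
  move=> t0; have /cvg_norm h := cF t t0.
  rewrite -(cvg_lim (@norm_hausdorff _ _) h); apply: limr_le; first by apply/cvg_ex; eexists; exact: h.
  by apply: nearW => m; exact: hF.
have fi : iRpos f.
  apply: (le_integrable measurable_Rpos _ _ ip); first exact/measurable_EFinP.
  by move=> t /RposP t0 /=; rewrite lee_fin (le_trans (hb t t0)) // ler_norm.
split=> //; apply: fine_cvg; rewrite -/(intR f) EFin_Rint //.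
apply: (dominated_cvg measurable_Rpos (g := EFin \o phi)) => //.
- by move=> m; apply/measurable_EFinP; exact: mF.
- by move=> t /RposP t0; apply/fine_cvgP; split; [exact: nearW|exact: cF].
- by move=> m t /RposP t0; rewrite lee_fin; exact: hF.
Qed.

Lemma Rint_swap (f : R -> R -> R) c phi : pcont2 f -> pcont1 phi -> iRpos phi -> 0 <= c ->
  (forall t u, 0 < t -> 0 < u -> `|f t u| <= c * phi t * phi u) ->
  intR (fun t => intR (fun u => f t u)) = intR (fun u => intR (fun t => f t u)).
Proof.
move=> cf cp ip c0 hf.
have p0 t : 0 < t -> 0 <= c * phi t * phi t by move=> t0; apply: le_trans (hf t t t0 t0).
(* The integrand is extended by zero to the plane, so that Fubini applies to the product of the full
   Lebesgue measures. *)
pose F (z : measurableTypeR R * measurableTypeR R) := (if (0 < z.1) && (0 < z.2) then f z.1 z.2 else 0)%:E.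
have patch (h : R -> \bar R) : (\int[lebR]_(t in Rpos) h t =
    \int[lebR]_t (if (0 < t :> R)%R then h t else 0))%E.
  rewrite integral_mkcond; apply: eq_integral => t _; rewrite patchE.
  by case: ifPn => [|]; rewrite ?inE ?notin_setE; [move=> /RposP ->|case: ifP => // t0 /(_ (iffRL (RposP t) t0))].
have iu t : 0 < t -> iRpos (f t).
  move=> t0; apply: (iRpos_dom _ (iRposZ (c * phi t) ip)) => [|u u0]; last exact: hf.
  by move=> u a hu ha cu; apply: (cf (fun=> t)) => //; exact: cvg_cst.
have it u : 0 < u -> iRpos (f^~ u).
  move=> u0; apply: (iRpos_dom _ (iRposZ (c * phi u) ip)) => [|t t0].
    by move=> v a hv ha cv; apply: (cf _ (fun=> u)) => //; exact: cvg_cst.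
  by rewrite mulrAC; apply: hf.
have iF : ((@lebesgue_measure R) \x (@lebesgue_measure R))%E.-integrable setT F.
  apply/integrable12ltyP; first by apply/measurable_EFinP; exact: pcont2_measurable.
  apply: (@le_lt_trans _ _ (\int[lebR]_t (if (0 < t :> R)%R then (c * `|intR phi| * `|phi t|)%:E else 0))%E).
    apply: ge0_le_integral => //.
    - by move=> t _; apply: integral_ge0.
    - have mF : measurable_fun setT F by apply/measurable_EFinP; exact: pcont2_measurable.
      apply: (@measurable_fun_fubini_tonelli_F _ _ _ _ R (@lebesgue_measure R) (fun z => `|F z|)%E) => //.
      exact: measurableT_comp.
    - rewrite (_ : (fun t => _) = EFin \o (fun t : R => if 0 < t then c * `|intR phi| * `|phi t| else 0)).
        apply/measurable_EFinP; apply: pcont1_measurableT => u a hu ha cu.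
        by apply: cvgM; [exact: cvg_cst|apply: cvg_norm; exact: cp].
      by apply/funext => t /=; case: ifP.
    move=> t _; case: ifP => t0; last first.
      by rewrite integral0_eq // => u _; rewrite /F /= t0 /= normr0.
    rewrite (_ : integral _ _ _ = \int[lebR]_(u in Rpos) `|f t u|%:E)%E; last first.
      rewrite patch; apply: eq_integral => u _; rewrite /F /= t0 /=; case: ifP => //=.
      by rewrite normr0.
    rewrite -EFin_Rint ?lee_fin; last exact: integrable_norm (iu t t0).
    apply: (@le_trans _ _ (intR (fun u => c * phi t * phi u))).
      by apply: Rint_le => //; [exact: integrable_norm (iu t t0)|exact: iRposZ|move=> u; exact: hf].
    by rewrite RintZ // (le_trans (ler_norm _)) // !normrM (ger0_norm c0) mulrAC.
  rewrite -(patch (fun t => (c * `|intR phi| * `|phi t|)%:E)).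
  have hi : iRpos (fun t => c * `|intR phi| * `|phi t|).
    by apply: iRposZ; exact: integrable_norm.
  by rewrite -EFin_Rint // ltry.
have := Fubini iF.
have -> : (\int[lebesgue_measure]_x \int[lebesgue_measure]_y F (x, y) =
    \int[lebR]_(t in Rpos) (intR (f t))%:E)%E.
  rewrite patch; apply: eq_integral => t _; case: ifP => t0; last first.
    by rewrite integral0_eq // => u _; rewrite /F /= t0.
  rewrite EFin_Rint; last exact: iu.
  by rewrite patch; apply: eq_integral => u _; rewrite /F /= t0 /=; case: ifP.
have -> : (\int[lebesgue_measure]_y \int[lebesgue_measure]_x F (x, y) =
    \int[lebR]_(u in Rpos) (intR (f^~ u))%:E)%E.
  rewrite patch; apply: eq_integral => u _; case: ifP => u0; last first.
    by rewrite integral0_eq // => t _; rewrite /F /= u0 andbF.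
  rewrite EFin_Rint; last exact: it.
  by rewrite patch; apply: eq_integral => t _; rewrite /F /= u0 andbT; case: ifP.
by move=> h; rewrite {1}/intR /Rintegral h.
Qed.

Lemma itv_FTC (K f : R -> R) (a b : R) : 0 < a -> a < b ->
  (forall t, 0 < t -> is_derive t 1 K (f t)) -> (forall t, 0 < t -> {for t, continuous f}) ->
  (\int[lebR]_(t in `[a, b]) (f t)%:E = (K b - K a)%:E)%E.
Proof.
move=> a0 ab dK cf; rewrite EFinB; apply: continuous_FTC2 => //.
- apply: continuous_in_subspaceT => t; rewrite inE /= in_itv /= => /andP[h _].
  by apply: cf; apply: lt_le_trans h.
- have cK t : 0 < t -> {for t, continuous K}.
    by move=> t0; apply: differentiable_continuous; apply/derivable1_diffP; have [] := dK t t0.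
  split.
  + move=> t; rewrite in_itv /= => /andP[h _].
    by have [] := dK t (lt_trans a0 h).
  + by apply: cvg_at_right_filter; exact: cK.
  + by apply: cvg_at_left_filter; apply: cK; exact: lt_trans ab.
- move=> t; rewrite in_itv /= => /andP[h _].
  by rewrite derive1E; apply: derive_val; apply: dK; exact: lt_trans h.
Qed.

Lemma invS_lt (N : nat) : N.+1%:R^-1 < N.+2%:R :> R.
Proof. by rewrite (@le_lt_trans _ _ 1) ?ltr1n // invf_le1 ?ltr0n // ler1n. Qed.

Lemma in_exhaust t : 0 < t ->
  \forall N \near \oo, (t \in `[N.+1%:R^-1, N.+2%:R]%R).
Proof.
move=> t0.
have h1 : \forall N \near \oo, N.+1%:R^-1 < t.
  by apply: (cvgr_lt 0) => //; exact: invS_cvg0.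
have h2 : \forall N \near \oo, t < N%:R :> R by apply: (@nbhs_infty_gtr R).
near=> N; rewrite in_itv /=; apply/andP; split; apply: ltW; first by near: N.
apply: (@lt_trans _ _ N%:R); last by rewrite ltr_nat.
by near: N.
Unshelve. all: by end_near.
Qed.

Lemma Rint_FTC (K f phi : R -> R) (x0 x1 : R) :
  (forall t, 0 < t -> is_derive t 1 K (f t)) -> (forall t, 0 < t -> {for t, continuous f}) ->
  iRpos phi -> (forall t, 0 < t -> `|f t| <= phi t) ->
  K (N.+1%:R^-1) @[N --> \oo] --> x0 -> K N.+2%:R @[N --> \oo] --> x1 ->
  intR f = x1 - x0.
Proof.
move=> dK cf ip hf c0 c1.
have pf : pcont1 f.
  by move=> u a hu ha cu; apply: continuous_cvg => //; exact: cf.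
(* The upper end is N + 2 and not N + 1 so that the interval is nondegenerate already for N = 0. *)
pose J N : set (measurableTypeR R) := `[N.+1%:R^-1, N.+2%:R].
pose FN N t := if t \in J N then f t else 0.
have mFN N : measurable_fun (Rpos : set (measurableTypeR R)) (FN N).
  rewrite -[FN N]/(f \_ (J N)); apply/measurable_restrict.
  - exact: measurable_itv.
  - exact: measurable_Rpos.
  - by apply: measurable_funS (pcont1_measurable pf) => //; exact: measurable_Rpos.
have hFN N : intR (FN N) = K N.+2%:R - K (N.+1%:R^-1).
  have N0 : 0 < N.+1%:R^-1 :> R by rewrite invr_gt0 ltr0n.
  rewrite /intR /Rintegral.
  have -> : (\int[lebR]_(x in Rpos) (FN N x)%:E = \int[lebR]_(x in J N) (f x)%:E)%E.
    rewrite [RHS]integral_mkcond [LHS]integral_mkcond; apply: eq_integral => t _.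
    rewrite !patchE /FN; case: ifPn; case: ifPn => //.
    rewrite inE notin_setE /J /= in_itv /= => /andP[h3 _] h'.
    by case: h'; apply/RposP; apply: lt_le_trans h3.
  by rewrite (itv_FTC N0 (invS_lt N) dK cf).
have [_ h] : iRpos f /\ intR (FN N) @[N --> \oo] --> intR f.
  apply: (Rint_DCT mFN ip).
  - move=> N t t0; rewrite /FN; case: ifP => _; first exact: hf.
    by rewrite normr0 (le_trans _ (hf t t0)).
  - move=> t t0; apply: cvg_near_cst; have := in_exhaust t0.
    by apply: filterS => N h; rewrite /FN ifT // inE.
have h' : intR (FN N) @[N --> \oo] --> x1 - x0.
  rewrite (_ : (fun N => intR (FN N)) = (fun N => K N.+2%:R - K (N.+1%:R^-1))); last exact/funext.
  exact: cvgB.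
exact: (cvg_unique (@Rhausdorff R) h h').
Qed.

(** Monotone convergence over an exhaustion: a nonnegative function with a bounded primitive is
    integrable. It supplies the explicit majorant near 0 that all later integrability rests on. *)
Lemma iRpos_FTC (K f : R -> R) (B : R) :
  (forall t, 0 < t -> is_derive t 1 K (f t)) -> (forall t, 0 < t -> {for t, continuous f}) ->
  (forall t, 0 < t -> 0 <= f t) -> (forall t, 0 < t -> 0 <= K t <= B) -> iRpos f.
Proof.
move=> dK cf f0 hK.
have pf : pcont1 f.
  by move=> u a hu ha cu; apply: continuous_cvg => //; exact: cf.
pose J N : set (measurableTypeR R) := `[N.+1%:R^-1, N.+2%:R].
have N0 N : 0 < N.+1%:R^-1 :> R by rewrite invr_gt0 ltr0n.
have JR : \bigcup_N J N = Rpos.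
  apply/seteqP; split=> t.
    by case=> N _; rewrite /J /= in_itv /= => /andP[h _]; apply/RposP; apply: lt_le_trans h.
  by move=> /RposP /in_exhaust [N _ /(_ N (leqnn N)) h]; exists N.
have mJ N : measurable_fun (J N) (EFin \o f).
  apply/measurable_EFinP; apply: measurable_funS (pcont1_measurable pf); first exact: measurable_Rpos.
  by rewrite -JR; exact: bigcup_sup.
apply/integrableP; split; first by apply/measurable_EFinP; exact: pcont1_measurable.
have -> : (\int[lebR]_(x in Rpos) `|(EFin \o f) x| = \int[lebR]_(x in Rpos) (f x)%:E)%E.
  by apply: eq_integral => t; rewrite inE => /RposP t0 /=; rewrite ger0_norm // f0.
have h : ((\int[lebR]_(x in J N) (f x)%:E)%E @[N --> \oo] --> (\int[lebR]_(x in Rpos) (f x)%:E)%E).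
  rewrite -JR; apply: ge0_nondecreasing_set_cvg_integral => //.
  - move=> N M NM; apply/subsetPset => t; rewrite /J /= !in_itv /= => /andP[a b].
    rewrite (le_trans _ a) ?(le_trans b) ?ler_nat ?ltnS //.
    by rewrite lef_pV2 ?posrE ?ltr0n // ler_nat ltnS.
  - by move=> N; exact: measurable_itv.
  - move=> N t; rewrite /J /= in_itv /= => /andP[a _].
    by rewrite lee_fin f0 // (lt_le_trans (N0 N)).
rewrite -(cvg_lim _ h) //; apply: (@le_lt_trans _ _ B%:E); last exact: ltry.
apply: lime_le; first by apply/cvg_ex; eexists; exact: h.
apply: nearW => N; rewrite (itv_FTC (N0 N) (invS_lt N) dK cf) lee_fin.
have /andP[_ h1] : 0 <= K N.+2%:R <= B by apply: hK; rewrite ltr0n.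
have /andP[h2 _] := hK _ (N0 N).
by rewrite (le_trans _ h1) // gerBl.
Qed.
End OneDim.

(** * Iterated integrals over the positive orthant *)

Section IteratedIntegral.
Local Open Scope classical_set_scope.
Variable R : realType.
Variables (n : nat) (phi : R -> R).
Hypotheses (phi_cont : pcont1 phi) (phi_int : iRpos phi) (phi_ge0 : forall t, 0 < t -> 0 <= phi t).
Implicit Types (G H : (nat -> R) -> R) (x y : nat -> R) (t c : R) (m : nat).

Fixpoint riter m G : (nat -> R) -> R :=
  if m is m'.+1 then fun x => intR (fun t => riter m' G (upd x m' t)) else G.

Definition posfrom m x := forall i, (m <= i < n)%N -> 0 < x i.
Definition cvgfrom m (xs : nat -> nat -> R) x :=
  forall i, (m <= i < n)%N -> xs N i @[N --> \oo] --> x i.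
Definition bnd m x : R := \prod_(m <= i < n) phi (x i).
(** The invariant of iterated integration: once the variables below m are integrated out, the
    function of the remaining ones is sequentially continuous and dominated by a multiple of the
    product of the one-dimensional majorants. Integrating one more variable multiplies the constant
    by the integral of phi ([nice_step]). *)
Definition nice m c G := [/\ 0 <= c, forall x, posfrom m x -> `|G x| <= c * bnd m x &
  forall xs x, (forall N, posfrom m (xs N)) -> posfrom m x -> cvgfrom m xs x ->
    G (xs N) @[N --> \oo] --> G x].

Lemma upd_eq x m t : upd x m t m = t. Proof. by rewrite /upd eqxx. Qed.
Lemma upd_neq x m t i : i != m -> upd x m t i = x i. Proof. by rewrite /upd => /negbTE ->. Qed.

Lemma posfrom_upd m x t : posfrom m.+1 x -> 0 < t -> posfrom m (upd x m t).
Proof.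
move=> px t0 i /andP[mi ni]; rewrite /upd; case: eqVneq => // im.
by apply: px; rewrite ni andbT ltn_neqAle eq_sym im.
Qed.

Lemma bnd_upd m x t : (m < n)%N -> bnd m (upd x m t) = phi t * bnd m.+1 x.
Proof.
move=> mn; rewrite /bnd big_ltn // upd_eq; congr (_ * _).
rewrite big_nat [RHS]big_nat; apply: eq_bigr => i /andP[mi _].
by rewrite upd_neq // gtn_eqF.
Qed.

Lemma bnd_ge0 m x : posfrom m x -> 0 <= bnd m x.
Proof. by move=> px; rewrite /bnd big_nat prodr_ge0 // => i hi; apply/phi_ge0/px. Qed.

Lemma bnd_cvg m xs x : (forall N, posfrom m (xs N)) -> posfrom m x -> cvgfrom m xs x ->
  bnd m (xs N) @[N --> \oo] --> bnd m x.
Proof.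
move=> pxs px cx; rewrite /bnd.
have h (r : seq nat) : (forall i, i \in r -> (m <= i < n)%N) ->
    \prod_(i <- r) phi (xs N i) @[N --> \oo] --> \prod_(i <- r) phi (x i).
  elim: r => [|i r IHr] hr.
    by rewrite big_nil; under eq_fun do rewrite big_nil; exact: cvg_cst.
  rewrite big_cons; under eq_fun do rewrite big_cons.
  apply: cvgM; last by apply: IHr => j hj; apply: hr; rewrite in_cons hj orbT.
  have hi : (m <= i < n)%N by apply: hr; rewrite mem_head.
  by apply: phi_cont; [move=> N; apply: pxs|apply: px|apply: cx].
by apply: h => i; rewrite mem_index_iota.
Qed.

Lemma nice_pcont1 m c G x : nice m c G -> posfrom m.+1 x -> pcont1 (fun t => G (upd x m t)).
Proof.
case=> _ _ cG px u a hu ha cu; apply: cG.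
- by move=> N; apply: posfrom_upd.
- exact: posfrom_upd.
- move=> i _; rewrite /upd; case: eqP => // _; exact: cvg_cst.
Qed.

Lemma nice_iRpos m c G x : nice m c G -> posfrom m.+1 x -> (m < n)%N ->
  iRpos (fun t => G (upd x m t)).
Proof.
move=> nG px mn; apply: (iRpos_dom (nice_pcont1 nG px) (iRposZ (c * bnd m.+1 x) phi_int)) => t t0.
by case: nG => _ h _; rewrite (le_trans (h _ (posfrom_upd px t0))) // bnd_upd // mulrAC mulrA.
Qed.

Lemma Rint_step_cvg m c (Gs : nat -> (nat -> R) -> R) G xs x : (m < n)%N ->
  (forall N, nice m c (Gs N)) ->
  (forall N, posfrom m.+1 (xs N)) -> posfrom m.+1 x -> cvgfrom m.+1 xs x ->
  (forall t, 0 < t -> Gs N (upd (xs N) m t) @[N --> \oo] --> G (upd x m t)) ->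
  intR (fun t => Gs N (upd (xs N) m t)) @[N --> \oo] --> intR (fun t => G (upd x m t)).
Proof.
move=> mn nG pxs px cx hc.
have [M hM] : exists M, forall N, bnd m.+1 (xs N) <= M.
  have /cvg_seq_bounded : cvgn (fun N => bnd m.+1 (xs N)).
    by apply/cvg_ex; exists (bnd m.+1 x); exact: (bnd_cvg pxs px cx).
  case=> M [_ /(_ (M + 1))]; rewrite ltrDl ltr01 => /(_ isT) h; exists (M + 1) => N.
  by rewrite (le_trans (ler_norm _)) // h.
have c0 : 0 <= c by case: (nG 0%N).
have [||||_ ] := @Rint_DCT R (fun N t => Gs N (upd (xs N) m t)) (fun t => G (upd x m t))
  (fun t => (c * M) * phi t).
- by move=> N; apply: pcont1_measurable; exact: nice_pcont1 (nG N) _.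
- exact: iRposZ.
- move=> N t t0; have [_ h _] := nG N; rewrite (le_trans (h _ (posfrom_upd (pxs N) t0))) //.
  rewrite bnd_upd // [phi t * _]mulrC mulrA ler_wpM2r ?phi_ge0 //.
  by rewrite ler_wpM2l.
- exact: hc.
- by [].
Qed.

Lemma nice_step m c G : (m < n)%N -> nice m c G ->
  nice m.+1 (c * intR phi) (fun x => intR (fun t => G (upd x m t))).
Proof.
move=> mn nG; have [c0 hG cG] := nG; split; first by rewrite mulr_ge0 // Rint_ge0.
- move=> x px; apply: le_trans (Rint_abs_le (nice_pcont1 nG px) (iRposZ (c * bnd m.+1 x) phi_int) _) _.
    by move=> t t0; rewrite (le_trans (hG _ (posfrom_upd px t0))) // bnd_upd // mulrAC mulrA.
  by rewrite RintZ // mulrAC.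
- move=> xs x pxs px cx; apply: (Rint_step_cvg mn (fun=> nG) pxs px cx) => t t0.
  apply: cG; [by move=> N; apply: posfrom_upd|exact: posfrom_upd|].
  move=> i /andP[mi ni]; rewrite /upd; case: eqVneq => im; first exact: cvg_cst.
  by apply: cx; rewrite ni andbT ltn_neqAle eq_sym im.
Qed.

Lemma nice_riter m c G : (m <= n)%N -> nice 0 c G -> nice m (c * intR phi ^+ m) (riter m G).
Proof.
elim: m => [|m IHm] mn nG; first by rewrite mulr1.
by rewrite exprSr mulrA; apply: nice_step mn (IHm (ltnW mn) nG).
Qed.

Lemma riter_cvg m c (Gs : nat -> (nat -> R) -> R) G : (m <= n)%N ->
  (forall N, nice 0 c (Gs N)) -> nice 0 c G ->
  (forall x, posfrom 0 x -> Gs N x @[N --> \oo] --> G x) ->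
  forall x, posfrom m x -> riter m (Gs N) x @[N --> \oo] --> riter m G x.
Proof.
move=> + nGs nG h; elim: m => [//|m IHm] mn x px.
apply: (@Rint_step_cvg m (c * intR phi ^+ m) (fun N => riter m (Gs N)) (riter m G) (fun=> x)) => //.
- by move=> N; apply: nice_riter => //; exact: ltnW.
- by move=> i _; exact: cvg_cst.
- by move=> t t0; apply: IHm; [exact: ltnW|exact: posfrom_upd].
Qed.

Lemma riter_eq_up m j G H : (m + j <= n)%N ->
  (forall x, posfrom m x -> riter m G x = riter m H x) ->
  forall x, posfrom (m + j) x -> riter (m + j) G x = riter (m + j) H x.
Proof.
elim: j => [|j IHj]; first by rewrite addn0.
rewrite addnS => mn h x px /=; apply: Rint_eq => t t0; apply: IHj => //; first exact: ltnW.
exact: posfrom_upd.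
Qed.

Lemma riter_eq m G H : (m <= n)%N -> (forall x, posfrom 0 x -> G x = H x) ->
  forall x, posfrom m x -> riter m G x = riter m H x.
Proof. by move=> mn h; apply: (@riter_eq_up 0 m). Qed.

Lemma riterD m c d G H : (m <= n)%N -> nice 0 c G -> nice 0 d H -> forall x, posfrom m x ->
  riter m (fun y => G y + H y) x = riter m G x + riter m H x.
Proof.
move=> + nG nH; elim: m => [//|m IHm] mn x px /=.
have nG' := nice_riter (ltnW mn) nG; have nH' := nice_riter (ltnW mn) nH.
rewrite -(RintD (nice_iRpos nG' px mn) (nice_iRpos nH' px mn)); apply: Rint_eq => t t0.
by apply: IHm; [exact: ltnW|exact: posfrom_upd].
Qed.

Lemma riterZ m c d G : (m <= n)%N -> nice 0 c G -> forall x, posfrom m x ->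
  riter m (fun y => d * G y) x = d * riter m G x.
Proof.
move=> + nG; elim: m => [//|m IHm] mn x px /=.
have nG' := nice_riter (ltnW mn) nG.
rewrite -(RintZ _ (nice_iRpos nG' px mn)); apply: Rint_eq => t t0.
by apply: IHm; [exact: ltnW|exact: posfrom_upd].
Qed.

Lemma iterint_abs_riter m c G : (m <= n)%N -> nice 0 c G -> (forall x, posfrom 0 x -> 0 <= G x) ->
  forall x, posfrom m x -> iterint_abs m (fun y => (G y)%:E) x = (riter m G x)%:E.
Proof.
move=> + nG G0; elim: m => [//|m IHm] mn x px /=.
rewrite EFin_Rint; last exact: nice_iRpos (nice_riter (ltnW mn) nG) px mn.
apply: eq_integral => t; rewrite inE => /RposP t0.
by apply: IHm; [exact: ltnW|exact: posfrom_upd].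
Qed.

Definition swapn m x : nat -> R :=
  fun i => if i == m then x m.+1 else if i == m.+1 then x m else x i.

Lemma riter_swapn_low m j G x : (j <= m)%N -> riter j (fun y => G (swapn m y)) x = riter j G (swapn m x).
Proof.
elim: j x => [//|j IHj] x jm /=; apply: Rint_eq => t _; rewrite IHj; last exact: ltnW.
congr (riter j G _); apply/funext => i; rewrite /swapn /upd.
case: (eqVneq i j) => [->|_]; first by rewrite (ltn_eqF jm) (@ltn_eqF j m.+1) // ltnS ltnW.
by rewrite (@gtn_eqF j m) // (@gtn_eqF j m.+1) // ltnS ltnW.
Qed.

Lemma riter_swapn m c G : (m.+1 < n)%N -> nice 0 c G -> forall x, posfrom n x ->
  riter n (fun y => G (swapn m y)) x = riter n G x.
Proof.
move=> mn nG; rewrite -(subnKC mn); apply: riter_eq_up; first by rewrite subnKC.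
move=> x px /=.
have mn1 : (m < n)%N by exact: ltnW.
have nG' := nice_riter (ltnW mn1) nG; have [c0 hG cG] := nG'.
pose f t u := riter m G (upd (upd x m.+1 t) m u).
have pp t u : 0 < t -> 0 < u -> posfrom m (upd (upd x m.+1 t) m u).
  by move=> t0 u0; do 2!apply: posfrom_upd => //.
transitivity (intR (fun u => intR (f^~ u))).
  apply: Rint_eq => t _; apply: Rint_eq => u _.
  rewrite riter_swapn_low //; congr (riter m G _); apply/funext => i; rewrite /swapn /upd.
  rewrite (ltn_eqF (ltnSn m)) (gtn_eqF (ltnSn m)) !eqxx.
  by case: eqP => // _; case: eqP.
symmetry; apply: (@Rint_swap R f (c * intR phi ^+ m * bnd m.+2 x) phi) => //.
- move=> u v a b hu hv ha hb cu cv; apply: cG.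
  + by move=> N; exact: pp.
  + exact: pp.
  + move=> i _; rewrite /upd; case: ifP => // _; case: ifP => // _; exact: cvg_cst.
- by rewrite mulr_ge0 // bnd_ge0.
- move=> t u t0 u0; apply: le_trans (hG _ (pp t u t0 u0)) _.
  by rewrite bnd_upd // bnd_upd // [phi t * _]mulrC [phi u * _]mulrC !mulrA.
Qed.

(** Variable 0 is the innermost one; its integration is split off and the others are renumbered, for
    use in the boundary computation. *)
Lemma riter_shift m G x : riter m.+1 G x =
  riter m (fun y => intR (fun t => G (fun i => if i is i'.+1 then y i' else t))) (fun i => x i.+1).
Proof.
elim: m x => [|m IHm] x.
  by apply: Rint_eq => t _; congr G; apply/funext => -[].
rewrite [LHS]/= [RHS]/=; apply: Rint_eq => t _; rewrite -/(riter m.+1 G _) IHm.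
by congr (riter m _ _); apply/funext => i; rewrite /upd eqSS.
Qed.
End IteratedIntegral.

(** * Complex-valued functions: modulus, convergence, exponential, derivatives in a real variable *)

Section ComplexToolkit.
Local Open Scope classical_set_scope.
Variable R : realType.
Local Notation C := (Cx R).
Implicit Types (z w : C) (u v : nat -> C) (x y t : R).

Lemma cReD z w : cRe (z + w) = cRe z + cRe w. Proof. by case: z w => [? ?] [? ?]. Qed.
Lemma cImD z w : cIm (z + w) = cIm z + cIm w. Proof. by case: z w => [? ?] [? ?]. Qed.
Lemma cReN z : cRe (- z) = - cRe z. Proof. by case: z. Qed.
Lemma cImN z : cIm (- z) = - cIm z. Proof. by case: z. Qed.
Lemma cReM z w : cRe (z * w) = cRe z * cRe w - cIm z * cIm w. Proof. by case: z w => [? ?] [? ?]. Qed.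
Lemma cImM z w : cIm (z * w) = cRe z * cIm w + cIm z * cRe w. Proof. by case: z w => [? ?] [? ?]. Qed.
Lemma cRe_cR x : cRe (cR x) = x. Proof. by []. Qed.
Lemma cIm_cR x : cIm (cR x) = 0. Proof. by []. Qed.
Lemma c_eq z w : cRe z = cRe w -> cIm z = cIm w -> z = w.
Proof. by case: z w => [a b] [c d] /= -> ->. Qed.
Lemma c_eta z : z = ((cRe z) +i* (cIm z))%C. Proof. by case: z. Qed.

Lemma norm_cabs z : `|z| = cR (cabs z).
Proof. by rewrite normc_def. Qed.
Lemma cabs_ge0 z : 0 <= cabs z. Proof. exact: sqrtr_ge0. Qed.
Lemma cabsM z w : cabs (z * w) = cabs z * cabs w.
Proof. by apply: (@complexI R); rewrite -!cRE cRM -!norm_cabs normrM. Qed.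
Lemma cabsD z w : cabs (z + w) <= cabs z + cabs w.
Proof. by rewrite -lecR -!cRE cRD -!norm_cabs ler_normD. Qed.
Lemma cabsN z : cabs (- z) = cabs z.
Proof. by apply: (@complexI R); rewrite -!cRE -!norm_cabs normrN. Qed.
Lemma cabs_cR x : cabs (cR x) = `|x|.
Proof. by rewrite /cabs cRe_cR cIm_cR expr0n /= addr0 sqrtr_sqr. Qed.
Lemma cabs0 : cabs (0 : C) = 0. Proof. by rewrite -[0]/(cR 0 : C) cabs_cR normr0. Qed.
Lemma cabs1 : cabs (1 : C) = 1. Proof. by rewrite -[1]/(cR 1 : C) cabs_cR normr1. Qed.
Lemma cabs_eq0 z : cabs z = 0 -> z = 0.
Proof. by move=> h; apply/eqP; rewrite -normr_eq0 norm_cabs h. Qed.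
Lemma cabs_sum (I : Type) (r : seq I) (P : pred I) (f : I -> C) :
  cabs (\sum_(i <- r | P i) f i) <= \sum_(i <- r | P i) cabs (f i).
Proof.
elim/big_rec2: _ => [|i x z _ h]; first by rewrite cabs0.
by apply: le_trans (cabsD _ _) _; rewrite lerD2l.
Qed.
Lemma cabs_prod (I : Type) (r : seq I) (P : pred I) (f : I -> C) :
  cabs (\prod_(i <- r | P i) f i) = \prod_(i <- r | P i) cabs (f i).
Proof. exact: (big_morph _ cabsM cabs1). Qed.
Lemma cabsX z m : cabs (z ^+ m) = cabs z ^+ m.
Proof. by elim: m => [|m IHm]; rewrite ?cabs1 // !exprS cabsM IHm. Qed.
Lemma cabsV z : cabs z^-1 = (cabs z)^-1.
Proof.
have [->|z0] := eqVneq z 0; first by rewrite invr0 cabs0 invr0.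
have h : cabs z != 0 by apply: contra_neq z0 => /cabs_eq0.
by apply: (mulIf h); rewrite -cabsM !mulVf // cabs1.
Qed.
Lemma cabs_ge_Re z : `|cRe z| <= cabs z.
Proof. by rewrite -sqrtr_sqr /cabs ler_wsqrtr // lerDl sqr_ge0. Qed.
Lemma cabs_ge_Im z : `|cIm z| <= cabs z.
Proof. by rewrite -sqrtr_sqr /cabs ler_wsqrtr // lerDr sqr_ge0. Qed.
Lemma cabs_le z : cabs z <= `|cRe z| + `|cIm z|.
Proof.
rewrite -[leRHS](ger0_norm (addr_ge0 _ _)) // -sqrtr_sqr /cabs ler_wsqrtr //.
by rewrite sqrrD !real_normK ?num_real // addrAC lerDl mulrn_wge0 // mulr_ge0.
Qed.
Lemma cabs_sqr z : cabs z ^+ 2 = cRe z ^+ 2 + cIm z ^+ 2.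
Proof. by rewrite sqr_sqrtr // addr_ge0 // sqr_ge0. Qed.

Definition ccvg u z := cRe (u N) @[N --> \oo] --> cRe z /\ cIm (u N) @[N --> \oo] --> cIm z.

Lemma ccvg_cst z : ccvg (fun=> z) z. Proof. by split; exact: cvg_cst. Qed.
Lemma ccvgD u v z w : ccvg u z -> ccvg v w -> ccvg (fun N => u N + v N) (z + w).
Proof.
by case=> a b [c d]; split; rewrite ?cReD ?cImD; under eq_fun do rewrite ?cReD ?cImD; exact: cvgD.
Qed.
Lemma ccvgM u v z w : ccvg u z -> ccvg v w -> ccvg (fun N => u N * v N) (z * w).
Proof.
case=> a b [c d]; split; rewrite ?cReM ?cImM; under eq_fun do rewrite ?cReM ?cImM.
- by apply: cvgB; exact: cvgM.
- by apply: cvgD; exact: cvgM.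
Qed.
Lemma ccvg_cR (f : nat -> R) x : f N @[N --> \oo] --> x -> ccvg (fun N => cR (f N)) (cR x).
Proof. by split=> //; exact: cvg_cst. Qed.
Lemma ccvg_sum (I : Type) (r : seq I) (P : pred I) (f : I -> nat -> C) (g : I -> C) :
  (forall i, P i -> ccvg (f i) (g i)) ->
  ccvg (fun N => \sum_(i <- r | P i) f i N) (\sum_(i <- r | P i) g i).
Proof.
move=> h; elim: r => [|i r IHr].
  by rewrite big_nil; under eq_fun do rewrite big_nil; exact: ccvg_cst.
rewrite big_cons; under eq_fun do rewrite big_cons.
by case Pi: (P i) => //; apply: ccvgD => //; exact: h.
Qed.
Lemma ccvg_unique u z w : ccvg u z -> ccvg u w -> z = w.
Proof. 
by case=> a b [c d]; apply: c_eq; [exact: (cvg_unique (@Rhausdorff R) a c)|exact: (cvg_unique (@Rhausdorff R) b d)].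
 Qed.
Lemma ccvgP u z : (cabs (u N - z) @[N --> \oo] --> (0 : R)) <-> ccvg u z.
Proof.
split=> [h|[a b]].
  have sq (f : C -> R) : (forall z, `|f z| <= cabs z) -> f (u N - z) @[N --> \oo] --> 0.
    move=> hf; apply/norm_cvg0P; apply: (@squeeze_cvgr _ _ _ _ (fun=> 0) (fun N => cabs (u N - z))) => //.
      by apply: nearW => N; rewrite normr_ge0 hf.
    exact: cvg_cst.
  split; apply/subr_cvg0.
    by have := sq _ cabs_ge_Re; under eq_fun do rewrite cReD cReN.
  by have := sq _ cabs_ge_Im; under eq_fun do rewrite cImD cImN.
apply: (@squeeze_cvgr _ _ _ _ (fun=> 0) (fun N => `|cRe (u N) - cRe z| + `|cIm (u N) - cIm z|)).
- by apply: nearW => N; rewrite cabs_ge0 -!cReN -!cImN -cReD -cImD cabs_le.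
- exact: cvg_cst.
- rewrite -[0 in X in _ --> X](addr0 0); apply: cvgD; apply/norm_cvg0P; exact/subr_cvg0.
Qed.
Lemma cvg_cabs u z : ccvg u z -> cabs (u N) @[N --> \oo] --> cabs z.
Proof.
case=> a b; rewrite /cabs; apply: continuous_cvg; first exact: sqrt_continuous.
by apply: cvgD; exact: cvgM.
Qed.

Lemma cexpD z w : cexp (z + w) = cexp z * cexp w.
Proof.
apply: c_eq; rewrite ?cReM ?cImM /cexp /= cReD cImD expRD ?cosD ?sinD.
- by ring.
- by ring.
Qed.
Lemma cexp0 : cexp (0 : C) = 1.
Proof. by rewrite /cexp /= expR0 cos0 sin0 mulr0 mulr1. Qed.
Lemma cabs_cexp z : cabs (cexp z) = expR (cRe z).
Proof.
by rewrite /cabs /cexp /= !exprMn -mulrDr cos2Dsin2 mulr1 sqrtr_sqr ger0_norm // expR_ge0.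
Qed.
Lemma cexp_sum (I : Type) (r : seq I) (P : pred I) (f : I -> C) :
  cexp (\sum_(i <- r | P i) f i) = \prod_(i <- r | P i) cexp (f i).
Proof. exact: (big_morph _ cexpD cexp0). Qed.
Lemma cexp_cR x : cexp (cR x) = cR (expR x).
Proof. by rewrite /cexp /= cos0 sin0 mulr1 mulr0. Qed.
Lemma ccvg_cexp u z : ccvg u z -> ccvg (fun N => cexp (u N)) (cexp z).
Proof.
case=> a b; split; apply: cvgM; apply: continuous_cvg => //.
- exact: continuous_expR.
- exact: continuous_cos.
- exact: continuous_expR.
- exact: continuous_sin.
Qed.

Definition cderiv (f : R -> C) (df : C) t :=
  is_derive t 1 (fun s => cRe (f s)) (cRe df) /\ is_derive t 1 (fun s => cIm (f s)) (cIm df).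

Lemma isdM (f g : R -> R) df dg t : is_derive t 1 f df -> is_derive t 1 g dg ->
  is_derive t 1 (fun s => f s * g s) (df * g t + f t * dg).
Proof.
by move=> hf hg; apply: (is_derive_eq (is_deriveM hf hg)); rewrite addrC; congr (_ + _); rewrite mulrC.
Qed.
Lemma isdD (f g : R -> R) df dg t : is_derive t 1 f df -> is_derive t 1 g dg ->
  is_derive t 1 (fun s => f s + g s) (df + dg).
Proof. by move=> hf hg; exact: is_deriveD. Qed.
Lemma isdN (f : R -> R) df t : is_derive t 1 f df -> is_derive t 1 (fun s => - f s) (- df).
Proof. by move=> hf; exact: is_deriveN. Qed.
Lemma isd_cst (c : R) t : is_derive t 1 (fun=> c) 0.
Proof. exact: is_derive_cst. Qed.

Lemma cderiv_eq f d d' t : cderiv f d t -> d = d' -> cderiv f d' t. Proof. by move=> h <-. Qed.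
Lemma cderiv_ext (f g : R -> C) d t : (forall s, f s = g s) -> cderiv f d t -> cderiv g d t.
Proof. by move=> /funext ->. Qed.
Lemma cderiv_cst z t : cderiv (fun=> z) 0 t. Proof. by split; exact: isd_cst. Qed.
Lemma cderiv_id t : cderiv (fun s => cR s) 1 t.
Proof. by split; [exact: is_derive_id|exact: isd_cst]. Qed.
Lemma cderiv_cR (f : R -> R) d t : is_derive t 1 f d -> cderiv (fun s => cR (f s)) (cR d) t.
Proof. by split=> //; exact: isd_cst. Qed.
Lemma cderivD f g df dg t : cderiv f df t -> cderiv g dg t -> cderiv (fun s => f s + g s) (df + dg) t.
Proof.
case=> a b [c d]; split; rewrite ?cReD ?cImD.
- by rewrite (_ : (fun s => _) = fun s => cRe (f s) + cRe (g s)); [exact: isdD|apply/funext => s; rewrite cReD].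
- by rewrite (_ : (fun s => _) = fun s => cIm (f s) + cIm (g s)); [exact: isdD|apply/funext => s; rewrite cImD].
Qed.
Lemma cderivM f g df dg t : cderiv f df t -> cderiv g dg t ->
  cderiv (fun s => f s * g s) (df * g t + f t * dg) t.
Proof.
case=> a b [c d]; split; rewrite ?cReD ?cImD ?cReM ?cImM.
- rewrite (_ : (fun s => _) = fun s => cRe (f s) * cRe (g s) + - (cIm (f s) * cIm (g s))); last first.
    by apply/funext => s; rewrite cReM.
  by apply: (is_derive_eq (isdD (isdM a c) (isdN (isdM b d)))); ring.
- rewrite (_ : (fun s => _) = fun s => cRe (f s) * cIm (g s) + cIm (f s) * cRe (g s)); last first.
    by apply/funext => s; rewrite cImM.
  by apply: (is_derive_eq (isdD (isdM a d) (isdM b c))); ring.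
Qed.
Lemma cderivZ z f df t : cderiv f df t -> cderiv (fun s => z * f s) (z * df) t.
Proof. by move=> h; apply: (cderiv_eq (cderivM (cderiv_cst z t) h)); rewrite mul0r add0r. Qed.
Lemma cderiv_sum (I : Type) (r : seq I) (P : pred I) (f : I -> R -> C) (df : I -> C) t :
  (forall i, cderiv (f i) (df i) t) ->
  cderiv (fun s => \sum_(i <- r | P i) f i s) (\sum_(i <- r | P i) df i) t.
Proof.
move=> h; elim: r => [|i r IHr].
  by rewrite big_nil; apply: (cderiv_ext _ (cderiv_cst 0 t)) => s; rewrite big_nil.
rewrite big_cons; case: ifP => Pi.
  by apply: (cderiv_ext _ (cderivD (h i) IHr)) => s; rewrite big_cons Pi.
by apply: (cderiv_ext _ IHr) => s; rewrite big_cons Pi.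
Qed.
Lemma cderiv_exp f df t : cderiv f df t -> cderiv (fun s => cexp (f s)) (df * cexp (f t)) t.
Proof.
case=> a b; rewrite /cexp; split=> /=.
- have h1 := is_derive1_comp (is_derive_expR (cRe (f t))) a.
  have h2 := is_derive1_comp (is_derive_cos (cIm (f t))) b.
  by apply: (is_derive_eq (isdM h1 h2)); rewrite cReM /=; ring.
- have h1 := is_derive1_comp (is_derive_expR (cRe (f t))) a.
  have h2 := is_derive1_comp (is_derive_sin (cIm (f t))) b.
  by apply: (is_derive_eq (isdM h1 h2)); rewrite cImM /=; ring.
Qed.

Lemma pcont1_continuous (f : R -> R) t : pcont1 f -> 0 < t -> {for t, continuous f}.
Proof.
move=> cf t0; apply/cvgrPdist_lt => e e0; apply: contrapT => h.
have /choice[u hu] : forall N : nat, exists x, [/\ 0 < x, `|t - x| < N.+1%:R^-1 & e <= `|f t - f x|].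
  move=> N; apply: contrapT => h'; apply: h; apply/nbhs_ballP.
  exists (Num.min t N.+1%:R^-1) => /=; first by rewrite lt_min t0 invr_gt0 ltr0n.
  move=> x; rewrite /ball /= lt_min => /andP[a b].
  rewrite ltNge; apply/negP => c; apply: h'; exists x; split=> //.
  by move: a; rewrite ltr_norml => /andP[_]; rewrite ltrBlDr ltrDl.
have cu : u N @[N --> \oo] --> t.
  apply/subr_cvg0/norm_cvg0P.
  apply: (@squeeze_cvgr _ _ _ _ (fun=> 0) (fun N => N.+1%:R^-1)); last 2 first.
  - exact: cvg_cst.
  - exact: invS_cvg0.
  by apply: nearW => N /=; rewrite normr_ge0 distrC; case: (hu N) => _ /ltW.
have u0 N : 0 < u N by case: (hu N).
have /cvgrPdist_lt /(_ e e0) [N _ /(_ N (leqnn N))] := cf u t u0 t0 cu.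
by rewrite ltNge /=; case: (hu N) => _ _ ->.
Qed.

(** The limit may be 0: for positive k the power is right continuous there, and for k = 0 it is
    constantly 1. The discriminant needs this on the hyperplanes. *)
Lemma pow0_cvg (u : nat -> R) x (k : R) : 0 <= k -> (forall N, 0 <= u N) ->
  u N @[N --> \oo] --> x -> (u N) `^ k @[N --> \oo] --> x `^ k.
Proof.
rewrite le_eqVlt => /predU1P[<- _ _|k0 u0 cu].
  by under eq_fun do rewrite powRr0; rewrite powRr0; exact: cvg_cst.
have x0 : 0 <= x by apply: (@cvgr_to_ge _ \oo _ _ _ _ _ cu); exact: nearW.
move: x0; rewrite le_eqVlt => /predU1P[xE|x0].
  rewrite -xE powR0 ?gt_eqF //; apply/cvgrPdist_lt => e e0.
  have d0 : 0 < e `^ k^-1 by rewrite powR_gt0.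
  move: cu; rewrite -xE => /cvgrPdist_lt /(_ _ d0); apply: filterS => N.
  rewrite !sub0r !normrN !ger0_norm ?powR_ge0 // => h.
  rewrite -[ltRHS](@powRr1 _ e) ?ltW // -(mulVf (lt0r_neq0 k0)) powRrM.
  by apply: gt0_ltr_powR; rewrite ?nnegrE ?powR_ge0.
have h : ln (u N) @[N --> \oo] --> ln x by apply: continuous_cvg => //; exact: continuous_ln.
have : expR (k * ln (u N)) @[N --> \oo] --> expR (k * ln x).
  apply: continuous_cvg; first exact: continuous_expR.
  by apply: cvgM => //; exact: cvg_cst.
rewrite {2}/powR gt_eqF //; apply: cvg_trans; apply: near_eq_cvg.
have : \forall N \near \oo, 0 < u N by apply: (cvgr_gt x).
apply: filterS => N hN.
by rewrite /powR gt_eqF.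
Qed.
End ComplexToolkit.

(** * The weight t^a exp(-s t) and its integrable majorants *)

Section Weight.
Local Open Scope classical_set_scope.
Variable R : realType.
Local Notation C := (Cx R).
Variables (a : C) (s : R).
Hypotheses (a_gt : -1 < cRe a) (s_gt0 : 0 < s).
Local Notation al := (cRe a).
Implicit Types (t p : R) (q : nat).

Definition wt t : C := cexp (a * cR (ln t)) * cR (expR (- s * t)).
Definition phi q t : R := t `^ al * (1 + t) ^+ q * expR (- s * t).

Lemma cabs_wt t : 0 < t -> cabs (wt t) = t `^ al * expR (- s * t).
Proof.
move=> t0; rewrite cabsM cabs_cexp cabs_cR ger0_norm ?expR_ge0 // cReM cRe_cR cIm_cR mulr0 subr0.
by rewrite /powR gt_eqF.
Qed.

Lemma exp_decay p : 0 <= p -> exists2 c, 0 < c & forall t, 0 < t -> (1 + t) `^ p * expR (- s * t) <= c.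
Proof.
(* From [ln y < y] at [y = d (1 + t)]; the choice of d gives [p d <= s], so the exponential beats
   the power with the explicit constant [exp(s - p ln d)]. *)
move=> p0; pose d := s / (p + 1).
have p1 : 0 < p + 1 by rewrite ltr_wpDl.
have d0 : 0 < d by rewrite divr_gt0.
exists (expR (s - p * ln d)) => [|t t0]; first exact: expR_gt0.
have t1 : 0 < 1 + t by rewrite ltr_wpDl.
rewrite /powR gt_eqF // -expRD ler_expR.
have /ltW := @ln_sublinear R (d * (1 + t)) (mulr_gt0 d0 t1).
rewrite lnM ?posrE // => h.
have h1 : p * ln (1 + t) <= p * (d * (1 + t) - ln d) by apply: ler_wpM2l => //; rewrite lerBrDl.
have h2 : p * d <= s.
  by rewrite /d mulrCA ler_piMr ?(ltW s_gt0) // ler_pdivrMr // mul1r lerDl.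
have h3 : p * d * (1 + t) <= s * (1 + t) by rewrite ler_pM2r.
by rewrite mulrBr mulrA in h1; lra.
Qed.

Lemma wt_cvg (u : nat -> R) t : (forall N, 0 < u N) -> 0 < t -> u N @[N --> \oo] --> t ->
  ccvg (fun N => wt (u N)) (wt t).
Proof.
move=> hu t0 cu; apply: ccvgM.
  apply: ccvg_cexp; apply: ccvgM; first exact: ccvg_cst.
  by apply: ccvg_cR; apply: continuous_cvg => //; exact: continuous_ln.
apply: ccvg_cR; apply: continuous_cvg; first exact: continuous_expR.
by apply: cvgM => //; exact: cvg_cst.
Qed.

Lemma exprn_cvg (u : nat -> R) t q : u N @[N --> \oo] --> t -> u N ^+ q @[N --> \oo] --> t ^+ q.
Proof.
move=> cu; elim: q => [|q IHq]; first exact: cvg_cst.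
by rewrite exprS; under eq_fun do rewrite exprS; exact: cvgM.
Qed.

Lemma phi_pcont q : pcont1 (phi q).
Proof.
move=> u t hu t0 cu; have h := cvg_cabs (wt_cvg hu t0 cu).
have -> : (fun N => phi q (u N)) = fun N => cabs (wt (u N)) * (1 + u N) ^+ q.
  by apply/funext => N; rewrite cabs_wt // mulrAC.
rewrite /phi mulrAC -cabs_wt //; apply: cvgM => //; apply: exprn_cvg.
by apply: cvgD => //; exact: cvg_cst.
Qed.

Lemma phi_ge0 q t : 0 < t -> 0 <= phi q t.
Proof. by move=> t0; rewrite !mulr_ge0 ?powR_ge0 ?expR_ge0 // exprn_ge0 // addr_ge0 // ltW. Qed.

Lemma isd_powR (f : R -> R) df t p : 0 < f t -> is_derive t 1 f df ->
  is_derive t 1 (fun x => f x `^ p) (p * f t `^ (p - 1) * df).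
Proof.
by move=> f0 hf; exact: (@is_derive1_comp R (fun y => y `^ p) f t _ _ (is_derive1_powR p f0) hf).
Qed.

(** The function is the derivative of [(t/(1+t))^(al+1) / (al+1)], which is bounded because [al + 1]
    is positive. *)
Lemma beta_iRpos : iRpos (fun t => (t / (1 + t)) `^ al / (1 + t) ^+ 2).
Proof.
have b0 : 0 < al + 1 by rewrite -ltrBlDr sub0r.
have pos t : 0 < t -> 0 < 1 + t by move=> t0; rewrite ltr_wpDl.
have pos2 t : 0 < t -> 0 < t / (1 + t) by move=> t0; rewrite divr_gt0 // pos.
have contq (u : nat -> R) t : 0 < t -> u N @[N --> \oo] --> t ->
    u N / (1 + u N) @[N --> \oo] --> t / (1 + t).
  move=> t0 cu; apply: cvgM => //; apply: cvgV; first by rewrite gt_eqF // pos.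
  by apply: cvgD => //; exact: cvg_cst.
apply: (@iRpos_FTC _ (fun t => (al + 1)^-1 * (t / (1 + t)) `^ (al + 1)) _ (al + 1)^-1).
- move=> t t0.
  have d1 : is_derive t 1 (fun x : R => x / (1 + x)) ((1 + t) ^+ 2)^-1.
    have h : is_derive t 1 (fun x : R => 1 + x) 1.
      by apply: (is_derive_eq (isdD (isd_cst 1 t) (is_derive_id t 1))); rewrite add0r.
    have h2 : is_derive t 1 (fun x : R => (1 + x)^-1) (- (1 + t) ^- 2).
      have h0 : 1 + t != 0 by rewrite gt_eqF // pos.
      by apply: (is_derive_eq (is_deriveV h0 h)); rewrite scaleNr /GRing.scale /= mulr1.
    apply: (is_derive_eq (isdM (is_derive_id t 1) h2)).
    by have := pos t t0; move=> p1; field; rewrite gt_eqF.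
  have d2 := @isd_powR (fun x => x / (1 + x)) _ t (al + 1) (pos2 t t0) d1.
  apply: (is_derive_eq (isdM (isd_cst (al + 1)^-1 t) d2)).
  by rewrite mul0r add0r addrK mulrA mulKf // gt_eqF.
- move=> t t0; apply: pcont1_continuous => // u b hu b0' cu; apply: cvgM.
    have h N : (u N / (1 + u N)) `^ al = expR (al * ln (u N / (1 + u N))).
      by rewrite /powR gt_eqF // pos2.
    under eq_fun do rewrite h.
    rewrite /powR gt_eqF ?pos2 //; apply: continuous_cvg; first exact: continuous_expR.
    apply: cvgM; first exact: cvg_cst.
    apply: continuous_cvg; first by apply: continuous_ln; exact: pos2.
    exact: contq.
  apply: cvgV; first by rewrite expf_neq0 // gt_eqF // pos.
  by apply: exprn_cvg; apply: cvgD => //; exact: cvg_cst.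
- by move=> t t0; rewrite divr_ge0 ?powR_ge0 // sqr_ge0.
- move=> t t0; rewrite mulr_ge0 ?powR_ge0 ?invr_ge0 ?(ltW b0) //=.
  rewrite ler_piMr ?invr_ge0 ?(ltW b0) //.
  rewrite -[leRHS](congr1 (fun f => f (al + 1)) (powR1 R)).
  apply: ge0_ler_powR; rewrite ?nnegrE ?ltW ?pos2 ?pos // ?ltr01 //.
  by rewrite ltr_pdivrMr ?pos // mul1r ltrDr.
Qed.

(** The quotient of [phi] by the previous function is a power of [1 + t] times [exp(-s t)], which is
    bounded. *)
Lemma phi_iRpos q : iRpos (phi q).
Proof.
have p0 : 0 <= al + q%:R + 2.
  by rewrite addrAC ltW // ltr_wpDr // -ltrBlDr sub0r; apply: lt_trans a_gt; rewrite ltrN2 ltr1n.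
have [c c0 hc] := exp_decay p0.
apply: (iRpos_dom (@phi_pcont q) (iRposZ c beta_iRpos)) => t t0.
have t1 : 0 < 1 + t by rewrite ltr_wpDl.
rewrite ger0_norm ?phi_ge0 //.
have -> : phi q t = ((t / (1 + t)) `^ al / (1 + t) ^+ 2) * ((1 + t) `^ (al + q%:R + 2) * expR (- s * t)).
  have t1' : (1 + t != 0) = true by rewrite gt_eqF.
  have -> : (1 + t) `^ (al + q%:R + 2) = (1 + t) `^ al * (1 + t) ^+ q * (1 + t) ^+ 2.
    rewrite (@powRD _ _ (al + q%:R)) ?t1' ?implybT // (@powRD _ _ al) ?t1' ?implybT //.
    by rewrite !powR_mulrn ?ltW.
  rewrite /phi powRM ?invr_ge0 ?ltW //.
  rewrite -powR_inv1 ?ltW // powRAC powR_inv1 ?powR_ge0 //.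
  have : 0 < (1 + t) `^ al by rewrite powR_gt0.
  by move: (t `^ al) ((1 + t) `^ al) (expR _) => x y e y0; field; rewrite !gt_eqF.
rewrite [leRHS]mulrC ler_wpM2l ?hc // divr_ge0 ?powR_ge0 ?sqr_ge0 //.
Qed.

Lemma wt_cderiv t : 0 < t -> cderiv wt ((a * cR t^-1 - cR s) * wt t) t.
Proof.
move=> t0.
have h1 : cderiv (fun x => a * cR (ln x)) (a * cR t^-1) t.
  by apply: cderivZ; apply: cderiv_cR; exact: is_derive1_ln.
have h2 : is_derive t 1 (fun x : R => expR (- s * x)) (- s * expR (- s * t)).
  have h : is_derive t 1 (fun x : R => - s * x) (- s).
    by apply: (is_derive_eq (isdM (isd_cst (- s) t) (is_derive_id t 1))); rewrite mul0r add0r mulr1.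
  by apply: (is_derive_eq (is_derive1_comp (is_derive_expR _) h)); rewrite mulrC.
apply: (cderiv_eq (cderivM (cderiv_exp h1) (cderiv_cR h2))).
rewrite /wt cRM cRN; set e := cexp _; set f := cR (expR _).
by ring.
Qed.
End Weight.

(** * The weighted integral as a linear, continuous, permutation invariant functional *)

Section Functional.
Local Open Scope classical_set_scope.
Variable R : realType.
Local Notation C := (Cx R).
Variables (n : nat) (a : C) (s : R).
Local Notation V := (rvec R n).
Implicit Types (g h : V -> C) (x y : V) (c : R) (q : nat).

Definition posv x := forall i, 0 < x i.
Definition W x : C := \prod_(i < n) wt a s (x i).
(** Growth is measured by a product over the coordinates, so that the majorant of an integrand
    factors into functions of one variable. *)
Definition gr x : R := \prod_(i < n) (1 + x i).

(* The class of integrands (divided by the weight): sequentially continuous functions of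
   polynomial growth on the positive orthant. *)
Definition seqcont g := forall (xs : nat -> V) x, (forall N, posv (xs N)) -> posv x ->
  (forall i, xs N i @[N --> \oo] --> x i) -> ccvg (fun N => g (xs N)) (g x).
Definition pgb c q g := [/\ 0 <= c, forall x, posv x -> cabs (g x) <= c * gr x ^+ q & seqcont g].
Definition pg g := exists c q, pgb c q g.
Definition I g : C := intRpos (fun x => g x * W x).

Lemma gr_ge1 x : posv x -> 1 <= gr x.
Proof. by move=> px; rewrite /gr -[leLHS](@big1_eq R _ *%R 'I_n (index_enum _) predT) ler_prod // => i _; rewrite ler01 lerDl ltW. Qed.

Lemma gr_ge0 x : posv x -> 0 <= gr x. Proof. by move=> /gr_ge1; apply: le_trans. Qed.

Lemma le_gr x i : posv x -> x i <= gr x.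
Proof.
move=> px; rewrite /gr (bigD1 i) //=; apply: (@le_trans _ _ (1 + x i)); first by rewrite lerDr.
rewrite ler_peMr //; first by rewrite addr_ge0 // ltW.
rewrite -[leLHS](@big1_eq R _ *%R 'I_n (index_enum _) (fun j => j != i)).
by rewrite ler_prod // => j _; rewrite ler01 lerDl ltW.
Qed.

Lemma pgb_mono c d q r g : c <= d -> (q <= r)%N -> pgb c q g -> pgb d r g.
Proof.
move=> cd qr [c0 h sg]; split=> //; first exact: le_trans cd.
move=> x px; apply: le_trans (h x px) _; apply: ler_pM => //; first exact: exprn_ge0 (gr_ge0 px).
by apply: ler_weXn2l => //; exact: gr_ge1.
Qed.

Lemma pgb_ext c q g h : (forall x, posv x -> g x = h x) -> pgb c q g -> pgb c q h.
Proof.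
move=> e [c0 hg sg]; split=> //; first by move=> x px; rewrite -e //; exact: hg.
move=> xs x pxs px cx; rewrite -e //.
by have := sg xs x pxs px cx; rewrite (_ : (fun N => g (xs N)) = (fun N => h (xs N))) //; apply/funext => N; exact: e.
Qed.
Lemma pg_ext g h : (forall x, posv x -> g x = h x) -> pg g -> pg h.
Proof. by move=> e [c [q hg]]; exists c, q; exact: pgb_ext hg. Qed.

Lemma pgb_cst (z : C) : pgb (cabs z) 0 (fun=> z).
Proof. by split=> [|x _|xs x _ _ _]; [exact: cabs_ge0|rewrite mulr1|exact: ccvg_cst]. Qed.
Lemma pg_cst (z : C) : pg (fun=> z). Proof. by exists (cabs z), 0%N; exact: pgb_cst. Qed.

Lemma pgbM c d q r g h : pgb c q g -> pgb d r h -> pgb (c * d) (q + r) (fun x => g x * h x).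
Proof.
move=> [c0 hg sg] [d0 hh sh]; split; first exact: mulr_ge0.
  by move=> x px; rewrite cabsM exprD mulrACA ler_pM ?cabs_ge0 ?hg ?hh.
by move=> xs x pxs px cx; apply: ccvgM; [exact: sg|exact: sh].
Qed.
Lemma pgM g h : pg g -> pg h -> pg (fun x => g x * h x).
Proof. by move=> [c [q hg]] [d [r hh]]; exists (c * d), (q + r)%N; exact: pgbM. Qed.

Lemma pgbD c d q g h : pgb c q g -> pgb d q h -> pgb (c + d) q (fun x => g x + h x).
Proof.
move=> [c0 hg sg] [d0 hh sh]; split; first exact: addr_ge0.
  by move=> x px; rewrite mulrDl (le_trans (cabsD _ _)) // lerD ?hg ?hh.
by move=> xs x pxs px cx; apply: ccvgD; [exact: sg|exact: sh].
Qed.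
Lemma pgD g h : pg g -> pg h -> pg (fun x => g x + h x).
Proof.
move=> [c [q hg]] [d [r hh]]; exists (c + d), (q + r)%N; apply: pgbD.
- exact: (pgb_mono (lexx c) (leq_addr r q)).
- exact: (pgb_mono (lexx d) (leq_addl q r)).
Qed.
Lemma pgZ (z : C) g : pg g -> pg (fun x => z * g x).
Proof. by move=> h; exact: pgM (pg_cst z) h. Qed.
Lemma pg_sum (T : Type) (r : seq T) (P : pred T) (f : T -> V -> C) : (forall i, pg (f i)) ->
  pg (fun x => \sum_(i <- r | P i) f i x).
Proof.
move=> h; elim: r => [|i r IHr].
  by apply: (pg_ext _ (pg_cst 0)) => x _; rewrite big_nil.
case Pi: (P i).
  by apply: (pg_ext _ (pgD (h i) IHr)) => x _; rewrite big_cons Pi.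
by apply: (pg_ext _ IHr) => x _; rewrite big_cons Pi.
Qed.
Lemma pgb_coord i : pgb 1 1 (fun x => cR (x i)).
Proof.
split=> // [x px|xs x pxs px cx]; last exact: ccvg_cR.
by rewrite cabs_cR mul1r expr1 ger0_norm ?le_gr // ltW.
Qed.
Lemma pg_coord i : pg (fun x => cR (x i)). Proof. by exists 1, 1%N; exact: pgb_coord. Qed.

Definition vperm (w : {perm 'I_n}) x : V := fun i => x (w i).
Lemma posv_perm w x : posv x -> posv (vperm w x). Proof. by move=> px i; exact: px. Qed.
Lemma gr_perm w x : gr (vperm w x) = gr x.
Proof. by rewrite /gr [RHS](reindex_inj (@perm_inj _ w)). Qed.
Lemma W_perm w x : W (vperm w x) = W x.
Proof. by rewrite /W [RHS](reindex_inj (@perm_inj _ w)). Qed.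
Lemma pgb_perm c q w g : pgb c q g -> pgb c q (fun x => g (vperm w x)).
Proof.
move=> [c0 hg sg]; split=> // [x px|xs x pxs px cx].
  by rewrite -(gr_perm w) hg //; exact: posv_perm.
by apply: (sg (fun N => vperm w (xs N))) => // [N||i]; [exact: posv_perm|exact: posv_perm|exact: cx].
Qed.
Lemma pg_perm w g : pg g -> pg (fun x => g (vperm w x)).
Proof. by move=> [c [q h]]; exists c, q; exact: pgb_perm. Qed.

Hypotheses (a_gt : -1 < cRe a) (s_gt0 : 0 < s).

Lemma W_cvg (xs : nat -> V) x : (forall N, posv (xs N)) -> posv x ->
  (forall i, xs N i @[N --> \oo] --> x i) -> ccvg (fun N => W (xs N)) (W x).
Proof.
move=> pxs px cx; rewrite /W.
have h (r : seq 'I_n) : ccvg (fun N => \prod_(i <- r) wt a s (xs N i)) (\prod_(i <- r) wt a s (x i)).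
  elim: r => [|i r IHr].
    by rewrite big_nil; under eq_fun do rewrite big_nil; exact: ccvg_cst.
  rewrite big_cons; under eq_fun do rewrite big_cons; apply: ccvgM => //.
  by apply: wt_cvg => // N; exact: pxs.
exact: h.
Qed.

Definition gW g (x : nat -> R) : C := g (fun i : 'I_n => x i) * W (fun i : 'I_n => x i).

Lemma nice_gW c q g (P : C -> R) : (forall z, `|P z| <= cabs z) ->
  (forall u z, ccvg u z -> P (u N) @[N --> \oo] --> P z) -> pgb c q g ->
  nice n (phi a s q) 0 c (fun x : nat -> R => P (gW g x)).
Proof.
move=> hP cP [c0 hg sg]; split=> //.
- move=> x px; apply: le_trans (hP _) _; rewrite /gW cabsM.
  have px' : posv (fun i : 'I_n => x i) by move=> i; apply: px; rewrite /= ltn_ord.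
  have -> : bnd n (phi a s q) 0 x = gr (fun i : 'I_n => x i) ^+ q * cabs (W (fun i : 'I_n => x i)).
    rewrite /bnd big_mkord cabs_prod /gr -prodrXl -big_split /=; apply: eq_bigr => i _.
    by rewrite cabs_wt // /phi mulrAC mulrC.
  by rewrite mulrA ler_wpM2r ?cabs_ge0 ?hg.
- move=> xs x pxs px cx; apply: cP; apply: ccvgM.
    apply: (sg (fun N (i : 'I_n) => xs N i)) => [N i|i|i].
    + by apply: pxs; rewrite /= ltn_ord.
    + by apply: px; rewrite /= ltn_ord.
    + by apply: cx; rewrite /= ltn_ord.
  apply: (@W_cvg (fun N (i : 'I_n) => xs N i)) => [N i|i|i].
  + by apply: pxs; rewrite /= ltn_ord.
  + by apply: px; rewrite /= ltn_ord.
  + by apply: cx; rewrite /= ltn_ord.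
Qed.

Lemma nice_Re c q g : pgb c q g ->
  nice n (phi a s q) 0 c (fun x : nat -> R => cRe (gW g x)).
Proof. by apply: nice_gW => [z|u z []//]; exact: cabs_ge_Re. Qed.
Lemma nice_Im c q g : pgb c q g ->
  nice n (phi a s q) 0 c (fun x : nat -> R => cIm (gW g x)).
Proof. by apply: nice_gW => [z|u z []//]; exact: cabs_ge_Im. Qed.
Lemma nice_cabs c q g : pgb c q g ->
  nice n (phi a s q) 0 c (fun x : nat -> R => cabs (gW g x)).
Proof. by apply: nice_gW => [z|u z]; [rewrite ger0_norm ?cabs_ge0|exact: cvg_cabs]. Qed.

Lemma iterint_riter m (F : (nat -> R) -> C) (x : nat -> R) :
  iterint m F x = ((riter m (cRe (R := R) \o F) x) +i* (riter m (cIm (R := R) \o F) x))%C.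
Proof.
elim: m x => [|m IHm] x /=; first exact: c_eta.
by rewrite /cint; congr (_ +i* _)%C; congr Rintegral; apply/funext => t; rewrite IHm.
Qed.

Lemma Re_I g : cRe (I g) = riter n (fun x : nat -> R => cRe (gW g x)) (fun=> 0).
Proof. by rewrite /I /intRpos iterint_riter. Qed.
Lemma Im_I g : cIm (I g) = riter n (fun x : nat -> R => cIm (gW g x)) (fun=> 0).
Proof. by rewrite /I /intRpos iterint_riter. Qed.

Lemma posfrom_n (x : nat -> R) : posfrom n n x. Proof. by move=> i; rewrite ltnNge andbN. Qed.

Lemma I_eq g h : (forall x, posv x -> g x = h x) -> I g = I h.
Proof.
move=> e; apply: c_eq; rewrite ?Re_I ?Im_I; apply: (@riter_eq R n n) => //; try exact: posfrom_n.
- by move=> x px; rewrite /gW e // => i; apply: px; rewrite /= ltn_ord.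
- by move=> x px; rewrite /gW e // => i; apply: px; rewrite /= ltn_ord.
Qed.

Let pc q := @phi_pcont R a s q.
Let pint q := @phi_iRpos R a s a_gt s_gt0 q.
Let pge q := @phi_ge0 R a s q.
Let rD q := @riterD R n (phi a s q) (@pc q) (@pint q) (@pge q) n.
Let rZ q := @riterZ R n (phi a s q) (@pc q) (@pint q) (@pge q) n.

Lemma ID g h : pg g -> pg h -> I (fun x => g x + h x) = I g + I h.
Proof.
move=> [c [q hg]] [d [r hh]].
have {}hg := pgb_mono (lexx c) (leq_addr r q) hg; have {}hh := pgb_mono (lexx d) (leq_addl q r) hh.
apply: c_eq; rewrite ?cReD ?cImD ?Re_I ?Im_I.
- rewrite -(rD _ (nice_Re hg) (nice_Re hh)) //; last exact: posfrom_n.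
  by congr riter; apply/funext => x; rewrite /gW mulrDl cReD.
- rewrite -(rD _ (nice_Im hg) (nice_Im hh)) //; last exact: posfrom_n.
  by congr riter; apply/funext => x; rewrite /gW mulrDl cImD.
Qed.

Lemma IZ (z : C) g : pg g -> I (fun x => z * g x) = z * I g.
Proof.
move=> [c [q hg]].
have nZ (d : R) G : nice n (phi a s q) 0 c G -> nice n (phi a s q) 0 (`|d| * c) (fun x : nat -> R => d * G x).
  move=> [c0 hG sG]; split; first by rewrite mulr_ge0.
  - by move=> x px; rewrite normrM -mulrA ler_wpM2l // hG.
  - by move=> xs x pxs px cx; apply: cvgM; [exact: cvg_cst|exact: sG].
have E d d' G H : nice n (phi a s q) 0 c G -> nice n (phi a s q) 0 c H ->
    riter n (fun x : nat -> R => d * G x + d' * H x) (fun=> 0) = d * riter n G (fun=> 0) + d' * riter n H (fun=> 0).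
  move=> nG nH; rewrite (rD (leqnn n) (nZ d _ nG) (nZ d' _ nH)); last exact: posfrom_n.
  by rewrite (rZ d (leqnn n) nG) ?(rZ d' (leqnn n) nH) //; exact: posfrom_n.
apply: c_eq; rewrite ?cReM ?cImM !Re_I !Im_I.
- rewrite -mulNr -(E _ _ _ _ (nice_Re hg) (nice_Im hg)).
  by congr riter; apply/funext => x; rewrite /gW -mulrA cReM mulNr.
- rewrite -(E _ _ _ _ (nice_Im hg) (nice_Re hg)).
  by congr riter; apply/funext => x; rewrite /gW -mulrA cImM.
Qed.

Lemma I0 : I (fun=> 0) = 0.
Proof.
by rewrite -[RHS](mul0r (I (fun=> 0))) -IZ; [apply: I_eq => x _; rewrite mulr0|exact: pg_cst].
Qed.

Lemma I_sum (T : Type) (r : seq T) (P : pred T) (f : T -> V -> C) : (forall i, pg (f i)) ->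
  I (fun x => \sum_(i <- r | P i) f i x) = \sum_(i <- r | P i) I (f i).
Proof.
move=> h; elim: r => [|i r IHr].
  by rewrite big_nil -[RHS]I0; apply: I_eq => x _; rewrite big_nil.
rewrite big_cons -IHr; case Pi: (P i).
  by rewrite -ID //; [apply: I_eq => x _; rewrite big_cons Pi|exact: pg_sum].
by apply: I_eq => x _; rewrite big_cons Pi.
Qed.

Lemma I_cvg c q (gs : nat -> V -> C) g : (forall N, pgb c q (gs N)) -> pgb c q g ->
  (forall x, posv x -> ccvg (fun N => gs N x) (g x)) -> ccvg (fun N => I (gs N)) (I g).
Proof.
move=> hgs hg h.
have h' (x : nat -> R) : posfrom n 0 x -> ccvg (fun N => gW (gs N) x) (gW g x).
  by move=> px; apply: ccvgM; [apply: h => i; apply: px; rewrite /= ltn_ord|exact: ccvg_cst].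
split; [rewrite Re_I; under eq_fun do rewrite Re_I|rewrite Im_I; under eq_fun do rewrite Im_I].
- apply: (@riter_cvg R n _ (@pc q) (@pint q) (@pge q) n c
    (fun N (x : nat -> R) => cRe (gW (gs N) x))) => //; try exact: posfrom_n; last first.
  + by move=> x px; case: (h' x px).
  + exact: nice_Re.
  + by move=> N; exact: nice_Re.
- apply: (@riter_cvg R n _ (@pc q) (@pint q) (@pge q) n c
    (fun N (x : nat -> R) => cIm (gW (gs N) x))) => //; try exact: posfrom_n; last first.
  + by move=> x px; case: (h' x px).
  + exact: nice_Im.
  + by move=> N; exact: nice_Im.
Qed.

Lemma I_fin g : pg g -> integrableRpos (fun x => g x * W x).
Proof.
move=> [c [q hg]]; rewrite /integrableRpos.
rewrite (iterint_abs_riter (@pc q) (@pint q) (@pge q) (leqnn n) (nice_cabs hg)) ?ltry //.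
  by move=> x _; exact: cabs_ge0.
exact: posfrom_n.
Qed.

Lemma vperm_swapn (x : nat -> R) m (lt1 : (m < n)%N) (lt2 : (m.+1 < n)%N) :
  vperm (tperm (Ordinal lt1) (Ordinal lt2)) (fun i => x i) = fun i : 'I_n => swapn m x i.
Proof.
apply/funext => i; rewrite /vperm /swapn; case: tpermP => [->|->|]; rewrite ?eqxx //=.
  by rewrite (gtn_eqF (ltnSn m)).
by move=> /eqP h1 /eqP h2; rewrite (negbTE (h1 : (i : nat) != m)) (negbTE (h2 : (i : nat) != m.+1)).
Qed.

Lemma I_swap_adj g m (lt1 : (m < n)%N) (lt2 : (m.+1 < n)%N) : pg g ->
  I (fun x => g (vperm (tperm (Ordinal lt1) (Ordinal lt2)) x)) = I g.
Proof.
move=> [c [q hg]]; set w := tperm _ _.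
have e (x : nat -> R) : gW (fun x => g (vperm w x)) x = gW g (swapn m x).
  by rewrite /gW -vperm_swapn -/w W_perm.
apply: c_eq; rewrite ?Re_I ?Im_I; under eq_fun do rewrite e.
- by apply: (riter_swapn (@pc q) (@pint q) (@pge q) lt2 (nice_Re hg)); exact: posfrom_n.
- by apply: (riter_swapn (@pc q) (@pint q) (@pge q) lt2 (nice_Im hg)); exact: posfrom_n.
Qed.

(** Fubini handles neighbouring transpositions; conjugation extends this to all transpositions, and
    these generate. *)
Lemma I_perm g w : pg g -> I (fun x => g (vperm w x)) = I g.
Proof.
pose Q (w : {perm 'I_n}) := forall g, pg g -> I (fun x => g (vperm w x)) = I g.
have QM u v : Q u -> Q v -> Q (u * v)%g.
  move=> hu hv g' hg'; rewrite -(hu _ hg') -(hv (fun x => g' (vperm u x))); last exact: pg_perm.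
  by apply: I_eq => x _; congr g'; apply/funext => i; rewrite /vperm permM.
have Qt (i j : 'I_n) : (i < j)%N -> Q (tperm i j).
  case: i j => [i hi] [j hj] /= ij; elim: j ij hj => // j IHj ij hj.
  have hj' : (j < n)%N by exact: ltnW.
  have Qa : Q (tperm (Ordinal hj') (Ordinal hj)) by move=> g' hg'; exact: I_swap_adj.
  move: ij; rewrite ltnS leq_eqVlt => /predU1P[e|ij].
    by subst i; rewrite (_ : Ordinal hi = Ordinal hj') //; exact: val_inj.
  have := tpermJ (Ordinal hi) (Ordinal hj') (tperm (Ordinal hj') (Ordinal hj)).
  rewrite tpermL tpermD; first last.
  - by apply/eqP => -[] e; move: ij; rewrite -e ltnNge leqnSn.
  - by apply/eqP => -[] e; move: ij; rewrite e ltnn.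
  by move=> <-; rewrite /conjg tpermV; exact: (QM _ _ Qa (QM _ _ (IHj ij hj') Qa)).
have Q1 : Q 1%g by move=> g' hg'; apply: I_eq => x _; congr g'; apply/funext => i; rewrite /vperm perm1.
move: g; rewrite -/(Q w); have [ts -> _] := prod_tpermP w.
elim: ts => [|[i j] ts IHts]; first by rewrite big_nil.
rewrite big_cons; apply: QM => //=.
case: (ltngtP i j) => [||/val_inj ->]; [exact: Qt|by rewrite tpermC; exact: Qt|by rewrite tperm1].
Qed.
End Functional.

(** * Integration by parts in one coordinate *)

Section IntegrationByParts.
Local Open Scope classical_set_scope.
Variable R : realType.
Local Notation C := (Cx R).
Variables (n : nat) (a : C) (s : R).
Local Notation V := (rvec R n).
Local Notation I := (@I R n a s).
Local Notation W := (@W R n a s).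
Hypotheses (a_gt : -1 < cRe a) (s_gt0 : 0 < s).

Definition updo (x : V) (i : 'I_n) (t : R) : V := fun j => if j == i then t else x j.

Lemma updo_eq x i t : updo x i t i = t. Proof. by rewrite /updo eqxx. Qed.
Lemma updo_id x i : updo x i (x i) = x.
Proof. by apply/funext => j; rewrite /updo; case: eqP => [->|]. Qed.
Lemma updo_updo x i t u : updo (updo x i t) i u = updo x i u.
Proof. by apply/funext => j; rewrite /updo; case: eqP. Qed.
Lemma posv_updo x i t : posv x -> 0 < t -> posv (updo x i t).
Proof. by move=> px t0 j; rewrite /updo; case: eqP. Qed.
Lemma vperm_updo x i t w : vperm w (updo x i t) = updo (vperm w x) ((w^-1)%g i) t.
Proof.
apply/funext => j; rewrite /vperm /updo -(inj_eq (@perm_inj _ w) j) permKV.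
by case: eqP.
Qed.
Lemma gr_updo x i t : gr (updo x i t) = (1 + t) * \prod_(j < n | j != i) (1 + x j).
Proof.
rewrite /gr (bigD1 i) //= updo_eq; congr (_ * _); apply: eq_bigr => j ne.
by rewrite /updo (negbTE ne).
Qed.
Lemma W_updo x i t : W (updo x i t) = wt a s t * \prod_(j < n | j != i) wt a s (x j).
Proof.
rewrite -[LHS]/(\prod_(j < n) wt a s (updo x i t j)) (bigD1 i) //= updo_eq; congr (_ * _); apply: eq_bigr => j ne.
by rewrite /updo (negbTE ne).
Qed.

Lemma boundary_tails q (f : R -> R) B : 0 <= B ->
  (forall t, 0 < t -> `|f t| <= B * (t `^ (cRe a + 1) * (1 + t) ^+ q * expR (- s * t))) ->
  f (N.+1%:R^-1) @[N --> \oo] --> (0 : R) /\ f N.+2%:R @[N --> \oo] --> (0 : R).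
Proof.
move=> B0 hf; have al1 : 0 < cRe a + 1 by rewrite -ltrBlDr sub0r.
have sq (u b : nat -> R) : (forall N, 0 < u N) -> (forall N, `|f (u N)| <= b N) ->
    b N @[N --> \oo] --> (0 : R) -> f (u N) @[N --> \oo] --> (0 : R).
  move=> u0 h cb; apply/norm_cvg0P; apply: (@squeeze_cvgr _ _ _ _ (fun=> 0) b) => //.
    by apply: nearW => N; rewrite normr_ge0 h.
  exact: cvg_cst.
have invc (c : R) : c * N.+1%:R^-1 @[N --> \oo] --> (0 : R).
  by rewrite -[X in _ --> X](mulr0 c); apply: cvgM; [exact: cvg_cst|exact: invS_cvg0].
split.
- have [c c0 hc] := exp_decay s_gt0 (ler0n R q).
  apply: (sq _ (fun N => B * c * (N.+1%:R^-1 `^ (cRe a + 1)))) => [N|N|].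
  + by rewrite invr_gt0 ltr0n.
  + have t0 : 0 < N.+1%:R^-1 :> R by rewrite invr_gt0 ltr0n.
    apply: le_trans (hf _ t0) _; rewrite -[leRHS]mulrA ler_wpM2l // -mulrA [leRHS]mulrC.
    by rewrite ler_wpM2l ?powR_ge0 // -powR_mulrn ?hc // addr_ge0 // ltW.
  + rewrite -[X in _ --> X](mulr0 (B * c)); apply: cvgM; first exact: cvg_cst.
    rewrite -(@powR0 R (cRe a + 1)) ?gt_eqF //; apply: pow0_cvg; rewrite ?ltW //.
    exact: invS_cvg0.
- have p0 : 0 <= cRe a + 1 + q%:R + 1 by apply: addr_ge0 => //; apply: addr_ge0 => //; exact: ltW.
  have [c c0 hc] := exp_decay s_gt0 p0.
  apply: (sq _ (fun N => B * c * N.+1%:R^-1)) => [N|N|//]; first by rewrite ltr0n.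
  have t0 : 0 < N.+2%:R :> R by rewrite ltr0n.
  apply: le_trans (hf _ t0) _; rewrite -[leRHS]mulrA ler_wpM2l //.
  have tN : N.+1%:R <= N.+2%:R :> R by rewrite ler_nat.
  move: N.+2%:R t0 tN => t t0 tN.
  have t1 : 0 < 1 + t by rewrite ltr_wpDl.
  have t1' : (1 + t != 0) = true by rewrite gt_eqF.
  have e1 : (1 + t) `^ (cRe a + 1 + q%:R + 1) = (1 + t) `^ (cRe a + 1) * (1 + t) ^+ q * (1 + t).
    rewrite (@powRD _ _ (cRe a + 1 + q%:R)) ?t1' ?implybT // powRr1 ?ltW //.
    by rewrite (@powRD _ _ (cRe a + 1)) ?t1' ?implybT // powR_mulrn ?ltW.
  have := hc t t0; rewrite e1.
  have h1 : t `^ (cRe a + 1) <= (1 + t) `^ (cRe a + 1).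
    by apply: ge0_ler_powR; rewrite ?nnegrE ?lerDr ?ltW.
  have h2 : N.+1%:R <= 1 + t by rewrite (le_trans tN) // lerDr.
  rewrite ler_pdivlMr ?ltr0n //; apply: le_trans.
  rewrite [leRHS]mulrAC; have t1w := ltW t1.
  apply: ler_pM => //; first by rewrite !mulr_ge0 ?powR_ge0 ?expR_ge0 ?exprn_ge0.
  by rewrite ler_wpM2r ?expR_ge0 // ler_wpM2r ?exprn_ge0.
Qed.

Lemma riter_cst0 m (x : nat -> R) : riter m (fun=> 0 : R) x = 0.
Proof.
elim: m x => [//|m IHm] x /=; transitivity (intR (fun=> 0 : R)); first exact: Rint_eq.
by rewrite /intR /Rintegral integral0.
Qed.

Definition along (h h' : V -> C) i := forall x, posv x ->
  cderiv (fun t => h (updo x i t)) (h' x) (x i).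

(** The derivative of [x_o h W] is integrated in the innermost variable. The factor x_o makes the
    boundary value at 0 vanish for every [Re a > -1], in particular when the weight itself is
    unbounded there. *)
Lemma IBP_first (h h' : V -> C) (o : 'I_n) : o = 0%N :> nat -> pg h -> pg h' -> along h h' o ->
  I (fun x => cR (x o) * h' x + (1 + a - cR s * cR (x o)) * h x) = 0.
Proof.
move=> o0 [ch [qh hh]] ph' dh; set G := fun x : V => _.
have ph : pg h by exists ch, qh.
have [c [q hG]] : pg G.
  apply: pgD; first by apply: pgM => //; exact: pg_coord.
  apply: pgM => //.
  apply: (@pg_ext _ _ (fun x => (1 + a) + (- cR s) * cR (x o))); first by move=> x _; rewrite mulNr.
  by apply: pgD; [exact: pg_cst|apply: pgZ; exact: pg_coord].
have n0 : (0 < n)%N by rewrite (leq_ltn_trans _ (ltn_ord o)).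
have main (P : C -> R) : (forall z, `|P z| <= cabs z) ->
    nice n (phi a s q) 0 c (fun x => P (gW a s G x)) ->
    (forall f df t, cderiv f df t -> is_derive t 1 (fun u => P (f u)) (P df)) ->
    riter n (fun x => P (gW a s G x)) (fun=> 0) = 0.
  move=> hP nG dP; rewrite -[RHS](riter_cst0 n (fun=> 0)).
  have en : (1 + n.-1)%N = n by rewrite add1n prednK.
  have := @riter_eq_up R n 1 n.-1 (fun x => P (gW a s G x)) (fun=> 0).
  rewrite en; apply => //; last exact: posfrom_n.
  move=> x px; rewrite [RHS]riter_cst0 /=.
  pose y : V := fun i => upd x 0 1 i.
  have py : posv y.
    by move=> i; apply: (@posfrom_upd R n 0) => //=.
  have yE t : (fun i : 'I_n => upd x 0 t i) = updo y o t.
    apply/funext => i; rewrite /updo /y /upd -(inj_eq val_inj) /= o0.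
    by case: eqP.
  pose M := \prod_(j < n | j != o) wt a s (y j).
  pose K t := (cR t * wt a s t) * (M * h (updo y o t)).
  have gE t : gW a s G (upd x 0 t) = G (updo y o t) * (wt a s t * M) by rewrite /gW yE W_updo.
  have dK t : 0 < t -> cderiv K (gW a s G (upd x 0 t)) t.
    move=> t0; have pt := posv_updo o py t0.
    have d1 : cderiv (fun u => h (updo y o u)) (h' (updo y o t)) t.
      have := dh _ pt; rewrite updo_eq; apply: cderiv_ext => u; by rewrite updo_updo.
    apply: (cderiv_eq (cderivM (cderivM (cderiv_id t) (wt_cderiv a s t0)) (cderivZ M d1))).
    have tt : cR t * cR t^-1 = 1 :> C by rewrite -cRM divff ?cR1 // gt_eqF.
    rewrite gE /G updo_eq; set w := wt _ _ _; set H := h _; set H' := h' _.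
    have -> : cR t * ((a * cR t^-1 - cR s) * w) = (a * (cR t * cR t^-1) - cR s * cR t) * w by ring.
    by rewrite tt; ring.
  rewrite -[RHS](subrr 0); have [_ hG1 _] := nG.
  have [tl0 tl1] : P (K (N.+1%:R^-1)) @[N --> \oo] --> (0 : R) /\ P (K N.+2%:R) @[N --> \oo] --> (0 : R).
    have [ch0 hh1 _] := hh.
    pose B := cabs M * (ch * (\prod_(j < n | j != o) (1 + y j)) ^+ qh).
    apply: (@boundary_tails qh (fun t => P (K t)) B).
      rewrite !mulr_ge0 ?cabs_ge0 // exprn_ge0 // prodr_ge0 // => j _.
      by rewrite addr_ge0 // ltW.
    move=> t t0; apply: le_trans (hP _) _; rewrite /K (cabsM (_ * wt a s t)) (cabsM (cR t) (wt a s t)) (cabsM M).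
    rewrite cabs_cR cabs_wt // (ger0_norm (ltW t0)).
    have -> : t `^ (cRe a + 1) = t * t `^ cRe a.
      have tn : (t != 0) = true by rewrite gt_eqF.
      by rewrite powRD ?tn ?implybT // powRr1 ?ltW // mulrC.
    have := hh1 _ (posv_updo o py t0); rewrite gr_updo exprMn.
    set z := \prod_(_ < _ | _) _; move=> hz.
    have e0 : 0 <= t * (t `^ cRe a * expR (- s * t)) by rewrite !mulr_ge0 ?powR_ge0 ?expR_ge0 // ltW.
    rewrite [leRHS](_ : _ = t * (t `^ cRe a * expR (- s * t)) * (cabs M * (ch * ((1 + t) ^+ qh * z ^+ qh)))).
      by rewrite ler_wpM2l // ler_wpM2l // cabs_ge0.
    by rewrite /B; move: (z ^+ qh) (expR _) ((1 + t) ^+ qh) => *; ring.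
  apply: (Rint_FTC (phi := fun t => c * bnd n (phi a s q) 1 x * phi a s q t)
    (fun t t0 => dP _ _ _ (dK t t0))) => //.
  - move=> t t0; apply: pcont1_continuous => //; exact: (nice_pcont1 nG px).
  - by apply: iRposZ; exact: phi_iRpos.
  - move=> t t0; apply: le_trans (hG1 _ (posfrom_upd px t0)) _.
    by rewrite bnd_upd // [phi a s q t * _]mulrC mulrA.
apply: c_eq; rewrite ?Re_I ?Im_I.
- by apply: main; [exact: cabs_ge_Re|exact: nice_Re|move=> f df t []].
- by apply: main; [exact: cabs_ge_Im|exact: nice_Im|move=> f df t []].
Qed.

Lemma IBP (h h' : V -> C) (i : 'I_n) : pg h -> pg h' -> along h h' i ->
  I (fun x => cR (x i) * h' x + (1 + a - cR s * cR (x i)) * h x) = 0.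
Proof.
move=> ph ph' dh.
pose o : 'I_n := Ordinal (leq_ltn_trans (leq0n i) (ltn_ord i)).
pose w := tperm o i.
rewrite -(@I_perm R n a s a_gt s_gt0 _ w); last first.
  apply: pgD; first by apply: pgM => //; exact: pg_coord.
  apply: pgM => //.
  apply: (@pg_ext _ _ (fun x => (1 + a) + (- cR s) * cR (x i))); first by move=> x _; rewrite mulNr.
  by apply: pgD; [exact: pg_cst|apply: pgZ; exact: pg_coord].
have -> : (fun x : V => cR (vperm w x i) * h' (vperm w x) + (1 + a - cR s * cR (vperm w x i)) * h (vperm w x))
    = (fun x => cR (x o) * h' (vperm w x) + (1 + a - cR s * cR (x o)) * h (vperm w x)).
  by apply/funext => x; rewrite /vperm /w tpermR.
apply: IBP_first => //; try exact: pg_perm.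
move=> x px; have := dh _ (posv_perm w px).
rewrite [vperm w x i](_ : _ = x o); last by rewrite /vperm tpermR.
by apply: cderiv_ext => t; rewrite vperm_updo /w tpermV tpermL.
Qed.
End IntegrationByParts.

(** * The regularised discriminant *)

Section Discriminant.
Local Open Scope classical_set_scope.
Variable R : realType.
Local Notation C := (Cx R).
Variables (n : nat) (k : R).
Hypothesis k_ge0 : 0 <= k.
Local Notation V := (rvec R n).
Implicit Types (x : V) (e : R).

(** Omega with every squared difference increased by e, differentiable across the hyperplanes when e
    is positive. The product runs over ordered pairs, whence the exponent k/2. *)
Definition Om e x : R :=
  \prod_(p : 'I_n * 'I_n | p.1 != p.2) ((x p.1 - x p.2) ^+ 2 + e) `^ (k / 2).

Lemma Om_ge0 e x : 0 <= Om e x. Proof. by apply: prodr_ge0 => p _; exact: powR_ge0. Qed.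

Lemma omega_Om x : omega k x = Om 0 x.
Proof.
have sq (d : R) : (d ^+ 2 + 0) `^ (k / 2) = `|d| `^ k.
  by rewrite addr0 -real_normK ?num_real // -powR_mulrn // -powRrM mulrCA divff ?mulr1.
rewrite /Om (bigID (fun p : 'I_n * 'I_n => (p.1 < p.2)%N)) /=.
have e (P : rel 'I_n) (F : 'I_n -> 'I_n -> R) :
    \prod_(p : 'I_n * 'I_n | P p.1 p.2) F p.1 p.2 = \prod_i \prod_(j | P i j) F i j.
  by rewrite pair_big_dep.
rewrite [X in _ = X * _](eq_bigl (fun p : 'I_n * 'I_n => (p.1 < p.2)%N)); last first.
  by case=> i j /=; rewrite -(inj_eq val_inj) /=; case: ltngtP => h.
rewrite [X in _ = _ * X](eq_bigl (fun p : 'I_n * 'I_n => (p.2 < p.1)%N)); last first.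
  by case=> i j /=; rewrite -(inj_eq val_inj) /=; case: ltngtP => h.
rewrite [X in _ = _ * X](reindex_inj (h := fun p : 'I_n * 'I_n => (p.2, p.1))) /=; last first.
  by case=> i j [i' j'] [-> ->].
rewrite -big_split /= (e (fun i j => (i < j)%N) (fun i j =>
   ((x i - x j) ^+ 2 + 0) `^ (k / 2) * ((x j - x i) ^+ 2 + 0) `^ (k / 2))).
apply: eq_bigr => i _; apply: eq_bigr => j _.
by rewrite !sq [`|x j - x i|]distrC [2 * k]mulrC powRrM powR_mulrn ?powR_ge0 // expr2.
Qed.

Lemma Om_perm e w x : Om e (vperm w x) = Om e x.
Proof.
rewrite /Om [RHS](reindex_inj (h := fun p : 'I_n * 'I_n => (w p.1, w p.2))) /=; last first.
  by case=> i j [i' j'] [/perm_inj -> /perm_inj ->].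
by apply: eq_bigl => -[i j] /=; rewrite (inj_eq (@perm_inj _ w)).
Qed.

Lemma pgb_prod (T : Type) (r : seq T) (P : pred T) (c : T -> R) (q : T -> nat) (f : T -> V -> C) :
  (forall i, P i -> pgb (c i) (q i) (f i)) ->
  pgb (\prod_(i <- r | P i) c i) (\sum_(i <- r | P i) q i) (fun x => \prod_(i <- r | P i) f i x).
Proof.
move=> h; elim: r => [|i r IHr].
  rewrite !big_nil -(cabs1 R); apply: (pgb_ext _ (pgb_cst _ 1)) => x _; by rewrite big_nil.
rewrite !big_cons; case Pi: (P i).
  by apply: (pgb_ext _ (pgbM (h i Pi) IHr)) => x _; rewrite big_cons Pi.
by apply: (pgb_ext _ IHr) => x _; rewrite big_cons Pi.
Qed.

Lemma diff_le_gr x i j : posv x -> (x i - x j) ^+ 2 <= gr x ^+ 2.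
Proof.
move=> px; rewrite -real_normK ?num_real // ler_pXn2r ?nnegrE ?gr_ge0 // ler_norml.
have := le_gr i px; have := le_gr j px; have := px i; have := px j; lra.
Qed.

(** The constants are uniform in e, as the passage to the limit e = 0 under the integral demands. *)
Lemma Om_pgb : exists c q, forall e, 0 <= e <= 1 -> pgb c q (fun x => cR (Om e x)).
Proof.
pose K := (Num.trunc (k / 2)).+1.
have hK : k / 2 <= K%:R by apply: ltW; have /andP[] := trunc_itv (divr_ge0 k_ge0 (ler0n R 2)).
exists (\prod_(p : 'I_n * 'I_n | p.1 != p.2) 2 ^+ K), (\sum_(p : 'I_n * 'I_n | p.1 != p.2) (2 * K))%N.
move=> e /andP[e0 e1].
apply: (@pgb_ext _ _ _ _ (fun x => \prod_(p : 'I_n * 'I_n | p.1 != p.2) cR (((x p.1 - x p.2) ^+ 2 + e) `^ (k / 2)))).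
  by move=> x _; rewrite /Om !cRE rmorph_prod.
apply: pgb_prod => -[i j] _ /=; split; first exact: exprn_ge0.
- move=> x px; rewrite cabs_cR ger0_norm ?powR_ge0 //.
  have g0 := gr_ge0 px.
  have g1 : 1 <= gr x ^+ 2 by rewrite exprn_ege1 // gr_ge1.
  have d2 : (x i - x j) ^+ 2 + e <= 2 * gr x ^+ 2.
    by have := diff_le_gr i j px; lra.
  apply: (@le_trans _ _ ((2 * gr x ^+ 2) `^ (k / 2))).
    apply: ge0_ler_powR; rewrite ?nnegrE ?divr_ge0 ?addr_ge0 ?sqr_ge0 ?mulr_ge0 ?sqr_ge0 //.
  apply: (@le_trans _ _ ((2 * gr x ^+ 2) `^ K%:R)); first by apply: ler_powR => //; move: g1; set z := gr x ^+ 2; lra.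
  by rewrite powR_mulrn ?mulr_ge0 ?sqr_ge0 // exprMn exprM.
- move=> xs x pxs px cx; apply: ccvg_cR; apply: pow0_cvg; first exact: divr_ge0.
    by move=> N; rewrite addr_ge0 // sqr_ge0.
  apply: cvgD; last exact: cvg_cst.
  by apply: exprn_cvg; apply: cvgB; exact: cx.
Qed.

Lemma pg_Om e : 0 <= e <= 1 -> pg (fun x => cR (Om e x)).
Proof. by move=> he; have [c [q h]] := Om_pgb; exists c, q; exact: h. Qed.

Lemma Om_cvg0 x : ccvg (fun N => cR (Om (N.+1%:R^-1) x)) (cR (Om 0 x)).
Proof.
apply: ccvg_cR; rewrite /Om.
have h (r : seq ('I_n * 'I_n)) : \prod_(p <- r | p.1 != p.2) ((x p.1 - x p.2) ^+ 2 + N.+1%:R^-1) `^ (k / 2)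
    @[N --> \oo] --> \prod_(p <- r | p.1 != p.2) ((x p.1 - x p.2) ^+ 2 + 0) `^ (k / 2).
  elim: r => [|p r IHr].
    by rewrite big_nil; under eq_fun do rewrite big_nil; exact: cvg_cst.
  rewrite big_cons; under eq_fun do rewrite big_cons; case: ifP => // _.
  apply: cvgM => //; apply: pow0_cvg; first exact: divr_ge0.
    by move=> N; rewrite addr_ge0 // ?sqr_ge0 // invr_ge0.
  by apply: cvgD; [exact: cvg_cst|exact: invS_cvg0].
exact: h.
Qed.

Lemma isd_logprod (T : Type) (r : seq T) (P : pred T) (f : T -> R -> R) (L : T -> R) (t : R) :
  (forall i, P i -> is_derive t 1 (f i) (L i * f i t)) ->
  is_derive t 1 (fun u => \prod_(i <- r | P i) f i u)
    ((\sum_(i <- r | P i) L i) * \prod_(i <- r | P i) f i t).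
Proof.
move=> h; elim: r => [|i r IHr].
  rewrite !big_nil mul0r (_ : (fun _ => _) = fun=> 1); first exact: isd_cst.
  by apply/funext => u; rewrite big_nil.
rewrite !big_cons; case Pi: (P i); last first.
  rewrite (_ : (fun u => \prod_(j <- i :: r | P j) f j u) = fun u => \prod_(j <- r | P j) f j u) //.
  by apply/funext => u; rewrite big_cons Pi.
rewrite (_ : (fun u => \prod_(j <- i :: r | P j) f j u) = fun u => f i u * \prod_(j <- r | P j) f j u).
  by apply: (is_derive_eq (isdM (h i Pi) IHr)); ring.
by apply/funext => u; rewrite big_cons Pi.
Qed.

(** The regularisation of [1/(x_i - x_j)] that occurs in the logarithmic derivative of [Om]. *)
Definition kern e x (i j : 'I_n) : R := (x i - x j) / ((x i - x j) ^+ 2 + e).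

Lemma kernC e x i j : kern e x j i = - kern e x i j.
Proof. by rewrite /kern -[x j - x i]opprB sqrrN mulNr. Qed.

Lemma Om_deriv e x (i : 'I_n) : 0 < e ->
  is_derive (x i) 1 (fun t => Om e (updo x i t)) ((2 * k * \sum_(j | j != i) kern e x i j) * Om e x).
Proof.
move=> e0.
pose L (p : 'I_n * 'I_n) := k * kern e x p.1 p.2 * ((p.1 == i)%:R - (p.2 == i)%:R).
have hL : \sum_(p : 'I_n * 'I_n | p.1 != p.2) L p = 2 * k * \sum_(j | j != i) kern e x i j.
  rewrite -(pair_big_dep predT (fun i j => i != j) (fun i j => L (i, j))) /=.
  have s1 : \sum_(j | i != j) L (i, j) = \sum_(j | j != i) k * kern e x i j.
    rewrite (eq_bigl (fun j => j != i)) => [|j]; last by rewrite eq_sym.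
    by apply: eq_bigr => j ne; rewrite /L /= eqxx (negbTE ne) subr0 mulr1.
  have s2 l : l != i -> \sum_(j | l != j) L (l, j) = k * kern e x i l.
    move=> ne; rewrite (bigD1 i) //= big1 ?addr0.
      by rewrite /L /= eqxx (negbTE ne) sub0r mulrN1 kernC mulrN opprK.
    by move=> j /andP[_ ji]; rewrite /L /= (negbTE ne) (negbTE ji) subrr mulr0.
  by rewrite (bigD1 i) //= s1 (eq_bigr _ s2) -!mulr_sumr; ring.
rewrite -hL; have d0 (p : 'I_n * 'I_n) (y : V) : 0 < (y p.1 - y p.2) ^+ 2 + e.
  by rewrite ltr_wpDl // sqr_ge0.
rewrite -{3}(updo_id x i); apply: isd_logprod => -[p1 p2] /= ne.
have dc (l : 'I_n) : is_derive (x i) 1 (fun t => updo x i t l) (l == i)%:R.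
  rewrite /updo; case: eqP => _; [exact: is_derive_id|exact: isd_cst].
have dd1 := isdD (dc p1) (isdN (dc p2)).
have d1 : is_derive (x i) 1 (fun t => (updo x i t p1 - updo x i t p2) ^+ 2 + e)
    (2 * (x p1 - x p2) * ((p1 == i)%:R - (p2 == i)%:R)).
  apply: (is_derive_eq (isdD (isdM dd1 dd1) (isd_cst e (x i)))).
  by rewrite !updo_id; ring.
have := @isd_powR R (fun t => (updo x i t p1 - updo x i t p2) ^+ 2 + e) _ (x i) (k / 2)
  (d0 (p1, p2) (updo x i (x i))) d1.
move=> dP; apply: (is_derive_eq dP); rewrite !updo_id /L /kern /=.
have dn := d0 (p1, p2) x; rewrite /= in dn.
set D := _ ^+ 2 + e in dn *; have -> : D `^ (k / 2) = D `^ (k / 2 - 1) * D.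
  have Dn : (D != 0) = true by rewrite gt_eqF.
  by rewrite -{3}(@powRr1 _ D) ?ltW // -powRD ?Dn ?implybT // subrK.
by move: (D `^ _) => z; field; rewrite gt_eqF.
Qed.

Lemma kern_pg e i j : 0 < e -> pg (fun x => cR (kern e x i j)).
Proof.
move=> e0; exists (1 + e^-1), 2%N; split; first by rewrite addr_ge0 // invr_ge0 ltW.
- move=> x px; rewrite cabs_cR /kern.
  have d0 : 0 < (x i - x j) ^+ 2 + e by rewrite ltr_wpDl // sqr_ge0.
  rewrite normrM normfV (gtr0_norm d0) ler_pdivrMr //.
  have g1 : 1 <= gr x ^+ 2 by rewrite exprn_ege1 // gr_ge1.
  have e1 : 0 < e^-1 by rewrite invr_gt0.
  have h : `|x i - x j| <= 1 * (1 + (x i - x j) ^+ 2).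
    rewrite -real_normK ?num_real //; have := normr_ge0 (x i - x j).
    by move: `|_| => d hd; have := sqr_ge0 (d - 1); nra.
  apply: (le_trans h); rewrite mul1r.
  have h2 : 1 + (x i - x j) ^+ 2 <= (1 + e^-1) * ((x i - x j) ^+ 2 + e).
    have : e^-1 * e = 1 by rewrite mulVf // gt_eqF.
    have h3 : 0 <= e^-1 * (x i - x j) ^+ 2 by rewrite mulr_ge0 ?sqr_ge0 ?(ltW e1).
    by move=> h4; rewrite mulrDl mul1r mulrDr h4; lra.
  apply: (le_trans h2); by rewrite ler_wpM2r ?(ltW d0) // ler_peMr // addr_ge0 // ltW.
- move=> xs x pxs px cx; apply: ccvg_cR; apply: cvgM; first by apply: cvgB; exact: cx.
  apply: cvgV; first by rewrite gt_eqF // ltr_wpDl // sqr_ge0.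
  by apply: cvgD; [apply: exprn_cvg; apply: cvgB; exact: cx|exact: cvg_cst].
Qed.
End Discriminant.

(** * Adjointness of the Dunkl operators and the moment identity *)

Section KeyIdentity.
Local Open Scope classical_set_scope.
Variable R : realType.
Local Notation C := (Cx R).
Variables (n : nat) (a : C) (s k : R).
Local Notation V := (rvec R n).
Local Notation I := (@I R n a s).
Local Notation W := (@W R n a s).
Local Notation P := (mpoly.mpoly n C).
Hypotheses (a_gt : -1 < cRe a) (s_gt0 : 0 < s) (k_ge0 : 0 <= k).

Lemma pg_meval (p : P) : pg (fun x : V => p.@[cofr x]).
Proof.
elim/mpoly_ind_mulX: p => [c p q hp hq||i p hp].
- apply: (pg_ext _ (pgD (pgZ c hp) hq)) => x _; by rewrite mpoly.mevalD mpoly.mevalZ.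
- by apply: (pg_ext _ (pg_cst n 1)) => x _; rewrite mpoly.meval1.
- by apply: (pg_ext _ (pgM (pg_coord R i) hp)) => x _; rewrite mpoly.mevalM mpoly.mevalXU.
Qed.

Lemma cderiv_meval (p : P) (x : V) i :
  cderiv (fun t => p.@[cofr (updo x i t)]) (p^`M(i)).@[cofr x] (x i).
Proof.
elim/mpoly_ind_mulX: p => [c p q hp hq||j p hp].
- rewrite mpoly.mderivD mpoly.mderivZ mpoly.mevalD mpoly.mevalZ.
  by apply: (cderiv_ext _ (cderivD (cderivZ c hp) hq)) => t; rewrite mpoly.mevalD mpoly.mevalZ.
- rewrite -mpoly.mpolyC1 mpoly.mderivC mpoly.meval0.
  by apply: (cderiv_ext _ (cderiv_cst 1 (x i))) => t; rewrite mpoly.mevalC.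
- rewrite mpoly.mderivM mpoly.mevalD !mpoly.mevalM mpoly.mevalXU mderivX1 mpoly.mevalC.
  have d : cderiv (fun t => cR (updo x i t j)) (j == i)%:R (x i).
    by rewrite /updo; case: eqP => _; [exact: cderiv_id|exact: cderiv_cst].
  apply: (cderiv_eq (cderiv_ext _ (cderivM d hp))); last by rewrite updo_id.
  by move=> t; rewrite mpoly.mevalM mpoly.mevalXU.
Qed.

Lemma meval_sw (p : P) i j (x : V) : (sw i j p).@[cofr x] = p.@[cofr (vperm (tperm i j) x)].
Proof. by rewrite /sw meval_msym. Qed.

Let pgOm N : pg (fun x : V => cR (Om k (N.+1%:R^-1) x)).
Proof. by apply: pg_Om => //; rewrite invr_ge0 ler0n invf_le1 ?ltr0n // ler1n. Qed.

Let e_gt0 N : 0 < N.+1%:R^-1 :> R. Proof. by rewrite invr_gt0 ltr0n. Qed.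

(** What is left of the singular factor after symmetrisation: it stays between 0 and 1 and tends to
    1 off the hyperplane as e tends to 0. *)
Definition damp e (i j : 'I_n) (x : V) : R := (x i - x j) ^+ 2 / ((x i - x j) ^+ 2 + e).

Lemma damp_bounds e i j x : 0 < e -> 0 <= damp e i j x <= 1.
Proof.
move=> e0; have d0 : 0 < (x i - x j) ^+ 2 + e by rewrite ltr_wpDl // sqr_ge0.
by rewrite /damp divr_ge0 ?sqr_ge0 ?(ltW d0) //= ler_pdivrMr // mul1r lerDl ltW.
Qed.

Lemma damp_kern e i j x : damp e i j x = (x i - x j) * kern e x i j.
Proof. by rewrite /damp /kern expr2 mulrA. Qed.

(** The kernel is antisymmetric and the measure symmetric under [s_ij], so p may be replaced by half
    of [p - s_ij p]. The factor [x_i - x_j] this produces turns the singular kernel into [damp]. *)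
Lemma antisym_kern N i j (p : P) :
  2 * I (fun x => p.@[cofr x] * cR (kern (N.+1%:R^-1) x i j) * cR (Om k (N.+1%:R^-1) x)) =
  I (fun x => (dd i j p).@[cofr x] * cR (damp (N.+1%:R^-1) i j x) * cR (Om k (N.+1%:R^-1) x)).
Proof.
pose e : R := N.+1%:R^-1.
pose H (q : P) (x : V) := q.@[cofr x] * cR (kern e x i j) * cR (Om k e x).
have pH q : pg (H q) by exact: (pgM (pgM (pg_meval q) (kern_pg i j (e_gt0 N))) (@pgOm N)).
have h : I (H p) = - I (H (sw i j p)).
  rewrite -mulN1r -(IZ a_gt s_gt0) // -(@I_perm R n a s a_gt s_gt0 (H p) (tperm i j)) //.
  apply: I_eq => x _; rewrite /H meval_sw Om_perm /kern /vperm tpermL tpermR.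
  by rewrite -[x j - x i]opprB sqrrN mulNr cRN mulrN mulNr mulN1r.
change (2 * I (H p) = I (fun x => (dd i j p).@[cofr x] * cR (damp e i j x) * cR (Om k e x))).
rewrite mulr_natl mulr2n {2}h -mulN1r -(IZ a_gt s_gt0) // -(ID a_gt s_gt0) //; last exact: pgZ.
apply: I_eq => x _; rewrite /H mulN1r -!mulNr -!mulrDl -mpoly.mevalN -mpoly.mevalD ddP.
rewrite mpoly.mevalM mpoly.mevalB !mpoly.mevalXU damp_kern cRM cRB.
by congr (_ * _); rewrite [RHS]mulrA; congr (_ * _); rewrite mulrC.
Qed.

Lemma approx_identity N i (p : P) :
  I (fun x => (cR (x i) * (p^`M(i)).@[cofr x] + (1 + a - cR s * cR (x i)) * p.@[cofr x]) *
        cR (Om k (N.+1%:R^-1) x)) +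
  cR k * \sum_(j | j != i) I (fun x => (dd i j ('X_i * p)).@[cofr x] *
        cR (damp (N.+1%:R^-1) i j x) * cR (Om k (N.+1%:R^-1) x)) = 0.
Proof.
pose e : R := N.+1%:R^-1.
pose O (x : V) := cR (Om k e x).
pose h (x : V) := p.@[cofr x] * O x.
pose h' (x : V) := (p^`M(i)).@[cofr x] * O x +
  p.@[cofr x] * (cR (2 * k) * \sum_(j | j != i) cR (kern e x i j)) * O x.
have pk : pg (fun x : V => cR (2 * k) * \sum_(j | j != i) cR (kern e x i j)).
  by apply: pgZ; apply: pg_sum => j; exact: kern_pg (e_gt0 N).
have ph : pg h := pgM (pg_meval p) (@pgOm N).
have ph' : pg h'.
  exact: (pgD (pgM (pg_meval _) (@pgOm N)) (pgM (pgM (pg_meval p) pk) (@pgOm N))).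
have dh : along h h' i.
  move=> x px; apply: (cderiv_eq (cderivM (cderiv_meval p x i) (cderiv_cR (Om_deriv k x i (e_gt0 N))))).
  by rewrite updo_id /h' /O cRM !cRM cR_sum !mulrA.
have hc : pg (fun x : V => 1 + a - cR s * cR (x i)).
  apply: (@pg_ext _ _ (fun x => (1 + a) + (- cR s) * cR (x i))); first by move=> x _; rewrite mulNr.
  by apply: pgD; [exact: pg_cst|apply: pgZ; exact: pg_coord].
rewrite -[RHS](IBP a_gt s_gt0 ph ph' dh).
under eq_bigr do rewrite -antisym_kern.
have pj j : pg (fun x : V => ('X_i * p).@[cofr x] * cR (kern e x i j) * O x).
  exact: (pgM (pgM (pg_meval _) (kern_pg i j (e_gt0 N))) (@pgOm N)).
rewrite -mulr_sumr -(I_sum a_gt s_gt0 _ _ pj) mulrA -(IZ a_gt s_gt0); last exact: pg_sum.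
rewrite -(ID a_gt s_gt0); last 2 first.
- exact: (pgM (pgD (pgM (pg_coord R i) (pg_meval _)) (pgM hc (pg_meval p))) (@pgOm N)).
- by apply: pgZ; exact: pg_sum.
apply: I_eq => x _; rewrite /h /h' -/e -/(O x) -mulr_suml -mulr_sumr mpoly.mevalM mpoly.mevalXU.
rewrite cRM cR_nat; set K := \sum_(_ | _) _; set D := (p^`M(i)).@[_]; set E := p.@[_].
rewrite -[cofr x i]/(cR (x i)).
by move: (O x) K D E (cR (x i)) (cR s) (cR k) => *; ring.
Qed.

(* The Dunkl operator is skew-adjoint with respect to the measure omega; combined with the
   logarithmic derivative of the weight this gives the recursion for the moments. *)
Lemma key_identity i (p : P) :
  cR s * I (fun x => ('X_i * p).@[cofr x] * cR (omega k x)) =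
  I (fun x => (T (cR k) i ('X_i * p) + a *: p).@[cofr x] * cR (omega k x)).
Proof.
have [c [q hO]] := Om_pgb n k_ge0.
have hON N : pgb c q (fun x : V => cR (Om k (N.+1%:R^-1) x)).
  by apply: hO; rewrite invr_ge0 ler0n invf_le1 ?ltr0n // ler1n.
have hO0 : pgb c q (fun x : V => cR (Om k 0 x)) by apply: hO; rewrite lexx ler01.
have pO0 : pg (fun x : V => cR (Om k 0 x)) by exists c, q.
pose A (x : V) := cR (x i) * (p^`M(i)).@[cofr x] + (1 + a - cR s * cR (x i)) * p.@[cofr x].
have hc : pg (fun x : V => 1 + a - cR s * cR (x i)).
  apply: (@pg_ext _ _ (fun x => (1 + a) + (- cR s) * cR (x i))); first by move=> x _; rewrite mulNr.
  by apply: pgD; [exact: pg_cst|apply: pgZ; exact: pg_coord].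
have [cA [qA hA]] : pg A.
  exact: (pgD (pgM (pg_coord R i) (pg_meval _)) (pgM hc (pg_meval p))).
have pA : pg A by exists cA, qA.
have c1 : ccvg (fun N => I (fun x => A x * cR (Om k (N.+1%:R^-1) x))) (I (fun x => A x * cR (Om k 0 x))).
  apply: (I_cvg a_gt s_gt0 (c := cA * c) (q := (qA + q)%N)) => [N||x px].
  - exact: pgbM (hON N).
  - exact: pgbM.
  - by apply: ccvgM; [exact: ccvg_cst|exact: Om_cvg0].
have c2 j : j != i -> ccvg (fun N => cR k * I (fun x => (dd i j ('X_i * p)).@[cofr x] *
        cR (damp (N.+1%:R^-1) i j x) * cR (Om k (N.+1%:R^-1) x)))
     (cR k * I (fun x => (dd i j ('X_i * p)).@[cofr x] * cR (Om k 0 x))).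
  (* For k = 0 the damping factor need not converge to 1 on the hyperplane, but the whole term
     carries the factor k. *)
  move=> ji; have [k0|kn0] := eqVneq k 0.
    by rewrite k0 cR0; under eq_fun do rewrite mul0r; rewrite mul0r; exact: ccvg_cst.
  have k_gt0 : 0 < k / 2 by rewrite divr_gt0 // lt_neqAle eq_sym kn0.
  apply: ccvgM; first exact: ccvg_cst.
  have [cB [qB hB]] := pg_meval (dd i j ('X_i * p)).
  apply: (I_cvg a_gt s_gt0 (c := cB * 1 * c) (q := (qB + 0 + q)%N)) => [N||x px].
  - apply: pgbM (hON N); apply: pgbM => //; split=> // [x px|xs x pxs px cx].
      rewrite cabs_cR mulr1; have /andP[d0 d1] := damp_bounds i j x (e_gt0 N).
      by rewrite ger0_norm.
    apply: ccvg_cR; apply: cvgM; first by apply: exprn_cvg; apply: cvgB; exact: cx.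
    apply: cvgV; first by rewrite gt_eqF // ltr_wpDl // sqr_ge0.
    by apply: cvgD; [apply: exprn_cvg; apply: cvgB; exact: cx|exact: cvg_cst].
  - rewrite mulr1 addn0; exact: pgbM.
  - under eq_fun do rewrite -mulrA; apply: ccvgM; first exact: ccvg_cst.
    (* On the hyperplane [damp] is identically 0, and for positive k the limiting weight vanishes
       there as well. *)
    have [xij|xij] := eqVneq (x i) (x j).
      have -> : Om k 0 x = 0.
        rewrite /Om (bigD1 (i, j)) /=; last by rewrite eq_sym.
        by rewrite xij subrr expr0n addr0 powR0 ?mul0r // gt_eqF.
      under eq_fun do rewrite /damp xij subrr expr0n mul0r cR0 mul0r.
      exact: ccvg_cst.
    rewrite -[X in ccvg _ X]mul1r; apply: ccvgM; last exact: Om_cvg0.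
    have d0 : 0 < (x i - x j) ^+ 2 by rewrite exprn_even_gt0 //= subr_eq0.
    rewrite -[X in ccvg _ X](cR1 R); apply: ccvg_cR; rewrite -[X in _ --> X](divff (lt0r_neq0 d0)); apply: cvgM; first exact: cvg_cst.
    apply: cvgV; first exact: lt0r_neq0.
    by rewrite -[X in _ --> X]addr0; apply: cvgD; [exact: cvg_cst|exact: invS_cvg0].
have c3 := ccvgD c1 (ccvg_sum (index_enum _) c2).
have z0 : I (fun x => A x * cR (Om k 0 x)) +
    \sum_(j | j != i) cR k * I (fun x => (dd i j ('X_i * p)).@[cofr x] * cR (Om k 0 x)) = 0.
  apply: (ccvg_unique c3); rewrite [X in ccvg X _](_ : _ = fun=> 0); first exact: ccvg_cst.
  by apply/funext => N; rewrite -mulr_sumr; exact: approx_identity.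
have pdd j : pg (fun x : V => (dd i j ('X_i * p)).@[cofr x] * cR (Om k 0 x)).
  exact: (pgM (pg_meval _) pO0).
have eO (q0 : P) : I (fun x => q0.@[cofr x] * cR (omega k x)) = I (fun x => q0.@[cofr x] * cR (Om k 0 x)).
  by apply: I_eq => x _; rewrite omega_Om.
have pq (q0 : P) : pg (fun x : V => q0.@[cofr x] * cR (Om k 0 x)).
  exact: (pgM (pg_meval _) pO0).
pose B (x : V) := A x * cR (Om k 0 x) +
  cR k * \sum_(j | j != i) (dd i j ('X_i * p)).@[cofr x] * cR (Om k 0 x).
have zB : I B = 0.
  rewrite -[RHS]z0 -mulr_sumr -(I_sum a_gt s_gt0 _ _ pdd) -(IZ a_gt s_gt0); last exact: pg_sum.
  by rewrite (ID a_gt s_gt0 (pgM pA pO0)) //; apply: pgZ; exact: pg_sum.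
have pB : pg B.
  by apply: pgD; [exact: pgM|apply: pgZ; exact: pg_sum].
rewrite !eO -[LHS]addr0 -[X in _ + X = _]zB -(IZ a_gt s_gt0) // -(ID a_gt s_gt0) //; last exact: pgZ.
apply: I_eq => x _; rewrite /B -mulr_suml TE mpoly.mevalD mpoly.mevalZ mpoly.mevalD mpoly.mevalZ.
rewrite mpoly.mderivM mderivX1 eqxx mul1r mpoly.mevalD !mpoly.mevalM mpoly.mevalXU.
rewrite [mpoly.meval _ (\sum_(j | j != i) _)]rmorph_sum /A -[cofr x i]/(cR (x i)).
set D := (p^`M(i)).@[_]; set S := \sum_(_ | _) _.
by move: (cR (Om _ _ _)) (cR k) (cR s) (cR (x i)) (p.@[_]) D S => *; ring.
Qed.
End KeyIdentity.

(** * Differentiability from a quadratic remainder *)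

Section QuadraticRemainder.
Local Open Scope classical_set_scope.

Lemma quad_deriv (K : numFieldType) (f : K -> K) (t d M r : K) : 0 < r -> 0 <= M ->
  (forall h, `|h| <= r -> `|f (h + t) - f t - h * d| <= M * `|h| ^+ 2) -> is_derive t 1 f d.
Proof.
move=> r0 M0 hf.
have hc : (fun h => h^-1 *: ((f \o shift t) (h *: 1) - f t)) @ 0^' --> d.
  have M1 : 0 < M + 1 by rewrite ltr_wpDl.
  apply/cvgrPdist_le => e e0; near=> h.
  have h0 : h != 0 by near: h; exact: nbhs_dnbhs_neq.
  have hr : `|h| <= r by near: h; exact: dnbhs0_le.
  have he : `|h| <= e / (M + 1) by near: h; apply: dnbhs0_le; rewrite divr_gt0.
  have hn : 0 < `|h| by rewrite normr_gt0.
  have -> : d - h^-1 *: ((f \o shift t) (h *: 1) - f t) = - (h^-1 * (f (h + t) - f t - h * d)).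
    rewrite /= /GRing.scale /= mulr1 [X in _ = - X]mulrBr mulKf // opprB; congr (_ - _).
  rewrite normrN normrM normfV ler_pdivrMl //; apply: (le_trans (hf h hr)).
  rewrite expr2 mulrCA ler_wpM2l //.
  rewrite ler_pdivlMr // in he; apply: le_trans he.
  by rewrite mulrC ler_wpM2l // lerDl.
split; first by apply/cvg_ex; exists d.
exact: (cvg_lim (@norm_hausdorff _ _) hc).
Unshelve. all: by end_near.
Qed.
End QuadraticRemainder.

(** * Complex series and termwise differentiation *)

Section ComplexSeries.
Local Open Scope classical_set_scope.
Variable R : realType.
Local Notation C := (Cx R).
Implicit Types (u v : nat -> C) (c : nat -> R) (t : C).

Definition psum u (N : nat) : C := \sum_(0 <= m < N) u m.
Definition csum u : C :=
  ((limn (series (fun m => cRe (u m)))) +i* (limn (series (fun m => cIm (u m)))))%C.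

Lemma cRe_sum (I : Type) (r : seq I) (f : I -> C) : cRe (\sum_(i <- r) f i) = \sum_(i <- r) cRe (f i).
Proof. by elim: r => [|i r IHr]; rewrite ?big_nil // !big_cons cReD IHr. Qed.
Lemma cIm_sum (I : Type) (r : seq I) (f : I -> C) : cIm (\sum_(i <- r) f i) = \sum_(i <- r) cIm (f i).
Proof. by elim: r => [|i r IHr]; rewrite ?big_nil // !big_cons cImD IHr. Qed.

Lemma csumP c u : cvgn (series c) -> (forall m, cabs (u m) <= c m) -> ccvg (psum u) (csum u).
Proof.
move=> cc h.
have key (f : C -> R) : (forall z, `|f z| <= cabs z) -> cvgn (series (fun m => f (u m))).
  move=> hf; apply: normed_cvg; apply: (@series_le_cvg _ _ c) => // m /=.
  - exact: normr_ge0.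
  - exact: le_trans (cabs_ge0 _) (h m).
  - exact: le_trans (hf _) (h m).
split; rewrite /psum /csum /=.
- have := key _ (@cabs_ge_Re R); rewrite [X in X @ _ --> _](_ : _ = series (fun m => cRe (u m))) //.
  by apply/funext => N; rewrite cRe_sum.
- have := key _ (@cabs_ge_Im R); rewrite [X in X @ _ --> _](_ : _ = series (fun m => cIm (u m))) //.
  by apply/funext => N; rewrite cIm_sum.
Qed.

Lemma csum_le c u : cvgn (series c) -> (forall m, cabs (u m) <= c m) -> cabs (csum u) <= limn (series c).
Proof.
move=> cc h; apply: (cvgr_to_le (cvg_cabs (csumP cc h))); apply: nearW => N.
apply: (@le_trans _ _ (series c N)).
  rewrite /psum /series /=; apply: le_trans (cabs_sum _ _ _) _; exact: ler_sum.
apply: nondecreasing_cvgn_le => //; apply/nondecreasing_seqP => m.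
by rewrite /series /= big_nat_recr //= lerDl (le_trans (cabs_ge0 _) (h m)).
Qed.

Lemma cvg_expseries (K : R) : cvgn (series (fun m => K ^+ m / m`!%:R)).
Proof. by have := @is_cvg_series_exp_coeff R K. Qed.

(** First order expansion at 0 on the unit disc, with value, slope and quadratic remainder
    controlled together by X. The class is stable under affine factors ([tame_aff]), finite
    combinations and summable series ([tame_csum]), which follows the recursion for [dunkl_pol]
    without any interchange of limit and derivative. *)
Definition tame (X : R) (p : C -> C) (b : C) := exists Q : R,
  [/\ 0 <= Q, forall t, cabs t <= 1 -> cabs (p t - p 0 - t * b) <= Q * cabs t ^+ 2 &
      cabs (p 0) + cabs b + Q <= X].

Lemma tame_le X Y p b : X <= Y -> tame X p b -> tame Y p b.
Proof. by move=> XY [Q [h1 h2 h3]]; exists Q; split=> //; exact: le_trans XY. Qed.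

Lemma tame_cst (z : C) : tame (cabs z) (fun=> z) 0.
Proof.
exists 0; split=> // [t _|]; last by rewrite cabs0 !addr0.
by rewrite subrr mulr0 subr0 cabs0 mul0r.
Qed.

Lemma tame_bound X p b t : tame X p b -> cabs t <= 1 -> cabs (p t) <= X.
Proof.
move=> [Q [Q0 h hX]] t1; apply: le_trans hX.
rewrite -[p t](subrK (p 0 + t * b)); apply: le_trans (cabsD _ _) _; rewrite addrC.
apply: lerD; first by apply: le_trans (cabsD _ _) _; rewrite lerD2l cabsM ler_piMl ?cabs_ge0.
rewrite opprD addrA; apply: le_trans (h t t1) _.
by rewrite ler_piMr // expr_le1 ?cabs_ge0.
Qed.

Lemma tame_lin (I : finType) (q b : I -> C) (p : I -> C -> C) (X : I -> R) :
  (forall i, tame (X i) (p i) (b i)) ->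
  tame (\sum_i cabs (q i) * X i) (fun t => \sum_i q i * p i t) (\sum_i q i * b i).
Proof.
move=> /choice[Q hQ]; exists (\sum_i cabs (q i) * Q i); split.
- by apply: sumr_ge0 => i _; rewrite mulr_ge0 ?cabs_ge0 //; case: (hQ i).
- move=> t t1; rewrite mulr_sumr -!sumrB mulr_suml; apply: le_trans (cabs_sum _ _ _) _.
  apply: ler_sum => i _; have [_ h _] := hQ i.
  by rewrite mulrCA -!mulrBr cabsM -mulrA ler_wpM2l ?cabs_ge0 ?h.
- apply: (@le_trans _ _ (\sum_i cabs (q i) * (cabs (p i 0) + cabs (b i) + Q i))).
    rewrite [leRHS](eq_bigr (fun i => cabs (q i * p i 0) + cabs (q i * b i) + cabs (q i) * Q i)).
      by rewrite !big_split /= lerD2r lerD // cabs_sum.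
    by move=> i _; rewrite !mulrDr !cabsM.
  by apply: ler_sum => i _; rewrite ler_wpM2l ?cabs_ge0 //; case: (hQ i).
Qed.

Lemma tame_aff (K X : R) (al be : C) p b : tame X p b -> cabs al + cabs be <= K ->
  tame (K * X) (fun t => (al + t * be) * p t) (be * p 0 + al * b).
Proof.
move=> [Q [Q0 h hX]] hK.
have [a0 b0 c0 d0] : [/\ 0 <= cabs al, 0 <= cabs be, 0 <= cabs b & 0 <= cabs (p 0)] by rewrite !cabs_ge0.
exists ((cabs al + cabs be) * Q + cabs be * cabs b); split.
- by rewrite addr_ge0 // mulr_ge0 // addr_ge0.
- move=> t t1.
  have -> : (al + t * be) * p t - (al + 0 * be) * p 0 - t * (be * p 0 + al * b) =
    (al + t * be) * (p t - p 0 - t * b) + t ^+ 2 * (be * b) by ring.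
  apply: le_trans (cabsD _ _) _; rewrite [leRHS]mulrDl; apply: lerD.
    rewrite cabsM -mulrA; apply: ler_pM; rewrite ?cabs_ge0 ?h //.
    by apply: le_trans (cabsD _ _) _; rewrite lerD2l cabsM ler_piMl.
  by rewrite (cabsM (t ^+ 2)) cabsM cabsX mulrC.
- apply: (@le_trans _ _ ((cabs al + cabs be) * X)); last first.
    by rewrite ler_wpM2r // (le_trans _ hX) // !addr_ge0.
  apply: (@le_trans _ _ ((cabs al + cabs be) * (cabs (p 0) + cabs b + Q))); last first.
    by rewrite ler_wpM2l // addr_ge0.
  rewrite mul0r addr0 cabsM; have := cabsD (be * p 0) (al * b); rewrite !cabsM.
  by nra.
Qed.

Lemma tame_deriv X p b : tame X p b -> is_derive (0 : C) 1 p b.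
Proof.
move=> [Q [Q0 h _]]; apply: (@quad_deriv C p 0 b (cR Q) 1) => // [|t]; first exact: cR_ge0.
rewrite norm_cabs -cR1 lecR addr0 => t1.
by rewrite !norm_cabs -!(rmorphXn (real_complex R)) /= -cRM lecR h.
Qed.

Lemma csum_lin (u v w : nat -> C) (t : C) (c d e : nat -> R) : cvgn (series c) -> cvgn (series d) -> cvgn (series e) ->
  (forall m, cabs (u m) <= c m) -> (forall m, cabs (v m) <= d m) -> (forall m, cabs (w m) <= e m) ->
  ccvg (psum (fun m => u m - v m - t * w m)) (csum u - csum v - t * csum w).
Proof.
move=> cc cd ce hu hv hw.
rewrite [X in ccvg X _](_ : _ = fun N => psum u N + -1 * psum v N + - t * psum w N); last first.
  apply/funext => N; rewrite /psum !mulr_sumr -!big_split /=; apply: eq_bigr => m _.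
  by rewrite mulN1r mulNr.
have -> : csum u - csum v - t * csum w = csum u + -1 * csum v + - t * csum w by rewrite mulN1r mulNr.
apply: ccvgD; last by apply: ccvgM; [exact: ccvg_cst|exact: csumP hw].
by apply: ccvgD; [exact: csumP hu|apply: ccvgM; [exact: ccvg_cst|exact: csumP hv]].
Qed.

Lemma tame_csum (X : nat -> R) (p : nat -> C -> C) (b : nat -> C) : cvgn (series X) ->
  (forall m, tame (X m) (p m) (b m)) -> is_derive (0 : C) 1 (fun t => csum (p^~ t)) (csum b).
Proof.
move=> cX hp.
have t0 : cabs (0 : C) <= 1 by rewrite cabs0.
have p0 m : 0 <= X m := le_trans (cabs_ge0 _) (tame_bound (hp m) t0).
have S0 : 0 <= limn (series X).
  by apply: limr_ge => //; apply: nearW => N; apply: sumr_ge0.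
apply: (@quad_deriv C _ 0 _ (cR (limn (series X))) 1) => // [|t]; first exact: cR_ge0.
rewrite norm_cabs -cR1 lecR addr0 => t1.
rewrite !norm_cabs -!(rmorphXn (real_complex R)) /= -cRM lecR.
have hb m : cabs (b m) <= X m.
  by have [Q [Q0 _ h]] := hp m; apply: le_trans h; have := cabs_ge0 (p m 0); lra.
have cz : ccvg (psum (fun m => p m t - p m 0 - t * b m)) (csum (p^~ t) - csum (p^~ 0) - t * csum b).
  apply: (csum_lin t cX cX cX) => m //; first exact: tame_bound (hp m) t1.
  exact: tame_bound (hp m) t0.
have cX2 : cvgn (series (fun m => cabs t ^+ 2 * X m)).
  by have := is_cvg_seriesZ (k := cabs t ^+ 2) cX; apply.
have h m : cabs (p m t - p m 0 - t * b m) <= cabs t ^+ 2 * X m.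
  have [Q [Q0 h hX]] := hp m; rewrite [leRHS]mulrC; apply: le_trans (h t t1) _.
  rewrite ler_wpM2r ?sqr_ge0 // (le_trans _ hX) // lerDr addr_ge0 ?cabs_ge0 //.
rewrite (ccvg_unique cz (csumP cX2 h)); apply: le_trans (csum_le cX2 h) _.
by rewrite (lim_seriesZ _ cX) [leRHS]mulrC.
Qed.
End ComplexSeries.

(** * Convergence of the kernel series and the Dunkl system for its sum *)

Section DunklSeries.
Local Open Scope classical_set_scope.
Variable R : realType.
Local Notation C := (Cx R).
Variables (n : nat) (k : R).
Hypotheses (k0 : 0 <= k) (n0 : (0 < n)%N).
Local Notation E := (dunkl_pol (cR_ge0 k0)).
Local Notation res := (resolvent (cR_ge0 k0) (n := n)).
Implicit Types (lam z : 'I_n -> C).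

Lemma sum_resolvent m : \sum_w cabs (res m w) <= m.+1%:R^-1.
Proof.
have := resolvent_norm n (cR_ge0 k0) m.
under eq_bigr do rewrite norm_cabs.
by rewrite -cR_sum -(cR_nat R m.+1) -[_^-1](fmorphV (real_complex R)) lecR.
Qed.

Lemma meval_linform lam (v : 'I_n -> C) : (linform lam).@[v] = \sum_i lam i * v i.
Proof. by rewrite rmorph_sum /=; apply: eq_bigr => i _; rewrite mpoly.mevalZ mpoly.mevalXU. Qed.

Lemma meval_dunkl_polS lam m (v : 'I_n -> C) :
  (E lam m.+1).@[v] = \sum_w res m w * ((\sum_i lam i * v (w i)) * (E lam m).@[v \o w]).
Proof.
rewrite /= rmorph_sum /=; apply: eq_bigr => w _.
by rewrite mpoly.mevalZ meval_msym mpoly.mevalM meval_linform.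
Qed.

Lemma sum_res_le m (X : R) : 0 <= X -> \sum_w cabs (res m w) * X <= X / m.+1%:R.
Proof. by move=> X0; rewrite -mulr_suml mulrC ler_wpM2l // sum_resolvent. Qed.

Lemma factS (K : R) m : K * (K ^+ m / m`!%:R) / m.+1%:R = K ^+ m.+1 / (m.+1)`!%:R.
Proof. by rewrite factS natrM invfM exprS -!mulrA; congr (_ * (_ * _)); rewrite mulrC. Qed.

(** One step of the recursion costs a factor K from the linear form and 1/(m + 1) from the total
    mass of the resolvent. The bound K must cover all permutations because the resolvent mixes
    them. *)
Lemma dunkl_pol_bound lam z (K : R) : 0 <= K ->
  (forall w : {perm 'I_n}, cabs (\sum_i lam i * z (w i)) <= K) ->
  forall m (u : {perm 'I_n}), cabs (E lam m).@[z \o u] <= K ^+ m / m`!%:R.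
Proof.
move=> K0 hK; elim=> [|m IHm] u; first by rewrite /= mpoly.meval1 cabs1 divr1.
rewrite meval_dunkl_polS -factS.
apply: le_trans (sum_res_le m _); last by rewrite mulr_ge0 // divr_ge0 // exprn_ge0.
apply: le_trans (cabs_sum _ _ _) _; apply: ler_sum => w _.
rewrite !cabsM ler_wpM2l ?cabs_ge0 //; apply: ler_pM; rewrite ?cabs_ge0 //.
  have := hK (w * u)%g; rewrite (eq_bigr (fun i => lam i * (z \o u) (w i))) // => i _.
  by rewrite permM.
have -> : (E lam m).@[(z \o u) \o w] = (E lam m).@[z \o (w * u)%g].
  by apply: mpoly.meval_eq => i /=; rewrite permM.
exact: IHm.
Qed.

Lemma tame_dunkl (lam z : C -> 'I_n -> C) (K : R) : 0 <= K ->
  (forall w : {perm 'I_n}, exists al be, cabs al + cabs be <= K /\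
     forall t, \sum_i lam t i * z t (w i) = al + t * be) ->
  forall m (u : {perm 'I_n}), exists b,
    tame (K ^+ m / m`!%:R) (fun t => (E (lam t) m).@[z t \o u]) b.
Proof.
move=> K0 hK; elim=> [|m IHm] u.
  exists 0; have := tame_cst (1 : C); rewrite cabs1 divr1 /=.
  by rewrite (_ : (fun t => _) = fun=> 1) //; apply/funext => t; rewrite mpoly.meval1.
pose X := K * (K ^+ m / m`!%:R).
have step (w : {perm 'I_n}) : exists b, tame X (fun t => (\sum_i lam t i * z t (u (w i))) *
    (E (lam t) m).@[(z t \o u) \o w]) b.
  have [al [be [h1 h2]]] := hK (w * u)%g; have [b hb] := IHm (w * u)%g.
  have := tame_aff hb h1.
  set f := (X in tame _ X _); set b' := (X in tame _ _ X) => h; exists b'.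
  rewrite (_ : (fun t => _) = f) //; apply/funext => t; rewrite /f -h2; congr (_ * _).
    by apply: eq_bigr => i _; rewrite permM.
  by apply: mpoly.meval_eq => i /=; rewrite permM.
have [b hb] := choice step.
exists (\sum_w res m w * b w); rewrite -factS.
apply: tame_le (sum_res_le m _) _; first by rewrite mulr_ge0 // divr_ge0 // exprn_ge0.
have := tame_lin (res m) hb; rewrite (_ : (fun t => \sum_w _) = fun t => (E (lam t) m.+1).@[z t \o u]) //.
by apply/funext => t; rewrite meval_dunkl_polS.
Qed.

Definition Eser lam z : C := csum (fun m => (E lam m).@[z]).

Lemma comp_id1 z : z \o (1%g : {perm 'I_n}) = z.
Proof. by apply/funext => i /=; rewrite perm1. Qed.

(** The pairings are only required to be affine in t, so lines in lam and lines in z are covered at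
    once. The slopes are returned with a summable bound, to be matched with the derivatives of the
    terms. *)
Lemma Eser_line (lam z : C -> 'I_n -> C) :
  (forall w : {perm 'I_n}, exists al be, forall t, \sum_i lam t i * z t (w i) = al + t * be) ->
  exists2 b : nat -> C, (forall m, exists X, tame X (fun t => (E (lam t) m).@[z t]) (b m)) &
    (exists2 c : nat -> R, cvgn (series c) & forall m, cabs (b m) <= c m) /\
    is_derive (0 : C) 1 (fun t => Eser (lam t) (z t)) (csum b).
Proof.
move=> /choice[al /choice[be h]].
pose K := \sum_w (cabs (al w) + cabs (be w)).
have K0 : 0 <= K by apply: sumr_ge0 => w _; rewrite addr_ge0 ?cabs_ge0.
have hK (w : {perm 'I_n}) : exists al be, cabs al + cabs be <= K /\ forall t, \sum_i lam t i * z t (w i) = al + t * be.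
  exists (al w), (be w); split=> //; rewrite /K (bigD1 w) //= lerDl.
  by apply: sumr_ge0 => v _; rewrite addr_ge0 ?cabs_ge0.
have /choice[b hb] : forall m, exists b, tame (K ^+ m / m`!%:R) (fun t => (E (lam t) m).@[z t]) b.
  by move=> m; have [b hb] := tame_dunkl K0 hK m 1%g; exists b; move: hb; under eq_fun do rewrite comp_id1.
exists b; first by move=> m; exists (K ^+ m / m`!%:R).
have H := tame_csum (p := fun m t => (E (lam t) m).@[z t]) (@cvg_expseries R K) hb.
split; last by rewrite /Eser.
exists (fun m => K ^+ m / m`!%:R); first exact: (@cvg_expseries R K).
by move=> m; have [Q [Q0 _ hQ]] := hb m; apply: le_trans hQ; have := cabs_ge0 (E (lam 0) m).@[z 0]; lra.
Qed.

Lemma Eser_cvg lam z : ccvg (psum (fun m => (E lam m).@[z])) (Eser lam z).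
Proof.
pose K := \sum_(w : {perm 'I_n}) cabs (\sum_i lam i * z (w i)).
apply: (csumP (@cvg_expseries R K)) => m.
have := @dunkl_pol_bound lam z K _ _ m 1%g; rewrite comp_id1; apply.
- by apply: sumr_ge0 => w _; exact: cabs_ge0.
- by move=> w; rewrite /K (bigD1 w) //= lerDl sumr_ge0 // => v _; exact: cabs_ge0.
Qed.

Lemma psum_shift (u : nat -> C) l : ccvg (psum u) l -> u 0%N = 0 -> ccvg (psum (fun m => u m.+1)) l.
Proof.
move=> [h1 h2] u0; rewrite (_ : psum _ = fun N => psum u N.+1).
  by split; [move: h1|move: h2]; rewrite -cvg_shiftS.
by apply/funext => N; rewrite /psum big_nat_recl // u0 add0r.
Qed.

(** The operator may be applied term by term; it sends degree m + 1 to the eigenvalue times degree m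
    and kills degree 0, so the series reproduces itself after a shift. *)
Lemma Eser_Dunkl lam xi x : regular x -> Dunkl k xi (Eser lam) x = bil lam (cofr xi) * Eser lam x.
Proof.
move=> rx.
have aff (w : {perm 'I_n}) : exists al be, forall t,
    \sum_i lam i * vadd x (vscale t (cofr xi)) (w i) = al + t * be.
  exists (\sum_i lam i * x (w i)), (\sum_i lam i * cofr xi (w i)) => t.
  rewrite mulr_sumr -big_split /=; apply: eq_bigr => i _.
  by rewrite /vadd /vscale mulrDr mulrCA.
have [b hb [[c cc hc] db]] := @Eser_line (fun=> lam) (fun t => vadd x (vscale t (cofr xi))) aff.
have bE m : b m = dderiv (fun y => (E lam m).@[y]) x (cofr xi).
  by have [X /tame_deriv [_ <-]] := hb m.
have dE : dderiv (Eser lam) x (cofr xi) = csum b by case: db => _ <-.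
have cb : ccvg (psum b) (csum b) by exact: csumP cc hc.
have h1 : ccvg (psum (fun m => Dunkl k xi (fun y => (E lam m).@[y]) x)) (Dunkl k xi (Eser lam) x).
  rewrite (_ : psum _ = fun N => psum b N + cR k * \sum_(i < n) \sum_(j < n | (i < j)%N)
     cR (xi i - xi j) * ((psum (fun m => (E lam m).@[x]) N +
        -1 * psum (fun m => (E lam m).@[swapv i j x]) N) * (x i - x j)^-1)); last first.
    apply/funext => N; rewrite /psum /Dunkl; under eq_bigr do rewrite -bE.
    rewrite big_split /= -mulr_sumr exchange_big /=; congr (_ + _ * _).
    apply: eq_bigr => i _; rewrite exchange_big /=; apply: eq_bigr => j _.
    by rewrite -mulr_sumr mulN1r -sumrB -mulr_suml.
  rewrite /Dunkl dE; apply: ccvgD => //; apply: ccvgM; first exact: ccvg_cst.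
  apply: ccvg_sum => i _; apply: ccvg_sum => j _; apply: ccvgM; first exact: ccvg_cst.
  apply: ccvgM; last exact: ccvg_cst.
  by rewrite -[X in ccvg _ (_ + X)]mulN1r; apply: ccvgD; [|apply: ccvgM; [exact: ccvg_cst|]]; exact: Eser_cvg.
have eD m : Dunkl k xi (fun y => (E lam m.+1).@[y]) x = bil lam (cofr xi) * (E lam m).@[x].
  rewrite Dunkl_meval // /bil. rewrite big_distrl /=. apply: eq_bigr => i _.
  by rewrite T_dunkl_pol mpoly.mevalZ mulrCA mulrA.
have e0 : Dunkl k xi (fun y => (E lam 0).@[y]) x = 0.
  by rewrite Dunkl_meval //; apply: big1 => i _; rewrite T1 mpoly.meval0 mulr0.
apply: (ccvg_unique (psum_shift h1 e0)).
rewrite (_ : psum _ = fun N => bil lam (cofr xi) * psum (fun m => (E lam m).@[x]) N).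
  by apply: ccvgM; [exact: ccvg_cst|exact: Eser_cvg].
by apply/funext => N; rewrite /psum mulr_sumr; apply: eq_bigr => m _; rewrite eD.
Qed.

Lemma Eser_x0 lam z : (forall w : {perm 'I_n}, \sum_i lam i * z (w i) = 0) -> Eser lam z = 1.
Proof.
move=> h; apply: (ccvg_unique (Eser_cvg lam z)).
suff e N : psum (fun m => (E lam m).@[z]) N.+1 = 1.
  by split; rewrite -cvg_shiftS; under eq_fun do rewrite e; exact: cvg_cst.
rewrite /psum big_nat_recl // big1 ?addr0 /= ?mpoly.meval1 // => m _.
by rewrite meval_dunkl_polS; apply: big1 => w _; rewrite h mul0r mulr0.
Qed.

Lemma Eser_is_kernel : is_DunklKernel k Eser.
Proof.
split; last first.
  move=> l; split=> [xi x|]; first exact: Eser_Dunkl.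
  by apply: Eser_x0 => w; apply: big1 => i _; rewrite mulr0.
split=> [l z i|z l i].
  have [|b _ [_ []//]] := @Eser_line (fun=> l) (fun t => vadd z (vscale t (cbasis R i))).
  move=> w; exists (\sum_j l j * z (w j)), (\sum_j l j * cbasis R i (w j)) => t.
  rewrite mulr_sumr -big_split /=; apply: eq_bigr => j _.
  by rewrite /vadd /vscale mulrDr mulrCA.
have [|b _ [_ []//]] := @Eser_line (fun t => vadd l (vscale t (cbasis R i))) (fun=> z).
move=> w; exists (\sum_j l j * z (w j)), (\sum_j cbasis R i j * z (w j)) => t.
rewrite mulr_sumr -big_split /=; apply: eq_bigr => j _.
by rewrite /vadd /vscale mulrDl mulrA.
Qed.

Lemma DunklE_is_kernel : is_DunklKernel k (@DunklE R n k).
Proof.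
rewrite /DunklE /the_unique; case: pselect => [h|[]]; last by exists Eser; exact: Eser_is_kernel.
exact: (projT2 (cid h)).
Qed.
End DunklSeries.

(** * Energy estimate for the Dunkl system at real points *)

Section RealUniqueness.
Local Open Scope classical_set_scope.
Variable R : realType.
Local Notation C := (Cx R).
Variables (n : nat) (k : R).
Hypothesis k0 : 0 <= k.
Local Notation V := (rvec R n).
Implicit Types (x y z : V) (i j : 'I_n) (lam : 'I_n -> C) (g : V -> C).

(* The Dunkl system restricted to real points, with only separate regularity. *)
Definition Dker lam g :=
  (forall x i (u : nat -> R), u N @[N --> \oo] --> x i -> ccvg (fun N => g (updo x i (u N))) (g x)) /\
  (forall x i, injective x -> cderiv (fun t => g (updo x i t))
     (lam i * g x - cR k * \sum_(j | j != i) (g x - g (vperm (tperm i j) x)) / cR (x i - x j)) (x i)).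

Definition sqN g x : R := \sum_(w : {perm 'I_n}) cabs (g (vperm w x)) ^+ 2.
Definition rdot (z w : C) : R := cRe z * cRe w + cIm z * cIm w.

Lemma isd_sqabs (f : R -> C) df t : cderiv f df t ->
  is_derive t 1 (fun s => cabs (f s) ^+ 2) (2 * rdot (f t) df).
Proof.
case=> a b; rewrite (_ : (fun s => _) = fun s => cRe (f s) * cRe (f s) + cIm (f s) * cIm (f s)); last first.
  by apply/funext => s; rewrite cabs_sqr !expr2.
by apply: (is_derive_eq (isdD (isdM a a) (isdM b b))); rewrite /rdot; ring.
Qed.

Lemma isd_sum (T : Type) (r : seq T) (f : T -> R -> R) (df : T -> R) (t : R) :
  (forall a, is_derive t 1 (f a) (df a)) ->
  is_derive t 1 (fun s => \sum_(a <- r) f a s) (\sum_(a <- r) df a).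
Proof.
move=> h; elim: r => [|a r IHr].
  rewrite big_nil (_ : (fun s => _) = fun=> 0); first exact: isd_cst.
  by apply/funext => s; rewrite big_nil.
rewrite big_cons (_ : (fun s => _) = fun s => f a s + \sum_(a <- r) f a s); first exact: isdD.
by apply/funext => s; rewrite big_cons.
Qed.

Lemma sqN_perm g w x : sqN g (vperm w x) = sqN g x.
Proof.
rewrite /sqN [RHS](reindex_inj (@mulIg _ w)) /=; apply: eq_bigr => v _; congr (cabs (g _) ^+ 2).
by apply/funext => i; rewrite /vperm permM.
Qed.

Lemma sqN_ge0 g x : 0 <= sqN g x. Proof. by apply: sumr_ge0 => w _; exact: sqr_ge0. Qed.

Lemma sqN_eq0 g x : sqN g x <= 0 -> g x = 0.
Proof.
move=> h; have := le_anti (introT andP (conj h (sqN_ge0 g x))) => /eqP.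
rewrite psumr_eq0 => [|w _]; last exact: sqr_ge0.
move=> /allP /(_ 1%g (mem_index_enum _)); rewrite sqrf_eq0 => /eqP /cabs_eq0.
by rewrite (_ : vperm 1 x = x) //; apply/funext => i; rewrite /vperm perm1.
Qed.

Definition dev g x i j : R :=
  \sum_(w : {perm 'I_n}) rdot (g (vperm w x)) (g (vperm w x) - g (vperm (w * tperm i j) x)).

(** Reindexing by right multiplication with the transposition and adding shows that twice [dev] is
    the orbit sum of the squared differences; both bounds follow. *)
Lemma dev_bounds g x i j : 0 <= dev g x i j <= 2 * sqN g x.
Proof.
pose G w := g (vperm w x); pose tau := tperm i j.
have e : dev g x i j + dev g x i j = \sum_(w : {perm 'I_n}) cabs (G w - G (w * tau)%g) ^+ 2.
  rewrite {2}/dev (reindex_inj (@mulIg _ tau)) /= /dev -big_split /=; apply: eq_bigr => w _.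
  rewrite -mulgA tperm2 mulg1 -!/(G _) cabs_sqr /rdot !cReD !cImD !cReN !cImN; ring.
have h0 : 0 <= dev g x i j + dev g x i j by rewrite e; apply: sumr_ge0 => w _; exact: sqr_ge0.
have h1 : dev g x i j + dev g x i j <= 2 * sqN g x + 2 * sqN g x.
  rewrite e -{2}(sqN_perm g tau x) /sqN !mulr_sumr -big_split /=; apply: ler_sum => w _.
  have -> : vperm w (vperm tau x) = vperm (w * tau) x.
    by apply/funext => l; rewrite /vperm permM.
  rewrite -/(G w) -/(G (w * tau)%g) !cabs_sqr cReD cImD cReN cImN.
  have := sqr_ge0 (cRe (G w) + cRe (G (w * tau)%g)); have := sqr_ge0 (cIm (G w) + cIm (G (w * tau)%g)).
  by nra.
by apply/andP; split; lra.
Qed.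

Definition rate lam x i (A : {pred 'I_n}) : R :=
  2 * \sum_j cabs (lam j) + \sum_(j in A) 4 * k / (x j - x i).

(** Over the orbit the difference part sums to [-2k] times the sum of [dev / (x_i - x_j)]. Terms
    with x_j below x_i have a favourable sign and are dropped; for x_j above x_i the bound on [dev]
    gives the rate [4k / (x_j - x_i)]. *)
Lemma sqN_deriv lam g x i : Dker lam g -> injective x ->
  exists2 D, is_derive (x i) 1 (fun t => sqN g (updo x i t)) D &
    D <= rate lam x i [pred j | x i < x j] * sqN g x.
Proof.
move=> [_ dg] ix.
pose L (w : {perm 'I_n}) := lam ((w^-1)%g i) * g (vperm w x) - cR k * \sum_(j | j != i)
   (g (vperm w x) - g (vperm (w * tperm i j) x)) / cR (x i - x j).
have dw (w : {perm 'I_n}) : is_derive (x i) 1 (fun t => cabs (g (vperm w (updo x i t))) ^+ 2)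
    (2 * rdot (g (vperm w x)) (L w)).
  have iw : injective (vperm w x) by move=> a b /ix /perm_inj.
  have xi : vperm w x ((w^-1)%g i) = x i by rewrite /vperm permKV.
  have := dg (vperm w x) ((w^-1)%g i) iw; rewrite xi => h.
  have h2 : cderiv (fun t => g (vperm w (updo x i t))) (L w) (x i).
    apply: (cderiv_eq (cderiv_ext _ h)) => [t|]; first by rewrite vperm_updo.
    rewrite /L; congr (_ - _ * _); rewrite (reindex_inj (@perm_inj _ (w^-1)%g)) /=.
    apply: eq_big => [j|j _]; first by rewrite (inj_eq (@perm_inj _ _)).
    have -> : vperm (tperm ((w^-1)%g i) ((w^-1)%g j)) (vperm w x) = vperm (w * tperm i j) x.
      apply/funext => l; rewrite /vperm permM; congr (x _).
      case: tpermP => [->|->|/eqP h1 /eqP h2]; rewrite ?permKV ?tpermL ?tpermR //.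
      by rewrite tpermD //; [apply: contraNneq h1 => ->|apply: contraNneq h2 => ->]; rewrite permK.
    by rewrite [vperm w x ((w^-1)%g j)]/vperm permKV.
  by have := isd_sqabs h2; rewrite updo_id.
exists (\sum_(w : {perm 'I_n}) 2 * rdot (g (vperm w x)) (L w)).
  exact: (isd_sum (index_enum {perm 'I_n}) dw).
have rdotE (w : {perm 'I_n}) : 2 * rdot (g (vperm w x)) (L w) =
   2 * cRe (lam ((w^-1)%g i)) * cabs (g (vperm w x)) ^+ 2 - 2 * k * \sum_(j | j != i)
     rdot (g (vperm w x)) (g (vperm w x) - g (vperm (w * tperm i j) x)) / (x i - x j).
  have rB (z u v : C) : rdot z (u - v) = rdot z u - rdot z v.
    by rewrite /rdot cReD cImD cReN cImN; ring.
  have rZ (z u : C) (r : R) : rdot z (cR r * u) = r * rdot z u.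
    by rewrite /rdot cReM cImM cRe_cR cIm_cR; ring.
  have rS (z : C) (f : 'I_n -> C) : rdot z (\sum_(j | j != i) f j) = \sum_(j | j != i) rdot z (f j).
    apply: (big_morph (rdot z)) => [u v|]; first by rewrite /rdot cReD cImD; ring.
    by rewrite /rdot !mulr0 addr0.
  rewrite /L rB rZ rS mulrBr; congr (_ - _).
    by rewrite cabs_sqr /rdot cReM cImM; ring.
  rewrite !mulrA; congr (_ * _); apply: eq_bigr => j _.
  by rewrite mulrC -(fmorphV (real_complex R)) -/(cR _) rZ mulrC.
rewrite (eq_bigr _ (fun w _ => rdotE w)) sumrB -mulr_sumr exchange_big /=.
rewrite (eq_bigr (fun j => dev g x i j / (x i - x j))); last by move=> j _; rewrite -mulr_suml.
rewrite /rate [leRHS]mulrDl; apply: lerD.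
  rewrite /sqN [leRHS]mulr_sumr; apply: ler_sum => w _; rewrite ler_wpM2r ?sqr_ge0 // ler_wpM2l //.
  apply: le_trans (ler_norm _) _; apply: le_trans (cabs_ge_Re _) _.
  by rewrite (bigD1 ((w^-1)%g i)) //= lerDl sumr_ge0 // => j _; exact: cabs_ge0.
rewrite -mulrN mulr_suml -sumrN mulr_sumr (bigID (fun j => x i < x j)) /=.
rewrite -[leRHS]addr0; apply: lerD.
  rewrite (eq_bigl (fun j => x i < x j)); last first.
    by move=> j; case: ltgtP => [h|_|_]; rewrite ?andbF ?andbT //; apply: contraTneq h => ->; rewrite ltxx.
  apply: ler_sum => j ij; have /andP[d0 d1] := dev_bounds g x i j.
  have p : 0 < x j - x i by rewrite subr_gt0.
  rewrite -[x i - x j]opprB invrN !mulrN opprK -!mulrA.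
  rewrite [leRHS](_ : _ = 2 * (k * ((2 * sqN g x) * (x j - x i)^-1))); last by ring.
  by rewrite ler_wpM2l // ler_wpM2l // ler_wpM2r // invr_ge0 ltW.
apply: sumr_le0 => j /andP[ji]; rewrite -leNgt => ij; have /andP[d0 d1] := dev_bounds g x i j.
have : 0 <= dev g x i j / (x i - x j) by rewrite divr_ge0 // subr_ge0.
by move=> h; rewrite mulrN oppr_le0; apply: mulr_ge0 => //; exact: mulr_ge0.
Qed.

(** A Gronwall argument: as the i-th coordinate descends without meeting another, its distance to
    the larger ones grows, so the initial rate bounds all later ones. *)
Lemma lower_coord lam g x i (y : R) : Dker lam g -> injective x -> y < x i ->
  (forall j, j != i -> x j < y \/ x i < x j) ->
  sqN g x <= expR (rate lam x i [pred j | x i < x j] * (x i - y)) * sqN g (updo x i y).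
Proof.
move=> dg ix yx hj; set M := rate _ _ _ _.
have inj t : y <= t <= x i -> injective (updo x i t).
  move=> /andP[t1 t2] a b; rewrite /updo; case: (eqVneq a i) => [->|ai]; case: (eqVneq b i) => [->|bi] //.
  - by case: (hj b bi) => h e; move: h; rewrite -e ltNge ?t1 ?t2.
  - by case: (hj a ai) => h e; move: h; rewrite e ltNge ?t1 ?t2.
  - exact: ix.
have dN t : y <= t <= x i -> exists2 D, is_derive t 1 (fun u => sqN g (updo x i u)) D &
    D <= M * sqN g (updo x i t).
  move=> ht; have [D] := sqN_deriv i dg (inj t ht).
  rewrite updo_eq (_ : (fun u => _) = fun u => sqN g (updo x i u)); last by apply/funext => u; rewrite updo_updo.
  move=> hD le; exists D => //; apply: le_trans le _; rewrite ler_wpM2r ?sqN_ge0 // /M /rate lerD2l.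
  rewrite updo_eq; rewrite (eq_bigl [pred j | x i < x j]); last first.
    move=> j; rewrite !inE /updo; case: (eqVneq j i) => [->|ji]; first by rewrite !ltxx.
    have /andP[t1 t2] := ht; case: (hj j ji) => h.
      by rewrite !ltNge (le_trans (ltW h) t1) (ltW (lt_trans h yx)).
    by rewrite h (le_lt_trans t2 h).
  apply: ler_sum => j; rewrite inE => ij; have ji : j != i by apply: contraTneq ij => ->; rewrite ltxx.
  have /andP[t1 t2] := ht; rewrite /updo (negbTE ji) ler_wpM2l ?mulr_ge0 //.
  by rewrite lef_pV2 ?posrE ?subr_gt0 ?(le_lt_trans t2 ij) // lerD2l lerN2.
pose psi t := sqN g (updo x i t) * expR (- M * t).
have dpsi t : y <= t <= x i -> exists2 D, is_derive t 1 psi D & D <= 0.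
  move=> ht; have [D hD le] := dN t ht.
  have he : is_derive t 1 (fun u : R => expR (- M * u)) (- M * expR (- M * t)).
    have h : is_derive t 1 (fun u : R => - M * u) (- M).
      by apply: (is_derive_eq (isdM (isd_cst (- M) t) (is_derive_id t 1))); rewrite mul0r add0r mulr1.
    by apply: (is_derive_eq (is_derive1_comp (is_derive_expR _) h)); rewrite mulrC.
  exists (D * expR (- M * t) + sqN g (updo x i t) * (- M * expR (- M * t))); first exact: isdM.
  rewrite mulrA -mulrDl; apply: mulr_le0_ge0; last exact: expR_ge0.
  by rewrite mulrN subr_le0 mulrC.
have h : psi (x i) <= psi y.
  have hin t : t \in `]y, x i[%R -> y <= t <= x i.
    by rewrite in_itv /= => /andP[a b]; rewrite !ltW.
  apply: (@ler0_derive1_nincr R psi y (x i)) => //; last exact: ltW.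
  - by move=> t /hin /dpsi [D [hD _]].
  - by move=> t /hin /dpsi [D [_ hD]]; rewrite derive1E hD.
  - apply: derivable_within_continuous => t; rewrite in_itv /= => /dpsi [D [hD _] _]; exact: hD.
move: h; rewrite /psi updo_id -ler_pdivlMr ?expR_gt0 // => /le_trans; apply.
rewrite -mulrA -expRN -expRD [leLHS]mulrC (_ : _ + _ = M * (x i - y)) //.
by ring.
Qed.
End RealUniqueness.

(** * Uniqueness of the Dunkl kernel on the positive orthant *)

Section RealUniqueness2.
Local Open Scope classical_set_scope.
Variable R : realType.
Local Notation C := (Cx R).
Variables (n : nat) (k : R).
Hypothesis k0 : 0 <= k.
Local Notation V := (rvec R n).
Implicit Types (x y z : V) (i j : 'I_n) (lam : 'I_n -> C) (g : V -> C).

Lemma sqN_cvg lam g x i (u : nat -> R) : Dker k lam g -> u N @[N --> \oo] --> x i ->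
  sqN g (updo x i (u N)) @[N --> \oo] --> sqN g x.
Proof.
move=> [cg _] cu; rewrite /sqN.
have h (r : seq {perm 'I_n}) : \sum_(w <- r) cabs (g (vperm w (updo x i (u N)))) ^+ 2 @[N --> \oo] -->
    \sum_(w <- r) cabs (g (vperm w x)) ^+ 2.
  elim: r => [|w r IHr]; first by rewrite big_nil; under eq_fun do rewrite big_nil; exact: cvg_cst.
  rewrite big_cons; under eq_fun do rewrite big_cons; apply: cvgD => //.
  apply: exprn_cvg; apply: cvg_cabs; under eq_fun do rewrite vperm_updo.
  by apply: cg; rewrite /vperm permKV.
exact: h.
Qed.

Definition mix x y (m : nat) : V := fun j => if (j < m)%N then x j else y j.

(** The coordinates are lowered below 0 one after the other, the smallest first, so that none
    crosses another. The constant depends on x but not on the target y, which may therefore tend to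
    0 afterwards. *)
Lemma lower_all lam g x : Dker k lam g -> (forall i j, (i < j)%N -> x j < x i) ->
  (forall i, 0 < x i) -> forall m, (m <= n)%N ->
  exists2 K, 0 <= K & forall y, (forall i j, (i < j)%N -> y j < y i) ->
    (forall i, -1 < y i < 0) -> sqN g x <= K * sqN g (mix x y (n - m)).
Proof.
move=> dg dx px; elim=> [|m IHm] mn.
  exists 1 => // y _ _; rewrite mul1r subn0 (_ : mix x y n = x) //.
  by apply/funext => j; rewrite /mix ltn_ord.
have [K K0 hK] := IHm (ltnW mn).
have hi : (n - m.+1 < n)%N by rewrite ltn_subrL //= (leq_ltn_trans _ mn).
pose i := Ordinal hi.
have eS : (n - m = (n - m.+1).+1)%N by rewrite -subSn // subSS.
pose M := rate k lam x i [pred j | x i < x j].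
have M0 : 0 <= M.
  rewrite addr_ge0 ?mulr_ge0 ?sumr_ge0 // => [j _|j]; first exact: cabs_ge0.
  by rewrite inE => h; rewrite divr_ge0 ?mulr_ge0 // subr_ge0 ltW.
exists (K * expR (M * (x i + 1))); first by rewrite mulr_ge0 // expR_ge0.
move=> y dy hy; apply: le_trans (hK y dy hy) _; rewrite -mulrA ler_wpM2l // eS.
pose z := mix x y (n - m.+1).+1.
have zi : z i = x i by rewrite /z /mix ltnSn.
have zlt (j : 'I_n) : (j < i)%N -> z j = x j by move=> h; rewrite /z /mix ltnS ltnW.
have zgt (j : 'I_n) : (i < j)%N -> z j = y j by move=> h; rewrite /z /mix ltnNge h.
have yx (a b : 'I_n) : y a < x b by have /andP[_ h] := hy a; exact: lt_trans h (px b).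
have dz (a b : 'I_n) : (a < b)%N -> z b < z a.
  by move=> ab; rewrite /z /mix; case: ltnP => hb; case: ltnP => ha //; [exact: dx| move: (leq_trans ha (ltnW ab)); rewrite leqNgt hb|exact: dy].
have iz : injective z.
  move=> a b e; apply: val_inj; apply/eqP; case: ltngtP => // /dz; by rewrite e ltxx.
have := @lower_coord R n k k0 lam g z i (y i) dg iz.
rewrite zi => /(_ (yx i i)) h; apply: le_trans (h _) _.
  move=> j ji; case: (ltngtP j i) => [ji'|ij|/val_inj e]; last by rewrite e eqxx in ji.
  - by right; rewrite zlt // dx.
  - by left; rewrite zgt // dy.
have -> : updo z i (y i) = mix x y (n - m.+1).
  apply/funext => j; rewrite /updo; case: (eqVneq j i) => [->|ji]; first by rewrite /mix ltnn.
  rewrite /z /mix ltnS leq_eqVlt; case: eqP => [e|_] //=; case/negP: ji; apply/eqP; exact: val_inj.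
rewrite ler_wpM2r ?sqN_ge0 // ler_expR.
have -> : rate k lam z i [pred j | x i < z j] = M.
  rewrite /M /rate zi; congr (_ + _).
  have e j : (x i < z j) = (j < i)%N.
    case: (ltngtP j i) => [ji|ij|/val_inj ->]; last by rewrite zi ltxx.
    - by rewrite zlt // dx.
    - by rewrite zgt // ltNge (ltW (yx j i)).
  have e' j : (x i < x j) = (j < i)%N.
    case: (ltngtP j i) => [ji|ij|/val_inj ->]; last by rewrite ltxx.
    - by rewrite dx.
    - by rewrite ltNge (ltW (dx _ _ ij)).
  apply: eq_big => j; first by rewrite !inE e e'.
  by rewrite inE e => ji; rewrite zlt.
rewrite ler_wpM2l // lerD2l; have /andP[h1 _] := hy i; by rewrite lerNl ltW.
Qed.

(** Only separate continuity is at hand, so y tends to 0 one coordinate at a time, starting with the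
    largest; this preserves the strict order of those that remain. *)
Lemma collapse_all lam g x : Dker k lam g -> (forall i j, (i < j)%N -> x j < x i) ->
  (forall i, 0 < x i) -> exists2 K, 0 <= K & forall m, (m <= n)%N ->
  forall y, (forall i j, (m <= i)%N -> (i < j)%N -> y j < y i) ->
    (forall i, (m <= i)%N -> -1 < y i < 0) -> sqN g x <= K * sqN g (mix (fun=> 0) y m).
Proof.
move=> dg dx px; have [K K0 hK] := lower_all dg dx px (leqnn n); exists K => //.
elim=> [|m IHm] mn y dy hy.
  apply: le_trans (hK y _ _) _ => [i j|i|]; [exact: dy|exact: hy|].
  by rewrite subnn (_ : mix x y 0 = mix (fun=> 0) y 0).
pose i := Ordinal mn.
(* Y is a negative bound for the coordinates still to be collapsed; the moving one approaches 0
   through values above Y. *)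
have [Y /andP[Y1 Y0] hY] : exists2 Y : R, -1 < Y < 0 & forall j, (i < j)%N -> y j <= Y.
  case: (ltnP m.+1 n) => h.
    exists (y (Ordinal h)); first exact: hy.
    move=> j ij; case: (ltngtP m.+1 j) => e; first by apply/ltW/dy.
    + by move: e; rewrite ltnS leqNgt ij.
    + by rewrite (_ : Ordinal h = j) //; exact: val_inj.
  exists (- 2^-1); first by apply/andP; split; lra.
  by move=> j ij; move: (leq_trans (ltn_ord j) h); rewrite leqNgt ltnS ij.
pose u (N : nat) := Y * N.+2%:R^-1.
have u01 N : Y < u N < 0.
  have p : 0 < N.+2%:R^-1 :> R by rewrite invr_gt0 ltr0n.
  rewrite /u nmulr_rlt0 // p andbT -[ltLHS]mulr1 ltr_nM2l // invf_lt1 ?ltr0n // ltr1n //.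
have cu : u N @[N --> \oo] --> mix (fun=> 0) y m.+1 i.
  rewrite /mix /= ltnSn -[X in _ --> X](mulr0 Y); apply: cvgM; first exact: cvg_cst.
  by have := @invS_cvg0 R; rewrite -(cvg_shiftS (fun N => N.+1%:R^-1 : R)).
have cN : K * sqN g (updo (mix (fun=> 0) y m.+1) i (u N)) @[N --> \oo] --> K * sqN g (mix (fun=> 0) y m.+1).
  by apply: cvgM; [exact: cvg_cst|exact: (sqN_cvg dg cu)].
apply: (cvgr_to_ge cN); apply: nearW => N.
have /andP[uN1 uN0] := u01 N.
apply: le_trans (IHm (ltnW mn) (updo y i (u N)) _ _) _.
- move=> a b ma ab; rewrite /updo.
  have bi : b == i = false by apply/eqP => e; move: (leq_ltn_trans ma ab); rewrite e ltnn.
  rewrite bi; case: (eqVneq a i) => [ai|ai]; first by apply: le_lt_trans uN1; apply: hY; rewrite -ai.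
  by apply: dy => //; rewrite ltn_neqAle ma andbT eq_sym.
- move=> a ma; rewrite /updo; case: (eqVneq a i) => [_|ai]; first by rewrite (lt_trans Y1 uN1).
  by apply: hy; rewrite ltn_neqAle ma andbT eq_sym.
rewrite (_ : mix _ _ m = updo (mix (fun=> 0) y m.+1) i (u N)) //.
apply/funext => j; rewrite /mix /updo; case: (eqVneq j i) => [->|ji]; first by rewrite ltnn.
rewrite ltnS [(j <= m)%N]leq_eqVlt; case: eqP => [e|_] //=.
by case/negP: ji; apply/eqP/val_inj; exact: e.
Qed.

Lemma Dker_zero_sorted lam g x : Dker k lam g -> g (fun=> 0) = 0 ->
  (forall i j, (i < j)%N -> x j < x i) -> (forall i, 0 < x i) -> sqN g x <= 0.
Proof.
move=> dg g0 dx px; have [K K0 hK] := collapse_all dg dx px.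
apply: le_trans (hK n (leqnn n) (fun=> 0) _ _) _ => [i j|i|].
- by rewrite leqNgt ltn_ord.
- by rewrite leqNgt ltn_ord.
rewrite (_ : sqN g _ = 0) ?mulr0 //; apply: big1 => w _.
rewrite (_ : vperm w _ = fun=> 0) ?g0 ?cabs0 ?expr0n //.
by apply/funext => j; rewrite /vperm /mix ltn_ord.
Qed.

Lemma sorting_perm x : injective x -> exists w, forall i j, (i < j)%N -> vperm w x j < vperm w x i.
Proof.
move=> ix; pose A i := [pred l | x i < x l].
have rlt i : (#|A i| < n)%N.
  rewrite -[ltnRHS]card_ord; apply: proper_card; apply/properP; split; first by apply/fintype.subsetP => l.
  by exists i; rewrite // inE ltxx.
pose r i := Ordinal (rlt i).
have mono p q : x p < x q -> (r q < r p)%N.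
  move=> pq /=; apply: proper_card; apply/properP; split.
    by apply/fintype.subsetP => l; rewrite !inE; exact: lt_trans.
  by exists q; rewrite !inE ?ltxx.
have ir : injective r.
  move=> p q e; apply: ix; apply/eqP; case: ltgtP => // /mono; by rewrite e ltnn.
exists (perm ir)^-1%g => i j ij; rewrite /vperm ltNge; apply/negP.
rewrite le_eqVlt => /predU1P[/ix /perm_inj e|]; first by move: ij; rewrite e ltnn.
move=> /mono; have := permKV (perm ir) i; have := permKV (perm ir) j; rewrite !permE => -> ->.
by rewrite ltnNge (ltnW ij).
Qed.

(** Points with distinct coordinates are sorted by a permutation, which does not change the orbit
    sum. Coincidences are removed by perturbing one coordinate at a time, again by separate
    continuity. *)
Lemma Dker_zero lam g x : Dker k lam g -> g (fun=> 0) = 0 -> (forall i, 0 < x i) -> g x = 0.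
Proof.
move=> dg g0.
have T0 y : injective y -> (forall i, 0 < y i) -> g y = 0.
  move=> iy py; have [w hw] := sorting_perm iy; apply: sqN_eq0; rewrite -(sqN_perm g w).
  by apply: (Dker_zero_sorted dg g0 hw) => i; exact: py.
suff T m : (m <= n)%N -> forall y, (forall i, 0 < y i) ->
    (forall i j, (m <= i)%N -> j != i -> y i != y j) -> g y = 0.
  by move=> px; apply: (T n (leqnn n)) => // i j; rewrite leqNgt ltn_ord.
elim: m => [|m IHm] mn y py hy.
  apply: T0 => // a b e; apply/eqP; apply: contraT => ab.
  by have := hy b a (leq0n b) ab; rewrite e eqxx.
pose i := Ordinal mn.
have [cg _] := dg.
have cu : y i + N.+1%:R^-1 @[N --> \oo] --> y i.
  by rewrite -[X in _ --> X]addr0; apply: cvgD; [exact: cvg_cst|exact: invS_cvg0].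
have ev : \forall N \near \oo, forall j, j != i -> y i + N.+1%:R^-1 != y j.
  apply: filter_forall => j; case: (ltP (y i) (y j)) => h.
    have : \forall N \near \oo, N.+1%:R^-1 < y j - y i.
      by apply: (cvgr_lt 0); [exact: invS_cvg0|rewrite subr_gt0].
    by apply: filterS => N hN _; rewrite lt_eqF // addrC -ltrBrDr.
  apply: nearW => N _; rewrite gt_eqF // (le_lt_trans h) // ltrDl invr_gt0 ltr0n //.
have h := cg y i _ cu.
apply: (ccvg_unique h).
have z : \forall N \near \oo, g (updo y i (y i + N.+1%:R^-1)) = 0.
  apply: filterS ev => N hN; apply: (IHm (ltnW mn)).
    by move=> a; rewrite /updo; case: eqP => // _; rewrite addr_gt0 // invr_gt0 ltr0n.
  move=> a b ma ba; rewrite /updo; case: (eqVneq a i) => [ai|ai].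
    by rewrite -ai in hN *; rewrite (negbTE ba) hN.
  have ma' : (m < a)%N by rewrite ltn_neqAle ma andbT eq_sym.
  case: (eqVneq b i) => [bi|bi]; first by rewrite eq_sym hN.
  exact: hy.
split; apply: cvg_near_cst; apply: filterS z => N -> //.
Qed.

Lemma DkerB lam g h : Dker k lam g -> Dker k lam h -> Dker k lam (fun x => g x + -1 * h x).
Proof.
move=> [cg dg] [ch dh]; split=> [x i u cu|x i ix].
  by apply: ccvgD; [exact: cg|apply: ccvgM; [exact: ccvg_cst|exact: ch]].
apply: (cderiv_eq (cderivD (dg x i ix) (cderivZ (-1) (dh x i ix)))).
set S1 := \sum_(_ | _) _; set S2 := \sum_(_ | _) _; set S3 := \sum_(_ | _) _.
have -> : S3 = S1 + -1 * S2.
  rewrite /S1 /S2 /S3 mulr_sumr -big_split /=; apply: eq_bigr => j _.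
  by rewrite mulrA -mulrDl; congr (_ / _); ring.
by ring.
Qed.

Lemma Dker_unique lam g h x : Dker k lam g -> Dker k lam h -> g (fun=> 0) = h (fun=> 0) ->
  (forall i, 0 < x i) -> g x = h x.
Proof.
move=> dg dh e px; apply/eqP; rewrite -subr_eq0 -mulN1r; apply/eqP.
by apply: (Dker_zero (DkerB dg dh)); rewrite // e mulN1r subrr.
Qed.

(** The exponential depends on the invariant sum of the coordinates alone, so it passes through the
    difference part and shifts every lam_i by c. *)
Lemma Dker_exp lam g (c : R) : Dker k lam g ->
  Dker k (fun i => lam i + cR c) (fun x => cR (expR (c * \sum_i x i)) * g x).
Proof.
move=> [cg dg].
have sumE x i t : \sum_j updo x i t j = \sum_(j | j != i) x j + t.
  rewrite (bigD1 i) //= updo_eq addrC; congr (_ + _); apply: eq_bigr => j ji.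
  by rewrite /updo (negbTE ji).
have sumP x w : \sum_j vperm w x j = \sum_j x j by rewrite [RHS](reindex_inj (@perm_inj _ w)).
split=> [x i u cu|x i ix].
  apply: ccvgM; last exact: cg; apply: ccvg_cR.
  rewrite -{2}(updo_id x i) sumE; under eq_fun do rewrite sumE.
  apply: continuous_cvg; first exact: continuous_expR.
  by apply: cvgM; [exact: cvg_cst|apply: cvgD => //; exact: cvg_cst].
have de : is_derive (x i) 1 (fun t => expR (c * \sum_j updo x i t j)) (c * expR (c * \sum_j x j)).
  have -> : (fun t => expR (c * \sum_j updo x i t j)) = fun t => expR (c * (\sum_(j | j != i) x j + t)).
    by apply/funext => t; rewrite sumE.
  have h : is_derive (x i) 1 (fun t : R => c * (\sum_(j | j != i) x j + t)) c.
    apply: (is_derive_eq (isdM (isd_cst c _) (isdD (isd_cst _ _) (is_derive_id _ _)))).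
    by rewrite mul0r !add0r mulr1.
  have := is_derive1_comp (is_derive_expR _) h; rewrite -sumE updo_id mulrC; exact.
apply: (cderiv_eq (cderivM (cderiv_cR de) (dg x i ix))); rewrite updo_id.
rewrite cRM; set e := cR (expR _); set S := \sum_(_ | _) _; set S' := \sum_(_ | _) _.
have -> : S' = e * S.
  by rewrite /S /S' mulr_sumr; apply: eq_bigr => j _; rewrite sumP mulrA mulrBr.
by ring.
Qed.

Lemma holo_line (f : C -> C) (d : C) (t : R) : is_derive (0 : C) 1 f d ->
  cderiv (fun s => f (cR (s - t))) d t.
Proof.
case=> df ed.
have hc : (fun h : C => h^-1 *: ((f \o shift 0) (h *: 1) - f 0)) @ 0^' --> d.
  by rewrite -ed; exact: df.
have key (P : C -> R) : (forall z : C, `|P z| <= cabs z) -> (forall z w : C, P (z - w) = P z - P w) ->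
    (forall (r : R) (z : C), P (cR r * z) = r * P z) -> is_derive t 1 (fun s => P (f (cR (s - t)))) (P d).
  move=> hP PB PZ.
  have hr : (fun h : R => h^-1 *: (((fun s => P (f (cR (s - t)))) \o shift t) (h *: 1) - P (f (cR (t - t)))))
      @ 0^' --> P d.
    apply/cvgrPdist_le => e e0.
    have ce0 : 0 < cR e by rewrite ltcR.
    have := hc; move=> /cvgrPdist_le /(_ _ ce0) /nbhs_ballP[dl /= dl0 hdl].
    have dlE : dl = cR (cRe dl) by move: dl0; rewrite ltcE /= => /andP[/eqP h _]; apply: c_eq.
    have r0 : 0 < cRe dl by move: dl0; rewrite dlE ltcR.
    apply/nbhs_ballP; exists (cRe dl) => //= h; rewrite /ball /= sub0r normrN => hh hn0.
    have := hdl (cR h); rewrite /ball /= sub0r normrN norm_cabs cabs_cR dlE ltcR => /(_ hh).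
    have hn : cR h != 0 by apply: contraNneq hn0 => /(@cR_inj R) ->.
    move=> /(_ hn); rewrite norm_cabs lecR; apply: le_trans.
    rewrite /GRing.scale /= !mulr1 addr0 addrK subrr.
    have -> : (cR h)^-1 = cR h^-1 by rewrite -(fmorphV (real_complex R)).
    by rewrite -PB -PZ -PB hP.
  split; first by apply/cvg_ex; exists (P d).
  exact: (cvg_lim (@norm_hausdorff _ _) hr).
split; apply: key.
- exact: cabs_ge_Re.
- by move=> z w; rewrite cReD cReN.
- by move=> r z; rewrite cReM cRe_cR cIm_cR mul0r subr0.
- exact: cabs_ge_Im.
- by move=> z w; rewrite cImD cImN.
- by move=> r z; rewrite cImM cRe_cR cIm_cR mul0r addr0.
Qed.

Lemma sum_neq_lt (f : 'I_n -> 'I_n -> C) : \sum_i \sum_(j < n | j != i) f i j =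
    \sum_(i < n) \sum_(j < n | (i < j)%N) (f i j + f j i).
Proof.
have -> : \sum_(i < n) \sum_(j < n | (i < j)%N) (f i j + f j i) =
   \sum_(i < n) \sum_(j < n | (i < j)%N) f i j + \sum_(i < n) \sum_(j < n | (j < i)%N) f i j.
  under eq_bigr do rewrite big_split /=; rewrite big_split /=; congr (_ + _).
  by rewrite (exchange_big_dep xpredT).
rewrite -big_split /=; apply: eq_bigr => i _.
rewrite (bigID (fun j : 'I_n => (i < j)%N)) /=; congr (_ + _); apply: eq_bigl => j.
  by rewrite -(inj_eq val_inj) /=; lia.
by rewrite -(inj_eq val_inj) /=; lia.
Qed.

Lemma kernel_Dker (F : cvec R n -> cvec R n -> C) lam : is_DunklKernel k F ->
  Dker k lam (fun x => F lam (cofr x)).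
Proof.
move=> [[hF _] /(_ lam)[dF _]].
have line x i : cderiv (fun t => F lam (cofr (updo x i t)))
    (dderiv (F lam) (cofr x) (cofr (fun j => (j == i)%:R))) (x i).
  have e1 : cofr (fun j => (j == i)%:R) = cbasis R i.
    by apply/funext => j; rewrite /cofr /cbasis cR_nat eq_sym.
  have h : is_derive (0 : C) 1 (fun t => F lam (vadd (cofr x) (vscale t (cbasis R i))))
     (dderiv (F lam) (cofr x) (cbasis R i)) by split; [exact: hF|].
  rewrite e1; apply: (cderiv_ext _ (holo_line (x i) h)) => t; congr (F lam _).
  apply/funext => j; rewrite /vadd /vscale /cbasis /cofr /updo eq_sym; case: (eqVneq j i) => [->|_].
    by rewrite mulr1 -cRD addrC subrK.
  by rewrite mulr0 addr0.
split=> [x i u cu|x i ix].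
  have [[d1 _] [d2 _]] := line x i.
  have c1 := differentiable_continuous (iffLR (derivable1_diffP _ _) d1).
  have c2 := differentiable_continuous (iffLR (derivable1_diffP _ _) d2).
  split; rewrite -{2}(updo_id x i).
  - exact: (cvg_comp _ _ cu c1).
  - exact: (cvg_comp _ _ cu c2).
apply: (cderiv_eq (line x i)).
have rx : regular (cofr x) by move=> a b; apply: contraNneq => /(@cR_inj R) /ix ->.
have := dF (fun j => (j == i)%:R) (cofr x) rx; rewrite /Dunkl.
set D := dderiv _ _ _.
pose Q a b := (F lam (cofr x) - F lam (swapv a b (cofr x))) / (cofr x a - cofr x b).
have -> : \sum_(a < n) \sum_(b < n | (a < b)%N) cR ((a == i)%:R - (b == i)%:R) * Q a b =
    \sum_(j | j != i) Q i j.
  have QC a b : Q b a = - Q a b.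
    rewrite /Q -[cofr x b - _]opprB invrN mulrN; congr (- (_ / _)); congr (_ - F lam _).
    by apply/funext => l; rewrite /swapv tpermC.
  transitivity (\sum_a \sum_(b < n | b != a) cR (a == i)%:R * Q a b).
    rewrite sum_neq_lt; apply: eq_bigr => a _; apply: eq_bigr => b _.
    by rewrite (QC a b) cRB mulrBl mulrN.
  rewrite (bigD1 i) //= [X in _ + X]big1 ?addr0 => [|a /negbTE ->]; last first.
    by apply: big1 => b _; rewrite cR0 mul0r.
  by apply: eq_bigr => b _; rewrite eqxx cR1 mul1r.
have -> : bil lam (cofr (fun j => (j == i)%:R)) = lam i.
  rewrite /bil (bigD1 i) //= /cofr eqxx cR1 mulr1 big1 ?addr0 // => j /negbTE ->.
  by rewrite cR0 mulr0.
have -> : \sum_(j | j != i) (F lam (cofr x) - F lam (cofr (vperm (tperm i j) x))) / cR (x i - x j) =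
    \sum_(j | j != i) Q i j by apply: eq_bigr => j _; rewrite /Q cRB.
by move=> <-; rewrite addrK.
Qed.
End RealUniqueness2.

(** * Dominated convergence for series *)

Section Tannery.
Local Open Scope classical_set_scope.
Variable R : realType.
Local Notation C := (Cx R).

Lemma psum_tail (c : nat -> R) (u : nat -> C) M : cvgn (series c) -> (forall m, cabs (u m) <= c m) ->
  cabs (csum u - psum u M) <= limn (series c) - series c M.
Proof.
move=> cc h.
have c0 m : 0 <= c m by exact: le_trans (cabs_ge0 _) (h m).
have nd : {homo series c : a b / (a <= b)%N >-> a <= b}.
  by apply/nondecreasing_seqP => m; rewrite /series /= big_nat_recr //= lerDl.
have cv : ccvg (fun N => psum u N - psum u M) (csum u - psum u M).
  by apply: ccvgD; [exact: csumP cc h|exact: ccvg_cst].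
apply: (cvgr_to_le (cvg_cabs cv)); exists M => // N /= MN.
have -> : psum u N - psum u M = \sum_(M <= m < N) u m.
  by rewrite /psum (big_cat_nat (n := M)) //= addrAC subrr add0r.
apply: le_trans (cabs_sum _ _ _) _.
apply: (@le_trans _ _ (\sum_(M <= m < N) c m)); first exact: ler_sum.
have -> : \sum_(M <= m < N) c m = series c N - series c M.
  by rewrite /series /= [X in _ = X - _](big_cat_nat (n := M)) //= addrAC subrr add0r.
by rewrite lerD2r; apply: nondecreasing_cvgn_le.
Qed.

Lemma csum_cvg (c : nat -> R) (u : nat -> nat -> C) (v : nat -> C) : cvgn (series c) ->
  (forall N m, cabs (u N m) <= c m) -> (forall m, cabs (v m) <= c m) ->
  (forall m, ccvg (fun N => u N m) (v m)) -> ccvg (fun N => csum (u N)) (csum v).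
Proof.
move=> cc hu hv h; apply/ccvgP/norm_cvg0P/cvgr0Pnorm_lt => e e0.
have e3 : 0 < e / 3 by rewrite divr_gt0.
have [M _ hM] : \forall M \near \oo, limn (series c) - series c M < e / 3.
  have : series c M @[M --> \oo] --> limn (series c) by [].
  move=> /cvgrPdist_lt /(_ _ e3); apply: filterS => M; apply: le_lt_trans; exact: ler_norm.
have t3 := hM M (leqnn M).
have cp : ccvg (fun N => psum (u N) M) (psum v M).
  by apply: ccvg_sum => m _; exact: h.
have /ccvgP /cvgr0Pnorm_lt /(_ _ e3) := cp; apply: filterS => N.
rewrite !normr_id ger0_norm ?cabs_ge0 // => hN; rewrite ger0_norm ?cabs_ge0 //.
have -> : csum (u N) - csum v = (csum (u N) - psum (u N) M) + (psum (u N) M - psum v M)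
   + - (csum v - psum v M) by ring.
have h1 := cabsD (csum (u N) - psum (u N) M + (psum (u N) M - psum v M)) (- (csum v - psum v M)).
have h2 := cabsD (csum (u N) - psum (u N) M) (psum (u N) M - psum v M).
have h3 := psum_tail M cc (hu N); have h4 := psum_tail M cc hv.
rewrite cabsN in h1.
by move: h1 h2 h3 h4 t3 hN; lra.
Qed.
End Tannery.

(** * Dependence of the integrals on values in the open orthant only *)

Section OpenIntegrands.
Variables (R : realType) (n : nat).
Local Notation C := (Cx R).

Lemma intRpos_eq (F G : rvec R n -> C) : (forall x, posv x -> F x = G x) -> intRpos F = intRpos G.
Proof.
move=> e; have h (H : rvec R n -> C) : intRpos H = @I R n 0 0 H.
  (* With a = 0 and s = 0 the weight [W] is identically 1. *)
  rewrite /I; congr intRpos; apply/funext => x; rewrite /W big1 ?mulr1 // => i _.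
  by rewrite /wt mul0r cexp0 oppr0 mul0r expR0 mul1r cR1.
by rewrite !h; exact: I_eq.
Qed.

Lemma iterint_abs_eq m (G H : (nat -> R) -> \bar R) : (m <= n)%N ->
  (forall x, posfrom n 0 x -> G x = H x) -> forall x, posfrom n m x -> iterint_abs m G x = iterint_abs m H x.
Proof.
move=> + h; elim: m => [|m IHm] mn x px /=; first exact: h.
apply: eq_integral => t; rewrite inE => /RposP t0; apply: IHm; first exact: ltnW.
exact: posfrom_upd.
Qed.

Lemma integrable_eq (F G : rvec R n -> C) : (forall x, posv x -> F x = G x) ->
  integrableRpos F -> integrableRpos G.
Proof.
move=> e; rewrite /integrableRpos.
rewrite (@iterint_abs_eq n _ (fun x => (cabs (G (fun i => x i)))%:E)) //; last exact: posfrom_n.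
by move=> x px; rewrite e // => i; apply: px; rewrite /= ltn_ord.
Qed.
End OpenIntegrands.

(** * Power series in a real variable and the principal logarithm *)

Section PowerSeries.
Local Open Scope classical_set_scope.
Variable R : realType.
Local Notation C := (Cx R).

Lemma tame_pow (x b : C) m :
  tame ((cabs x + cabs b) ^+ m) (fun t => (x + t * b) ^+ m) (m%:R * (b * x ^+ m.-1)).
Proof.
elim: m => [|m IHm].
  by have h := @tame_cst R 1; rewrite cabs1 in h; rewrite mulr0n mul0r; exact: h.
have h := tame_aff IHm (lexx (cabs x + cabs b)).
have -> : m.+1%:R * (b * x ^+ m.+1.-1) = b * (x + 0 * b) ^+ m + x * (m%:R * (b * x ^+ m.-1)).
  by rewrite mul0r addr0 -natr1; case: m {IHm h} => [|m]; rewrite /= ?exprS ?expr0; ring.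
rewrite exprS (_ : (fun t => _ ^+ m.+1) = (fun t => (x + t * b) * (x + t * b) ^+ m)) //.
by apply/funext => t; rewrite exprS.
Qed.

(** The expansion about t is taken on a disc of radius 1, because [tame] is; hence convergence is
    required at radius t + 1. *)
Lemma pseries_cderiv (u : nat -> C) (K t : R) : cvgn (series (fun m => cabs (u m) * K ^+ m)) ->
  0 <= t -> t + 1 <= K ->
  ccvg (psum (fun m => u m * (m%:R * cR t ^+ m.-1))) (csum (fun m => u m * (m%:R * cR t ^+ m.-1))) /\
  cderiv (fun r => csum (fun m => u m * cR r ^+ m)) (csum (fun m => u m * (m%:R * cR t ^+ m.-1))) t.
Proof.
move=> cc t0 tK; have K0 : 0 <= K by apply: le_trans tK; rewrite addr_ge0.
have h m : tame (cabs (u m) * K ^+ m) (fun r => u m * (cR t + r * 1) ^+ m) (u m * (m%:R * cR t ^+ m.-1)).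
  have h := tame_aff (tame_pow (cR t) 1 m) (lexx (cabs (u m) + cabs 0)).
  move: h; rewrite (_ : (fun _ => _) = (fun r : C => u m * (cR t + r * 1) ^+ m)); last first.
    by apply/funext => r; rewrite mulr0 addr0.
  rewrite cabs0 addr0 mul0r add0r [1 * _]mul1r; apply: tame_le.
  rewrite ler_wpM2l ?cabs_ge0 // cabs1 cabs_cR ger0_norm //.
  by apply: lerXn2r => //; rewrite nnegrE ?addr_ge0.
split.
  apply: (csumP cc) => m; have [Q [Q0 _ hX]] := h m; apply: le_trans hX.
  by rewrite [cabs _ + cabs _]addrC -addrA lerDl addr_ge0 // cabs_ge0.
have d := holo_line t (tame_csum cc h).
have e : (fun r : R => csum (fun m => u m * (cR t + cR (r - t) * 1) ^+ m)) =
    fun r : R => csum (fun m => u m * cR r ^+ m).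
  apply/funext => r; apply: (congr1 (@csum R)); apply/funext => m.
  have -> : cR t + cR (r - t) * 1 = cR r :> C by rewrite mulr1 -cRD addrC subrK.
  by [].
have d' : cderiv (fun r : R => csum (fun m => u m * (cR t + cR (r - t) * 1) ^+ m))
    (csum (fun m => u m * (m%:R * cR t ^+ m.-1))) t := d.
by rewrite e in d'.
Qed.

Lemma bounded_cvg (c : nat -> R) (B K K1 : R) : 0 <= K -> K < K1 -> (forall m, 0 <= c m) ->
  (forall m, c m * K1 ^+ m <= B) -> cvgn (series (fun m => c m * K ^+ m)).
Proof.
move=> K0 KK c0 h; have K10 : 0 < K1 by exact: le_lt_trans KK.
have B0 : 0 <= B by apply: le_trans (h 0%N); rewrite mulr_ge0 // exprn_ge0 // ltW.
apply: (@series_le_cvg R _ (geometric B (K / K1))) => [m|m|m|].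
- by rewrite mulr_ge0 // exprn_ge0.
- by rewrite /geometric /= mulr_ge0 // exprn_ge0 // divr_ge0 // ltW.
- rewrite /geometric /= expr_div_n mulrA ler_pdivlMr ?exprn_gt0 //.
  by rewrite mulrAC ler_wpM2r // exprn_ge0.
- apply: is_cvg_geometric_series; rewrite ger0_norm ?divr_ge0 ?(ltW K10) //.
  by rewrite ltr_pdivrMr // mul1r.
Qed.

Lemma psum_bounded (u : nat -> C) l : ccvg (psum u) l -> exists B, forall m, cabs (u m) <= B.
Proof.
move=> cu; have [B hB] : exists B, forall N, cabs (psum u N) <= B.
  have /cvg_seq_bounded : cvgn (fun N => cabs (psum u N)) by apply/cvg_ex; exists (cabs l); exact: cvg_cabs.
  case=> M [_ /(_ (M + 1))]; rewrite ltrDl ltr01 => /(_ isT) h; exists (M + 1) => N.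
  by rewrite (le_trans (ler_norm _)) // h.
exists (B + B) => m; have -> : u m = psum u m.+1 - psum u m.
  by rewrite /psum big_nat_recr //= addrAC subrr add0r.
by apply: le_trans (cabsD _ _) _; rewrite cabsN lerD.
Qed.

Lemma cderiv_cLog (f : R -> C) df t : cderiv f df t -> 0 < cRe (f t) ->
  cderiv (fun s => cLog (f s)) (df / f t) t.
Proof.
move=> [h1 h2] f0; set X := cRe (f t) in h1 f0; pose Y := cIm (f t).
pose N := X ^+ 2 + Y ^+ 2.
have N0 : 0 < N by rewrite ltr_pwDl // ?exprn_gt0 // sqr_ge0.
have X0 : X != 0 by rewrite gt_eqF.
pose D : C := (((X * cRe df + Y * cIm df) / N) +i* ((cIm df * X - Y * cRe df) / N))%C.
have -> : df / f t = D.
  have fn : f t != 0 by apply: contraTneq f0 => e; rewrite /X e ltxx.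
  apply: (mulIf fn); rewrite divfK //; apply: c_eq; rewrite ?cReM ?cImM -/X -/Y /D /=; rewrite /cRe /cIm /=;
    rewrite -/(cRe df) -/(cIm df) /N; field; exact: lt0r_neq0.
have dY : is_derive t 1 (fun s => cIm (f s)) (cIm df) := h2.
split.
- rewrite (_ : (fun s => _) = fun s => 2^-1 * ln (cRe (f s) ^+ 2 + cIm (f s) ^+ 2)); last first.
    apply/funext => s; rewrite /cLog /=; set v := _ + _.
    have v0 : 0 <= v by rewrite addr_ge0 // sqr_ge0.
    have [->|v1] := eqVneq v 0; first by rewrite sqrtr0 ln0 // mulr0.
    have vp : 0 < v by rewrite lt_neqAle eq_sym v1.
    have -> : ln v = ln (Num.sqrt v) + ln (Num.sqrt v).
      by rewrite -lnM ?posrE ?sqrtr_gt0 // -expr2 sqr_sqrtr.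
    by move: (ln (Num.sqrt v)) => L; lra.
  have d1 : is_derive t 1 (fun s => cRe (f s) ^+ 2 + cIm (f s) ^+ 2) (2 * (X * cRe df + Y * cIm df)).
    rewrite (_ : (fun s => _) = fun s => cRe (f s) * cRe (f s) + cIm (f s) * cIm (f s)); last first.
      by apply/funext => s; rewrite !expr2.
    by apply: (is_derive_eq (isdD (isdM h1 h1) (isdM h2 h2))); rewrite -/X -/Y; ring.
  have d2 : is_derive (cRe (f t) ^+ 2 + cIm (f t) ^+ 2) 1 (@ln R) N^-1 by exact: is_derive1_ln.
  have d3 := @is_derive1_comp R (@ln R) (fun s => cRe (f s) ^+ 2 + cIm (f s) ^+ 2) t _ _ d2 d1.
  apply: (is_derive_eq (isdM (isd_cst (2^-1) t) d3)); rewrite mul0r add0r /cRe /= /D /=.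
  by rewrite -/(cRe df) -/(cIm df); field; rewrite gt_eqF.
- have dX : is_derive t 1 (fun s => (cRe (f s))^-1) (- (X ^- 2) * cRe df).
    have h := @is_deriveV R (fun s => cRe (f s)) t (cRe df) 1 X0 h1.
    by apply: (is_derive_eq h); rewrite -/X.
  have d1 := isdM h2 dX.
  have d3 := @is_derive1_comp R (@atan R) (fun s => cIm (f s) * (cRe (f s))^-1) t _ _ (is_derive1_atan _) d1.
  have eD : cIm D = (cIm df * X - Y * cRe df) / N by [].
  apply: (is_derive_eq d3); rewrite eD -/X -/Y /N; field; rewrite X0 /=.
  by rewrite -/N gt_eqF.
Qed.

Lemma cderiv0_const (f : R -> C) (a b : R) : a <= b -> (forall t, a <= t <= b -> cderiv f 0 t) -> f a = f b.
Proof.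
move=> ab d.
have h (g : R -> R) : (forall t, a <= t <= b -> is_derive t 1 g 0) -> g a = g b.
  move=> dg; have [t|x|c _] := @MVT_segment R g (fun=> 0) a b ab.
  - by rewrite in_itv /= => /andP[h1 h2]; apply: dg; rewrite !ltW.
  - apply: derivable_within_continuous => t; rewrite in_itv /= => ht; by case: (dg t ht).
  - by rewrite mul0r => /eqP; rewrite subr_eq0 => /eqP.
by apply: c_eq; [apply: (h (fun t => cRe (f t)))|apply: (h (fun t => cIm (f t)))] => t /d [].
Qed.

Lemma cLog_cR (t : R) : 0 < t -> cLog (cR t) = cR (ln t).
Proof.
move=> t0; rewrite /cLog cRe_cR cIm_cR expr0n addr0 sqrtr_sqr ger0_norm ?(ltW t0) //.
by rewrite mul0r atan0.
Qed.
End PowerSeries.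

(** * The Laplace functional of the Dunkl kernel *)

Section LaplaceFunctional.
Local Open Scope classical_set_scope.
Variable R : realType.
Local Notation C := (Cx R).
Variables (n : nat) (k : R).
Hypotheses (k0 : 0 <= k) (n0 : (0 < n)%N).
Variable a : C.
Hypothesis a_gt : -1 < cRe a.
Local Notation V := (rvec R n).
Local Notation P := (mpoly.mpoly n C).
Local Notation E := (dunkl_pol (cR_ge0 k0)).
Implicit Types (p q : P) (lam : 'I_n -> C) (x : V) (s rho : R).

Definition tr x : R := \sum_i x i.

Lemma I_shift s rho (g : V -> C) :
  I a (s + rho) g = I a s (fun x => g x * cR (expR (- rho * tr x))).
Proof.
rewrite /I; congr intRpos; apply/funext => x; rewrite -mulrA; congr (_ * _).
rewrite /W /tr mulr_sumr expR_sum cRE rmorph_prod -big_split /=; apply: eq_bigr => i _.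
by rewrite /wt mulrCA -cRE -cRM -expRD; congr (_ * cR (expR _)); ring.
Qed.

Lemma pg_omega : pg (fun x : V => cR (omega k x)).
Proof. by apply: (pg_ext _ (@pg_Om R n k k0 0 _)) => [x _|]; rewrite ?omega_Om // lexx ler01. Qed.

Definition ell s p : C := I a s (fun x => p.@[cofr x] * cR (omega k x)).

Lemma pg_pw p : pg (fun x : V => p.@[cofr x] * cR (omega k x)).
Proof. exact: pgM (pg_meval p) pg_omega. Qed.

Lemma ell_lin s c p q : 0 < s -> ell s (c *: p + q) = c * ell s p + ell s q.
Proof.
move=> s0; have hz : pg (fun x : V => c * (p.@[cofr x] * cR (omega k x))) by apply: pgZ; exact: pg_pw.
rewrite /ell -(IZ a_gt s0 c (pg_pw p)) -(ID a_gt s0 hz (pg_pw q)).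
by apply: I_eq => x _; rewrite mpoly.mevalD mpoly.mevalZ mulrDl mulrA.
Qed.

Lemma ellZ s c p : 0 < s -> ell s (c *: p) = c * ell s p.
Proof.
by move=> s0; rewrite /ell -(IZ a_gt s0 c (pg_pw p)); apply: I_eq => x _; rewrite mpoly.mevalZ mulrA.
Qed.

Lemma ell_sum s (T : Type) (r : seq T) (Q : pred T) (f : T -> P) : 0 < s ->
  ell s (\sum_(i <- r | Q i) f i) = \sum_(i <- r | Q i) ell s (f i).
Proof.
move=> s0; rewrite /ell -(I_sum a_gt s0) => [|i]; last exact: pg_pw.
by apply: I_eq => x _; rewrite (raddf_sum (mpoly.meval (cofr x))) mulr_suml.
Qed.

Lemma omega_perm w x : omega k (vperm w x) = omega k x.
Proof. by rewrite !omega_Om Om_perm. Qed.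

Lemma ell_msym s w p : 0 < s -> ell s (mpoly.msym w p) = ell s p.
Proof.
move=> s0; rewrite /ell -(I_perm a_gt s0 w (pg_pw p)); apply: I_eq => x _.
by rewrite meval_msym omega_perm.
Qed.

Definition raise_op i p : P := T (cR k) i ('X_i * p) + a *: p.

Lemma ell_anti s i j p q : i != j -> 0 < s -> ell s (dd i j p * (q - sw i j q)) = 0.
Proof.
move=> ij s0; have := ell_msym (tperm i j) (dd i j p * (q - sw i j q)) s0.
rewrite -/(sw i j _) sw_T_M_correction // -scaleN1r ellZ // mulN1r => /eqP.
by rewrite eq_sym -addr_eq0 -mulr2n mulrn_eq0 => /eqP.
Qed.

(** [key_identity] applied to the product; the correction in [T_M] is antisymmetric and the
    functional invariant, so it disappears. *)
Lemma ell_rec s i p q : 0 < s ->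
  cR s * ell s ('X_i * p * q) = ell s (raise_op i p * q) + ell s ('X_i * p * T (cR k) i q).
Proof.
move=> s0; rewrite /ell -mulrA (key_identity a_gt s0 k0) mulrA -/(ell s _) T_M.
have -> : T (cR k) i ('X_i * p) * q + 'X_i * p * T (cR k) i q
    - cR k *: (\sum_(j | j != i) dd i j ('X_i * p) * (q - sw i j q)) + a *: (p * q) =
    (- cR k) *: (\sum_(j | j != i) dd i j ('X_i * p) * (q - sw i j q)) +
    (1 *: (raise_op i p * q) + 'X_i * p * T (cR k) i q).
  rewrite /raise_op scale1r scaleNr mulrDl -scalerAl.
  move: (T _ _ _ * q) ('X_i * p * T _ _ _) (_ *: \sum_(_ | _) _) (a *: (p * q)) => A B D F.
  by rewrite [RHS]addrC [LHS]addrAC; congr (_ + _); exact: addrAC.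
rewrite ell_lin // ell_lin // ell_sum // big1 => [|j]; last by rewrite eq_sym => ji; exact: ell_anti.
by rewrite mulr0 add0r mul1r.
Qed.

Section FixedRate.
Variables (s rho : R) (lam : 'I_n -> C).
Hypotheses (rho0 : 0 <= rho) (rs : rho < s) (hlam : forall i, cabs (lam i) <= rho).
Let s0 : 0 < s. Proof. exact: le_lt_trans rs. Qed.
Let sg0 : 0 < s - rho. Proof. by rewrite subr_gt0. Qed.

Lemma tr_ge0 x : posv x -> 0 <= tr x. Proof. by move=> px; apply: sumr_ge0 => i _; exact: ltW. Qed.

Lemma E_bound m x : posv x -> cabs (E lam m).@[cofr x] <= (rho * tr x) ^+ m / m`!%:R.
Proof.
move=> px; have := @dunkl_pol_bound R n k k0 lam (cofr x) (rho * tr x) _ _ m 1%g.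
rewrite comp_id1; apply; first by rewrite mulr_ge0 // tr_ge0.
move=> w; apply: le_trans (cabs_sum _ _ _) _.
rewrite /tr [X in _ <= _ * X](reindex_inj (@perm_inj _ w)) mulr_sumr; apply: ler_sum => i _.
by rewrite cabsM cabs_cR ger0_norm ?(ltW (px _)) // ler_wpM2r // ltW.
Qed.

Lemma expR_psum (y : R) N : 0 <= y -> \sum_(0 <= m < N) y ^+ m / m`!%:R <= expR y.
Proof.
move=> y0; rewrite -[leLHS]/(series (fun m => y ^+ m / m`!%:R) N).
apply: (@nondecreasing_cvgn_le R (series (fun m => y ^+ m / m`!%:R))); last exact: cvg_expseries.
apply/nondecreasing_seqP => m.
by rewrite /series /= big_nat_recr //= lerDl divr_ge0 // exprn_ge0.
Qed.

(** The series damped by [exp(-rho tr x)]. Since the terms sum to at most [exp(rho tr x)] in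
    absolute value, this function and all its partial sums are bounded by 1. *)
Definition gE x : C := cR (expR (- rho * tr x)) * Eser k0 lam (cofr x).
Definition gEN N x : C := cR (expR (- rho * tr x)) * psum (fun m => (E lam m).@[cofr x]) N.

Lemma seqcont_exp : seqcont (fun x => cR (expR (- rho * tr x))).
Proof.
move=> xs x pxs px cx; apply: ccvg_cR; apply: continuous_cvg; first exact: continuous_expR.
apply: cvgM; first exact: cvg_cst.
have h (r : seq 'I_n) : \sum_(i <- r) xs N i @[N --> \oo] --> \sum_(i <- r) x i.
  elim: r => [|i r IHr]; first by rewrite big_nil; under eq_fun do rewrite big_nil; exact: cvg_cst.
  by rewrite big_cons; under eq_fun do rewrite big_cons; apply: cvgD.
exact: h.
Qed.

Lemma tr_cvg (xs : nat -> V) x : (forall i, xs N i @[N --> \oo] --> x i) -> tr (xs N) @[N --> \oo] --> tr x.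
Proof.
move=> cx.
have h (r : seq 'I_n) : \sum_(i <- r) xs N i @[N --> \oo] --> \sum_(i <- r) x i.
  elim: r => [|i r IHr]; first by rewrite big_nil; under eq_fun do rewrite big_nil; exact: cvg_cst.
  by rewrite big_cons; under eq_fun do rewrite big_cons; apply: cvgD.
exact: h.
Qed.

Lemma gEN_pgb N : pgb 1 0 (gEN N).
Proof.
split=> // [x px|]; last first.
  move=> xs x pxs px cx; apply: ccvgM; first exact: seqcont_exp.
  by apply: ccvg_sum => m _; have [c [q [_ _ h]]] := pg_meval (E lam m); exact: h.
rewrite mul1r expr0 cabsM cabs_cR ger0_norm ?expR_ge0 // mulNr expRN mulrC ler_pdivrMr ?expR_gt0 // mul1r.
apply: le_trans (expR_psum N (mulr_ge0 rho0 (tr_ge0 px))).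
by apply: le_trans (cabs_sum _ _ _) _; apply: ler_sum => m _; exact: E_bound.
Qed.

Lemma gEN_cvg x : ccvg (fun N => gEN N x) (gE x).
Proof. by apply: ccvgM; [exact: ccvg_cst|exact: Eser_cvg]. Qed.

Lemma gE_pgb : pgb 1 0 gE.
Proof.
split=> // [x px|xs x pxs px cx].
  apply: (cvgr_to_le (cvg_cabs (gEN_cvg x))); apply: nearW => N.
  by have [_ h _] := gEN_pgb N; exact: h.
apply: ccvgM; first exact: seqcont_exp.
have ct := tr_cvg cx.
have [M hM] : exists M, forall N, tr (xs N) <= M.
  have /cvg_seq_bounded : cvgn (fun N => tr (xs N)) by apply/cvg_ex; exists (tr x).
  case=> M [_ /(_ (M + 1))]; rewrite ltrDl ltr01 => /(_ isT) h; exists (M + 1) => N.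
  by rewrite (le_trans (ler_norm _)) // h.
have hMx : tr x <= M by apply: (cvgr_to_le ct); exact: nearW.
have mono y : posv y -> tr y <= M -> forall m, cabs (E lam m).@[cofr y] <= (rho * M) ^+ m / m`!%:R.
  move=> py yM m; apply: le_trans (E_bound m py) _; rewrite ler_wpM2r ?invr_ge0 //.
  apply: lerXn2r; rewrite ?nnegrE ?mulr_ge0 ?tr_ge0 //; first exact: le_trans (tr_ge0 py) yM.
  exact: ler_wpM2l.
apply: (@csum_cvg R (fun m => (rho * M) ^+ m / m`!%:R)).
- exact: cvg_expseries.
- by move=> N m; exact: mono.
- by move=> m; exact: mono.
- by move=> m; have [c [q [_ _ h]]] := pg_meval (E lam m); exact: h.
Qed.

(** The functional at the point [z = s - lam]. Of the factor [exp(-s tr x)] a part with rate rho is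
    used up by the series; the remaining rate [s - rho] is positive and secures integrability. *)
Definition Lf p : C := I a (s - rho) (fun x => p.@[cofr x] * cR (omega k x) * gE x).

Lemma Lf_cvg p : ccvg (psum (fun m => ell s (p * E lam m))) (Lf p).
Proof.
have [c [q hp]] := pg_pw p.
rewrite (_ : psum _ = fun N => I a (s - rho) (fun x => p.@[cofr x] * cR (omega k x) * gEN N x)).
  apply: (I_cvg a_gt sg0 (c := c * 1) (q := (q + 0)%N)) => [N||x px].
  - exact: pgbM (gEN_pgb N).
  - exact: pgbM gE_pgb.
  - by apply: ccvgM; [exact: ccvg_cst|exact: gEN_cvg].
have sh g : I a s g = I a (s - rho) (fun x => g x * cR (expR (- rho * tr x))) by rewrite -I_shift subrK.
apply/funext => N; rewrite /psum -(ell_sum _ _ _ s0) /ell sh.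
apply: I_eq => x _; rewrite /gEN -mulr_sumr (mpoly.mevalM (cofr x) p) (raddf_sum (mpoly.meval (cofr x))) /psum.
have r (x1 x2 x3 x4 : C) : x1 * x2 * x3 * x4 = x1 * x3 * (x4 * x2) by ring.
exact: r.
Qed.

Lemma Lf_lin c p q : Lf (c *: p + q) = c * Lf p + Lf q.
Proof.
apply: (ccvg_unique (Lf_cvg _)).
rewrite (_ : psum _ = fun N => c * psum (fun m => ell s (p * E lam m)) N + psum (fun m => ell s (q * E lam m)) N).
  by apply: ccvgD; [apply: ccvgM; [exact: ccvg_cst|exact: Lf_cvg]|exact: Lf_cvg].
apply/funext => N; rewrite /psum mulr_sumr -big_split /=; apply: eq_bigr => m _.
by rewrite mulrDl -scalerAl ell_lin.
Qed.

Lemma LfZ c p : Lf (c *: p) = c * Lf p.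
Proof.
apply: (ccvg_unique (Lf_cvg _)).
rewrite (_ : psum _ = fun N => c * psum (fun m => ell s (p * E lam m)) N).
  by apply: ccvgM; [exact: ccvg_cst|exact: Lf_cvg].
by apply/funext => N; rewrite /psum mulr_sumr; apply: eq_bigr => m _; rewrite -scalerAl ellZ.
Qed.

(** The moment identity is summed over the series; [T_i] lowers the index by one and yields lam_i,
    so that [s - lam_i = z_i] appears on the left. *)
Lemma Lf_mulX i p : (cR s - lam i) * Lf ('X_i * p) = Lf (raise_op i p).
Proof.
have step m : cR s * ell s ('X_i * p * E lam m.+1) =
    ell s (raise_op i p * E lam m.+1) + lam i * ell s ('X_i * p * E lam m).
  by rewrite ell_rec // T_dunkl_pol -scalerAr ellZ.
have step0 : cR s * ell s ('X_i * p * E lam 0) = ell s (raise_op i p * E lam 0).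
  rewrite ell_rec // T1 mulr0 -[X in _ + ell s X](scale0r (0 : P)) ellZ // mul0r addr0 //.
have c1 : ccvg (fun N => cR s * psum (fun m => ell s ('X_i * p * E lam m)) N.+1) (cR s * Lf ('X_i * p)).
  apply: ccvgM; first exact: ccvg_cst.
  by have [h1 h2] := Lf_cvg ('X_i * p); split; [move: h1|move: h2]; rewrite -cvg_shiftS.
have c2 : ccvg (fun N => psum (fun m => ell s (raise_op i p * E lam m)) N.+1 +
    lam i * psum (fun m => ell s ('X_i * p * E lam m)) N) (Lf (raise_op i p) + lam i * Lf ('X_i * p)).
  apply: ccvgD; last by apply: ccvgM; [exact: ccvg_cst|exact: Lf_cvg].
  by have [h1 h2] := Lf_cvg (raise_op i p); split; [move: h1|move: h2]; rewrite -cvg_shiftS.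
apply/eqP; rewrite mulrBl subr_eq; apply/eqP; apply: (ccvg_unique c1).
rewrite (_ : (fun N => cR s * _) = (fun N => psum (fun m => ell s (raise_op i p * E lam m)) N.+1 +
    lam i * psum (fun m => ell s ('X_i * p * E lam m)) N)) //.
apply/funext => N; rewrite /psum !(big_nat_recl N) // mulrDr step0 -addrA; congr (_ + _).
by rewrite !mulr_sumr -big_split /=; apply: eq_bigr => m _; rewrite step.
Qed.
End FixedRate.

Lemma Lf_msym s rho lam w p : 0 <= rho -> rho < s -> (forall i, cabs (lam i) <= rho) ->
  Lf s rho lam (mpoly.msym w p) = Lf s rho (lam \o w) p.
Proof.
move=> r0 rs hl; have s0 := le_lt_trans r0 rs.
apply: (ccvg_unique (Lf_cvg r0 rs hl _)).
rewrite (_ : psum _ = psum (fun m => ell s (p * E (lam \o w) m))).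
  by apply: (Lf_cvg r0 rs) => i; exact: hl.
apply/funext => N; apply: eq_bigr => m _.
rewrite -(ell_msym (w^-1)%g _ s0) mpoly.msymM -mpoly.msymMm mulgV mpoly.msym1m msym_dunkl_pol.
by rewrite invgK.
Qed.

Lemma Lf0 s rho lam p : (forall i, lam i = 0) -> Lf s rho lam p = ell s p.
Proof.
move=> l0; have sh g : I a s g = I a (s - rho) (fun x => g x * cR (expR (- rho * tr x))) by rewrite -I_shift subrK.
rewrite /Lf /ell sh; apply: I_eq => x _.
by rewrite /gE Eser_x0 ?mulr1 // => w; rewrite big1 // => i _; rewrite l0 mul0r.
Qed.

Lemma dunkl_pol_scale (c : C) lam m : E (fun i => c * lam i) m = c ^+ m *: E lam m.
Proof.
elim: m => [|m IHm]; first by rewrite expr0 scale1r.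
rewrite [LHS]/= [E lam m.+1]/= IHm scaler_sumr; apply: eq_bigr => w _.
have -> : linform (fun i => c * lam i) = c *: linform lam.
  by rewrite /linform scaler_sumr; apply: eq_bigr => i _; rewrite scalerA.
rewrite -scalerAl -scalerAr [c *: (_ *: _)]scalerA -exprS mpoly.msymZ [LHS]scalerA [RHS]scalerA.
by rewrite [_ * c ^+ _]mulrC.
Qed.

Lemma ell_G s p : 0 < s -> ell s (G (cR k) p) = 0.
Proof.
move=> s0; rewrite GE ellZ // ell_sum // big1 ?mulr0 // => -[i j] _ /=.
by rewrite -scaleN1r addrC ell_lin // /sw ell_msym // mulN1r addNr.
Qed.

(** Being permutation invariant, the functional annihilates the image of [G] and turns the resolvent
    equation into a scalar recursion. *)
Lemma ell_dunkl_polS s lam m : 0 < s ->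
  m.+1%:R * ell s (E lam m.+1) = \sum_i lam i * ell s ('X_i * E lam m).
Proof.
move=> s0; have := congr1 (ell s) (dunkl_polS (cR_ge0 k0) lam m).
rewrite ell_lin // ell_G // addr0 => ->.
rewrite /linform mulr_suml ell_sum //; apply: eq_bigr => i _.
by rewrite -scalerAl ellZ.
Qed.

Local Notation mu := (a + 1 + cR (k * (n%:R - 1))).

Lemma raise_one i : raise_op i 1 = mu *: 1.
Proof.
rewrite /raise_op T_X T1 mulr0 add0r.
have -> : \sum_(j | j != i) sw i j (1 : P) = (n%:R - 1 : C) *: 1.
  rewrite (eq_bigr (fun=> (1 : P))) => [|j _]; last by rewrite /sw rmorph1.
  have h : \sum_(j < n) (1 : P) = n%:R by rewrite sumr_const card_ord.
  rewrite (bigD1 i) //= in h.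
  by rewrite scalerBl scaler_nat scale1r -h [1 + _]addrC addrK.
rewrite scalerA !scalerDl scale1r cRM cRB cR_nat cR1.
by rewrite [LHS]addrC [LHS]addrA.
Qed.

Lemma Deltapow_cderiv s lam t : (forall i, 0 < cRe (cR s - cR t * lam i)) ->
  cderiv (fun r => Deltapow (fun i => cR s - cR r * lam i) mu)
    (- (\sum_i mu * lam i / (cR s - cR t * lam i)) * Deltapow (fun i => cR s - cR t * lam i) mu) t.
Proof.
move=> h0; rewrite /Deltapow.
have hf i : cderiv (fun r => cR s - cR r * lam i) (- lam i) t.
  apply: (cderiv_ext (f := fun r => cR s + (- lam i) * cR r)) => [r|]; first by rewrite mulNr mulrC.
  apply: (cderiv_eq (cderivD (cderiv_cst (cR s) t) (cderivZ (- lam i) (cderiv_id t)))).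
  by rewrite add0r mulr1.
have hs := cderiv_sum (index_enum 'I_n) xpredT (fun i => cderiv_cLog (hf i) (h0 i)).
apply: (cderiv_eq (cderiv_exp (cderivZ mu hs))); congr (_ * _).
rewrite mulr_sumr -sumrN; apply: eq_bigr => i _.
by rewrite mulNr mulrN -[mu * _ / _]mulrA.
Qed.

(** Along the ray [s - t lm] the value at the polynomial 1 is a power series in t whose derivative
    is the sum of the values at [lm_i x_i]. By [Lf_mulX] this is the value times
    [mu lm_i / (s - t lm_i)] summed over i, so the product with [Deltapow] has derivative 0. *)
Lemma Lf_one s rho lam : 0 <= rho -> rho < s -> (forall i, cabs (lam i) <= rho) ->
  Lf s rho lam 1 * Deltapow (fun i : 'I_n => cR s - lam i) mu = ell s 1 * Deltapow (fun _ : 'I_n => cR s) mu.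
Proof.
move=> r0 rs hl; have s0 := le_lt_trans r0 rs.
(* The point lam is reached at [T = 1/d] along [lm = d lam]. The derivative at T needs convergence
   at radius T + 1, obtained by comparison with T + 2; there the coefficients have rate
   [(1 + 2 d) rho], which has to stay below s. *)
have [d d0 hd] : exists2 d, 0 < d & (1 + 2 * d) * rho < s.
  have q0 : 0 < (s - rho) / (4 * (rho + 1)) by rewrite divr_gt0 ?subr_gt0 // mulr_gt0 // ltr_wpDl.
  exists ((s - rho) / (4 * (rho + 1))) => //; move: q0; set q := _ / _ => q0.
  have e : q * (4 * (rho + 1)) = s - rho.
    by rewrite divfK // mulf_neq0 // ?gt_eqF // ltr_wpDl.
  by have := mulr_ge0 (ltW q0) r0; nra.
pose T := d^-1; pose lm i := cR d * lam i.
have T0 : 0 < T by rewrite invr_gt0.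
have Td : T * d = 1 by rewrite mulVf // gt_eqF.
have lmT i : cR T * lm i = lam i by rewrite /lm mulrA -cRM Td cR1 mul1r.
have clm c i : 0 <= c -> cabs (cR c * lm i) = c * d * cabs (lam i).
  by move=> c0; rewrite !cabsM !cabs_cR !ger0_norm ?(ltW d0) // mulrA.
have hr t : 0 <= t <= T -> forall i, cabs (cR t * lm i) <= rho.
  move=> /andP[t0 tT] i; rewrite clm //; apply: le_trans (hl i).
  by rewrite ler_piMl ?cabs_ge0 // -Td ler_wpM2r // ltW.
pose c m := ell s (E lm m).
have cE t m : ell s (1 * E (fun i => cR t * lm i) m) = c m * cR t ^+ m.
  by rewrite mul1r dunkl_pol_scale ellZ // mulrC.
have cc : cvgn (series (fun m => cabs (c m) * (T + 1) ^+ m)).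
  have T2 : 0 <= T + 2 by rewrite addr_ge0 // ltW.
  have h1 i : cabs (cR (T + 2) * lm i) <= (1 + 2 * d) * rho.
    rewrite clm // mulrDl Td; apply: ler_wpM2l => //.
    by rewrite addr_ge0 // mulr_ge0 // ltW.
  have h0 : 0 <= (1 + 2 * d) * rho by rewrite mulr_ge0 // addr_ge0 // mulr_ge0 // ltW.
  have [B hB] := psum_bounded (Lf_cvg h0 hd h1 1).
  apply: (@bounded_cvg _ (fun m => cabs (c m)) B (T + 1) (T + 2)) => [|||m].
  - by rewrite addr_ge0 // ltW.
  - by rewrite ltrD2l; lra.
  - by move=> m; exact: cabs_ge0.
  - by have := hB m; rewrite cE cabsM cabsX cabs_cR ger0_norm.
have Hc t : 0 <= t <= T -> csum (fun m => c m * cR t ^+ m) = Lf s rho (fun i => cR t * lm i) 1.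
  move=> ht; have /andP[t0 tT] := ht.
  have cv : ccvg (psum (fun m => c m * cR t ^+ m)) (csum (fun m => c m * cR t ^+ m)).
    apply: (csumP cc) => m; rewrite cabsM cabsX cabs_cR ger0_norm // ler_wpM2l ?cabs_ge0 //.
    apply: lerXn2r; rewrite ?nnegrE ?addr_ge0 ?(ltW T0) //.
    by rewrite (le_trans tT) // lerDl.
  apply: (ccvg_unique cv).
  rewrite (_ : psum _ = psum (fun m => ell s (1 * E (fun i => cR t * lm i) m))).
    exact: Lf_cvg r0 rs (hr t ht) 1.
  by congr psum; apply/funext => m; rewrite cE.
have dpos t i : 0 <= t <= T -> 0 < cRe (cR s - cR t * lm i).
  move=> ht; rewrite cReD cReN cRe_cR subr_gt0; apply: le_lt_trans rs; apply: le_trans (hr t ht i).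
  by apply: le_trans (ler_norm _) _; exact: cabs_ge_Re.
have dH t : 0 <= t <= T -> cderiv (fun r => csum (fun m => c m * cR r ^+ m))
    ((\sum_i mu * lm i / (cR s - cR t * lm i)) * csum (fun m => c m * cR t ^+ m)) t.
  move=> ht; have /andP[t0 tT] := ht.
  have tT1 : t + 1 <= T + 1 by rewrite lerD2r.
  have [cv dv] := pseries_cderiv cc t0 tT1; apply: (cderiv_eq dv).
  apply: (ccvg_unique (psum_shift cv _)); first by rewrite mul0r mulr0.
  rewrite (_ : psum _ = fun N => \sum_i lm i * psum (fun m => ell s ('X_i * E (fun i => cR t * lm i) m)) N); last first.
    apply/funext => N; rewrite /psum; under [RHS]eq_bigr do rewrite mulr_sumr.
    rewrite exchange_big /=; apply: eq_bigr => m _.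
    rewrite mulrA [c _ * _]mulrC /c ell_dunkl_polS // mulr_suml; apply: eq_bigr => i _.
    by rewrite dunkl_pol_scale -scalerAr ellZ // -mulrA [_ * cR t ^+ m]mulrC.
  rewrite mulr_suml; apply: ccvg_sum => i _.
  have e : mu * lm i / (cR s - cR t * lm i) * csum (fun m => c m * cR t ^+ m) =
      lm i * Lf s rho (fun i => cR t * lm i) 'X_i.
    have dn : cR s - cR t * lm i != 0 by apply: contraTneq (dpos t i ht) => ->; rewrite ltxx.
    have := Lf_mulX r0 rs (hr t ht) i 1; rewrite mulr1 raise_one (LfZ r0 rs (hr t ht)) -(Hc t ht) => h.
    apply: (mulfI dn); rewrite [RHS]mulrCA h.
    by move: (csum _) (a + 1 + _) => H M; field.
  rewrite e; apply: ccvgM; first exact: ccvg_cst.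
  exact: Lf_cvg r0 rs (hr t ht) _.
pose F t := csum (fun m => c m * cR t ^+ m) * Deltapow (fun i : 'I_n => cR s - cR t * lm i) mu.
have main : F 0 = F T.
  apply: (@cderiv0_const R F 0 T (ltW T0)) => t ht.
  apply: (cderiv_eq (cderivM (dH t ht) (Deltapow_cderiv (fun i => dpos t i ht)))).
  by move: (csum _) (Deltapow _ _) (\sum_ _ _) => x1 x2 x3; ring.
have hT : 0 <= T <= T by rewrite lexx andbT ltW.
have h0 : 0 <= (0 : R) <= T by rewrite lexx ltW.
have f0 : (fun i => cR s - cR 0 * lm i) = fun _ : 'I_n => cR s.
  by apply/funext => i; rewrite cR0 mul0r subr0.
have fT : (fun i => cR s - cR T * lm i) = fun i => cR s - lam i.
  by apply/funext => i; rewrite lmT.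
have g0 : Lf s rho (fun i => cR 0 * lm i) 1 = ell s 1.
  by apply: Lf0 => i; rewrite cR0 mul0r.
have gT : (fun i => cR T * lm i) = lam by apply/funext.
by move: main; rewrite /F (Hc 0 h0) (Hc T hT) g0 gT f0 fT => ->.
Qed.

(** Both sides solve the Dunkl system with parameter [-z] and equal 1 at the origin. Uniqueness thus
    identifies the selected kernel with the series and moves the exponential outside in one
    stroke. *)
Lemma DunklE_rep s z x : posv x ->
  DunklE k (vneg z) (cofr x) = cR (expR (- s * tr x)) * Eser k0 (fun i => cR s - z i) (cofr x).
Proof.
move=> px.
have h1 : Dker k (vneg z) (fun x => DunklE k (vneg z) (cofr x)) by apply: kernel_Dker; first [exact: k0|exact: (DunklE_is_kernel k0 n0)].
have e : (fun i => cR s - z i + cR (- s)) = vneg z.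
  by apply/funext => i; rewrite /vneg cRN addrAC subrr add0r.
have h2 : Dker k (vneg z) (fun x => cR (expR (- s * \sum_i x i)) * Eser k0 (fun i => cR s - z i) (cofr x)).
  by rewrite -e; apply: Dker_exp; first [exact: k0|apply: kernel_Dker; first [exact: k0|exact: (Eser_is_kernel k0 n0)]].
apply: (Dker_unique k0 h1 h2 _ px).
have c0 : cofr (fun _ : 'I_n => (0 : R)) = fun=> 0 by apply/funext => i; exact: cR0.
have [_ /(_ (vneg z)) [_ e0]] := DunklE_is_kernel k0 n0.
have [_ /(_ (fun i => cR s - z i)) [_ e1]] := Eser_is_kernel k0 n0.
by rewrite c0 e0 e1 big1 // mulr0 expR0 cR1 mul1r.
Qed.

Lemma W_Deltapow s x : posv x ->
  W a s x = Deltapow (cofr x) a * cR (expR (- s * tr x)).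
Proof.
move=> px; rewrite /W /wt big_split /=; congr (_ * _).
  rewrite /Deltapow mulr_sumr cexp_sum; apply: eq_bigr => i _.
  by rewrite /cofr cLog_cR.
by rewrite /tr mulr_sumr expR_sum [RHS]cRE rmorph_prod.
Qed.

Definition Lint z p x : C :=
  DunklE k (vneg z) (cofr x) * p.@[cofr x] * Deltapow (cofr x) a * cR (omega k x).
Definition Lap z p : C := intRpos (Lint z p).

Lemma Lint_rep s rho z p x : posv x ->
  p.@[cofr x] * cR (omega k x) * gE rho (fun i => cR s - z i) x * W a (s - rho) x = Lint z p x.
Proof.
move=> px; rewrite /Lint (DunklE_rep s) // W_Deltapow // /gE.
have -> : cR (expR (- s * tr x)) = cR (expR (- rho * tr x)) * cR (expR (- (s - rho) * tr x)).
  rewrite -cRM -expRD; congr (cR (expR _)).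
  by move: (tr x) => y; ring.
have r (x1 x2 x3 x4 x5 x6 : C) : x1 * x2 * (x3 * x4) * (x5 * x6) = x3 * x6 * x4 * x1 * x5 * x2 by ring.
exact: r.
Qed.

Lemma Lap_Lf s rho z p : Lap z p = Lf s rho (fun i => cR s - z i) p.
Proof. by symmetry; apply: intRpos_eq => x; exact: Lint_rep. Qed.

Definition rates (z : 'I_n -> C) s rho := [/\ 1 <= s, 0 <= rho, rho < s & forall i, cabs (cR s - z i) <= rho].

(** [|s - z_i| < s] amounts to [s > |z_i|^2 / (2 Re z_i)], whence the summands f. The additional 1
    in s allows [Lap_one] to compare z with the point (1, ..., 1) at the same s. *)
Lemma rates_exist z : (forall i, 0 < cRe (z i)) -> exists s rho, rates z s rho.
Proof.
move=> hz; pose f i := cabs (z i) ^+ 2 / (2 * cRe (z i)).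
have f0 i : 0 <= f i by rewrite divr_ge0 ?sqr_ge0 // mulr_ge0 // ltW.
pose s := 1 + \sum_i f i.
have s1 : 1 <= s by rewrite lerDl sumr_ge0.
have hs i : cabs (cR s - z i) < s.
  have s0 : 0 <= s by apply: le_trans s1.
  have fs : f i < s.
    by rewrite /s (bigD1 i) //= addrCA ltrDl ltr_wpDr // ?sumr_ge0.
  have : cabs (z i) ^+ 2 < s * (2 * cRe (z i)) by rewrite -ltr_pdivrMr ?mulr_gt0.
  move=> h; rewrite -(ltr_pXn2r (n := 2)) ?nnegrE ?cabs_ge0 //; move: h; rewrite !cabs_sqr cReD cReN cImD cImN cRe_cR cIm_cR.
  by move: (cRe (z i)) (cIm (z i)) (s) => X Y S; nra.
have i0 : 'I_n by exact: Ordinal n0.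
case: (@arg_maxP _ R 'I_n i0 predT (fun i => cabs (cR s - z i)) isT) => j _ hj.
by exists s, (cabs (cR s - z j)); split=> //; [exact: cabs_ge0|move=> i; exact: hj].
Qed.

Lemma Lap_lin z c p q : (forall i, 0 < cRe (z i)) -> Lap z (c *: p + q) = c * Lap z p + Lap z q.
Proof. by move=> /rates_exist [s [r [_ r0 rs h]]]; rewrite !(Lap_Lf s r) (Lf_lin r0 rs h). Qed.

Lemma LapZ z c p : (forall i, 0 < cRe (z i)) -> Lap z (c *: p) = c * Lap z p.
Proof. by move=> /rates_exist [s [r [_ r0 rs h]]]; rewrite !(Lap_Lf s r) (LfZ r0 rs h). Qed.

Lemma Lap_mulX z i p : (forall i, 0 < cRe (z i)) -> z i * Lap z ('X_i * p) = Lap z (raise_op i p).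
Proof.
move=> /rates_exist [s [r [_ r0 rs h]]]; rewrite !(Lap_Lf s r) -(Lf_mulX r0 rs h).
by rewrite subKr.
Qed.

Lemma Lap_msym z w p : (forall i, 0 < cRe (z i)) -> Lap z (mpoly.msym w p) = Lap (z \o w) p.
Proof. by move=> /rates_exist [s [r [_ r0 rs h]]]; rewrite !(Lap_Lf s r) (Lf_msym w p r0 rs h). Qed.

Lemma Deltapow1 (b : C) : Deltapow (fun _ : 'I_n => 1) b = 1.
Proof.
rewrite /Deltapow big1 ?mulr0 ?cexp0 // => i _.
by rewrite -(cR1 R) cLog_cR // ln1 cR0.
Qed.

Lemma Lap_one z : (forall i, 0 < cRe (z i)) -> Lap z 1 * Deltapow z mu = ell 1 1.
Proof.
move=> /rates_exist [s [r [s1 r0 rs h]]].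
have sub w t : (fun i : 'I_n => cR t - (cR t - w i)) = w by apply/funext => i; rewrite subKr.
have := Lf_one r0 rs h; rewrite -Lap_Lf sub => ->.
have h0 : 0 <= s - 1 by rewrite subr_ge0.
have h1 : s - 1 < s by lra.
have h2 i : cabs (cR s - (fun _ : 'I_n => 1) i) <= s - 1.
  by rewrite -(cR1 R) -cRB cabs_cR ger0_norm.
have := Lf_one h0 h1 h2; rewrite -Lap_Lf sub Deltapow1 mulr1 => <-.
by rewrite (Lap_Lf 1 0) Lf0 // => i; rewrite cR1 subrr.
Qed.

Lemma Lint_fin z p : (forall i, 0 < cRe (z i)) -> integrableRpos (Lint z p).
Proof.
move=> /rates_exist [s [r [_ r0 rs h]]].
have sr : 0 < s - r by rewrite subr_gt0.
have g : pg (fun x => p.@[cofr x] * cR (omega k x) * gE r (fun i => cR s - z i) x).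
  by apply: pgM; [exact: pg_pw|exists 1, 0%N; exact: gE_pgb].
by apply: (integrable_eq _ (I_fin a_gt sr g)) => x; exact: Lint_rep.
Qed.
End LaplaceFunctional.

(** * Laplace transforms of Jack polynomials up to a constant *)

Section JackLaplace.
Variable R : realType.
Local Notation C := (Cx R).
Variables (n : nat) (k : R).
Hypotheses (k0 : 0 <= k) (n0 : (0 < n)%N).
Variable a : C.
Hypothesis a_gt : -1 < cRe a.
Local Notation P := (mpoly.mpoly n C).
Local Notation kC := (cR k : C).
Local Notation kp := (cR_ge0 k0).
Local Notation mu := (a + 1 + cR (k * (n%:R - 1))).
Implicit Types (p q : P) (z : 'I_n -> C) (m : mpoly.multinom n).

Definition poch (s : C) N : C := \prod_(l < N) (s + l%:R).

(** The generalised Pochhammer symbol of the decreasing rearrangement of m. Indexing by rank makes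
    the effect of raising visible; [jack_poch_mplus] is the usual form, which shows the invariance
    under permutations. *)
Definition jack_poch m : C := \prod_i poch (mu - kC * (rk m i)%:R) (m i).

Lemma prod_rk (f : nat -> nat -> C) m : \prod_i f (m i) (rk m i) = \prod_(j < n) f (mplus (mi_of m) j) j.
Proof.
rewrite [RHS](reindex_inj (@perm_inj _ (rkp m))); apply: eq_bigr => i _.
by rewrite mplus_rkp rkpE.
Qed.

Lemma jack_poch_mplus m : jack_poch m = \prod_(j < n) poch (mu - kC * j%:R) (mplus (mi_of m) j).
Proof. exact: (prod_rk (fun x y => poch (mu - kC * y%:R) x)). Qed.

Lemma jack_poch_perm m (w : {perm 'I_n}) : jack_poch (m#w) = jack_poch m.
Proof. by rewrite !jack_poch_mplus mplus_perm. Qed.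

Lemma Deltapow_opp z (s : C) : Deltapow z s * Deltapow z (- s) = 1.
Proof. by rewrite /Deltapow -cexpD -mulrDl subrr mul0r cexp0. Qed.

Lemma Deltapow_perm z (w : {perm 'I_n}) (s : C) : Deltapow (z \o w) s = Deltapow z s.
Proof. by rewrite /Deltapow; congr (cexp (_ * _)); rewrite [RHS](reindex_inj (@perm_inj _ w)). Qed.

Definition laplace_formula m p := forall z, (forall i, 0 < cRe (z i)) ->
  Lap k a z p = ell k a 1 (1 : P) * jack_poch m * p.@[vinv z] * Deltapow z (- mu).

Lemma laplace_formula_lin m c p q : laplace_formula m p -> laplace_formula m q -> laplace_formula m (c *: p + q).
Proof.
move=> hp hq z hz; rewrite (Lap_lin k0 n0 a_gt) // hp // hq // mpoly.mevalD mpoly.mevalZ.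
have r (x1 x2 x3 x4 x5 x6 : C) : x5 * (x1 * x2 * x3 * x4) + x1 * x2 * x6 * x4 = x1 * x2 * (x5 * x3 + x6) * x4.
  by ring.
exact: r.
Qed.

Lemma laplace_formula_msym m p (w w' : {perm 'I_n}) : laplace_formula m p ->
  laplace_formula (m#w') (mpoly.msym w p).
Proof.
move=> hp z hz; rewrite (Lap_msym k0 n0 a_gt) // hp => [|i]; last exact: hz.
by rewrite jack_poch_perm meval_msym Deltapow_perm.
Qed.

(** The last operator [D mx] on a raised polynomial is [x_mx T_mx] plus a scalar, its sum of
    transpositions being empty. Since [D_raise_max] gives its eigenvalue, cancelling x_mx shows that
    the right side of the Laplace recursion is a multiple of the rotated polynomial. *)
Lemma raise_op_eigen (o mx : 'I_n) (o0 : o = 0%N :> nat) (mxn : mx.+1 = n) m p :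
  eigen kC m p -> raise_op k a mx (mpoly.msym (rot kp o0 mxn)^-1%g p) =
   (mu - kC * (rk m o)%:R + (m o)%:R) *: mpoly.msym (rot kp o0 mxn)^-1%g p.
Proof.
move=> ep; set q := mpoly.msym _ p.
have h := D_raise_max kp o0 mxn p.
rewrite ep -[X in _ = raise_pol _ _ _ (_ + X)]scale1r -scalerDl in h.
rewrite /raise_pol DE mpoly.msymZ -/q -scalerAr in h.
rewrite [\sum_(l < n | (mx < l)%N) _]big1 in h; last first.
  move=> l hl; have : (l < mx.+1)%N by rewrite mxn.
  by rewrite ltnS leqNgt hl.
have nz : 'X_mx != 0 :> P.
  apply/eqP => e; have := congr1 (mpoly.meval (fun=> (1 : C))) e.
  by rewrite mpoly.mevalXU mpoly.meval0 => /eqP; rewrite oner_eq0.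
have e : T kC mx ('X_mx * q) = (eb kC m o + 1 - kC * (1 - n%:R)) *: q.
  apply: (mulfI nz); rewrite -scalerAr scalerBl; apply/eqP; rewrite -subr_eq opprK; apply/eqP.
  by rewrite -h scaler0 addr0.
rewrite /raise_op e -scalerDl; congr (_ *: _); rewrite /eb cRM cRB cR1 cR_nat.
by move: (m o)%:R (rk m o)%:R (n%:R : C) => *; ring.
Qed.

Lemma pochS (s : C) N : poch s N.+1 = poch s N * (s + N%:R).
Proof. by rewrite /poch big_ord_recr. Qed.

Lemma jack_poch_raise (o mx : 'I_n) (o0 : o = 0%N :> nat) (mxn : mx.+1 = n) m :
  jack_poch (raise kp o0 mxn m) = jack_poch m * (mu - kC * (rk m o)%:R + (m o)%:R).
Proof.
have hr i : rk (raise kp o0 mxn m) i = rk m (rot kp o0 mxn i).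
  rewrite /rk [RHS](reindex_inj (@perm_inj _ (rot kp o0 mxn))) /=.
  by apply: eq_bigr => l _; rewrite before_raise.
rewrite /jack_poch [in RHS](reindex_inj (@perm_inj _ (rot kp o0 mxn))) /=.
rewrite (bigD1 mx) //= [in RHS](bigD1 mx) //= hr raiseE eqxx addn1 rot_mx pochS mulrAC; congr (_ * _ * _).
by apply: eq_bigr => i ni; rewrite hr raiseE (negbTE ni) addn0.
Qed.

Lemma laplace_formula_raise (o mx : 'I_n) (o0 : o = 0%N :> nat) (mxn : mx.+1 = n) m p :
  eigen kC m p -> laplace_formula m p -> laplace_formula (raise kp o0 mxn m) (raise_pol kp o0 mxn p).
Proof.
move=> ep hp z hz; have zn : z mx != 0 by apply: contraTneq (hz mx) => ->; rewrite ltxx.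
apply: (mulfI zn); rewrite /raise_pol (Lap_mulX k0 n0 a_gt) // (raise_op_eigen _ _ ep).
rewrite (LapZ k0 n0 a_gt) // (laplace_formula_msym (rot kp o0 mxn)^-1%g 1%g hp) //.
rewrite jack_poch_perm jack_poch_raise mpoly.mevalM mpoly.mevalXU.
have e : z mx * (vinv z mx) = 1 by rewrite mulfV.
have r (x1 x2 x3 x4 x5 x6 x7 : C) : x6 * x7 = 1 ->
    x1 * (x2 * x3 * x4 * x5) = x6 * (x2 * (x3 * x1) * (x7 * x4) * x5).
  move=> h; have -> : x6 * (x2 * (x3 * x1) * (x7 * x4) * x5) = x6 * x7 * (x1 * (x2 * x3 * x4 * x5)) by ring.
  by rewrite h mul1r.
exact: r.
Qed.

Lemma laplace_formula_1 : laplace_formula mpoly.mnm0 1.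
Proof.
move=> z hz; rewrite jack_poch_mplus big1 => [|j _]; last first.
  rewrite -[j](permKV (rkp mpoly.mnm0)) mplus_rkp mpoly.mnm0E /poch big_ord0 //.
rewrite mpoly.meval1 !mulr1 -(Lap_one k0 n0 a_gt hz) -mulrA Deltapow_opp mulr1 //.
Qed.

Lemma jack_laplace m q : eigen kC m q -> laplace_formula m q.
Proof.
have mxP : (n.-1 < n)%N by rewrite prednK.
have mxn : (Ordinal mxP : nat).+1 = n by rewrite /= prednK.
move=> eq; have [m' i j p hp|m' i j p hp|m' p ep hp|p [p0 ep hp]] := @eigen_induction _ n kC kp
  (Ordinal n0) (Ordinal mxP) (erefl _) mxn laplace_formula laplace_formula_1 laplace_formula_lin _ _ _ m.
- exact: laplace_formula_msym.
- by move=> z hz; rewrite jack_poch_perm hp.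
- exact: laplace_formula_raise.
have [c ->] := eigen_prop (cR_ge0 k0) ep p0 eq.
move=> z hz; rewrite (LapZ k0 n0 a_gt) // hp // mpoly.mevalZ.
have r (x1 x2 x3 x4 x5 : C) : x5 * (x1 * x2 * x3 * x4) = x1 * x2 * (x5 * x3) * x4 by ring.
exact: r.
Qed.

Definition prodX : P := \prod_(l < n) 'X_l.
Definition ones : mpoly.multinom n := mnm_of (fun _ : 'I_n => 1%N).

Lemma sw_prodX i j : sw i j prodX = prodX.
Proof.
rewrite /sw /prodX rmorph_prod /= [RHS](reindex_inj (@perm_inj _ (tperm i j))) /=.
by apply: eq_bigr => l _; rewrite msymXi.
Qed.

Lemma eigen_prodX : eigen kC ones prodX.
Proof.
move=> i; rewrite DE (eq_bigr (fun=> prodX)) => [|l _]; last exact: sw_prodX.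
have -> : 'X_i * T kC i prodX = prodX.
  rewrite TE big1 ?scaler0 ?addr0 => [|j ji]; last by apply: dd_sym; rewrite 1?eq_sym // sw_prodX.
  rewrite /prodX (bigD1 i) //= mpoly.mderivM mderivX1 eqxx mul1r; congr (_ * _).
  rewrite [X in _ + _ * X](_ : _ = 0) ?mulr0 ?addr0 //.
  elim/big_ind: _ => [|p q hp hq|l li].
  - by rewrite mpoly.mderivC.
  - by rewrite mpoly.mderivM hp hq mul0r mulr0 addr0.
  - by rewrite mderivX1 (negbTE li).
have -> : \sum_(l < n | (i < l)%N) prodX = (\sum_(l < n) (i < l))%N%:R *: prodX.
  by rewrite scaler_nat -sumrMnr big_mkcond; apply: eq_bigr => l _; case: ifP.
rewrite scalerA -[X in X + _ + _]scale1r -!scalerDl; congr (_ *: _).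
rewrite /eb mnm_ofE; set A := (\sum_(l < n) (i < l))%N; have : (rk ones i + A + 1 = n)%N.
  have e1 : (\sum_(l < n) (l == i) = 1)%N by rewrite (bigD1 i) //= eqxx big1 // => l /negbTE ->.
  rewrite -[X in (_ + X)%N]e1 /A /rk -!big_split /= -[RHS]card_ord -sum1_card; apply: eq_bigr => l _.
  have -> : (l == i) = (nat_of_ord l == i) by [].
  by rewrite /before !mnm_ofE eqxx ltnn /=; case: ltngtP.
move=> e; rewrite -[in LHS]e !natrD; move: (A%:R : C) ((rk ones i)%:R : C) => x y; ring.
Qed.

Lemma mplus_ones j : mplus (mi_of ones) j = 1%N.
Proof. by rewrite -[j](permKV (rkp ones)) mplus_rkp mnm_ofE. Qed.

Lemma W_succ s (x : rvec R n) : posv x -> W (a + 1) s x = (\prod_i cR (x i)) * W a s x.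
Proof.
move=> px; rewrite /W -big_split; apply: eq_bigr => i _ /=; rewrite /wt mulrDl mul1r cexpD mulrA.
by rewrite [cexp (a * _) * _]mulrC cexp_cR lnK // posrE.
Qed.

Lemma meval_prodX (v : 'I_n -> C) : prodX.@[v] = \prod_i v i.
Proof.
rewrite /prodX rmorph_prod; apply: eq_bigr => i _; exact: mpoly.mevalXU.
Qed.

(** The product of all variables is the Jack polynomial of (1, ..., 1), and multiplying by it raises
    a by 1; its Laplace transform at z = (1, ..., 1) is the asserted recursion. *)
Lemma ell_succ : ell k (a + 1) 1 (1 : P) = ell k a 1 (1 : P) * \prod_(j < n) (mu - kC * j%:R).
Proof.
have z1 i : 0 < cRe ((fun _ : 'I_n => 1 : C) i) by rewrite -(cR1 R) cRe_cR.
have := jack_laplace eigen_prodX z1.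
rewrite (Lap_Lf k0 n0 a 1 0) Lf0 => [|i]; last by rewrite cR1 subrr.
rewrite jack_poch_mplus meval_prodX Deltapow1 mulr1 [X in _ * X]big1 ?mulr1 => [|i _]; last exact: invr1.
rewrite (eq_bigr (fun j : 'I_n => mu - kC * j%:R)) => [<-|j _]; last first.
  by rewrite mplus_ones /poch big_ord_recl big_ord0 mulr1 addr0.
rewrite /ell /I; apply: intRpos_eq => x px; rewrite W_succ // mpoly.meval1 mul1r meval_prodX.
by rewrite mulrA [cR (omega _ _) * _]mulrC.
Qed.
End JackLaplace.

(** * Monotonicity of the functional for real exponents *)

Section MonotoneFunctional.
Local Open Scope classical_set_scope.
Variable R : realType.
Local Notation C := (Cx R).

Lemma cR_prod (T : Type) (r : seq T) (P : pred T) (f : T -> R) :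
  cR (\prod_(i <- r | P i) f i) = \prod_(i <- r | P i) cR (f i) :> C.
Proof. by rewrite cRE rmorph_prod. Qed.

Lemma cRV (x : R) : cR x^-1 = (cR x)^-1 :> C.
Proof. by rewrite !cRE fmorphV. Qed.

Lemma riter_le n (phi : R -> R) m (c d : R) G H : pcont1 phi -> iRpos phi ->
  (forall t, 0 < t -> 0 <= phi t) -> (m <= n)%N -> nice n phi 0 c G -> nice n phi 0 d H ->
  (forall x, posfrom n 0 x -> G x <= H x) -> forall x, posfrom n m x -> riter m G x <= riter m H x.
Proof.
move=> pc pint pge + nG nH h; elim: m => [|m IHm] mn x px /=; first exact: h.
apply: Rint_le => [||t t0].
- exact: (nice_iRpos pint (nice_riter pc pint pge (ltnW mn) nG) px mn).
- exact: (nice_iRpos pint (nice_riter pc pint pge (ltnW mn) nH) px mn).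
- by apply: IHm; [exact: ltnW|exact: posfrom_upd].
Qed.

Variables (n : nat) (al s : R).
Hypotheses (al_gt : -1 < al) (s_gt0 : 0 < s).
Local Notation V := (rvec R n).
Local Notation a := (cR al : C).

Lemma W_real (x : V) : W a s x = cR (\prod_(i < n) (expR (al * ln (x i)) * expR (- s * x i))).
Proof.
rewrite cR_prod; apply: eq_bigr => i _.
by rewrite /wt -cRM cexp_cR -cRM.
Qed.

Lemma Re_I_le (g : V -> C) (h : V -> R) : pg g -> pg (fun x => cR (h x)) ->
  (forall x, posv x -> cabs (g x) <= h x) -> cRe (I a s g) <= cRe (I a s (fun x => cR (h x))).
Proof.
move=> [c [q hg]] [d [r hh]] le.
have hg' := pgb_mono (lexx c) (leq_addr r q) hg.
have hh' := pgb_mono (lexx d) (leq_addl q r) hh.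
have ag : -1 < cRe a by [].
rewrite !Re_I; apply: (riter_le (@phi_pcont R a s _) (phi_iRpos ag s_gt0 _) (phi_ge0 a s _)
  (leqnn n) (nice_Re a s hg') (nice_Re a s hh')); last exact: posfrom_n.
move=> x px; pose y : V := fun i => x i.
have py : posv y by move=> i; apply: px; rewrite /= ltn_ord.
rewrite /gW -/y W_real !cReM !cRe_cR !cIm_cR !mulr0 !subr0.
apply: ler_wpM2r; first by apply: prodr_ge0 => i _; rewrite mulr_ge0 ?expR_ge0.
by apply: le_trans (le y py); apply: le_trans (ler_norm _) _; exact: cabs_ge_Re.
Qed.

(** Multiplication of g by a complex unit makes its integral nonnegative and reduces the claim to
    real parts. *)
Lemma cabs_I_le (g : V -> C) (h : V -> R) : pg g -> pg (fun x => cR (h x)) ->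
  (forall x, posv x -> cabs (g x) <= h x) -> cabs (I a s g) <= cRe (I a s (fun x => cR (h x))).
Proof.
move=> pgg ph le; have ag : -1 < cRe a by [].
have [e|z0] := eqVneq (I a s g) 0.
  have := @Re_I_le (fun=> 0) h (pg_cst n 0) ph; rewrite (I0 n ag s_gt0) e cabs0; apply => x px.
  by apply: le_trans (le x px); exact: cabs_ge0.
pose u : C := cR (cabs (I a s g)) / I a s g.
have cu : cabs u = 1.
  rewrite /u cabsM cabsV cabs_cR ger0_norm ?cabs_ge0 // divff //.
  by apply: contra_neq z0; exact: cabs_eq0.
have := @Re_I_le (fun x => u * g x) h (pgZ u pgg) ph.
rewrite (IZ ag s_gt0) // /u divfK // cRe_cR; apply => x px.
by rewrite -/u cabsM cu mul1r; exact: le.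
Qed.
End MonotoneFunctional.

(** * A polynomial majorant for the deviation of a power from 1 *)

Section Concentration.
Local Open Scope classical_set_scope.
Variable R : realType.
Local Notation C := (Cx R).

Lemma isd_ball (f : R -> R) (df e : R) : is_derive (0 : R) 1 f df -> 0 < e ->
  exists2 d, 0 < d & forall l, `|l| < d -> `|f l - f 0| < e.
Proof.
move=> [df' _] e0; have /derivable1_diffP/differentiable_continuous c := df'.
have : f l @[l --> (0 : R)] --> f 0 := c.
move=> /cvgrPdist_lt /(_ e e0) /nbhs_ballP [d /= d0 h]; exists d => // l hl.
by rewrite distrC; apply: h; rewrite /ball /= sub0r normrN.
Qed.

(** With [y = exp l] the quantity on the left is [|y^w - 1|]. Near y = 1 continuity makes it small;
    elsewhere [(y - 1)^2] is bounded below and [|y^w| <= 1 + y^M]. The majorant is a polynomial in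
    y, so its integral is known from finitely many moments. *)
Lemma cexp_near (w : C) (e : R) : 0 <= cRe w -> 0 < e -> exists K M, 0 <= K /\
  forall l, cabs (cexp (w * cR l) - 1) <= e + K * ((expR l - 1) ^+ 2 * (1 + expR l ^+ M)).
Proof.
move=> w0 e0; have e2 : 0 < e / 2 by rewrite divr_gt0.
have [d1 d2] := cderiv_exp (cderivZ w (cderiv_id (0 : R))).
have [r1 r10 h1] := isd_ball d1 e2; have [r2 r20 h2] := isd_ball d2 e2.
have z0 : cexp (w * cR 0) = 1 by rewrite cR0 mulr0 cexp0.
pose d := Num.min r1 r2.
have d0 : 0 < d by rewrite lt_min r10.
(* A lower bound for [|exp l - 1|] when [|l| >= d]; the negative side is the extremal one. *)
pose eta := 1 - expR (- d).
have eta0 : 0 < eta by rewrite subr_gt0 -expR0 ltr_expR oppr_lt0.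
pose M := (Num.trunc (cRe w)).+1.
have hM : cRe w <= M%:R by apply: ltW; have /andP[] := trunc_itv w0.
exists (2 / eta ^+ 2), M; split=> [|l]; first by rewrite divr_ge0 // sqr_ge0.
have Z0 : 0 <= expR l ^+ M by rewrite exprn_ge0 // expR_ge0.
have K0 : 0 <= 2 / eta ^+ 2 * ((expR l - 1) ^+ 2 * (1 + expR l ^+ M)).
  by rewrite mulr_ge0 ?divr_ge0 ?sqr_ge0 // mulr_ge0 ?sqr_ge0 // addr_ge0.
have [ld|dl] := ltP `|l| d.
  move: ld; rewrite lt_min => /andP[l1 l2].
  have := h1 l l1; have := h2 l l2; rewrite z0 => i2 i1.
  apply: le_trans (cabs_le _) _; rewrite cReD cImD cReN cImN.
  by move: i1 i2 K0; set A := `|_|; set B := `|_|; lra.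
have sq : eta ^+ 2 <= (expR l - 1) ^+ 2.
  have ed : 1 <= expR d by rewrite -expR0 ler_expR ltW.
  have em : expR d * expR (- d) = 1 by rewrite -expRD subrr expR0.
  have en0 := expR_ge0 (- d).
  have e1 : 1 - expR (- d) <= expR d - 1.
    have e4 : expR (- d) * (expR d - 1) ^+ 2 = expR d + expR (- d) - 2.
      have -> : expR (- d) * (expR d - 1) ^+ 2 =
        expR d * (expR d * expR (- d)) - 2 * (expR d * expR (- d)) + expR (- d) by ring.
      by rewrite em; ring.
    have := mulr_ge0 en0 (sqr_ge0 (expR d - 1)); rewrite e4; lra.
  move: dl; rewrite ler_normr => /orP[dl|dl].
    have h3 : expR d <= expR l by rewrite ler_expR.
    by apply: lerXn2r; rewrite ?nnegrE /eta; move: eta0; rewrite /eta; lra.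
  have h3 : expR l <= expR (- d) by rewrite ler_expR lerNr.
  rewrite -[leRHS]sqrrN opprB.
  by apply: lerXn2r; rewrite ?nnegrE /eta; move: eta0; rewrite /eta; lra.
apply: (@le_trans _ _ (2 * (1 + expR l ^+ M))).
  apply: le_trans (cabsD _ _) _; rewrite cabsN cabs1 cabs_cexp cReM cRe_cR cIm_cR mulr0 subr0.
  have : expR (cRe w * l) <= 1 + expR l ^+ M.
    rewrite -expRM_natl; have [l0|l0] := leP 0 l.
      apply: (@le_trans _ _ (expR (M%:R * l))); first by rewrite ler_expR ler_wpM2r.
      by rewrite lerDr.
    apply: (@le_trans _ _ 1); last by rewrite lerDl expR_ge0.
    by rewrite -expR0 ler_expR mulr_ge0_le0 // ltW.
  by move: Z0; set Z := _ ^+ M; lra.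
apply: (@le_trans _ _ (2 / eta ^+ 2 * ((expR l - 1) ^+ 2 * (1 + expR l ^+ M)))); last first.
  by rewrite lerDr ltW.
rewrite mulrA ler_wpM2r ?addr_ge0 // -[leLHS]mulr1 -mulrA ler_wpM2l //.
by rewrite mulrC ler_pdivlMr ?exprn_gt0 // mul1r.
Qed.

Lemma ccvg_prod (T : Type) (r : seq T) (f : T -> nat -> C) (g : T -> C) :
  (forall i, ccvg (f i) (g i)) -> ccvg (fun N => \prod_(i <- r) f i N) (\prod_(i <- r) g i).
Proof.
move=> h; elim: r => [|i r IHr].
  by rewrite big_nil; under eq_fun do rewrite big_nil; exact: ccvg_cst.
by rewrite big_cons; under eq_fun do rewrite big_cons; exact: ccvgM.
Qed.
End Concentration.

(** * The Selberg-type integral: recursion and growth in the parameter *)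

Section SelbergAsymptotics.
Local Open Scope classical_set_scope.
Variable R : realType.
Local Notation C := (Cx R).
Variables (n : nat) (k : R).
Hypotheses (k0 : 0 <= k) (n0 : (0 < n)%N).
Local Notation V := (rvec R n).
Implicit Types (a w : C) (al : R) (N : nat).

Definition sel a : C := I a 1 (fun x : V => cR (omega k x)).
Definition fac a : C := \prod_(j < n) (a + 1 + cR (k * (n%:R - 1)) - cR k * j%:R).
Definition PN a N : C := \prod_(l < N) fac (a + l%:R).

Lemma sel_ell a : sel a = ell k a 1 (1 : mpoly.mpoly n C).
Proof. by apply: I_eq => x _; rewrite mpoly.meval1 mul1r. Qed.

Lemma sel_succ a : -1 < cRe a -> sel (a + 1) = sel a * fac a.
Proof. by move=> ha; rewrite !sel_ell (ell_succ k0 n0 ha). Qed.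

Lemma cRe_natD a N : -1 < cRe a -> -1 < cRe (a + N%:R).
Proof. by move=> ha; rewrite cReD -(cR_nat R) cRe_cR ltr_wpDr. Qed.

Lemma sel_shift a N : -1 < cRe a -> sel (a + N%:R) = sel a * PN a N.
Proof.
move=> ha; elim: N => [|N IHN]; first by rewrite addr0 /PN big_ord0 mulr1.
by rewrite -natr1 addrA sel_succ ?cRe_natD // IHN /PN big_ord_recr /= mulrA.
Qed.

Lemma W_add a w s (x : V) : W (a + w) s x = W w 0 x * W a s x.
Proof.
rewrite /W -big_split; apply: eq_bigr => i _ /=.
rewrite /wt mulrDl cexpD oppr0 mul0r expR0 cR1 mulr1 mulrA; congr (_ * _); exact: mulrC.
Qed.

Lemma pg_W w : 0 <= cRe w -> pg (fun x : V => W w 0 x).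
Proof.
move=> w0; pose M := (Num.trunc (cRe w)).+1.
have hM : cRe w <= M%:R by apply: ltW; have /andP[] := trunc_itv w0.
exists 1, M; split=> // [x px|xs x pxs px cx]; last exact: W_cvg.
rewrite /W cabs_prod mul1r /gr -prodrXl; apply: ler_prod => i _.
rewrite cabs_ge0 cabs_wt // oppr0 mul0r expR0 mulr1.
have x1 : 1 <= 1 + x i by rewrite lerDl ltW.
apply: (@le_trans _ _ ((1 + x i) `^ cRe w)).
  by apply: ge0_ler_powR; rewrite ?nnegrE ?(ltW (px i)) ?lerDr // addr_ge0 // ltW.
apply: (@le_trans _ _ ((1 + x i) `^ M%:R)); first exact: ler_powR.
by rewrite powR_mulrn // addr_ge0 // ltW.
Qed.

Lemma sel_W a w : sel (a + w) = I a 1 (fun x : V => W w 0 x * cR (omega k x)).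
Proof.
apply: intRpos_eq => x px; rewrite W_add mulrA; congr (_ * _); exact: mulrC.
Qed.

Lemma W_nat m (x : V) : posv x -> W (m%:R) 0 x = cR (\prod_i x i ^+ m).
Proof.
move=> px; rewrite cR_prod; apply: eq_bigr => i _.
by rewrite /wt oppr0 mul0r expR0 cR1 mulr1 -(cR_nat R) -cRM cexp_cR expRM_natl lnK // posrE.
Qed.

(** Multiplying by the m-th power of the product of the coordinates shifts a by m, so all moments of
    this product follow from the recursion. *)
Lemma sel_ratio a (t : R) m : 0 < t -> -1 < cRe a ->
  I a 1 (fun x : V => cR ((\prod_i x i / t ^+ n) ^+ m) * cR (omega k x)) =
  sel a * (PN a m / cR (t ^+ (n * m))).
Proof.
move=> t0 ha; rewrite mulrA -sel_shift // sel_W mulrC -cRV.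
have pw : pg (fun x : V => W m%:R 0 x * cR (omega k x)).
  by apply: pgM; [apply: pg_W; rewrite -(cR_nat R) cRe_cR|exact: pg_omega].
rewrite -(IZ ha ltr01 _ pw); apply: I_eq => x px.
rewrite W_nat // mulrA -[in RHS]cRM; congr (cR _ * _).
by rewrite expr_div_n prodrXl exprM [RHS]mulrC.
Qed.

(** Each of the n m factors is [N + 1] plus a bounded quantity. Hence under the weight with
    parameter [al + N], all moments of the product of the coordinates divided by [(N + 1)^n] tend to
    1: the product concentrates. *)
Lemma PN_ratio_cvg al m :
  ccvg (fun N => PN (cR al + N%:R) m / cR (N.+1%:R ^+ (n * m))) 1.
Proof.
have e1 : \prod_(l < m) \prod_(j < n) (1 : C) = 1 by rewrite big1 // => l _; rewrite big1.
rewrite -[X in ccvg _ X]e1.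
rewrite (_ : (fun N => _) = fun N => \prod_(l < m) \prod_(j < n)
    (1 + cR (N.+1%:R^-1) * (cR al + l%:R + cR (k * (n%:R - 1)) - cR k * j%:R))).
  apply: ccvg_prod => l; apply: ccvg_prod => j.
  rewrite -[X in ccvg _ X]addr0; apply: ccvgD; first exact: ccvg_cst.
  rewrite -[X in ccvg _ X](mul0r (cR al + l%:R + cR (k * (n%:R - 1)) - cR k * j%:R)) -(cR0 R).
  apply: ccvgM; last exact: ccvg_cst.
  by apply: ccvg_cR; exact: invS_cvg0.
apply/funext => N; pose t : C := cR (N.+1%:R).
have t0 : t != 0 by rewrite /t cR_nat pnatr_eq0.
have -> : cR (N.+1%:R ^+ (n * m)) = \prod_(l < m) \prod_(j < n) t.
  rewrite !prodr_const !card_ord -exprM cRE rmorphXn //.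
rewrite /PN /fac -prodf_div; apply: eq_bigr => l _; rewrite -prodf_div; apply: eq_bigr => j _.
rewrite cRV -/t.
have -> : cR al + N%:R + l%:R + 1 = t + (cR al + l%:R) by rewrite /t cR_nat -natr1; ring.
by move: (cR (k * _)) (cR k * _) => X Y; field.
Qed.

(** Up to the factor [sel(al + w) / sel(al)], this is [sel(al + w + N) / sel(al + N)] divided by
    [(N + 1)^(n w)]. Its limit expresses the growth of the integral without any Stirling formula. *)
Definition growth al w N : C :=
  PN (cR al + w) N / PN (cR al) N * cexp (- (w * cR (n%:R * ln N.+1%:R))).

Lemma fac_gt0 al l : -1 < al -> exists2 r, 0 < r & fac (cR al + l%:R) = cR r.
Proof.
move=> ha; exists (\prod_(j < n) (al + l%:R + 1 + k * (n%:R - 1) - k * j%:R)).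
  apply: prodr_gt0 => j _; have jn : j%:R <= n%:R - 1 :> R.
    by rewrite lerBrDr natr1 ler_nat.
  have := ler_wpM2l k0 jn; have l0 : 0 <= l%:R :> R by [].
  by move: (k * (n%:R - 1)) (k * j%:R) => X Y; lra.
rewrite cR_prod; apply: eq_bigr => j _.
by rewrite cRB (cRM k j%:R) !cRD cR1 !cR_nat.
Qed.

Lemma PN_gt0 al N : -1 < al -> exists2 r, 0 < r & PN (cR al) N = cR r.
Proof.
move=> ha; elim: N => [|N [r r0 IHN]]; first by exists 1; rewrite // /PN big_ord0 cR1.
have [u u0 hu] := fac_gt0 N ha; exists (r * u); first exact: mulr_gt0.
by rewrite /PN big_ord_recr /= -/(PN _ N) IHN hu cRM.
Qed.

(** The list is the expansion of [e + K (y - 1)^2 (1 + y^M)] into pairs of coefficient and exponent,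
    where y is the normalised product of the coordinates. The difference on the left is the integral
    of [y^w - 1], divided by [PN (cR al) N] to return from [al + N] to al. *)
Lemma shift_estimate al w (e K : R) (M N : nat) : -1 < al -> 0 <= cRe w ->
  (forall l, cabs (cexp (w * cR l) - 1) <= e + K * ((expR l - 1) ^+ 2 * (1 + expR l ^+ M))) ->
  cabs (sel (cR al + w) * growth al w N - sel (cR al)) <=
  cRe (\sum_(ci <- [:: (e, 0%N); (K, 0%N); (- 2 * K, 1%N); (K, 2%N); (K, M); (- 2 * K, M.+1); (K, M.+2)])
    cR ci.1 * (sel (cR al) * (PN (cR al + N%:R) ci.2 / cR (N.+1%:R ^+ (n * ci.2))))).
Proof.
move=> ha w0 h; set L := [:: _; _; _; _; _; _; _].
have hac : -1 < cRe (cR al : C) by [].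
have [p p0 hp] := PN_gt0 N ha.
have pn : cR p != 0 :> C by rewrite -(cR0 R) (inj_eq (@cR_inj R)) gt_eqF.
pose t : R := N.+1%:R; have t0 : 0 < t by rewrite ltr0n.
pose b : R := al + N%:R; have hb : -1 < b by rewrite ltr_wpDr.
have bE : cR al + N%:R = cR b :> C by rewrite cRD cR_nat.
have hbc : -1 < cRe (cR b : C) by [].
pose E : C := cexp (- (w * cR (n%:R * ln t))).
pose D := I (cR b) 1 (fun x : V => (E * W w 0 x + - 1) * cR (omega k x)).
have pwo : pg (fun x : V => W w 0 x * cR (omega k x)) by apply: pgM; [exact: pg_W|exact: pg_omega].
have pgD' : pg (fun x : V => (E * W w 0 x + - 1) * cR (omega k x)).
  by apply: pgM; [apply: pgD; [apply: pgZ; exact: pg_W|exact: pg_cst]|exact: pg_omega].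
have DE : D = E * sel (cR b + w) - sel (cR b).
  have e1 := IZ hbc ltr01 E pwo; have e2 := IZ hbc ltr01 (-1) (pg_omega n k0).
  rewrite sel_W -e1 -mulN1r -e2 -(ID hbc ltr01 (pgZ E pwo) (pgZ (-1) (pg_omega n k0))).
  by apply: I_eq => x _; rewrite mulrDl mulrA.
have -> : sel (cR al + w) * growth al w N - sel (cR al) = cR p^-1 * D.
  have hw : -1 < cRe (cR al + w) by rewrite cReD cRe_cR ltr_wpDr.
  rewrite DE -bE -addrA [N%:R + w]addrC addrA !sel_shift // hp /growth hp -/t -/E.
  rewrite cRV.
  have fld (x1 x2 x3 x4 x5 : C) : x5 != 0 ->
      x1 * (x3 / x5 * x4) - x2 = x5^-1 * (x4 * (x1 * x3) - x2 * x5) by move=> hx; field.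
  exact: fld.
pose T (x : V) := \sum_(ci <- L) ci.1 * (\prod_i x i / t ^+ n) ^+ ci.2.
have TE x : cR (T x * omega k x) = \sum_(ci <- L) cR ci.1 * (cR ((\prod_i x i / t ^+ n) ^+ ci.2) * cR (omega k x)).
  by rewrite cRM cR_sum mulr_suml; apply: eq_bigr => ci _; rewrite cRM mulrA.
have pm m : pg (fun x : V => cR ((\prod_i x i / t ^+ n) ^+ m) * cR (omega k x)).
  apply: (@pg_ext _ _ (fun x : V => cR ((t ^+ n)^-1 ^+ m) * (W m%:R 0 x * cR (omega k x)))) => [x px|].
    rewrite W_nat // mulrA -cRM; congr (cR _ * _).
    by rewrite exprVn prodrXl expr_div_n mulrC.
  by apply: pgZ; apply: pgM; [apply: pg_W; rewrite -(cR_nat R) cRe_cR|exact: pg_omega].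
have pT : pg (fun x : V => cR (T x * omega k x)).
  apply: (@pg_ext _ _ (fun x : V => \sum_(ci <- L) cR ci.1 * (cR ((\prod_i x i / t ^+ n) ^+ ci.2) * cR (omega k x)))) => [x _|].
    by rewrite TE.
  by apply: pg_sum => ci; apply: pgZ; exact: pm.
have om0 (x : V) : 0 <= omega k x by rewrite omega_Om; exact: Om_ge0.
have bound : cabs D <= cRe (I (cR b) 1 (fun x : V => cR (T x * omega k x))).
  apply: (cabs_I_le hb ltr01 pgD' pT) => x px; rewrite cabsM cabs_cR ger0_norm //.
  apply: ler_wpM2r => //; pose l := \sum_i ln (x i) - n%:R * ln t.
  have -> : E * W w 0 x = cexp (w * cR l).
    have -> : W w 0 x = cexp (w * cR (\sum_i ln (x i))).
      rewrite cR_sum mulr_sumr cexp_sum; apply: eq_bigr => i _.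
      by rewrite /wt oppr0 mul0r expR0 cR1 mulr1.
    by rewrite /E -cexpD /l cRB; congr cexp; ring.
  have el : expR l = \prod_i x i / t ^+ n.
    rewrite /l expRB expR_sum expRM_natl lnK ?posrE //; congr (_ / _).
    by apply: eq_bigr => i _; rewrite lnK // posrE.
  apply: le_trans (h l) _; rewrite /T /L !big_cons big_nil /= el.
  move: (\prod_i x i / t ^+ n) => y; rewrite !exprS expr0.
  by move: (y ^+ M) => Z; lra.
rewrite cabsM cabs_cR ger0_norm; last by rewrite invr_ge0 ltW.
apply: (@le_trans _ _ (p^-1 * cRe (I (cR b) 1 (fun x : V => cR (T x * omega k x))))).
  by rewrite ler_wpM2l // invr_ge0 ltW.
have -> : I (cR b) 1 (fun x : V => cR (T x * omega k x)) =
    \sum_(ci <- L) cR ci.1 * (sel (cR b) * (PN (cR b) ci.2 / cR (t ^+ (n * ci.2)))).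
  under eq_bigr => ci _ do rewrite -(sel_ratio _ t0 hbc) -(IZ hbc ltr01 _ (pm _)).
  rewrite -(I_sum hbc ltr01) => [|ci]; last by apply: pgZ; exact: pm.
  by apply: I_eq => x _; rewrite TE.
have -> : p^-1 * cRe (\sum_(ci <- L) cR ci.1 * (sel (cR b) * (PN (cR b) ci.2 / cR (t ^+ (n * ci.2))))) =
   cRe (cR p^-1 * (\sum_(ci <- L) cR ci.1 * (sel (cR b) * (PN (cR b) ci.2 / cR (t ^+ (n * ci.2)))))).
  by rewrite cReM cRe_cR cIm_cR mul0r subr0.
have -> // : cR p^-1 * (\sum_(ci <- L) cR ci.1 * (sel (cR b) * (PN (cR b) ci.2 / cR (t ^+ (n * ci.2))))) =
  \sum_(ci <- L) cR ci.1 * (sel (cR al) * (PN (cR al + N%:R) ci.2 / cR (N.+1%:R ^+ (n * ci.2)))).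
rewrite mulr_sumr; apply: eq_bigr => ci _; rewrite -bE sel_shift // hp bE -/t.
rewrite cRV; move: (_ / _) (sel _) (cR ci.1) => x1 x2 x3.
by field.
Qed.

Lemma growth_cvg al w : -1 < al -> 0 <= cRe w ->
  ccvg (fun N => sel (cR al + w) * growth al w N) (sel (cR al)).
Proof.
move=> ha w0; apply/ccvgP/cvgr0Pnorm_lt => e e0.
pose S := cRe (sel (cR al)); have S1 : 0 < `|S| + 1 by rewrite ltr_wpDl.
pose d := e / 2 / (`|S| + 1); have d0 : 0 < d by rewrite !divr_gt0.
have [K [M [K0 hK]]] := cexp_near w0 d0.
have dS : d * S < e.
  apply: (@le_lt_trans _ _ (d * (`|S| + 1))).
    by apply: ler_wpM2l; [exact: ltW|rewrite (le_trans (ler_norm _)) // lerDl].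
  by rewrite /d divfK ?gt_eqF // ltr_pdivrMr //; lra.
set L := [:: (d, 0%N); (K, 0%N); (- 2 * K, 1%N); (K, 2%N); (K, M); (- 2 * K, M.+1); (K, M.+2)].
pose B N : C := \sum_(ci <- L)
    cR ci.1 * (sel (cR al) * (PN (cR al + N%:R) ci.2 / cR (N.+1%:R ^+ (n * ci.2)))).
have [cB _] : ccvg B (\sum_(ci <- L) cR ci.1 * (sel (cR al) * 1)).
  apply: ccvg_sum => ci _; apply: ccvgM; first exact: ccvg_cst.
  by apply: ccvgM; [exact: ccvg_cst|exact: PN_ratio_cvg].
(* All moments have the limit 1, so K, -2K and K cancel twice and only the term with d survives. *)
have eL : cRe (\sum_(ci <- L) cR ci.1 * (sel (cR al) * 1)) = d * S.
  rewrite mulr1 -mulr_suml -cR_sum cReM cRe_cR cIm_cR mul0r subr0; congr (_ * _).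
  by rewrite /L !big_cons big_nil /=; lra.
rewrite eL in cB.
have hlt : 0 < e - d * S by rewrite subr_gt0.
have /cvgrPdist_lt /(_ _ hlt) := cB; apply: filterS => N hN.
rewrite ger0_norm ?cabs_ge0 //.
apply: le_lt_trans (shift_estimate N ha w0 hK) _; rewrite -/L -/(B N).
by have := ler_norm (cRe (B N) - d * S); rewrite distrC; move: hN; set A := `|_|; lra.
Qed.
End SelbergAsymptotics.

(** * Comparison with products of Gamma functions *)

Section GammaFactors.
Local Open Scope classical_set_scope.
Variable R : realType.
Local Notation C := (Cx R).

Lemma fac1 (k : R) (a : C) : fac 1 k a = a + 1.
Proof. by rewrite /fac big_ord1 subrr mulr0 cR0 addr0 mulr0 subr0. Qed.

(** Euler's integral is the case n = 1, so the Gamma function inherits both the recursion and the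
    growth statement from [sel]. *)
Lemma cGamma_sel (k : R) (s : C) : cGamma s = sel 1 k (s - 1).
Proof.
rewrite /cGamma /sel /I /intRpos /=; congr cint; apply/funext => t.
rewrite /omega big_ord1 big1 => [|j]; last by rewrite [j]ord1.
by rewrite cR1 mul1r /W big_ord1 /wt /upd /= mulN1r.
Qed.

Lemma sel_cGamma (k : R) (a : C) : sel 1 k a = cGamma (a + 1).
Proof. by rewrite (cGamma_sel k) addrK. Qed.

Lemma cGamma_succ (s : C) : 0 < cRe s -> cGamma (s + 1) = s * cGamma s.
Proof.
move=> s0; have h : -1 < cRe (s - 1) by rewrite cReD cReN -(cR1 R) cRe_cR; lra.
have := sel_succ (lexx (0 : R)) (ltn0Sn 0) h.
by rewrite fac1 subrK !sel_cGamma subrK mulrC.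
Qed.

Definition gamma_prod n (k : R) (a : C) : C :=
  \prod_(j < n) cGamma (a + 1 + cR (k * (n%:R - 1)) - cR k * j%:R).

Lemma gamma_shift_ge0 n (k : R) (j : 'I_n) : 0 <= k -> 0 <= k * (n%:R - 1) - k * j%:R.
Proof.
move=> k0; rewrite -mulrBr mulr_ge0 // subr_ge0 lerBrDr natr1 ler_nat //.
Qed.

(** [fac] splits into linear factors, one for each shifted Gamma function, and so does the power of
    [N + 1]. *)
Lemma growth_prod n (k : R) (w : C) N :
  \prod_(j < n) growth 1 k (k * (n%:R - 1) - k * j%:R) w N = growth n k 0 w N.
Proof.
have PN1 a : PN 1 k a N = \prod_(l < N) (a + l%:R + 1) by apply: eq_bigr => l _; exact: fac1.
have e (a : C) : \prod_(j < n) PN 1 k (cR (k * (n%:R - 1) - k * j%:R) + a) N = PN n k a N.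
  rewrite (eq_bigr _ (fun j _ => PN1 _)) exchange_big; apply: eq_bigr => l _; apply: eq_bigr => j _ /=.
  rewrite cRB (cRM k j%:R) cR_nat; ring.
rewrite /growth big_split /= prodf_div e cR0 add0r; congr (_ / _ * _).
  by rewrite -[in RHS]e; apply: eq_bigr => j _; rewrite addr0.
rewrite -cexp_sum sumr_const card_ord mul1r cRM cR_nat -mulr_natl; congr cexp; ring.
Qed.

Lemma gamma_prodE n (k : R) (a : C) :
  gamma_prod n k a = \prod_(j < n) sel 1 k (cR (k * (n%:R - 1) - k * j%:R) + a).
Proof.
apply: eq_bigr => j _; rewrite sel_cGamma; congr cGamma.
rewrite cRB (cRM k j%:R) cR_nat; ring.
Qed.

(** The n-dimensional integral and the product of one-dimensional ones have the same growth factor.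
    One sequence therefore converges to either side of the equation. *)
Lemma sel_gamma_prod n (k : R) (w : C) : 0 <= k -> (0 < n)%N -> 0 <= cRe w ->
  sel n k w * gamma_prod n k 0 = sel n k 0 * gamma_prod n k w.
Proof.
move=> k0 n0 w0.
have z1 : -1 < 0 :> R by rewrite ltrN10.
have c1 := growth_cvg k0 n0 z1 w0.
have c2 (j : 'I_n) : ccvg (fun N => sel 1 k (cR (k * (n%:R - 1) - k * j%:R) + w) *
    growth 1 k (k * (n%:R - 1) - k * j%:R) w N) (sel 1 k (cR (k * (n%:R - 1) - k * j%:R))).
  by apply: growth_cvg => //; rewrite (lt_le_trans z1) // gamma_shift_ge0.
have c3 := ccvgM c1 (ccvg_cst (gamma_prod n k w)).
have c4 := ccvgM (ccvg_prod (index_enum 'I_n) c2) (ccvg_cst (sel n k w)).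
rewrite cR0 in c3.
have -> : gamma_prod n k 0 = \prod_(j < n) sel 1 k (cR (k * (n%:R - 1) - k * j%:R)).
  by rewrite gamma_prodE; apply: eq_bigr => j _; rewrite addr0.
rewrite [LHS]mulrC; apply: (ccvg_unique c4); move: c3; congr (ccvg _ _); apply/funext => N.
rewrite big_split /= growth_prod -gamma_prodE add0r.
by move: (sel _ _ _) (growth _ _ _ _ _) (gamma_prod _ _ _) => x1 x2 x3; ring.
Qed.
End GammaFactors.

(** * Reduction of the dimension through a boundary term *)

Section Boundary.
Local Open Scope classical_set_scope.
Variable R : realType.
Local Notation C := (Cx R).
Variables (m : nat) (k : R).
Hypothesis k0 : 0 <= k.

Definition pcons (t : R) (y : rvec R m) : rvec R m.+1 :=
  fun i => if unlift ord0 i is Some j then y j else t.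

Lemma pcons0 t y : pcons t y ord0 = t. Proof. by rewrite /pcons unlift_none. Qed.
Lemma pconsS t y j : pcons t y (lift ord0 j) = y j. Proof. by rewrite /pcons liftK. Qed.

Lemma pcons_nat t (y : nat -> R) :
  (fun i : 'I_m.+1 => (fun l : nat => if l is l'.+1 then y l' else t) i) = pcons t (fun i : 'I_m => y i).
Proof.
apply/funext => i; case: (unliftP ord0 i) => [j ->|->]; first by rewrite pconsS lift0.
by rewrite pcons0.
Qed.

Lemma posv_pcons t y : 0 < t -> posv y -> posv (pcons t y).
Proof. by move=> t0 py i; rewrite /pcons; case: (unlift _ _). Qed.

Lemma gr_pcons t y : gr (pcons t y) = (1 + t) * gr y.
Proof.
rewrite /gr big_ord_recl pcons0; congr (_ * _).
by apply: eq_bigr => j _; rewrite pconsS.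
Qed.

Lemma W_pcons (a : C) s t y : W a s (pcons t y) = wt a s t * W a s y.
Proof.
rewrite /W big_ord_recl pcons0; congr (_ * _).
by apply: eq_bigr => j _; rewrite pconsS.
Qed.

Lemma updo_pcons t u y : updo (pcons t y) ord0 u = pcons u y.
Proof.
apply/funext => i; rewrite /updo; case: (unliftP ord0 i) => [j ->|->]; last by rewrite eqxx pcons0.
by rewrite !pconsS eq_sym (negbTE (neq_lift _ _)).
Qed.

Lemma omega_pcons y : posv y -> omega k (pcons 0 y) = (\prod_j y j `^ (2 * k)) * omega k y.
Proof.
move=> py; rewrite /omega big_ord_recl; congr (_ * _).
  rewrite big_mkcond big_ord_recl /= mul1r; apply: eq_bigr => j _.
  by rewrite pcons0 pconsS sub0r normrN ger0_norm // ltW.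
apply: eq_bigr => i _; rewrite [LHS]big_mkcond big_ord_recl /= mul1r [RHS]big_mkcond.
by apply: eq_bigr => j _; rewrite !pconsS /bump /= !add1n ltnS.
Qed.

(** At a = 0 the one-dimensional weight equals 1 at the origin. In contrast with [IBP_first] no
    factor of the variable suppresses the boundary value, and the integral over the face remains. *)
Lemma IBP_boundary (h h' : rvec R m.+1 -> C) : pg h -> pg h' -> along h h' ord0 ->
  (forall y, posv y -> ccvg (fun N => h (pcons (N.+1%:R^-1) y)) (h (pcons 0 y))) ->
  I 0 1 (fun x => h' x + -1 * h x) = I 0 1 (fun y : rvec R m => -1 * h (pcons 0 y)).
Proof.
move=> [ch [qh hh]] ph' dh hc; set G := fun x : rvec R m.+1 => _; set g := fun y : rvec R m => _.
have a0 : -1 < cRe (0 : C) by rewrite -(cR0 R) cRe_cR ltrN10.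
have [c [q hG]] : pg G by apply: pgD => //; apply: pgZ; exists ch, qh.
have main (P : C -> R) : (forall z, `|P z| <= cabs z) -> (forall z, P (- z) = - P z) ->
    (forall u z, ccvg u z -> P (u N) @[N --> \oo] --> P z) ->
    nice m.+1 (phi 0 1 q) 0 c (fun x => P (gW 0 1 G x)) ->
    (forall f df t, cderiv f df t -> is_derive t 1 (fun u => P (f u)) (P df)) ->
    riter m.+1 (fun x => P (gW 0 1 G x)) (fun=> 0) = riter m (fun y => P (gW 0 1 g y)) (fun=> 0).
  move=> hP PN cP nG dP; rewrite riter_shift.
  apply: (@riter_eq R m m) => //; last exact: posfrom_n.
  move=> y py; pose yv : rvec R m := fun i => y i.
  have pyv : posv yv by move=> i; apply: py; rewrite /= ltn_ord.
  pose M := W (0 : C) 1 yv.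
  have gE t : gW 0 1 G (fun l : nat => if l is l'.+1 then y l' else t) = G (pcons t yv) * (wt 0 1 t * M).
    by rewrite /gW pcons_nat W_pcons.
  pose z (l : nat) : R := if l is l'.+1 then y l' else 1.
  have pz : posfrom m.+1 1 z.
    by case=> [|i] // /andP[_ im]; apply: py.
  have zE t : (fun l : nat => if l is l'.+1 then y l' else t) = upd z 0 t by apply/funext => -[].
  pose K t := h (pcons t yv) * (wt 0 1 t * M).
  have dK t : 0 < t -> cderiv K (gW 0 1 G (upd z 0 t)) t.
    move=> t0; have pt := posv_pcons t0 pyv.
    have d1 : cderiv (fun u => h (pcons u yv)) (h' (pcons t yv)) t.
      have := dh _ pt; rewrite pcons0 (_ : (fun u => _) = fun u => h (pcons u yv)) //.
      by apply/funext => u; rewrite updo_pcons.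
    have d2 := cderivM (wt_cderiv (0 : C) 1 t0) (cderiv_cst M t).
    apply: (cderiv_eq (cderivM d1 d2)); rewrite -zE gE /G cR1 mul0r sub0r.
    have r (x1 x2 x3 x4 : C) : x2 * (x3 * x4) + x1 * (- 1 * x3 * x4 + x3 * 0) =
      (x2 + - 1 * x1) * (x3 * x4) by ring.
    exact: r.
  have -> : (fun t => P (gW 0 1 G (fun l : nat => if l is l'.+1 then y l' else t))) =
      fun t => P (gW 0 1 G (upd z 0 t)) by apply/funext => t; rewrite zE.
  have -> : P (gW 0 1 g y) = 0 - P (h (pcons 0 yv) * M).
    by rewrite /gW -/yv -/M /g mulN1r mulNr PN sub0r.
  have [_ hG1 _] := nG.
  apply: (Rint_FTC (phi := fun t => c * bnd m.+1 (phi 0 1 q) 1 z * phi 0 1 q t)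
    (fun t t0 => dP _ _ _ (dK t t0))).
  - by move=> t t0; apply: pcont1_continuous => //; exact: (nice_pcont1 nG pz).
  - by apply: iRposZ; exact: phi_iRpos.
  - move=> t t0; apply: le_trans (hG1 _ (posfrom_upd pz t0)) _.
    by rewrite bnd_upd // [phi 0 1 q t * _]mulrC mulrA.
  - apply: cP; apply: ccvgM; first exact: hc.
    rewrite -[X in ccvg _ X]mul1r; apply: ccvgM; last exact: ccvg_cst.
    rewrite (_ : (fun N => _) = fun N => cR (expR (- 1 * N.+1%:R^-1))); last first.
      by apply/funext => N; rewrite /wt mul0r cexp0 mul1r.
    have lim : expR (- 1 * N.+1%:R^-1) @[N --> \oo] --> (1 : R).
      rewrite -[X in _ --> X](@expR0 R); apply: continuous_cvg; first exact: continuous_expR.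
      by rewrite -[X in _ --> X](mulr0 (-1)); apply: cvgM; [exact: cvg_cst|exact: invS_cvg0].
    by rewrite -[X in ccvg _ X](cR1 R); exact: ccvg_cR.
  - have [ch0 hh1 _] := hh.
    pose B := ch * gr yv ^+ qh * cabs M.
    have B0 : 0 <= B by rewrite !mulr_ge0 ?cabs_ge0 // exprn_ge0 // gr_ge0.
    have bK t : 0 < t -> `|P (K t)| <= B * ((1 + t) ^+ qh * expR (- 1 * t)).
      move=> t0; apply: le_trans (hP _) _; rewrite /K cabsM (cabsM (wt 0 1 t)) cabs_wt // (_ : cRe (0 : C) = 0) // powRr0 mul1r.
      have := hh1 _ (posv_pcons t0 pyv); rewrite gr_pcons exprMn => hb.
      have -> : B * ((1 + t) ^+ qh * expR (- 1 * t)) =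
        (ch * ((1 + t) ^+ qh * gr yv ^+ qh)) * (expR (-1 * t) * cabs M) by rewrite /B; ring.
      by apply: ler_wpM2r => //; rewrite mulr_ge0 ?expR_ge0 ?cabs_ge0.
    have hb t : 0 < t -> `|t * P (K t)| <= B * (t `^ (cRe (0 : C) + 1) * (1 + t) ^+ qh * expR (- 1 * t)).
      move=> t0; rewrite normrM ger0_norm ?(ltW t0) //.
      have -> : t `^ (cRe (0 : C) + 1) = t by rewrite -(cR0 R) cRe_cR add0r powRr1 // ltW.
      have -> : B * (t * (1 + t) ^+ qh * expR (- 1 * t)) = t * (B * ((1 + t) ^+ qh * expR (- 1 * t))) by ring.
      by apply: ler_wpM2l; [exact: ltW|exact: bK].
    (* The tail estimate is stated for functions bounded with the factor [t^(Re a + 1) = t]. It is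
       applied to t times the function, whose decay at [t = N + 2 >= 1] implies that of the
       function. *)
    have [_ tl] := @boundary_tails R 0 1 a0 ltr01 qh (fun t => t * P (K t)) B B0 hb.
    apply/norm_cvg0P.
    apply: (@squeeze_cvgr _ _ _ _ (fun=> 0) (fun N => `|N.+2%:R * P (K N.+2%:R)|)).
    + apply: nearW => N; rewrite normr_ge0 normrM /= ler_peMl // ger0_norm ?ler0n //.
      by rewrite ler1n.
    + exact: cvg_cst.
    + by apply/norm_cvg0P.
apply: c_eq; rewrite ?Re_I ?Im_I.
- apply: main; [exact: cabs_ge_Re|exact: cReN|by move=> u z []|exact: nice_Re|by move=> f df t []].
- apply: main; [exact: cabs_ge_Im|exact: cImN|by move=> u z []|exact: nice_Im|by move=> f df t []].
Qed.

Lemma Om_seqcont n e (xs : nat -> rvec R n) x : 0 <= e ->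
  (forall i, xs N i @[N --> \oo] --> x i) -> ccvg (fun N => cR (Om k e (xs N))) (cR (Om k e x)).
Proof.
move=> e0 cx; rewrite cR_prod (_ : (fun N => _) = fun N => \prod_(p : 'I_n * 'I_n | p.1 != p.2)
   cR (((xs N p.1 - xs N p.2) ^+ 2 + e) `^ (k / 2))); last by apply/funext => N; rewrite cR_prod.
rewrite big_mkcond (_ : (fun N => _) = fun N => \prod_(p : 'I_n * 'I_n)
   if p.1 != p.2 then cR (((xs N p.1 - xs N p.2) ^+ 2 + e) `^ (k / 2)) else 1); last first.
  by apply/funext => N; rewrite big_mkcond.
apply: ccvg_prod => p; case: ifP => _; last exact: ccvg_cst.
apply: ccvg_cR; apply: pow0_cvg; first exact: divr_ge0.
  by move=> N; rewrite addr_ge0 // sqr_ge0.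
by apply: cvgD; [apply: exprn_cvg; apply: cvgB|exact: cvg_cst].
Qed.

Lemma pcons_cvg (us : nat -> R) (ys : nat -> rvec R m) t y : us N @[N --> \oo] --> t ->
  (forall i, ys N i @[N --> \oo] --> y i) -> forall i, pcons (us N) (ys N) i @[N --> \oo] --> pcons t y i.
Proof. by move=> cu cy i; rewrite /pcons; case: (unlift _ _). Qed.

Lemma boundary_Om e : 0 < e <= 1 -> (forall j, j != ord0 ->
    I 0 1 (fun x : rvec R m.+1 => cR (kern e x ord0 j) * cR (Om k e x)) = 0) ->
  I 0 1 (fun x : rvec R m.+1 => cR (Om k e x)) = I 0 1 (fun y : rvec R m => cR (Om k e (pcons 0 y))).
Proof.
move=> /andP[e0 e1] hk; have a0 : -1 < cRe (0 : C) by rewrite -(cR0 R) cRe_cR ltrN10.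
have pO : pg (fun x : rvec R m.+1 => cR (Om k e x)) by apply: pg_Om; rewrite // ltW.
have pk j : pg (fun x : rvec R m.+1 => cR (kern e x ord0 j) * cR (Om k e x)).
  exact: (pgM (kern_pg ord0 j e0) pO).
pose h' (x : rvec R m.+1) := cR (2 * k) * \sum_(j | j != ord0) cR (kern e x ord0 j) * cR (Om k e x).
have ph' : pg h' by apply: pgZ; exact: pg_sum.
have := @IBP_boundary (fun x => cR (Om k e x)) h' pO ph'.
have zI : I 0 1 h' = 0.
  by rewrite /h' (IZ a0 ltr01) ?(I_sum a0 ltr01) ?big1 ?mulr0 //; exact: pg_sum.
have e2 := ID a0 ltr01 ph' (pgZ (-1) pO); rewrite zI add0r (IZ a0 ltr01) // mulN1r in e2.
rewrite e2 => /(_ _ _) e3.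
have e4 : - I 0 1 (fun x : rvec R m.+1 => cR (Om k e x)) =
    I 0 1 (fun y : rvec R m => -1 * cR (Om k e (pcons 0 y))).
  apply: e3 => [x px|y py].
    apply: (cderiv_eq (cderiv_cR (Om_deriv k x ord0 e0))).
    by rewrite /h' cRM (cRM (2 * k)) cR_sum -mulr_suml mulrA.
  apply: Om_seqcont; first exact: ltW.
  by apply: pcons_cvg; [exact: invS_cvg0|move=> i; exact: cvg_cst].
have [c [q hO]] := @Om_pgb R m.+1 k k0.
have [c0 hb _] : pgb c q (fun x : rvec R m.+1 => cR (Om k e x)) by apply: hO; rewrite e1 ltW.
have pO' : pg (fun y : rvec R m => cR (Om k e (pcons 0 y))).
  exists (c * 2 ^+ q), q; split; first by rewrite mulr_ge0 // exprn_ge0.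
    move=> y py.
    have cc : ccvg (fun N => cR (Om k e (pcons (N.+1%:R^-1) y))) (cR (Om k e (pcons 0 y))).
      apply: Om_seqcont; first exact: ltW.
      by apply: pcons_cvg; [exact: invS_cvg0|move=> i; exact: cvg_cst].
    apply: (cvgr_to_le (cvg_cabs cc)); apply: nearW => N.
    have t0 : 0 < N.+1%:R^-1 :> R by rewrite invr_gt0 ltr0n.
    apply: le_trans (hb _ (posv_pcons t0 py)) _; rewrite gr_pcons -mulrA -exprMn ler_wpM2l //.
    have g0 := gr_ge0 py; apply: lerXn2r; rewrite ?nnegrE ?mulr_ge0 ?addr_ge0 ?(ltW t0) //.
    by apply: ler_wpM2r => //; rewrite (_ : 2 = 1 + 1) // lerD2l invf_le1 ?ltr0n // ler1n.
  move=> ys y _ _ cy; apply: Om_seqcont; first exact: ltW.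
  by apply: pcons_cvg => //; exact: cvg_cst.
by move: e4; rewrite (IZ a0 ltr01) // mulN1r => /oppr_inj.
Qed.

(** The logarithmic derivative of the discriminant integrates to 0 by antisymmetry, leaving the face
    where the first coordinate vanishes. There the discriminant contributes the factors [y_j^(2k)],
    which form the weight with exponent 2k in one dimension less. *)
Lemma boundary_sel : sel m.+1 k 0 = sel m k (cR (2 * k)).
Proof.
have a0 : -1 < cRe (0 : C) by rewrite -(cR0 R) cRe_cR ltrN10.
have eN N : 0 < (N.+1%:R^-1 : R) <= 1 by rewrite invr_gt0 ltr0n invf_le1 ?ltr0n // ler1n.
have ek N j : j != ord0 ->
    I 0 1 (fun x : rvec R m.+1 => cR (kern (N.+1%:R^-1) x ord0 j) * cR (Om k (N.+1%:R^-1) x)) = 0.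
  move=> j0; have := antisym_kern a0 ltr01 k0 N (ord0 : 'I_m.+1) j (1 : mpoly.mpoly _ C).
  have -> : dd ord0 j (1 : mpoly.mpoly m.+1 C) = 0.
    by apply: dd_sym; rewrite 1?eq_sym // /sw rmorph1.
  have z : I 0 1 (fun x : rvec R m.+1 => mpoly.meval (cofr x) (0 : mpoly.mpoly m.+1 C) *
      cR (damp (N.+1%:R^-1) ord0 j x) * cR (Om k (N.+1%:R^-1) x)) = 0.
    by rewrite -[RHS](I0 m.+1 a0 ltr01); apply: I_eq => x _; rewrite mpoly.meval0 !mul0r.
  rewrite z => /eqP; rewrite mulf_eq0 pnatr_eq0 /= => /eqP e; rewrite -[RHS]e.
  by apply: I_eq => x _; rewrite mpoly.meval1 mul1r.
have eq N := boundary_Om (eN N) (ek N).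
have c1 : ccvg (fun N => I 0 1 (fun x : rvec R m.+1 => cR (Om k (N.+1%:R^-1) x))) (sel m.+1 k 0).
  have [c [q hO]] := @Om_pgb R m.+1 k k0.
  rewrite /sel (_ : (fun x => cR (omega k x)) = fun x => cR (Om k 0 x)); last first.
    by apply/funext => x; rewrite omega_Om.
  apply: (I_cvg a0 ltr01 (c := c) (q := q)) => [N||x _].
  - by apply: hO; have /andP[h1 h2] := eN N; rewrite h2 ltW.
  - by apply: hO; rewrite lexx ler01.
  - exact: Om_cvg0.
have [c [q hO]] := @Om_pgb R m.+1 k k0.
have pO e : 0 <= e <= 1 -> pgb (c * 2 ^+ q) q (fun y : rvec R m => cR (Om k e (pcons 0 y))).
  move=> he; have [c0 hb _] := hO _ he; have /andP[e0 e1] := he.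
  split; first by rewrite mulr_ge0 // exprn_ge0.
    move=> y py.
    have cc : ccvg (fun N => cR (Om k e (pcons (N.+1%:R^-1) y))) (cR (Om k e (pcons 0 y))).
      by apply: Om_seqcont => //; apply: pcons_cvg; [exact: invS_cvg0|move=> i; exact: cvg_cst].
    apply: (cvgr_to_le (cvg_cabs cc)); apply: nearW => N.
    have t0 : 0 < N.+1%:R^-1 :> R by rewrite invr_gt0 ltr0n.
    apply: le_trans (hb _ (posv_pcons t0 py)) _; rewrite gr_pcons -mulrA -exprMn ler_wpM2l //.
    have g0 := gr_ge0 py; apply: lerXn2r; rewrite ?nnegrE ?mulr_ge0 ?addr_ge0 ?(ltW t0) //.
    by apply: ler_wpM2r => //; rewrite (_ : 2 = 1 + 1) // lerD2l invf_le1 ?ltr0n // ler1n.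
  move=> ys y _ _ cy; apply: Om_seqcont => //.
  by apply: pcons_cvg => //; exact: cvg_cst.
apply: (ccvg_unique c1); rewrite (_ : (fun N => _) = fun N => I 0 1 (fun y : rvec R m => cR (Om k (N.+1%:R^-1) (pcons 0 y)))); last first.
  by apply/funext => N; exact: eq.
have -> : sel m k (cR (2 * k)) = I 0 1 (fun y : rvec R m => cR (Om k 0 (pcons 0 y))).
  rewrite -[cR (2 * k)]add0r sel_W; apply: I_eq => y py; rewrite -omega_Om omega_pcons // [in RHS]cRM; congr (_ * _).
  rewrite cR_prod; apply: eq_bigr => i _.
  by rewrite /wt oppr0 mul0r expR0 cR1 mulr1 -cRM cexp_cR /powR gt_eqF.
apply: (I_cvg a0 ltr01 (c := c * 2 ^+ q) (q := q)) => [N||y _].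
- by apply: pO; have /andP[h1 h2] := eN N; rewrite h2 ltW.
- by apply: pO; rewrite lexx ler01.
- exact: Om_cvg0.
Qed.
End Boundary.

(** * Evaluation of the constant *)

Section SelbergEvaluation.
Variables (R : realType) (k : R).
Hypothesis k0 : 0 <= k.
Local Notation C := (Cx R).

Lemma sel0 (a : C) : sel 0 k a = 1.
Proof. by rewrite /sel /I /intRpos /= /W /omega !big_ord0 cR1 mulr1. Qed.

(** The boundary reduction from dimension 1 to dimension 0. *)
Lemma cGamma1 : cGamma (1 : C) = 1.
Proof. by rewrite -[X in cGamma X]add0r -(sel_cGamma k) boundary_sel // sel0. Qed.

(** If the value were 0, the sequence of [growth_cvg] would vanish identically although its limit is
    the value of Gamma at 1. *)
Lemma cGamma_neq0 (w : C) : 0 <= cRe w -> cGamma (w + 1) != 0.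
Proof.
move=> w0; apply/eqP => e.
have z1 : -1 < 0 :> R by rewrite ltrN10.
have := growth_cvg k0 (ltn0Sn 0) z1 w0; rewrite cR0 add0r !sel_cGamma e add0r cGamma1 => c.
have := ccvg_unique c; rewrite (_ : (fun N => _) = fun=> 0); last by apply/funext => N; rewrite mul0r.
by move=> /(_ _ (ccvg_cst 0)) /eqP; rewrite oner_eq0.
Qed.

Lemma cGamma_cR_neq0 (x : R) : 0 <= x -> cGamma (cR (1 + x) : C) != 0.
Proof. by move=> x0; rewrite cRD cR1 addrC cGamma_neq0 // cRe_cR. Qed.

(** Both sides satisfy the same recursion in a, with a nonzero factor; one step down extends the
    identity from [Re a >= 0] to [Re a > -1]. *)
Lemma sel_ext n (a : C) : (0 < n)%N -> -1 < cRe a ->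
  sel n k a * gamma_prod n k 0 = sel n k 0 * gamma_prod n k a.
Proof.
move=> n0 ha; have re j : 0 < cRe (a + 1 + cR (k * (n%:R - 1)) - cR k * (j : 'I_n)%:R).
  have -> : a + 1 + cR (k * (n%:R - 1)) - cR k * (j : 'I_n)%:R = a + cR (1 + (k * (n%:R - 1) - k * j%:R)).
    by rewrite cRD cR1 cRB (cRM k j%:R) cR_nat; ring.
  have := gamma_shift_ge0 j k0; rewrite cReD cRe_cR.
  by move: ha; move: (k * _ - _) => X; lra.
have gs : gamma_prod n k (a + 1) = gamma_prod n k a * fac n k a.
  rewrite /gamma_prod /fac -big_split; apply: eq_bigr => j _ /=.
  have -> : a + 1 + 1 + cR (k * (n%:R - 1)) - cR k * j%:R = (a + 1 + cR (k * (n%:R - 1)) - cR k * j%:R) + 1 by ring.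
  by rewrite cGamma_succ // mulrC.
have f0 : fac n k a != 0.
  apply/prodf_neq0 => j _; apply: contraTneq (re j) => ->.
  by rewrite -(cR0 R) cRe_cR ltxx.
have w0 : 0 <= cRe (a + 1) by rewrite cReD -(cR1 R) cRe_cR; move: ha; lra.
have := sel_gamma_prod k0 n0 w0; rewrite sel_succ // gs => h; apply: (mulIf f0).
by rewrite mulrAC h mulrA.
Qed.

(** All factors are values [G i] of Gamma at [1 + i k]: on the left i runs from 2 to m + 1 together
    with i = 1, on the right over m + 1 and 0 to m. They agree since [G 0 = 1]. *)
Lemma gamma_prod_boundary m :
  gamma_prod m k (cR (2 * k)) * cGamma (cR (1 + k)) = cGamma (cR (1 + m.+1%:R * k)) * gamma_prod m.+1 k (0 : C).
Proof.
pose G (i : nat) : C := cGamma (cR (1 + i%:R * k)).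
have G0 : G 0%N = 1 by rewrite /G mul0r addr0 cR1 cGamma1.
have e1 : gamma_prod m k (cR (2 * k)) = \prod_(j < m) G (m.+1 - j)%N.
  apply: eq_bigr => j _; congr cGamma; rewrite natrB; last by rewrite ltnW // ltnS ltnW.
  by rewrite -natr1 -(cR_nat R) -cRM -(cR1 R) -!cRD -cRB; congr cR; ring.
have e2 : gamma_prod m.+1 k 0 = \prod_(j < m.+1) G (m - j)%N.
  apply: eq_bigr => j _; congr cGamma; rewrite natrB; last by rewrite -ltnS.
  by rewrite -natr1 -(cR_nat R) -cRM -(cR1 R) -(cR0 R) -!cRD -cRB; congr cR; ring.
rewrite e1 e2 -/(G m.+1) (_ : cGamma (cR (1 + k)) = G 1%N); last by rewrite /G mul1r.
have e3 : \prod_(j < m.+2) G (m.+1 - j)%N = G m.+1 * \prod_(j < m.+1) G (m - j)%N.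
  by rewrite big_ord_recl subn0; congr (_ * _); apply: eq_bigr => j _; rewrite lift0 subSS.
by rewrite -e3 !big_ord_recr /= subnn G0 mulr1 subSnn.
Qed.

(** At a = 0 the reduction of dimension multiplies the constant by Gamma(1 + (m + 1) k) / Gamma(1 +
    k), the factor by which [d_n] grows; [sel_ext] carries this to all a. *)
Lemma selberg n (a : C) : -1 < cRe a -> sel n k a = d_n n k * gamma_prod n k a.
Proof.
elim: n a => [|m IHm] a ha; first by rewrite sel0 /d_n /gamma_prod !big_ord0 mulr1.
have gn : gamma_prod m.+1 k (0 : C) != 0.
  apply/prodf_neq0 => j _; have := gamma_shift_ge0 j k0 => h.
  have -> : 0 + 1 + cR (k * (m.+1%:R - 1)) - cR k * j%:R = cR (1 + (k * (m.+1%:R - 1) - k * j%:R)) :> C.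
    by rewrite cRD cR1 cRB (cRM k j%:R) cR_nat; ring.
  exact: cGamma_cR_neq0.
have g1 : cGamma (cR (1 + k) : C) != 0 by exact: cGamma_cR_neq0.
apply: (mulIf gn); rewrite sel_ext // boundary_sel // IHm; last first.
  by rewrite cRe_cR (lt_le_trans (ltrN10 R)) // mulr_ge0.
have hb := gamma_prod_boundary m.
rewrite /d_n big_ord_recr /= -/(d_n m k).
apply: (mulIf g1).
have r1 (x1 x2 x3 x4 : C) : x1 * x2 * x3 * x4 = x1 * x3 * (x2 * x4) by ring.
rewrite r1 hb.
by move: (d_n _ _) (gamma_prod _ _ _) (cGamma _) (gamma_prod _ _ _) (cGamma _) g1 => y1 y2 y3 y4 y5 h; field.
Qed.
End SelbergEvaluation.

(** * The two integral formulas *)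

Section Assembly.
Variables (R : realType) (n : nat) (k : R).
Hypotheses (k0 : 0 <= k) (n0 : (0 < n)%N).
Local Notation C := (Cx R).
Local Notation P := (mpoly.mpoly n C).
Implicit Types (p q : P) (z : 'I_n -> C) (x : rvec R n).

Lemma cGamma_poch (s : C) N : 0 < cRe s -> cGamma (s + N%:R) = poch s N * cGamma s.
Proof.
move=> s0; elim: N => [|N IHN]; first by rewrite addr0 /poch big_ord0 mul1r.
rewrite -natr1 addrA cGamma_succ ?IHN ?pochS; first by rewrite mulrA [_ * poch _ _]mulrC.
by rewrite cReD -(cR_nat R) cRe_cR ltr_wpDr.
Qed.

Lemma partition_rk (l : mi n) : is_partition l -> forall j : 'I_n, rk (mnm_of l) j = j.
Proof.
move=> hl j; have h (i : 'I_n) : before (mnm_of l) i j = (i < j)%N.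
  rewrite /before !mnm_ofE; have [ij|ji|e] := ltngtP i j.
  - by have := hl i j (ltnW ij); rewrite leq_eqVlt eq_sym => /orP[->|->]; rewrite ?orbT.
  - by rewrite andbF orbF; apply/negbTE; rewrite -leqNgt; apply: hl; exact: ltnW.
  - by rewrite (ord_inj e) ltnn andbF.
have h2 : (\sum_(i < j) 1 = j)%N by rewrite sum_nat_const card_ord muln1.
rewrite -[RHS]h2 (big_ord_widen n (fun=> 1%N) (ltnW (ltn_ord j))) big_mkcond.
by apply: eq_bigr => i _; rewrite h; case: (i < j)%N.
Qed.

Lemma partition_mplus (l : mi n) : is_partition l -> mplus l = l.
Proof.
move=> hl; apply/ffunP => j; rewrite -{1}(mi_of_mnm_of l).
have e : rkp (mnm_of l) j = j by apply: val_inj; rewrite /= rkpE partition_rk.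
by rewrite -{1}e mplus_rkp mnm_ofE.
Qed.

Variable a : C.
Hypothesis a_gt : -1 < cRe a.
Local Notation mu := (a + 1 + cR (k * (n%:R - 1))).

Lemma Gamma_n_jack (e : mi n) :
  ell k a 1 (1 : P) * jack_poch k a (mnm_of e) = Gamma_n k (vadd (mi_to_c R (mplus e)) (vconst mu)).
Proof.
rewrite -sel_ell (selberg k0) // jack_poch_mplus mi_of_mnm_of /Gamma_n -mulrA; congr (_ * _).
rewrite /gamma_prod -big_split; apply: eq_bigr => j _ /=.
have re : 0 < cRe (mu - cR k * j%:R).
  have -> : mu - cR k * j%:R = a + cR (1 + (k * (n%:R - 1) - k * j%:R)).
    by rewrite cRD cR1 cRB (cRM k j%:R) cR_nat; ring.
  have := gamma_shift_ge0 j k0; rewrite cReD cRe_cR.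
  by move: a_gt; move: (k * _ - _) => X; lra.
rewrite mulrC -cGamma_poch //; congr cGamma.
rewrite /vadd /mi_to_c /vconst cR_nat (cRM k j%:R) cR_nat.
by rewrite addrC addrA.
Qed.

Lemma laplace_formula_sum m (T : Type) (r : seq T) (f : T -> P) :
  (forall i, laplace_formula k a m (f i)) -> laplace_formula k a m (\sum_(i <- r) f i).
Proof.
move=> hf; elim: r => [|i r IHr]; last first.
  by rewrite big_cons -[f i]scale1r; exact: (laplace_formula_lin k0 n0 a_gt 1).
by move=> z hz; rewrite big_nil -(scale0r (0 : P)) (LapZ k0 n0 a_gt) // scale0r mpoly.meval0 mulr0 !mul0r.
Qed.

Lemma laplace_symz m p : laplace_formula k a m p -> laplace_formula k a m (symz p).
Proof.
move=> hp; apply: laplace_formula_sum => w z hz.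
by rewrite (laplace_formula_msym k0 n0 a_gt w 1%g hp) // jack_poch_perm.
Qed.

Lemma symsum_symz (l : mi n) p (v : 'I_n -> C) : nsJack k l = (fun x : cvec R n => p.@[x]) -> symsum k l v = (symz p).@[v].
Proof.
move=> hp; rewrite /symsum /symz (raddf_sum (mpoly.meval v)) /= (reindex_inj invg_inj) /=.
apply: eq_bigr => s _; rewrite hp meval_msym; apply: mpoly.meval_eq => i.
by rewrite /pact invgK.
Qed.

Lemma meval_symz_perm p (v : 'I_n -> C) (w : {perm 'I_n}) : (symz p).@[v \o w] = (symz p).@[v].
Proof.
rewrite /symz !(raddf_sum (mpoly.meval _)) /= [RHS](reindex_inj (@mulIg _ w)) /=.
apply: eq_bigr => u _; rewrite !meval_msym; apply: mpoly.meval_eq => i.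
by rewrite /= permM.
Qed.

(** Each of the n! permuted kernels is brought back to the original one by a change of variables
    that leaves the symmetrised polynomial, the powers and omega unchanged. The averaged integral is
    therefore a single Laplace transform. *)
Lemma laplace_average z p (c : C) : (forall i, 0 < cRe (z i)) ->
  let F x := (n`!%:R^-1 * \sum_(s : {perm 'I_n}) DunklE k (vneg z) (pact s (cofr x))) * (c * (symz p).@[cofr x]) *
    Deltapow (cofr x) a * cR (omega k x) in
  integrableRpos F /\ intRpos F = c * Lap k a z (symz p).
Proof.
move=> hz F; have [s [r [_ r0 rs h]]] := rates_exist n0 hz.
have sr : 0 < s - r by rewrite subr_gt0.
pose g x := (symz p).@[cofr x] * cR (omega k x) * gE k0 r (fun i => cR s - z i) x.
have pgg : pg g.
  by apply: pgM; [exact: pg_pw|exists 1, 0%N; exact: (gE_pgb k0 r0 h)].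
pose A x := c * n`!%:R^-1 * \sum_(w : {perm 'I_n}) g (vperm (w^-1)%g x).
have pA : pg A by apply: pgZ; apply: pg_sum => w; exact: pg_perm.
have FE x : posv x -> A x * W a (s - r) x = F x.
  move=> px; rewrite /A -mulrA mulr_suml.
  rewrite (eq_bigr (fun w => DunklE k (vneg z) (pact w (cofr x)) *
     ((symz p).@[cofr x] * Deltapow (cofr x) a * cR (omega k x)))) => [|w _].
    rewrite -mulr_suml /F.
    by move: (\sum_ _ _) (n`!%:R^-1) ((symz p).@[_]) (Deltapow _ _) (cR _) => x1 x2 x3 x4 x5; ring.
  rewrite -(W_perm a (s - r) (w^-1)%g x) (Lint_rep k0 n0 a s r z (symz p)); last exact: posv_perm.
  have e1 : (symz p).@[cofr (vperm (w^-1)%g x)] = (symz p).@[cofr x] := meval_symz_perm p (cofr x) (w^-1)%g.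
  have e2 : Deltapow (cofr (vperm (w^-1)%g x)) a = Deltapow (cofr x) a := Deltapow_perm (cofr x) (w^-1)%g a.
  by rewrite /Lint omega_perm e1 e2 -[cofr (vperm _ _)]/(pact w (cofr x)) !mulrA.
split; first exact: (integrable_eq FE (I_fin a_gt sr pA)).
rewrite -(intRpos_eq FE) -/(I a (s - r) A) (IZ a_gt sr) ?(I_sum a_gt sr); last 2 first.
- by move=> w; exact: pg_perm.
- by apply: pg_sum => w; exact: pg_perm.
rewrite (eq_bigr (fun=> I a (s - r) g)) => [|w _]; last exact: (I_perm a_gt sr).
have -> : \sum_(w : {perm 'I_n}) I a (s - r) g = n`!%:R * I a (s - r) g.
  by rewrite sumr_const (_ : #|_| = n`!) ?mulr_natl //; exact: card_Sn.
rewrite mulrA divfK; last by rewrite pnatr_eq0 -lt0n fact_gt0.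
by rewrite (Lap_Lf k0 n0 a s r).
Qed.
End Assembly.

Theorem theorem3p5 (R : realType) (k : R) (n : nat) :
  0 <= k -> (0 < n)%N ->
  forall (mu : Cx R) (z : cvec R n),
    k * (n%:R - 1) < cRe mu ->
    (forall i : 'I_n, 0 < cRe (z i)) ->
    (forall eta : mi n,
       integrableRpos (fun x : rvec R n =>
         DunklE k (vneg z) (cofr x) * nsJack k eta (cofr x) *
         Deltapow (cofr x) (mu - cR (k * (n%:R - 1)) - 1) * cR (omega k x)) /\
       intRpos (fun x : rvec R n =>
         DunklE k (vneg z) (cofr x) * nsJack k eta (cofr x) *
         Deltapow (cofr x) (mu - cR (k * (n%:R - 1)) - 1) * cR (omega k x))
       = Gamma_n k (vadd (mi_to_c R (mplus eta)) (vconst mu)) *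
         nsJack k eta (vinv z) * Deltapow z (- mu)) /\
    (forall lam : mi n, is_partition lam ->
       integrableRpos (fun x : rvec R n =>
         DunklJ k (vneg z) (cofr x) * sJack k lam (cofr x) *
         Deltapow (cofr x) (mu - cR (k * (n%:R - 1)) - 1) * cR (omega k x)) /\
       intRpos (fun x : rvec R n =>
         DunklJ k (vneg z) (cofr x) * sJack k lam (cofr x) *
         Deltapow (cofr x) (mu - cR (k * (n%:R - 1)) - 1) * cR (omega k x))
       = Gamma_n k (vadd (mi_to_c R lam) (vconst mu)) *
         sJack k lam (vinv z) * Deltapow z (- mu)).
Proof.
move=> k0 n0 mu z hmu hz; set a := mu - cR (k * (n%:R - 1)) - 1.
have muE : mu = a + 1 + cR (k * (n%:R - 1)) by rewrite /a; ring.
have a_gt : -1 < cRe a.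
  by rewrite /a !cReD !cReN cRe_cR -(cR1 R) cRe_cR; move: hmu; move: (k * _) => X; lra.
clearbody a; rewrite {}muE; split=> [eta|lam hlam].
  have [p [ep _ hp]] := nsJackP k0 n0 eta; rewrite hp.
  split; first exact: (Lint_fin k0 n0 a_gt p hz).
  by rewrite -(Gamma_n_jack k0 a_gt); exact: (jack_laplace k0 n0 a_gt ep hz).
have [c hc] := sJackP k0 n0 hlam.
have [p [ep _ hp]] := nsJackP k0 n0 lam.
have hs : sJack k lam = fun x : cvec R n => c * (symz p).@[x].
  by apply/funext => x; rewrite hc (symsum_symz _ hp).
rewrite hs; have [i1 ->] := laplace_average k0 n0 a_gt p c hz; split=> //.
rewrite (laplace_symz k0 n0 a_gt (jack_laplace k0 n0 a_gt ep)) //.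
rewrite (Gamma_n_jack k0 a_gt) (partition_mplus hlam).
by move: (Gamma_n _ _) ((symz p).@[_]) (Deltapow _ _) => x1 x2 x3; ring.
Qed.
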